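(* Let $K$ be a field. There is an algorithm, using only row and column operations on matrices, which, given as input a representation $V$ of the commutative ladder $CL(fb)$ in the form of the matrices over $K$ of its seven structure maps $f_{12},f_{32},f_{45},f_{65},f_{14},f_{25},f_{36}$ with respect to some chosen bases of $V^1,\dots,V^6$, computes an indecomposable decomposition of $V$, and hence the persistence diagram $D_V$ of $V$, in worst-case time $O(n^3)$, where $n=\max_{1\le i\le 6}\dim V^i$ and time is the number of arithmetic operations in $K$.
   Context: $CL(fb)$ is the path algebra over $K$ of the quiver with vertices $1,2,3$ (lower row) and $4,5,6$ (upper row) and arrows $1\to2$, $3\to2$, $4\to5$, $6\to5$, $1\to4$, $2\to5$, $3\to6$, modulo the commutativity relations identifying the two paths from $1$ to $5$ and identifying the two paths from $3$ to $5$. A representation $V$ of $CL(fb)$ consists of finite-dimensional $K$-vector spaces $V^1,\dots,V^6$ and linear maps $f_{ij}:V^i\to V^j$ for each arrow $i\to j$ with $f_{45}f_{14}=f_{25}f_{12}$ and $f_{65}f_{36}=f_{25}f_{32}$. $CL(fb)$ has finitely many isomorphism classes of indecomposable representations; let $\Gamma_0$ be the set of these classes. Every representation has a decomposition $V\simeq\bigoplus_{[I]\in\Gamma_0}I^{k_{[I]}}$ with uniquely determined multiplicities $k_{[I]}\in\{0,1,2,\dots\}$, and the persistence diagram of $V$ is the function $D_V:\Gamma_0\to\{0,1,2,\dots\}$, $[I]\mapsto k_{[I]}$. *)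

(* Defs.v *)
From HB Require Import structures.
From mathcomp Require Import all_boot all_algebra.

Set Implicit Arguments.
Unset Strict Implicit.
Unset Printing Implicit Defensive.

Import GRing.Theory.
Local Open Scope ring_scope.

(** * Representations of the commutative ladder CL(fb) *)

Inductive vertex := v1 | v2 | v3 | v4 | v5 | v6.
Inductive arrow := a12 | a32 | a45 | a65 | a14 | a25 | a36.

Lemma vertex_comparable : comparable vertex.
Proof. by move=> x y; rewrite /decidable; decide equality. Qed.
HB.instance Definition _ := comparableMixin vertex_comparable.

Lemma arrow_comparable : comparable arrow.
Proof. by move=> x y; rewrite /decidable; decide equality. Qed.
HB.instance Definition _ := comparableMixin arrow_comparable.

Definition src (a : arrow) : vertex :=
  match a with
  | a12 => v1 | a32 => v3 | a45 => v4 | a65 => v6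
  | a14 => v1 | a25 => v2 | a36 => v3
  end.

Definition tgt (a : arrow) : vertex :=
  match a with
  | a12 => v2 | a32 => v2 | a45 => v5 | a65 => v5
  | a14 => v4 | a25 => v5 | a36 => v6
  end.

(** A representation is given in coordinates: [V^i = K^(rdim i)], and [rmap a]
    is the matrix of the structure map of [a] acting on column vectors. *)
Record rep (K : fieldType) := Rep {
  rdim : vertex -> nat;
  rmap : forall a, 'M[K]_(rdim (tgt a), rdim (src a));
  rep_comm_l : rmap a45 *m rmap a14 = rmap a25 *m rmap a12;
  rep_comm_r : rmap a65 *m rmap a36 = rmap a25 *m rmap a32 }.

Definition is_hom (K : fieldType) (V W : rep K)
    (phi : forall v, 'M[K]_(rdim W v, rdim V v)) : Prop :=
  forall a, phi (tgt a) *m rmap V a = rmap W a *m phi (src a).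

Definition is_iso (K : fieldType) (V W : rep K)
    (phi : forall v, 'M[K]_(rdim W v, rdim V v)) : Prop :=
  is_hom phi /\
  forall v, exists psi : 'M[K]_(rdim V v, rdim W v),
    psi *m phi v = 1%:M /\ phi v *m psi = 1%:M.

Definition isomorphic (K : fieldType) (V W : rep K) : Prop :=
  exists phi : forall v, 'M[K]_(rdim W v, rdim V v), is_iso phi.

Definition rep0 (K : fieldType) : rep K :=
  @Rep K (fun _ => 0%N) (fun _ => 0) (erefl _) (erefl _).

Section DirectSum.
Variables (K : fieldType) (V W : rep K).

Definition dsum_f a :
  'M[K]_(rdim V (tgt a) + rdim W (tgt a), rdim V (src a) + rdim W (src a)) :=
  block_mx (rmap V a) 0 0 (rmap W a).

Lemma dsum_comm_l : dsum_f a45 *m dsum_f a14 = dsum_f a25 *m dsum_f a12.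
Proof.
by rewrite !mulmx_block !mulmx0 !mul0mx !addr0 !add0r !rep_comm_l.
Qed.

Lemma dsum_comm_r : dsum_f a65 *m dsum_f a36 = dsum_f a25 *m dsum_f a32.
Proof.
by rewrite !mulmx_block !mulmx0 !mul0mx !addr0 !add0r !rep_comm_r.
Qed.

Definition dsum : rep K :=
  @Rep K (fun v => rdim V v + rdim W v)%N dsum_f dsum_comm_l dsum_comm_r.

End DirectSum.

Definition is_zero (K : fieldType) (V : rep K) : Prop :=
  forall v, rdim V v = 0%N.

Definition indecomposable (K : fieldType) (V : rep K) : Prop :=
  ~ is_zero V /\
  forall A B : rep K, isomorphic V (dsum A B) -> is_zero A \/ is_zero B.

(** [Gamma] lists exactly one representative of each class in [Gamma_0]. *)
Definition is_Gamma0 (K : fieldType) (N : nat) (Gamma : 'I_N -> rep K) : Prop :=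
  [/\ forall k, indecomposable (Gamma k),
      forall I : rep K, indecomposable I -> exists k, isomorphic I (Gamma k)
    & forall k l, isomorphic (Gamma k) (Gamma l) -> k = l].

(** The direct sum of [D k] copies of [Gamma k], for [k = 0, ..., N - 1] in
    this order. *)
Definition dsum_of (K : fieldType) (N : nat) (Gamma : 'I_N -> rep K)
    (D : 'I_N -> nat) : rep K :=
  foldr (@dsum K) (rep0 K)
    (flatten [seq nseq (D k) (Gamma k) | k <- enum 'I_N]).

(** By Krull-Schmidt at most one [D] satisfies this for a given [V]. *)
Definition is_persistence_diagram (K : fieldType) (N : nat)
    (Gamma : 'I_N -> rep K) (V : rep K) (D : 'I_N -> nat) : Prop :=
  isomorphic (dsum_of Gamma D) V.

Definition max_dim (d : vertex -> nat) : nat :=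
  (\max_(v <- [:: v1; v2; v3; v4; v5; v6]) d v)%N.

(** * Algorithms by row and column operations

    A finite program acts on a fixed family of matrices over [K], which it can
    change only by elementary row and column operations and inspect only by
    testing an entry for zero.  Its control flow uses arrays of natural
    numbers.  The programs contain no field constants besides 0 and 1 and do
    not depend on the dimensions, so that one program treats all inputs. *)

(** [Str a] initially contains the structure matrix of [a]; [Bas v] is a square
    matrix that is initially the identity and serves to record a basis of
    [V^v]. *)
Inductive reg := Str of arrow | Bas of vertex.

Lemma reg_comparable : comparable reg.
Proof. by move=> x y; rewrite /decidable; decide equality; apply/eq_comparable. Qed.
HB.instance Definition _ := comparableMixin reg_comparable.

(** [NLoad x e] is the entry at index [e] of the array named [x]; [NLe] and
    [NEq] have value 1 or 0. *)
Inductive nexp :=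
| NConst of nat
| NDim of vertex
| NLoad of nat & nexp
| NAdd of nexp & nexp
| NSub of nexp & nexp
| NMul of nexp & nexp
| NLe of nexp & nexp
| NEq of nexp & nexp.

Inductive fexp :=
| FZero
| FOne
| FEntry of reg & nexp & nexp
| FAdd of fexp & fexp
| FSub of fexp & fexp
| FMul of fexp & fexp
| FDiv of fexp & fexp.

Inductive cmd :=
| Skip
| Store (x : nat) (e e' : nexp)              (* x[e] := e' *)
| TestZero (x : nat) (e : nexp) (r : reg) (i j : nexp)
                                             (* x[e] := (r i j == 0) *)
| RowSwap (r : reg) (i j : nexp)
| RowScale (r : reg) (i : nexp) (c : fexp)   (* row i *= c *)
| RowAdd (r : reg) (i j : nexp) (c : fexp)   (* row i += c * row j *)
| ColSwap (r : reg) (i j : nexp)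
| ColScale (r : reg) (i : nexp) (c : fexp)   (* col i *= c *)
| ColAdd (r : reg) (i j : nexp) (c : fexp)   (* col i += c * col j *)
| Seq (p q : cmd)
| If (e : nexp) (p q : cmd)                  (* p if e is nonzero, else q *)
| While (e : nexp) (p : cmd).                (* p as long as e is nonzero *)

Section Semantics.
Variables (K : fieldType) (d : vertex -> nat).

Definition nrows (r : reg) : nat :=
  match r with Str a => d (tgt a) | Bas v => d v end.
Definition ncols (r : reg) : nat :=
  match r with Str a => d (src a) | Bas v => d v end.

Record state := State {
  mx : forall r : reg, 'M[K]_(nrows r, ncols r);
  arr : nat -> nat -> nat }.

Definition set_mx (s : state) (r : reg) (M : 'M[K]_(nrows r, ncols r)) : state :=
  State (dfwith (mx s) M) (arr s).

Definition set_mem (s : state) (x k n : nat) : state :=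
  State (mx s)
    (fun x' k' => if (x' == x) && (k' == k) then n else arr s x' k').

Fixpoint neval (s : state) (e : nexp) : nat :=
  match e with
  | NConst n => n
  | NDim v => d v
  | NLoad x e => arr s x (neval s e)
  | NAdd e e' => neval s e + neval s e'
  | NSub e e' => neval s e - neval s e'
  | NMul e e' => neval s e * neval s e'
  | NLe e e' => (neval s e <= neval s e')%N
  | NEq e e' => neval s e == neval s e'
  end%N.

(** Undefined on out-of-range entries and on division by zero. *)
Fixpoint feval (s : state) (c : fexp) : option K :=
  let lift2 op o o' :=
    match o, o' with Some x, Some y => op x y | _, _ => None end in
  match c with
  | FZero => Some 0
  | FOne => Some 1
  | FEntry r i j =>
      match insub (neval s i), insub (neval s j) with
      | Some i, Some j => Some (mx s r i j)
      | _, _ => None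
      end
  | FAdd c c' => lift2 (fun x y => Some (x + y)) (feval s c) (feval s c')
  | FSub c c' => lift2 (fun x y => Some (x - y)) (feval s c) (feval s c')
  | FMul c c' => lift2 (fun x y => Some (x * y)) (feval s c) (feval s c')
  | FDiv c c' => lift2 (fun x y => if y == 0 then None else Some (x / y))
                   (feval s c) (feval s c')
  end.

Fixpoint fcost (c : fexp) : nat :=
  match c with
  | FZero | FOne | FEntry _ _ _ => 0
  | FAdd c c' | FSub c c' | FMul c c' | FDiv c c' => (fcost c + fcost c').+1
  end%N.

Definition row_scale m n (i : 'I_m) (c : K) (M : 'M[K]_(m, n)) : 'M[K]_(m, n) :=
  \matrix_(k, l) if k == i then c * M k l else M k l.
Definition row_add m n (i j : 'I_m) (c : K) (M : 'M[K]_(m, n)) : 'M[K]_(m, n) :=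
  \matrix_(k, l) if k == i then M k l + c * M j l else M k l.
Definition col_scale m n (i : 'I_n) (c : K) (M : 'M[K]_(m, n)) : 'M[K]_(m, n) :=
  \matrix_(k, l) if l == i then c * M k l else M k l.
Definition col_add m n (i j : 'I_n) (c : K) (M : 'M[K]_(m, n)) : 'M[K]_(m, n) :=
  \matrix_(k, l) if l == i then M k l + c * M k j else M k l.

(** [exec p s s' t]: started in [s], the program [p] halts in [s'] after [t]
    arithmetic operations in [K], tests for zero being counted as well.
    Computations with natural numbers, and exchanges of rows or columns,
    perform no arithmetic operation in [K].  No rule applies to an index out of
    range, a scaling by zero, the addition of a line to itself or an undefined
    coefficient: such a run does not halt. *)
Inductive exec : cmd -> state -> state -> nat -> Prop :=
| ESkip s : exec Skip s s 0
| EStore s x e e' :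
    exec (Store x e e') s (set_mem s x (neval s e) (neval s e')) 0
| ETestZero s x e r ei ej (i : 'I_(nrows r)) (j : 'I_(ncols r)) :
    neval s ei = i -> neval s ej = j ->
    exec (TestZero x e r ei ej) s
      (set_mem s x (neval s e) (mx s r i j == 0)) 1
| ERowSwap s r ei ej (i j : 'I_(nrows r)) :
    neval s ei = i -> neval s ej = j ->
    exec (RowSwap r ei ej) s (set_mx s (xrow i j (mx s r))) 0
| ERowScale s r ei (i : 'I_(nrows r)) ec c :
    neval s ei = i -> feval s ec = Some c -> c != 0 ->
    exec (RowScale r ei ec) s (set_mx s (row_scale i c (mx s r)))
      (fcost ec + ncols r)%N
| ERowAdd s r ei ej (i j : 'I_(nrows r)) ec c :
    neval s ei = i -> neval s ej = j -> i != j -> feval s ec = Some c ->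
    exec (RowAdd r ei ej ec) s (set_mx s (row_add i j c (mx s r)))
      (fcost ec + 2 * ncols r)%N
| EColSwap s r ei ej (i j : 'I_(ncols r)) :
    neval s ei = i -> neval s ej = j ->
    exec (ColSwap r ei ej) s (set_mx s (xcol i j (mx s r))) 0
| EColScale s r ei (i : 'I_(ncols r)) ec c :
    neval s ei = i -> feval s ec = Some c -> c != 0 ->
    exec (ColScale r ei ec) s (set_mx s (col_scale i c (mx s r)))
      (fcost ec + nrows r)%N
| EColAdd s r ei ej (i j : 'I_(ncols r)) ec c :
    neval s ei = i -> neval s ej = j -> i != j -> feval s ec = Some c ->
    exec (ColAdd r ei ej ec) s (set_mx s (col_add i j c (mx s r)))
      (fcost ec + 2 * nrows r)%N
| ESeq p q s s' s'' t t' :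
    exec p s s' t -> exec q s' s'' t' -> exec (Seq p q) s s'' (t + t')%N
| EIfTrue e p q s s' t :
    neval s e != 0%N -> exec p s s' t -> exec (If e p q) s s' t
| EIfFalse e p q s s' t :
    neval s e = 0%N -> exec q s s' t -> exec (If e p q) s s' t
| EWhileStop e p s : neval s e = 0%N -> exec (While e p) s s 0
| EWhileStep e p s s' s'' t t' :
    neval s e != 0%N -> exec p s s' t -> exec (While e p) s' s'' t' ->
    exec (While e p) s s'' (t + t')%N.

End Semantics.

Definition init (K : fieldType) (V : rep K) : state K (rdim V) :=
  State (fun r => match r return 'M[K]_(nrows (rdim V) r, ncols (rdim V) r) with
                  | Str a => rmap V a
                  | Bas v => 1%:M
                  end)
        (fun _ _ => 0%N).

(** The multiplicities are read off the array named 0. *)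
Definition output_diagram (K : fieldType) (d : vertex -> nat) (s : state K d)
    (N : nat) (k : 'I_N) : nat := arr s 0 k.

(** The columns of the matrices [Bas v] are the images of the standard basis
    under an isomorphism from the direct sum of the [Gamma k], with the output
    multiplicities, to [V].  As [rdim (dsum_of _ _) v] and [rdim V v] are only
    provably equal, the columns are matched by their values. *)
Definition outputs_decomposition (K : fieldType) (N : nat)
    (Gamma : 'I_N -> rep K) (V : rep K) (s : state K (rdim V)) : Prop :=
  let S := dsum_of Gamma (output_diagram s (N := N)) in
  exists2 phi : forall v, 'M[K]_(rdim V v, rdim S v),
    is_iso phi &
    forall v (i : 'I_(rdim V v)) (j : 'I_(rdim S v)) (j' : 'I_(rdim V v)),
      j = j' :> nat -> phi v i j = mx s (Bas v) i j'.

(* Main.v *)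
Require Import Defs.
From HB Require Import structures.
From mathcomp Require Import all_boot all_algebra perm.
From mathcomp Require Import zify ring.

Set Implicit Arguments.
Unset Strict Implicit.
Unset Printing Implicit Defensive.
Import GRing.Theory.

(** Basis vectors carry labels.  The vectors with label [x] span a subrepresentation
    as far as the arrows already treated are concerned, and adding the vectors
    labelled [x] to those labelled [y] at all common vertices keeps these arrows in
    normal form, provided the map from [x] to [y] is a homomorphism there.  The
    arrows of the path 5 <- 4 <- 1 -> 2 <- 3 -> 6 are treated one by one, each
    adding a new end vertex: the labels living at the old end are totally ordered
    by the admissible additions, so a Bruhat-type elimination turns the matrix of
    the arrow into a partial permutation, and matched vectors get a common label.
    Every label then lives on an interval of the path.

    For 6 -> 5, commutativity fixes the columns of labels living at 1, the rows of
    labels living at both 5 and 6 are cleared, and the rest is again totally ordered.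
    For 2 -> 5, commutativity fixes the columns of labels living at 1 or 3.  The
    other columns have labels living at 2 only; on them the rows that cannot be
    cleared have one of four types, according to whether their label lives at 4 and
    whether it is linked through 6 -> 5.  The types form the poset {0,1}^2, and
    three eliminations reduce the block except for pairs of incomparable rows
    linked with the same column.

    The connected components of the resulting links have at most four labels and 30
    possible shapes.  Each shape has only scalar endomorphisms, so is
    indecomposable, and the shapes are told apart by their dimension vectors.  Each
    elimination makes O(n^2) row and column operations. *)

(** * Matrix entries and changes of basis *)

(** A label has at most one vector at each vertex, so adding one label to another takes one row or
    column operation on at most four registers at each of six vertices: O(n) field operations. With
    O(n^2) additions per elimination this gives O(n^3); bookkeeping in natural numbers is free. The
    order at an end of the path is total because two intervals ending there agree up to the first
    vertex where one of them stops, and the direction of the arrow to that vertex decides which may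
    be added to which. A support is a vector of six booleans, so such facts are checked on all 64 by
    computation. Commutativity is the obstacle: once the path is in normal form it determines part
    of the two remaining matrices, and only the undetermined columns can be normalised. For 2 -> 5,
    adding a row to another must be continued at 4 and at 6; this makes two types incomparable and
    produces the summands with two labels at 5. The algorithm also certifies the list of
    indecomposables: an indecomposable fed to it comes out as a single member of the list. *)

Section Entries.
Local Open Scope ring_scope.
Variable K : fieldType.

(** Natural indices with value 0 outside the matrix match the positions computed by programs, and
    let entries be compared across dimensions that agree only propositionally. *)
Definition ent m n (M : 'M[K]_(m, n)) (i j : nat) : K :=
  match insub i, insub j with Some i, Some j => M i j | _, _ => 0 end.

Lemma entE m n (M : 'M[K]_(m, n)) (i : 'I_m) (j : 'I_n) : ent M i j = M i j.
Proof. by rewrite /ent !valK. Qed.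

Lemma ent_out_row m n (M : 'M[K]_(m, n)) i j : (m <= i)%N -> ent M i j = 0.
Proof. by move=> h; rewrite /ent insubF // ltnNge h. Qed.

Lemma ent_out_col m n (M : 'M[K]_(m, n)) i j : (n <= j)%N -> ent M i j = 0.
Proof. by move=> h; rewrite /ent; case: insub => // k; rewrite insubF // ltnNge h. Qed.

Variant ent_spec m n (M : 'M[K]_(m, n)) (i j : nat) : K -> Type :=
| EntIn (i' : 'I_m) (j' : 'I_n) of i = i' & j = j' : ent_spec M i j (M i' j')
| EntOut of (m <= i)%N || (n <= j)%N : ent_spec M i j 0.

Lemma entP m n (M : 'M[K]_(m, n)) i j : ent_spec M i j (ent M i j).
Proof.
case: (ltnP i m) => hi; last by rewrite ent_out_row //; constructor; rewrite hi.
case: (ltnP j n) => hj; last by rewrite ent_out_col //; constructor; rewrite hj orbT.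
by rewrite -[i]/(nat_of_ord (Ordinal hi)) -[j]/(nat_of_ord (Ordinal hj)) entE; constructor.
Qed.

Lemma ent_eq m n (A B : 'M[K]_(m, n)) :
  (forall i j, (i < m)%N -> (j < n)%N -> ent A i j = ent B i j) -> A = B.
Proof. by move=> h; apply/matrixP=> i j; rewrite -!entE h. Qed.

Lemma ent_mx m n (F : nat -> nat -> K) i j : (i < m)%N -> (j < n)%N ->
  ent (\matrix_(i < m, j < n) F i j) i j = F i j.
Proof.
move=> hi hj; rewrite -[i]/(nat_of_ord (Ordinal hi)) -[j]/(nat_of_ord (Ordinal hj)).
by rewrite entE mxE.
Qed.

Lemma ent_mul m n p (A : 'M[K]_(m, n)) (B : 'M[K]_(n, p)) i j :
  ent (A *m B) i j = \sum_(l < n) ent A i l * ent B l j.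
Proof.
case: entP => [i' j' -> ->|/orP[] h]; first by rewrite mxE; apply: eq_bigr => l _; rewrite !entE.
- by rewrite big1 // => l _; rewrite ent_out_row // mul0r.
- by rewrite big1 // => l _; rewrite (ent_out_col _ _ h) mulr0.
Qed.

(** The elementary matrix [1 + c E_xy]: on the right it adds [c] times column [x] to column [y], on
    the left [c] times row [y] to row [x]. An index out of range gives the identity. *)
Definition Emx (x y : nat) (c : K) n : 'M[K]_n :=
  \matrix_(i, j) ((i == j)%:R + c * ((i == x :> nat) && (j == y :> nat))%:R).
Definition Dmx (x : nat) (c : K) n : 'M[K]_n :=
  \matrix_(i, j) ((i == j)%:R * (if j == x :> nat then c else 1)).
Definition swp (x y j : nat) := if j == x then y else if j == y then x else j.
Definition Smx (x y : nat) n : 'M[K]_n :=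
  \matrix_(i, j) ((i == swp x y j :> nat)%:R).

Lemma sum_pick n (F : nat -> K) (x : nat) :
  \sum_(l < n) F l * (l == x :> nat)%:R = if (x < n)%N then F x else 0.
Proof.
case: ltnP => hx.
  rewrite (bigD1 (Ordinal hx)) //= eqxx mulr1 big1 ?addr0 // => l.
  by rewrite -val_eqE /= => /negPf ->; rewrite mulr0.
rewrite big1 // => l _; rewrite (_ : (l == x :> nat) = false) ?mulr0 //.
by apply/negbTE; rewrite neq_ltn (leq_trans (ltn_ord l) hx).
Qed.

Lemma ent_mulE m n (M : 'M[K]_(m, n)) x y c i j : (y < n)%N ->
  ent (M *m Emx x y c n) i j = ent M i j + (j == y)%:R * (c * ent M i x).
Proof.
move=> hy; case: (ltnP j n) => hj; last first.
  by rewrite !(ent_out_col _ _ hj) gtn_eqF ?mul0r ?addr0 // (leq_trans hy).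
rewrite ent_mul (eq_bigr (fun l : 'I_n => ent M i l * (l == j :> nat)%:R
   + (c * (j == y)%:R) * (ent M i l * (l == x :> nat)%:R))); last first.
  move=> l _; rewrite (_ : ent (Emx x y c n) l j = ((l == j :> nat)%:R + c * ((l == x :> nat) && (j == y :> nat))%:R)).
    by case: (l == x :> nat); case: (j == y); rewrite /= ?mulr1 ?mulr0 ?mulrDr; ring.
  by rewrite -[j]/(nat_of_ord (Ordinal hj)) entE mxE.
rewrite big_split /= -mulr_sumr !sum_pick hj; case: ltnP => hx; first by ring.
by rewrite (ent_out_col _ _ hx); ring.
Qed.

Lemma ent_Emul m n (M : 'M[K]_(m, n)) x y c i j : (x < m)%N ->
  ent (Emx x y c m *m M) i j = ent M i j + (i == x)%:R * (c * ent M y j).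
Proof.
move=> hy; case: (ltnP i m) => hi; last first.
  by rewrite !(ent_out_row _ _ hi) gtn_eqF ?mul0r ?addr0 // (leq_trans hy).
rewrite ent_mul (eq_bigr (fun l : 'I_m => ent M l j * (l == i :> nat)%:R
   + (c * (i == x)%:R) * (ent M l j * (l == y :> nat)%:R))); last first.
  move=> l _; rewrite (_ : ent (Emx x y c m) i l = ((l == i :> nat)%:R + c * ((i == x :> nat) && (l == y :> nat))%:R)).
    by case: (i == x :> nat); case: (l == y :> nat); rewrite /= ?mulr1 ?mulr0 ?mulrDr; ring.
  by rewrite -[i]/(nat_of_ord (Ordinal hi)) entE mxE /= -val_eqE eq_sym.
rewrite big_split /= -mulr_sumr (sum_pick _ (fun l => ent M l j)) (sum_pick _ (fun l => ent M l j)) hi.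
by case: ltnP => hx; [ring | rewrite (ent_out_row _ _ hx); ring].
Qed.

Lemma ent_mulD m n (M : 'M[K]_(m, n)) x c i j :
  ent (M *m Dmx x c n) i j = ent M i j * (if j == x then c else 1).
Proof.
case: (ltnP j n) => hj; last by rewrite !(ent_out_col _ _ hj) mul0r.
rewrite ent_mul (eq_bigr (fun l : 'I_n => (ent M i l * (if j == x then c else 1)) * (l == j :> nat)%:R)).
  by rewrite (sum_pick _ (fun l => ent M i l * _)) hj.
move=> l _; rewrite (_ : ent (Dmx x c n) l j = (l == j :> nat)%:R * (if j == x then c else 1)); first by ring.
by rewrite -[j]/(nat_of_ord (Ordinal hj)) entE mxE.
Qed.

Lemma ent_Dmul m n (M : 'M[K]_(m, n)) x c i j :
  ent (Dmx x c m *m M) i j = ent M i j * (if i == x then c else 1).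
Proof.
case: (ltnP i m) => hi; last by rewrite !(ent_out_row _ _ hi) mul0r.
rewrite ent_mul (eq_bigr (fun l : 'I_m => (ent M l j * (if i == x then c else 1)) * (l == i :> nat)%:R)).
  by rewrite (sum_pick _ (fun l => ent M l j * _)) hi.
move=> l _; rewrite (_ : ent (Dmx x c m) i l = (l == i :> nat)%:R * (if l == x :> nat then c else 1)).
  by case: eqP => [->|_] /=; ring.
by rewrite -[i]/(nat_of_ord (Ordinal hi)) entE mxE /= -val_eqE eq_sym.
Qed.

Lemma swpK x y : involutive (swp x y).
Proof. by move=> j; rewrite /swp; do !case: eqP; lia. Qed.

Lemma swp_lt n x y j : (x < n)%N -> (y < n)%N -> (swp x y j < n)%N = (j < n)%N.
Proof. by move=> hx hy; rewrite /swp; do !case: eqP => [->|?]; rewrite ?hx ?hy. Qed.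

Lemma swp_eq x y i j : (i == swp x y j) = (swp x y i == j).
Proof. by apply/eqP/eqP => [->|<-]; rewrite swpK. Qed.

Lemma ent_mulS m n (M : 'M[K]_(m, n)) x y i j : (x < n)%N -> (y < n)%N ->
  ent (M *m Smx x y n) i j = ent M i (swp x y j).
Proof.
move=> hx hy; case: (ltnP j n) => hj; last by rewrite !ent_out_col // leqNgt swp_lt // -leqNgt.
rewrite ent_mul (eq_bigr (fun l : 'I_n => ent M i l * (l == swp x y j :> nat)%:R)).
  by rewrite (sum_pick _ (fun l => ent M i l)) swp_lt ?hj.
by move=> l _; rewrite -[j]/(nat_of_ord (Ordinal hj)) entE mxE.
Qed.

Lemma ent_Smul m n (M : 'M[K]_(m, n)) x y i j : (x < m)%N -> (y < m)%N ->
  ent (Smx x y m *m M) i j = ent M (swp x y i) j.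
Proof.
move=> hx hy; case: (ltnP i m) => hi; last by rewrite !ent_out_row // leqNgt swp_lt // -leqNgt.
rewrite ent_mul (eq_bigr (fun l : 'I_m => ent M l j * (l == swp x y i :> nat)%:R)).
  by rewrite (sum_pick _ (fun l => ent M l j)) swp_lt ?hi.
move=> l _; rewrite mulrC; congr (_ * _).
by rewrite -[i]/(nat_of_ord (Ordinal hi)) entE mxE /= swp_eq eq_sym.
Qed.

Lemma ent1 n i j : (i < n)%N -> ent (1%:M : 'M[K]_n) i j = (i == j)%:R.
Proof.
move=> hi; case: entP => [i' j' -> ->|/orP[h|h]]; first by rewrite mxE.
  by rewrite leqNgt hi in h.
by rewrite ltn_eqF // (leq_trans hi).
Qed.

Lemma EmxK x y c n : x != y -> Emx x y c n *m Emx x y (- c) n = 1%:M.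
Proof.
move=> nxy; apply: ent_eq => i j hi hj.
case: (ltnP y n) => hy.
  rewrite ent_mulE // -[Emx x y c n]mul1mx !(ent_mulE 1%:M) // !ent1 //.
  by rewrite (negPf nxy) mul0r addr0; ring.
have h0 e : Emx x y e n = 1%:M.
  apply/matrixP => k l; rewrite !mxE (ltn_eqF (leq_trans (ltn_ord l) hy)) andbF mulr0 addr0 //.
by rewrite !h0 mul1mx.
Qed.

Lemma DmxK x c n : c != 0 -> Dmx x c n *m Dmx x c^-1 n = 1%:M.
Proof.
move=> c0; apply: ent_eq => i j hi hj; rewrite ent_mulD -[Dmx x c n]mul1mx ent_mulD ent1 //.
by case: (j == x); rewrite -mulrA ?divff // ?mul1r ?mulr1.
Qed.

Lemma SmxK x y n : (x < n)%N -> (y < n)%N -> Smx x y n *m Smx x y n = 1%:M.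
Proof.
move=> hx hy; apply: ent_eq => i j hi hj.
rewrite ent_Smul // -[i in RHS](swpK x y) -[Smx x y n]mul1mx ent_mulS // !ent1 ?swp_lt //.
by rewrite [in RHS]swpK swp_eq swpK.
Qed.

End Entries.

(** * Base changes and the isomorphism recorded by the basis matrices *)

Section Tracking.
Local Open Scope ring_scope.
Variable K : fieldType.

Definition mxs (d : vertex -> nat) := forall r, 'M[K]_(nrows d r, ncols d r).

(* Effect on the matrix in register [r] of the changes of basis of [V^v] by
   [E v], with inverse [E' v], at all vertices [v] in [T]. *)
Definition chg (T : pred vertex) (E E' : vertex -> forall n, 'M[K]_n)
    r m n (M : 'M[K]_(m, n)) : 'M[K]_(m, n) :=
  match r with
  | Str b => let M1 := if T (src b) then M *m E (src b) n else M in
             if T (tgt b) then E' (tgt b) m *m M1 else M1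
  | Bas w => if T w then M *m E w n else M
  end.

(** The source of an arrow acts on its matrix from the right and the target from the left, so
    changes at disjoint sets of vertices do not interfere. *)
Lemma chg_disjoint (T1 T2 : pred vertex) (E E' : vertex -> forall n, 'M[K]_n) r m n
    (M : 'M[K]_(m, n)) : (forall v, ~~ (T1 v && T2 v)) ->
  chg T2 E E' r (chg T1 E E' r M) = chg (fun v => T1 v || T2 v) E E' r M.
Proof.
move=> dis; case: r => [b|w] /=.
  have := dis (src b); have := dis (tgt b);
  by case: (T1 (src b)); case: (T2 (src b)); case: (T1 (tgt b)); case: (T2 (tgt b)) => //= _ _; rewrite ?mulmxA.
by have := dis w; case: (T1 w); case: (T2 w).
Qed.

Lemma eq_chg (T1 T2 : pred vertex) (E E' : vertex -> forall n, 'M[K]_n) r m n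
    (M : 'M[K]_(m, n)) : T1 =1 T2 -> chg T1 E E' r M = chg T2 E E' r M.
Proof. by move=> eT; rewrite /chg; case: r => [b|w]; rewrite !eT. Qed.

(** The invariant of all base changes: the matrices [Bas] are an isomorphism onto [V] from the
    representation currently held in the registers [Str]. *)
Definition tracks (V : rep K) (m : mxs (rdim V)) :=
  (forall v, m (Bas v) \in unitmx) /\
  forall a, rmap V a *m m (Bas (src a)) = m (Bas (tgt a)) *m m (Str a).

Lemma chg_tracks (V : rep K) (T : pred vertex) (E E' : vertex -> forall n, 'M[K]_n) (m m' : mxs (rdim V)) :
  (forall v, T v -> E v (rdim V v) *m E' v (rdim V v) = 1%:M) ->
  (forall r, m' r = chg T E E' r (m r)) ->
  tracks m -> tracks m'.
Proof.
move=> EE' hm [hu hc]; split=> [w|a].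
  have := hu w; rewrite hm /= !unitmxE; case: ifP => // Tw.
  rewrite det_mulmx unitrM => -> /=.
  by have /mulmx1_unit[] := EE' _ Tw; rewrite unitmxE.
rewrite !hm /=.
have -> : rmap V a *m (if T (src a) then m (Bas (src a)) *m E (src a) (rdim V (src a)) else m (Bas (src a)))
  = m (Bas (tgt a)) *m (if T (src a) then m (Str a) *m E (src a) (rdim V (src a)) else m (Str a)).
  by case: ifP => _; rewrite ?mulmxA hc.
case: (boolP (T (tgt a))) => // Ta; rewrite mulmxA -[_ *m E _ _ *m E' _ _]mulmxA.
by rewrite EE' // mulmx1.
Qed.

(** The stored matrices are conjugate to those of [V], so the relations carry over once the
    invertible [Bas v5] is cancelled. *)
Lemma tracks_comm (V : rep K) (m : mxs (rdim V)) : tracks m ->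
  m (Str a45) *m m (Str a14) = m (Str a25) *m m (Str a12) /\
  m (Str a65) *m m (Str a36) = m (Str a25) *m m (Str a32).
Proof.
case=> hu hc.
have inj p (A B : 'M[K]_(rdim V v5, p)) : m (Bas v5) *m A = m (Bas v5) *m B -> A = B.
  by move=> e; rewrite -[A](mulKmx (hu v5)) e mulKmx.
have h12 := hc a12; have h32 := hc a32; have h45 := hc a45; have h65 := hc a65.
have h14 := hc a14; have h25 := hc a25; have h36 := hc a36.
have cl := rep_comm_l V; have cr := rep_comm_r V.
rewrite /= in h12 h32 h45 h65 h14 h25 h36 cl cr.
split; apply: inj; rewrite !mulmxA /=.
  by rewrite -h45 -h25 -!mulmxA -h14 -h12 !mulmxA cl.
by rewrite -h65 -h25 -!mulmxA -h36 -h32 !mulmxA cr.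
Qed.

End Tracking.

(** * Running programs *)

Definition V x := NLoad x (NConst 0).

Definition For x e body :=
  Seq (Store x (NConst 0) (NConst 0))
    (While (NLe (NAdd (V x) (NConst 1)) e)
       (Seq body (Store x (NConst 0) (NAdd (V x) (NConst 1))))).

Definition seqs := foldr Seq Skip.

Section Runs.
Variables (K : fieldType) (d : vertex -> nat).
Notation state := (state K d).

(** Total correctness with a cost bound: a stuck or diverging run has no derivation of [exec], so
    exhibiting one proves termination too. *)
Definition runs p (s : state) B (Q : state -> Prop) :=
  exists s' t, [/\ exec p s s' t, t <= B & Q s'].

Lemma runs_weak p s B B' (Q Q' : state -> Prop) :
  runs p s B Q -> B <= B' -> (forall s', Q s' -> Q' s') -> runs p s B' Q'.
Proof.
by move=> [s' [t [h1 h2 h3]]] hB hQ; exists s', t; split; [|apply: leq_trans hB|apply: hQ].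
Qed.

Lemma runs_skip s B (Q : state -> Prop) : Q s -> runs Skip s B Q.
Proof. by move=> q; exists s, 0; split=> //; constructor. Qed.

Lemma runs_store s x e e' B (Q : state -> Prop) :
  Q (set_mem s x (neval s e) (neval s e')) -> runs (Store x e e') s B Q.
Proof. by move=> q; eexists _, 0; split; [constructor| |exact: q]. Qed.

Lemma runs_seq p q s B1 B2 B (Q : state -> Prop) :
  runs p s B1 (fun s' => runs q s' B2 Q) -> B1 + B2 <= B -> runs (Seq p q) s B Q.
Proof.
move=> [s1 [t1 [e1 l1 [s2 [t2 [e2 l2 q2]]]]]] hB.
exists s2, (t1 + t2); split=> //; first exact: ESeq e1 e2.
exact: leq_trans (leq_add l1 l2) hB.
Qed.

Lemma runs_if e p q s B (Q : state -> Prop) :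
  (neval s e != 0 -> runs p s B Q) -> (neval s e = 0 -> runs q s B Q) ->
  runs (If e p q) s B Q.
Proof.
case: (eqVneq (neval s e) 0) => [e0 _ /(_ e0)|e0 /(_ isT) h _].
  by move=> [s' [t [h1 h2 h3]]]; exists s', t; split=> //; apply: EIfFalse.
by case: h => [s' [t [h1 h2 h3]]]; exists s', t; split=> //; apply: EIfTrue.
Qed.

Lemma runs_test s x e r ei ej B (Q : state -> Prop) :
  neval s ei < nrows d r -> neval s ej < ncols d r ->
  Q (set_mem s x (neval s e) (ent (mx s r) (neval s ei) (neval s ej) == 0%R)) ->
  0 < B -> runs (TestZero x e r ei ej) s B Q.
Proof.
move=> hi hj q hB.
have := ETestZero x e (erefl : neval s ei = Ordinal hi) (erefl : neval s ej = Ordinal hj).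
by move=> h; eexists _, _; split; [exact: h| |rewrite -entE].
Qed.

Lemma neval_arr (s1 s2 : state) e : arr s1 = arr s2 -> neval s1 e = neval s2 e.
Proof. by move=> h; elim: e => //= [x e ->|e -> e' ->|e -> e' ->|e -> e' ->|e -> e' ->|e -> e' ->]; rewrite ?h. Qed.

Lemma runs_for x e body s n B B' (I : nat -> state -> Prop) (Q : state -> Prop) :
  I 0 (set_mem s x 0 0) ->
  (forall k s1, k <= n -> I k s1 -> neval s1 e = n) ->
  (forall k s1, k < n -> I k s1 -> arr s1 x 0 = k ->
     runs body s1 B (fun s2 => arr s2 x 0 = k /\ I k.+1 (set_mem s2 x 0 k.+1))) ->
  n * B <= B' -> (forall s1, I n s1 -> Q s1) -> runs (For x e body) s B' Q.
Proof.
move=> I0 In Ib hB IQ; apply: runs_weak IQ; last exact: hB.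
apply: (@runs_seq _ _ _ 0 (n * B)) => //; apply: runs_store => /=.
(* Induction on the number [m] of rounds that are left. *)
have gen m k s1 : k + m = n -> I k s1 -> arr s1 x 0 = k ->
    runs (While (NLe (NAdd (V x) (NConst 1)) e) (Seq body (Store x (NConst 0) (NAdd (V x) (NConst 1)))))
      s1 (m * B) (I n); last by apply: (gen n 0) => //=; rewrite !eqxx.
elim: m k s1 => [|m IH] k s1 km Ik ek.
  exists s1, 0; split=> //; last by rewrite addn0 in km; rewrite -km.
  apply: EWhileStop => /=; rewrite ek /= (In k) // -?km ?addn0 //.
  by rewrite addn1 ltnn.
have kn : k < n by rewrite -km addnS ltnS leq_addr.
have [s2 [t2 [e2 l2 [q2 i2]]]] := Ib k s1 kn Ik ek.
have [||s3 [t3 [e3 l3 q3]]] := IH k.+1 (set_mem s2 x 0 k.+1) _ i2.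
- by rewrite -km addSnnS.
- by rewrite /= !eqxx.
exists s3, (t2 + t3); split=> //; last by rewrite mulSn leq_add.
apply: EWhileStep e3.
  by rewrite /= ek (In k) ?(ltnW kn) // addn1 kn.
rewrite -[t2]addn0; apply: ESeq e2 _.
by have := EStore s2 x (NConst 0) (NAdd (V x) (NConst 1)); rewrite /= q2 addn1.
Qed.

Lemma exec_cat ps qs (s s' s'' : state) t t' :
  exec (seqs ps) s s' t -> exec (seqs qs) s' s'' t' -> exec (seqs (ps ++ qs)) s s'' (t + t').
Proof.
elim: ps s t => [|p ps IH] s t /= h; inversion h; subst => // h'.
by rewrite -addnA; apply: ESeq; [eassumption | apply: IH h'].
Qed.

Lemma runs_cat ps qs s B1 B2 B (Q : state -> Prop) :
  runs (seqs ps) s B1 (fun s' => runs (seqs qs) s' B2 Q) -> B1 + B2 <= B ->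
  runs (seqs (ps ++ qs)) s B Q.
Proof.
move=> [s1 [t1 [e1 l1 [s2 [t2 [e2 l2 q2]]]]]] hB.
exists s2, (t1 + t2); split=> //; first exact: exec_cat e1 e2.
exact: leq_trans (leq_add l1 l2) hB.
Qed.

Local Open Scope ring_scope.

Lemma dfwith_same (m : mxs K d) r M : dfwith m M r = M.
Proof. exact: dfwith_in. Qed.

Lemma dfwith_other (m : mxs K d) r (M : 'M[K]_(nrows d r, ncols d r)) r' :
  r' != r -> dfwith m M r' = m r'.
Proof. by move=> h; rewrite dfwith_out // eq_sym. Qed.

Definition only_changes (s s' : state) r (M : 'M[K]_(nrows d r, ncols d r)) :=
  [/\ arr s' = arr s, mx s' r = M & forall r', r' != r -> mx s' r' = mx s r'].

Lemma set_mx_only s r (M : 'M[K]_(nrows d r, ncols d r)) : only_changes s (set_mx s M) M.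
Proof. by split=> //= [|r' hr']; rewrite ?dfwith_same ?dfwith_other. Qed.

Lemma col_addE m n (i j : 'I_n) c (M : 'M[K]_(m, n)) : col_add i j c M = M *m Emx j i c n.
Proof.
apply: ent_eq => k l hk hl; rewrite ent_mulE //.
rewrite -[k]/(nat_of_ord (Ordinal hk)) -[l]/(nat_of_ord (Ordinal hl)) !entE mxE -val_eqE /=.
by case: eqP => _; rewrite ?mul1r ?mul0r ?addr0.
Qed.

Lemma row_addE m n (i j : 'I_m) c (M : 'M[K]_(m, n)) : row_add i j c M = Emx i j c m *m M.
Proof.
apply: ent_eq => k l hk hl; rewrite ent_Emul //.
rewrite -[k]/(nat_of_ord (Ordinal hk)) -[l]/(nat_of_ord (Ordinal hl)) !entE mxE -val_eqE /=.
by case: eqP => _; rewrite ?mul1r ?mul0r ?addr0.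
Qed.

Lemma col_scaleE m n (i : 'I_n) c (M : 'M[K]_(m, n)) : col_scale i c M = M *m Dmx i c n.
Proof.
apply: ent_eq => k l hk hl; rewrite ent_mulD.
rewrite -[k]/(nat_of_ord (Ordinal hk)) -[l]/(nat_of_ord (Ordinal hl)) !entE mxE -val_eqE /=.
by case: eqP => _; rewrite ?mulr1 // mulrC.
Qed.

Lemma row_scaleE m n (i : 'I_m) c (M : 'M[K]_(m, n)) : row_scale i c M = Dmx i c m *m M.
Proof.
apply: ent_eq => k l hk hl; rewrite ent_Dmul.
rewrite -[k]/(nat_of_ord (Ordinal hk)) -[l]/(nat_of_ord (Ordinal hl)) !entE mxE -val_eqE /=.
by case: eqP => _; rewrite ?mulr1 // mulrC.
Qed.

Lemma tperm_swp n (x y j : 'I_n) : tperm x y j = swp x y j :> nat.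
Proof. by rewrite /swp; case: tpermP => [->|->|/eqP/negPf h1 /eqP/negPf h2]; rewrite ?eqxx //; [case: eqP => // <- | rewrite !val_eqE h1 h2]. Qed.

Lemma xcolE m n (x y : 'I_n) (M : 'M[K]_(m, n)) : xcol x y M = M *m Smx K x y n.
Proof.
apply: ent_eq => k l hk hl; rewrite ent_mulS //.
rewrite -[k]/(nat_of_ord (Ordinal hk)) -[l]/(nat_of_ord (Ordinal hl)) !entE mxE.
by rewrite -tperm_swp entE.
Qed.

Lemma xrowE m n (x y : 'I_m) (M : 'M[K]_(m, n)) : xrow x y M = Smx K x y m *m M.
Proof.
apply: ent_eq => k l hk hl; rewrite ent_Smul //.
rewrite -[k]/(nat_of_ord (Ordinal hk)) -[l]/(nat_of_ord (Ordinal hl)) !entE mxE.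
by rewrite -tperm_swp entE.
Qed.

Section Ops.
Variables (s : state) (r : reg).

Lemma runs_coladd ei ej ec c x y : neval s ei = y -> neval s ej = x ->
  (y < ncols d r)%N -> (x < ncols d r)%N -> x != y -> feval s ec = Some c ->
  runs (ColAdd r ei ej ec) s (fcost ec + 2 * nrows d r)
    (fun s' => only_changes s s' (mx s r *m Emx x y c _)).
Proof.
move=> e1 e2 hy hx nxy ec1.
have h := @EColAdd K d s r ei ej (Ordinal hy) (Ordinal hx) ec c e1 e2 _ ec1.
eexists _, _; split; [apply: h; rewrite -val_eqE /= eq_sym // | by [] |].
by rewrite col_addE; apply: set_mx_only.
Qed.

Lemma runs_rowadd ei ej ec c x y : neval s ei = x -> neval s ej = y ->
  (y < nrows d r)%N -> (x < nrows d r)%N -> x != y -> feval s ec = Some c ->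
  runs (RowAdd r ei ej ec) s (fcost ec + 2 * ncols d r)
    (fun s' => only_changes s s' (Emx x y c _ *m mx s r)).
Proof.
move=> e1 e2 hy hx nxy ec1.
have h := @ERowAdd K d s r ei ej (Ordinal hx) (Ordinal hy) ec c e1 e2 _ ec1.
eexists _, _; split; [apply: h; rewrite -val_eqE // | by [] |].
by rewrite row_addE; apply: set_mx_only.
Qed.

Lemma runs_colscale ei ec c x : neval s ei = x -> (x < ncols d r)%N ->
  feval s ec = Some c -> c != 0 ->
  runs (ColScale r ei ec) s (fcost ec + nrows d r)
    (fun s' => only_changes s s' (mx s r *m Dmx x c _)).
Proof.
move=> e1 hx ec1 c0; have h := @EColScale K d s r ei (Ordinal hx) ec c e1 ec1 c0.
by eexists _, _; split; [apply: h | by [] |]; rewrite col_scaleE; apply: set_mx_only.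
Qed.

Lemma runs_rowscale ei ec c x : neval s ei = x -> (x < nrows d r)%N ->
  feval s ec = Some c -> c != 0 ->
  runs (RowScale r ei ec) s (fcost ec + ncols d r)
    (fun s' => only_changes s s' (Dmx x c _ *m mx s r)).
Proof.
move=> e1 hx ec1 c0; have h := @ERowScale K d s r ei (Ordinal hx) ec c e1 ec1 c0.
by eexists _, _; split; [apply: h | by [] |]; rewrite row_scaleE; apply: set_mx_only.
Qed.

Lemma runs_colswap ei ej x y : neval s ei = x -> neval s ej = y ->
  (x < ncols d r)%N -> (y < ncols d r)%N ->
  runs (ColSwap r ei ej) s 0 (fun s' => only_changes s s' (mx s r *m Smx K x y _)).
Proof.
move=> e1 e2 hx hy; have h := @EColSwap K d s r ei ej (Ordinal hx) (Ordinal hy) e1 e2.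
by eexists _, _; split; [apply: h | by [] |]; rewrite xcolE; apply: set_mx_only.
Qed.

Lemma runs_rowswap ei ej x y : neval s ei = x -> neval s ej = y ->
  (x < nrows d r)%N -> (y < nrows d r)%N ->
  runs (RowSwap r ei ej) s 0 (fun s' => only_changes s s' (Smx K x y _ *m mx s r)).
Proof.
move=> e1 e2 hx hy; have h := @ERowSwap K d s r ei ej (Ordinal hx) (Ordinal hy) e1 e2.
by eexists _, _; split; [apply: h | by [] |]; rewrite xrowE; apply: set_mx_only.
Qed.

End Ops.

End Runs.

(** * Programs that change bases at several vertices *)

Definition vertices := [:: v1; v2; v3; v4; v5; v6].
Definition arrows := [:: a12; a32; a45; a65; a14; a25; a36].
Definition code v :=
  match v with v1 => 0 | v2 => 1 | v3 => 2 | v4 => 3 | v5 => 4 | v6 => 5 end.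

Definition acode a :=
  match a with a12 => 0 | a32 => 1 | a45 => 2 | a65 => 3 | a14 => 4 | a25 => 5 | a36 => 6 end.

(* The equality tests of [vertex] and [arrow] are opaque. *)
Definition veq v w := code v == code w.
Definition aeq a b := acode a == acode b.

Lemma veqE v w : veq v w = (v == w).
Proof. by apply/eqP/eqP => [|->] //; case: v; case: w. Qed.

Lemma aeqE a b : aeq a b = (a == b).
Proof. by apply/eqP/eqP => [|->] //; case: a; case: b. Qed.

Lemma mem_vertices v : v \in vertices.
Proof. by rewrite !inE -!veqE; case: v. Qed.

Lemma dim_le (d : vertex -> nat) v : d v <= max_dim d.
Proof. by rewrite /max_dim !big_cons big_nil /= !leq_max; case: v; rewrite leqnn ?orbT. Qed.

Lemma nrows_le (d : vertex -> nat) r : nrows d r <= max_dim d.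
Proof. by case: r => x; apply: dim_le. Qed.

Lemma ncols_le (d : vertex -> nat) r : ncols d r <= max_dim d.
Proof. by case: r => x; apply: dim_le. Qed.

Definition incident v r :=
  match r with Str b => veq (src b) v || veq (tgt b) v | Bas w => veq w v end.
Definition registers := map Str arrows ++ map Bas vertices.
Definition is_str a r := match r with Str b => aeq b a | Bas _ => false end.

Lemma is_strE a r : is_str a r = (r == Str a).
Proof.
by case: r => [b|v] /=; [rewrite aeqE; apply/eqP/eqP => [->|[]] | apply/esym/eqP].
Qed.

Lemma mem_registers r : r \in registers.
Proof.
rewrite mem_cat; case: r => [b|v]; apply/orP; [left|right]; apply: map_f; last exact: mem_vertices.
by rewrite !inE -!aeqE; case: b.
Qed.

Lemma uniq_vertices : uniq vertices.
Proof. exact: (@map_uniq _ _ code). Qed.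

Lemma uniq_registers : uniq registers.
Proof.
exact: (@map_uniq _ _ (fun r => match r with Str b => acode b | Bas v => 10 + code v end)).
Qed.

(* The register [Str a] comes last: the coefficient of a change of basis is
   computed from an entry of it, which the change of basis destroys. *)
Definition registers_at v a :=
  [seq r <- registers | incident v r && ~~ is_str a r] ++ [seq r <- [:: Str a] | incident v r].

Definition basis_op (fc fr : reg -> cmd) v r :=
  match r with Str b => if veq (src b) v then fc r else fr r | Bas _ => fc r end.

(** The vertex [v0] comes last: it is the only one at which the change may touch [Str a], so
    coefficients read from [Str a] keep their original value until the very last operation. *)
Definition change_basis (g : vertex -> nexp) (fc fr : vertex -> reg -> cmd) a v0 :=
  seqs [seq If (g v) (seqs [seq basis_op (fc v) (fr v) v r | r <- registers_at v a]) Skip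
       | v <- rcons [seq v <- vertices | ~~ veq v v0] v0].

Section ChangeBasis.
Local Open Scope ring_scope.
Variables (K : fieldType) (d : vertex -> nat) (a : arrow) (s0 : state K d).
Variables (T : pred vertex) (E E' : vertex -> forall n, 'M[K]_n).
Variables (g : vertex -> nexp) (fc fr : vertex -> reg -> cmd) (B : nat).
Hypothesis Hg : forall (s : state K d) v, arr s = arr s0 -> (neval s (g v) != 0%N) = T v.
Hypothesis Hc : forall (s : state K d) v r, T v -> arr s = arr s0 -> mx s (Str a) = mx s0 (Str a) ->
  ncols d r = d v -> runs (fc v r) s B (fun s' => only_changes s s' (mx s r *m E v _)).
Hypothesis Hr : forall (s : state K d) v r, T v -> arr s = arr s0 -> mx s (Str a) = mx s0 (Str a) ->
  nrows d r = d v -> runs (fr v r) s B (fun s' => only_changes s s' (E' v _ *m mx s r)).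

Lemma basis_op_runs s v r : T v -> incident v r -> arr s = arr s0 ->
  mx s (Str a) = mx s0 (Str a) ->
  runs (basis_op (fc v) (fr v) v r) s B
    (fun s' => only_changes s s' (chg (pred1 v) E E' r (mx s r))).
Proof.
move=> Tv iv es em; case: r iv => [b|w] /=; rewrite !veqE; last first.
  by move/eqP=> ew; subst w; rewrite /in_mem /= eqxx; apply: Hc.
have st : src b != tgt b by rewrite -veqE; case: (b).
rewrite /in_mem /=; case: (src b =P v) => [e _|_ /= /eqP e]; subst v.
  by rewrite eq_sym (negPf st); apply: Hc.
by rewrite eqxx; apply: Hr.
Qed.

Lemma basis_ops_runs s v rs : T v -> all (incident v) rs -> uniq rs -> Str a \notin rs ->
  arr s = arr s0 -> mx s (Str a) = mx s0 (Str a) ->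
  runs (seqs [seq basis_op (fc v) (fr v) v r | r <- rs]) s (size rs * B)
    (fun s' => arr s' = arr s /\
       forall r, mx s' r = if r \in rs then chg (pred1 v) E E' r (mx s r) else mx s r).
Proof.
move=> Tv; elim: rs s => [|r rs IH] s /= => [_ _ _ _ _|/andP[iv ivs] /andP[nr us]].
  exact: runs_skip.
rewrite inE negb_or => /andP[nar nars] es em.
apply: runs_seq (leqnn _); apply: runs_weak (basis_op_runs Tv iv es em) (leqnn _) _.
move=> s1 [ea er eo].
have es1 : arr s1 = arr s0 by rewrite ea.
have em1 : mx s1 (Str a) = mx s0 (Str a) by rewrite eo.
apply: runs_weak (IH s1 ivs us nars es1 em1) (leqnn _) _ => s2 [ea2 em2].
split=> [|r']; first by rewrite ea2.
rewrite em2 inE; case: (eqVneq r' r) => [->|n'] /=; first by rewrite (negPf nr).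
by rewrite eo.
Qed.

(** A vertex meets at most three arrows; the fourth register records its basis. *)
Lemma size_registers_at v : (size (registers_at v a) <= 4)%N.
Proof. by case: v; case: a. Qed.

Lemma vertex_runs s v : T v -> arr s = arr s0 -> mx s (Str a) = mx s0 (Str a) ->
  runs (seqs [seq basis_op (fc v) (fr v) v r | r <- registers_at v a]) s (4 * B)
    (fun s' => arr s' = arr s /\ forall r, mx s' r = chg (pred1 v) E E' r (mx s r)).
Proof.
move=> Tv es em; set Q := (X in runs _ _ _ X).
have hs : (size (registers_at v a) * B <= 4 * B)%N by rewrite leq_mul2r size_registers_at orbT.
apply: (@runs_weak _ _ _ _ (size (registers_at v a) * B) _ Q) => // {hs}.
  rewrite /Q /registers_at.
  set rs := [seq r <- registers | _].
  have inrs r : (r \in rs) = incident v r && (r != Str a) by rewrite mem_filter mem_registers andbT is_strE.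
  have h1 := @basis_ops_runs s v rs Tv.
  have h0 : all (incident v) rs by apply/allP=> r; rewrite inrs => /andP[].
  move: h0 => /h1 {}h1.
  have /h1 {}h1 : uniq rs by rewrite filter_uniq // uniq_registers.
  have /h1 {}h1 : Str a \notin rs by rewrite inrs eqxx andbF.
  have {}h1 := h1 es em.
  have noinc r : ~~ incident v r -> mx s r = chg (pred1 v) E E' r (mx s r).
    case: r => [b|w] /=; rewrite !veqE /in_mem /=; last by move/negPf=> ->.
    by rewrite negb_or => /andP[/negPf-> /negPf->].
  rewrite [filter _ [:: Str a]]/=; case: ifP => ia; last first.
    rewrite cats0; apply: runs_weak h1 (leqnn _) _ => s1 [e1 e2]; split=> // r.
    rewrite e2 inrs; case: (boolP (incident v r)) => [ir|/noinc //] /=.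
    by case: eqP => // er; move: ir; rewrite er /= ia.
  rewrite map_cat size_cat; apply: (@runs_cat _ _ _ _ _ (size rs * B) B); last by rewrite mulnDl mul1n.
  apply: runs_weak h1 (leqnn _) _ => s1 [e1 e2].
  apply: (@runs_seq _ _ _ _ _ B 0); last by rewrite addn0.
  have ea1 : mx s1 (Str a) = mx s (Str a) by rewrite e2 inrs eqxx andbF.
  apply: runs_weak (@basis_op_runs s1 v (Str a) Tv ia _ _) (leqnn _) _; rewrite ?e1 ?ea1 //.
  move=> s2 [f1 f2 f3]; apply: runs_skip; split; first by rewrite f1.
  move=> r; case: (eqVneq r (Str a)) => [->|nr]; first by rewrite f2.
  by rewrite f3 // e2 inrs nr andbT; case: (boolP (incident v r)) => // /noinc.
Qed.

Lemma vertices_runs vs s (U : pred vertex) :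
  all (fun v => T v ==> ~~ incident v (Str a)) vs -> uniq vs ->
  (forall v, v \in vs -> ~~ U v) ->
  arr s = arr s0 -> mx s (Str a) = mx s0 (Str a) ->
  runs (seqs [seq If (g v) (seqs [seq basis_op (fc v) (fr v) v r | r <- registers_at v a]) Skip
       | v <- vs]) s (size vs * (4 * B))
    (fun s' => [/\ arr s' = arr s, mx s' (Str a) = mx s (Str a)
       & forall r, mx s' r = chg (fun v => (v \in vs) && T v) E E' r (mx s r)]).
Proof.
elim: vs s U => [|v vs IH] s U /=; first by move=> *; apply: runs_skip; split=> // -[].
move=> /andP[iv ivs] /andP[nv uvs] dis es em.
apply: runs_seq (leqnn _).
have hv : runs (If (g v) (seqs [seq basis_op (fc v) (fr v) v r | r <- registers_at v a]) Skip) s (4 * B)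
   (fun s' => arr s' = arr s /\ forall r, mx s' r = chg (fun w => (w == v) && T w) E E' r (mx s r)).
  apply: runs_if.
    rewrite Hg // => Tv; apply: runs_weak (vertex_runs Tv es em) (leqnn _) _ => s1 [e1 e2].
    by split=> // r; rewrite e2; apply: eq_chg => w; rewrite /in_mem /=; case: eqP => // ->.
  move=> gv; apply: runs_skip; split=> // r.
  have nT : T v = false by rewrite -(@Hg s) // gv.
  have nU w : (w == v) && T w = false by case: eqP => // ->.
  by case: r => [b|w] /=; rewrite !nU.
apply: runs_weak hv (leqnn _) _ => s1 [e1 e2].
have ea : mx s1 (Str a) = mx s (Str a).
  rewrite e2 /=; have [Tv|nT] := boolP (T v).
    move: iv; rewrite Tv /= !veqE negb_or => /andP[h1 h2].
    by rewrite (negPf h1) (negPf h2).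
  have nU w : (w == v) && T w = false by case: eqP => // ->; apply/negbTE.
  by rewrite !nU.
have h := IH s1 (fun=> false) ivs uvs _ _ _.
apply: runs_weak (h _ _ _) (leqnn _) _ => //; rewrite ?e1 ?ea //.
move=> s2 [f1 f2 f3]; split; rewrite ?f1 ?f2 // => r.
rewrite f3 e2 chg_disjoint.
  by apply: eq_chg => w; rewrite inE; case: eqP => //= ->; rewrite (negPf nv) orbF.
by move=> w; case: eqP => //= ->; rewrite (negPf nv) andbF.
Qed.

(** The factor 24 counts six vertices with at most four registers each. *)
Lemma change_basis_runs v0 : (forall v, v != v0 -> T v -> ~~ incident v (Str a)) ->
  runs (change_basis g fc fr a v0) s0 (24 * B)
    (fun s' => arr s' = arr s0 /\ forall r, mx s' r = chg T E E' r (mx s0 r)).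
Proof.
move=> dis; rewrite /change_basis -cats1 map_cat.
apply: (@runs_cat _ _ _ _ _ (size [seq v <- vertices | ~~ veq v v0] * (4 * B)) (4 * B)); last first.
  by case: (v0) => /=; lia.
have h := @vertices_runs [seq v <- vertices | ~~ veq v v0] s0 (fun=> false).
apply: runs_weak (h _ _ _ _ _) (leqnn _) _ => //.
- by apply/allP => v; rewrite mem_filter veqE => /andP[n0 _]; apply/implyP; apply: dis.
- by rewrite filter_uniq // uniq_vertices.
move=> s1 [e1 e2 e3].
apply: (@runs_seq _ _ _ _ _ (4 * B) 0); last by rewrite addn0.
have mE w : (w \in [seq v <- vertices | ~~ veq v v0]) = (w != v0) by rewrite mem_filter mem_vertices andbT veqE.
apply: runs_if.
  rewrite Hg // => Tv; apply: runs_weak (vertex_runs Tv e1 e2) (leqnn _) _ => s2 [f1 f2].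
  apply: runs_skip; split; rewrite ?f1 // => r; rewrite f2 e3 chg_disjoint.
    by apply: eq_chg => w; rewrite mE /=; case: eqP => [->|_] /=; rewrite ?Tv ?orbF.
  by move=> w; rewrite mE /=; case: eqP => //= _; rewrite andbF.
move=> gv; apply: runs_skip; apply: runs_skip; split=> // r; rewrite e3.
apply: eq_chg => w; rewrite mE; case: eqP => //= ->.
by rewrite -(@Hg s1) // gv.
Qed.

End ChangeBasis.

(** * Labels *)

Definition idA v := 10 + code v.
Definition ixA v := 20 + code v.
Definition IDe v e := NLoad (idA v) e.
Definition POSe v u := NSub (NLoad (ixA v) u) (NConst 1).

(* [A (idA v) i] is the label of the [i]-th basis vector of [V^v]; the array
   [ixA v] is inverse to [idA v], shifted by one so that 0 means "absent". *)
Definition labels_ok (d : vertex -> nat) (A : nat -> nat -> nat) :=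
  (forall v i, i < d v -> A (ixA v) (A (idA v) i) = i.+1) /\
  (forall v u i, A (ixA v) u = i.+1 -> i < d v /\ A (idA v) i = u).

Definition pres (A : nat -> nat -> nat) u v := A (ixA v) u != 0.
Definition pos (A : nat -> nat -> nat) u v := (A (ixA v) u).-1.
Definition both A x y v := pres A x v && pres A y v.

Section Labels.
Variables (d : vertex -> nat) (A : nat -> nat -> nat).
Hypothesis ok : labels_ok d A.

Lemma pos_lt u v : pres A u v -> pos A u v < d v.
Proof. by rewrite /pres /pos; case e: (A (ixA v) u) => [//|i] _; have [] := ok.2 _ _ _ e. Qed.

Lemma pos_id u v : pres A u v -> A (idA v) (pos A u v) = u.
Proof. by rewrite /pres /pos; case e: (A (ixA v) u) => [//|i] _; have [] := ok.2 _ _ _ e. Qed.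

Lemma id_pres v i : i < d v -> pres A (A (idA v) i) v.
Proof. by move=> hi; rewrite /pres ok.1. Qed.

Lemma id_pos v i : i < d v -> pos A (A (idA v) i) v = i.
Proof. by move=> hi; rewrite /pos ok.1. Qed.

Lemma id_inj v i j : i < d v -> j < d v -> A (idA v) i = A (idA v) j -> i = j.
Proof. by move=> hi hj e; rewrite -(id_pos hi) e id_pos. Qed.

Lemma id_eq v i u : i < d v -> (A (idA v) i == u) = pres A u v && (i == pos A u v).
Proof.
move=> hi; apply/eqP/andP => [<-|[pu /eqP->]]; last exact: pos_id.
by rewrite id_pres // id_pos.
Qed.
End Labels.

(** Positions are stored plus one, so the product in the guard is nonzero exactly where both labels
    live. The vector of [uy] receives [c] times that of [ux]; rows of arrows ending at the vertex
    undergo the inverse change, whence a second coefficient [cN], meant to be the opposite of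
    [c]. *)
Definition add_labels a v0 ux uy c cN :=
  change_basis (fun v => NMul (NLoad (ixA v) ux) (NLoad (ixA v) uy))
    (fun v r => ColAdd r (POSe v uy) (POSe v ux) c)
    (fun v r => RowAdd r (POSe v ux) (POSe v uy) cN) a v0.

Definition scale_label a v0 u c cV :=
  change_basis (fun v => NLoad (ixA v) u)
    (fun v r => ColScale r (POSe v u) c) (fun v r => RowScale r (POSe v u) cV) a v0.

Section LabelOps.
Local Open Scope ring_scope.
Variables (K : fieldType) (d : vertex -> nat).
Implicit Types (s : state K d) (m : mxs K d) (A : nat -> nat -> nat).

Definition addE A x y (c : K) v n := Emx (pos A x v) (pos A y v) c n.
Definition scaleE A u (c : K) v n := Dmx (pos A u v) c n.

Definition added A x y c m m' :=
  forall r, m' r = chg (both A x y) (addE A x y c) (addE A x y (- c)) r (m r).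
Definition scaled A u c m m' :=
  forall r, m' r = chg (pres A u) (scaleE A u c) (scaleE A u c^-1) r (m r).

(** Here 72 is 24 * 3: an operation costs at most 1 + 2 * [max_dim d], which is at most 3 *
    [max_dim d] because the dimension is positive wherever both labels live. *)
Lemma add_labels_runs s a v0 ux uy c cN x y g : labels_ok d (arr s) ->
  neval s ux = x -> neval s uy = y -> x != y -> (fcost c <= 1)%N -> (fcost cN <= 1)%N ->
  (forall s1, arr s1 = arr s -> mx s1 (Str a) = mx s (Str a) ->
     feval s1 c = Some g /\ feval s1 cN = Some (- g)) ->
  (forall v, v != v0 -> both (arr s) x y v -> ~~ incident v (Str a)) ->
  runs (add_labels a v0 ux uy c cN) s (72 * max_dim d)
    (fun s' => arr s' = arr s /\ added (arr s) x y g (mx s) (mx s')).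
Proof.
move=> ok ex ey nxy hc hcN hev dis.
have hpos s1 v u e : arr s1 = arr s -> neval s e = u -> neval s1 (POSe v e) = pos (arr s) u v.
  by move=> e1 <-; rewrite /= (neval_arr _ e1) e1 subn1.
have nxyv v : both (arr s) x y v -> pos (arr s) x v != pos (arr s) y v.
  by case/andP=> px py; apply: contra nxy => /eqP e; rewrite -(pos_id ok px) e (pos_id ok py).
have hcost v (k l : nat) : both (arr s) x y v -> (k <= 1)%N -> (l <= max_dim d)%N ->
    (k + 2 * l <= 3 * max_dim d)%N.
  move=> /andP[px _]; have := leq_trans (pos_lt ok px) (dim_le d v); lia.
have := @change_basis_runs K d a s (both (arr s) x y) (addE (arr s) x y g) (addE (arr s) x y (- g))
  (fun v => NMul (NLoad (ixA v) ux) (NLoad (ixA v) uy))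
    (fun v r => ColAdd r (POSe v uy) (POSe v ux) c)
    (fun v r => RowAdd r (POSe v ux) (POSe v uy) cN) (3 * max_dim d) _ _ _ v0 dis.
have -> : (24 * (3 * max_dim d) = 72 * max_dim d)%N by lia.
apply.
- by move=> s1 v e1; rewrite /= !(neval_arr _ e1) ex ey e1 muln_eq0 negb_or.
- move=> s1 v r Tv e1 em er; have [h1 _] := hev s1 e1 em.
  have [px py] := andP Tv.
  have := @runs_coladd K d s1 r (POSe v uy) (POSe v ux) c g (pos (arr s) x v) (pos (arr s) y v)
    (hpos _ _ _ _ e1 ey) (hpos _ _ _ _ e1 ex).
  have lt u : pres (arr s) u v -> (pos (arr s) u v < ncols d r)%N by rewrite er; apply: pos_lt.
  move=> /(_ (lt _ py) (lt _ px) (nxyv _ Tv) h1) h.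
  by apply: runs_weak h _ _ => //; apply: (hcost v); rewrite ?nrows_le.
- move=> s1 v r Tv e1 em er; have [_ h1] := hev s1 e1 em.
  have [px py] := andP Tv.
  have := @runs_rowadd K d s1 r (POSe v ux) (POSe v uy) cN (- g) (pos (arr s) x v) (pos (arr s) y v)
    (hpos _ _ _ _ e1 ex) (hpos _ _ _ _ e1 ey).
  have lt u : pres (arr s) u v -> (pos (arr s) u v < nrows d r)%N by rewrite er; apply: pos_lt.
  move=> /(_ (lt _ py) (lt _ px) (nxyv _ Tv) h1) h.
  by apply: runs_weak h _ _ => //; apply: (hcost v); rewrite ?ncols_le.
Qed.

Lemma scale_label_runs s a v0 ux c cV x g : labels_ok d (arr s) ->
  neval s ux = x -> (fcost c <= 1)%N -> (fcost cV <= 1)%N -> g != 0 ->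
  (forall s1, arr s1 = arr s -> mx s1 (Str a) = mx s (Str a) ->
     feval s1 c = Some g /\ feval s1 cV = Some (g^-1)) ->
  (forall v, v != v0 -> pres (arr s) x v -> ~~ incident v (Str a)) ->
  runs (scale_label a v0 ux c cV) s (72 * max_dim d)
    (fun s' => arr s' = arr s /\ scaled (arr s) x g (mx s) (mx s')).
Proof.
move=> ok ex hc hcN g0 hev dis.
have hpos s1 v u e : arr s1 = arr s -> neval s e = u -> neval s1 (POSe v e) = pos (arr s) u v.
  by move=> e1 <-; rewrite /= (neval_arr _ e1) e1 subn1.
have hcost v (k l : nat) : pres (arr s) x v -> (k <= 1)%N -> (l <= max_dim d)%N ->
    (k + l <= 3 * max_dim d)%N.
  move=> px; have := leq_trans (pos_lt ok px) (dim_le d v); lia.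
have := @change_basis_runs K d a s (pres (arr s) x) (scaleE (arr s) x g) (scaleE (arr s) x g^-1)
  (fun v => NLoad (ixA v) ux)
    (fun v r => ColScale r (POSe v ux) c) (fun v r => RowScale r (POSe v ux) cV)
    (3 * max_dim d) _ _ _ v0 dis.
have -> : (24 * (3 * max_dim d) = 72 * max_dim d)%N by lia.
apply.
- by move=> s1 v e1; rewrite /= !(neval_arr _ e1) ex e1.
- move=> s1 v r px e1 em er; have [h1 _] := hev s1 e1 em.
  have := @runs_colscale K d s1 r (POSe v ux) c g (pos (arr s) x v) (hpos _ _ _ _ e1 ex).
  have lt : (pos (arr s) x v < ncols d r)%N by rewrite er; apply: pos_lt.
  move=> /(_ lt h1 g0) h.
  by apply: runs_weak h _ _ => //; apply: (hcost v); rewrite ?nrows_le.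
- move=> s1 v r px e1 em er; have [_ h1] := hev s1 e1 em.
  have := @runs_rowscale K d s1 r (POSe v ux) cV g^-1 (pos (arr s) x v) (hpos _ _ _ _ e1 ex).
  have lt : (pos (arr s) x v < nrows d r)%N by rewrite er; apply: pos_lt.
  rewrite invr_eq0 => /(_ lt h1 g0) h.
  by apply: runs_weak h _ _ => //; apply: (hcost v); rewrite ?ncols_le.
Qed.

(** [tu] and [tw] tell whether the change acts at the source and at the target. Column [xu] is zero
    or the unit vector at [xw], and row [yw] is zero or the unit vector at [yu]; so the two
    operations can alter only the entry in row [xw] and column [yu], where [c] and [- c] cancel. *)
Lemma add_fixes (m n : nat) (f : 'M[K]_(m, n)) xw yw xu yu (tw tu : bool) (c : K) :
  (tu -> yu < n)%N -> (tw -> xw < m)%N ->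
  (tu -> tw -> xw != yw) ->
  (tu -> forall i, (i < m)%N -> ent f i xu = (tw && (i == xw))%:R) ->
  (tw -> forall j, (j < n)%N -> ent f yw j = (tu && (j == yu))%:R) ->
  (if tw then Emx xw yw (- c) m *m (if tu then f *m Emx xu yu c n else f)
   else if tu then f *m Emx xu yu c n else f) = f.
Proof.
move=> hyu hxw nw hu hw; apply: ent_eq => i j hi hj.
case: tw hxw nw hu hw => [/(_ isT) hxw|_] nw hu hw; case: tu hyu nw hu hw => [/(_ isT) hyu|_] nw hu hw //.
- have hyw j' : ent f yw j' = (j' == yu)%:R.
    case: (ltnP j' n) => hj'; first by rewrite hw.
    by rewrite ent_out_col // gtn_eqF // (leq_trans hyu).
  case: (ltnP yw m) => hyw'; last first.
    by have := hyw yu; rewrite eqxx ent_out_row // => /eqP; rewrite eq_sym oner_eq0.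
  rewrite ent_Emul // !ent_mulE // !hu // !hyw [yw == xw]eq_sym (negPf (nw isT isT)).
  by case: (i == xw); case: (j == yu); rewrite /=; ring.
- by rewrite ent_Emul // hw // !mulr0 addr0.
- by rewrite ent_mulE // hu // !mulr0 addr0.
Qed.

Definition linked A b m := forall i j, (i < d (tgt b))%N -> (j < d (src b))%N ->
  ent (m (Str b)) i j = (A (idA (tgt b)) i == A (idA (src b)) j)%:R.

(* [e_y := e_y + c e_x] is a base change by an endomorphism of the linked part. *)
Definition adm (px py : vertex -> bool) b :=
  (px (src b) && py (src b) && px (tgt b) ==> py (tgt b)) &&
  (px (tgt b) && py (tgt b) && py (src b) ==> px (src b)).

(** The two halves of [adm] are what turns column [x] and row [y] of a linked matrix into the unit
    vectors required by [add_fixes]. *)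
Lemma linked_add A x y c b m m' : labels_ok d A -> x != y -> linked A b m ->
  adm (pres A x) (pres A y) b -> added A x y c m m' -> linked A b m'.
Proof.
move=> ok nxy lb /andP[ad1 ad2] am i j hi hj; rewrite -lb // am /=; congr (ent _ i j).
move: ad1 ad2; rewrite -!/(both A x y _) => ad1 ad2.
apply: add_fixes.
- by case/andP=> _; apply: (pos_lt ok).
- by case/andP=> + _; apply: (pos_lt ok).
- move=> _ /andP[px py]; apply: contra nxy => /eqP e.
  by rewrite -(pos_id ok px) e (pos_id ok py).
- move=> bu i1 hi1; have /andP[pxu pyu] := bu.
  rewrite lb // ?(pos_lt ok) // (pos_id ok) // (id_eq ok) //; congr ((_ : bool)%:R).
  apply/andP/andP => -[h1 h2]; split=> //; last by case/andP: h1.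
  by rewrite /both h1; move: ad1; rewrite bu h1.
- move=> bw j1 hj1; have /andP[pxw pyw] := bw.
  rewrite lb // ?(pos_lt ok) // (pos_id ok) // eq_sym (id_eq ok) //; congr ((_ : bool)%:R).
  apply/andP/andP => -[h1 h2]; split=> //; last by case/andP: h1.
  by rewrite /both h1 andbT; move: ad2; rewrite bw h1.
Qed.

Lemma linked_scale A u c b m m' : labels_ok d A -> c != 0 -> linked A b m ->
  scaled A u c m m' -> linked A b m'.
Proof.
move=> ok c0 lb sm i j hi hj; rewrite sm /=.
have h1 : ent (if pres A u (src b) then m (Str b) *m scaleE A u c (src b) (d (src b)) else m (Str b)) i j
   = (A (idA (tgt b)) i == A (idA (src b)) j)%:R * (if A (idA (src b)) j == u then c else 1).
  rewrite [A (idA (src b)) j == u](id_eq ok) //; case: ifP => pu /=; last by rewrite mulr1 lb.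
  by rewrite ent_mulD lb.
have h2 : ent (if pres A u (tgt b) then scaleE A u c^-1 (tgt b) (d (tgt b)) *m (if pres A u (src b) then m (Str b) *m scaleE A u c (src b) (d (src b)) else m (Str b)) else (if pres A u (src b) then m (Str b) *m scaleE A u c (src b) (d (src b)) else m (Str b))) i j
   = (A (idA (tgt b)) i == A (idA (src b)) j)%:R * (if A (idA (src b)) j == u then c else 1) * (if A (idA (tgt b)) i == u then c^-1 else 1).
  rewrite [A (idA (tgt b)) i == u](id_eq ok) //; case: ifP => pu /=; last by rewrite mulr1 h1.
  by rewrite ent_Dmul h1.
rewrite h2; case: eqP => [->|_]; last by rewrite !mul0r.
by case: eqP => _; rewrite mul1r ?mulr1 // mulfV.
Qed.

Lemma added_col A x y c a m m' i j : labels_ok d A -> both A x y (src a) -> ~~ both A x y (tgt a) ->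
  added A x y c m m' ->
  ent (m' (Str a)) i j = ent (m (Str a)) i j + (j == pos A y (src a))%:R * (c * ent (m (Str a)) i (pos A x (src a))).
Proof.
move=> ok bs bt am; rewrite am /= bs (negPf bt); apply: ent_mulE.
by case/andP: bs => _; apply: (pos_lt ok).
Qed.

Lemma added_row A x y c a m m' i j : labels_ok d A -> both A x y (tgt a) -> ~~ both A x y (src a) ->
  added A x y c m m' ->
  ent (m' (Str a)) i j = ent (m (Str a)) i j - (i == pos A x (tgt a))%:R * (c * ent (m (Str a)) (pos A y (tgt a)) j).
Proof.
move=> ok bs bt am; rewrite am /= bs (negPf bt) ent_Emul; first by rewrite mulNr mulrN.
by case/andP: bs => + _; apply: (pos_lt ok).
Qed.

Lemma added_same A x y c m m' r : added A x y c m m' ->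
  (forall v, incident v r -> ~~ both A x y v) -> m' r = m r.
Proof.
move=> am h; rewrite am; case: r h => [b|w] h /=.
  by rewrite !(negPf (h _ _)) //= !veqE eqxx ?orbT.
by rewrite (negPf (h _ _)) //= veqE eqxx.
Qed.

End LabelOps.

Section TrackedOps.
Local Open Scope ring_scope.
Variables (K : fieldType) (W : rep K).
Notation d := (rdim W).

Lemma tracks_add A x y c (m m' : mxs K d) : labels_ok d A -> x != y ->
  tracks m -> added A x y c m m' -> tracks m'.
Proof.
move=> ok nxy tm am; apply: (chg_tracks _ am tm) => v /andP[px py].
by apply: EmxK; apply: contra nxy => /eqP e; rewrite -(pos_id ok px) e (pos_id ok py).
Qed.

Lemma tracks_scale A u c (m m' : mxs K d) : c != 0 ->
  tracks m -> scaled A u c m m' -> tracks m'.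
Proof. by move=> c0 tm sm; apply: (chg_tracks _ sm tm) => v _; apply: DmxK. Qed.

Definition tree (Done : seq arrow) A (m : mxs K d) :=
  tracks m /\ forall b, b \in Done -> linked A b m.

Lemma tree_add Done A x y c (m m' : mxs K d) : labels_ok d A -> x != y ->
  all (adm (pres A x) (pres A y)) Done ->
  added A x y c m m' -> tree Done A m -> tree Done A m'.
Proof.
move=> ok nxy ad am [tm lm]; split; first exact: tracks_add am.
by move=> b hb; apply: linked_add am => //; [apply: lm | apply: (allP ad)].
Qed.

Lemma tree_scale Done A u c (m m' : mxs K d) : labels_ok d A -> c != 0 ->
  scaled A u c m m' -> tree Done A m -> tree Done A m'.
Proof.
move=> ok c0 am [tm lm]; split; first exact: tracks_scale am.
by move=> b hb; apply: linked_scale am => //; apply: lm.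
Qed.

End TrackedOps.

(** * Elimination *)

Definition PIV := NSub (V 1) (NConst 1).
Definition NNot e := NEq e (NConst 0).

(* Array 0 holds the multiplicities, arrays 1 to 9 are local variables, 10 to 29
   hold the labels, 30 to 41 and 61 to 66 the pivots (index plus one, 0 for none),
   50 the label linked with a row of [Str a65], 70 to 74 the links between labels,
   75 a bound on the labels and 80 the number of vectors in final position. *)
Definition keep (K : fieldType) d (s s' : state K d) := forall x k, 9 < x -> arr s' x k = arr s x k.

Definition condE := (muln_eq0, addn_eq0, negb_or, negb_and, eqb0, negbK).

Lemma runs_ifb (K : fieldType) d e p q (s : state K d) B (Q : state K d -> Prop) b :
  (neval s e != 0) = b -> (b -> runs p s B Q) -> (~~ b -> runs q s B Q) -> runs (If e p q) s B Q.
Proof.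
move=> eb h1 h2; apply: runs_if; first by rewrite eb.
by move=> e0; apply: h2; rewrite -eb e0.
Qed.

Section Sweep.
Local Open Scope ring_scope.

Variables (a : arrow) (rp cp : nat) (kapE rhoE cmE rmE : nexp -> nexp) (RA CA SC : cmd).

(** Array 1 holds the pivot row plus one. Its rank is least among the candidates, so that it may be
    added to every other one. *)
Definition find_pivot :=
  Seq (Store 1 (NConst 0) (NConst 0))
   (For 5 (NDim (tgt a)) (If (NMul (rmE (V 5)) (NNot (NLoad rp (V 5))))
     (Seq (TestZero 2 (NConst 0) (Str a) (V 5) (V 4))
        (If (NMul (NNot (V 2)) (NAdd (NNot (V 1)) (NLe (NAdd (rhoE (V 5)) (NConst 1)) (rhoE PIV))))
          (Store 1 (NConst 0) (NAdd (V 5) (NConst 1))) Skip)) Skip)).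

Definition clear_column :=
  For 5 (NDim (tgt a)) (If (NMul (NMul (rmE (V 5)) (NNot (NLoad rp (V 5)))) (NNot (NEq (V 5) PIV)))
    (Seq (TestZero 2 (NConst 0) (Str a) (V 5) (V 4)) (If (NNot (V 2)) RA Skip)) Skip).

Definition clear_row :=
  For 6 (NDim (src a)) (If (NMul (cmE (V 6)) (NNot (NEq (V 6) (V 4))))
    (Seq (TestZero 2 (NConst 0) (Str a) PIV (V 6)) (If (NNot (V 2)) CA Skip)) Skip).

Definition pivot_step :=
  Seq find_pivot
   (If (V 1) (seqs [:: SC; clear_column; clear_row;
      Store rp PIV (NAdd (V 4) (NConst 1)); Store cp (V 4) (NAdd PIV (NConst 1))]) Skip).

(* Bruhat reduction of the block of [Str a] selected by the masks [rm] and
   [cm]: rows may be added to rows of larger or equal rank [rho], columns to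
   columns of larger or equal rank [kap]. *)
Definition sweep :=
  For 3 (NConst 64) (For 4 (NDim (src a))
    (If (NMul (cmE (V 4)) (NEq (kapE (V 4)) (V 3))) pivot_step Skip)).

Variables (K : fieldType) (d : vertex -> nat) (A0 : nat -> nat -> nat).
Implicit Types (s : state K d).
Hypotheses (rp9 : (9 < rp)%N) (cp9 : (9 < cp)%N) (rpcp : rp != cp).

Definition frame s := forall x k, (9 < x)%N -> x != rp -> x != cp -> arr s x k = A0 x k.

Variables (kap rho : nat -> nat) (cm rm : nat -> bool) (Psi : mxs K d -> Prop) (B : nat).
Notation nr := (d (tgt a)).
Notation nc := (d (src a)).
Notation M s := (ent (mx s (Str a))).

Hypothesis kapP : forall s e, frame s -> neval s (kapE e) = kap (neval s e).
Hypothesis rhoP : forall s e, frame s -> neval s (rhoE e) = rho (neval s e).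
Hypothesis cmP : forall s e, frame s -> (neval s (cmE e) != 0%N) = cm (neval s e).
Hypothesis rmP : forall s e, frame s -> (neval s (rmE e) != 0%N) = rm (neval s e).
Hypothesis kap64 : forall j, (j < nc)%N -> cm j -> (kap j < 64)%N.

(** The three commands stay abstract, with only their effect on the selected block specified,
    because 2 -> 5 needs composite ones: [SC] makes the pivot 1, [RA] clears an entry of its column,
    [CA] an entry of its row. [Psi] collects what they must preserve elsewhere. *)
Hypothesis SCP : forall s i j, frame s -> Psi (mx s) -> (i < nr)%N -> (j < nc)%N -> rm i -> cm j ->
  neval s PIV = i -> neval s (V 4) = j -> M s i j != 0 ->
  runs SC s B (fun s' => [/\ arr s' = arr s, Psi (mx s'), M s' i j = 1,
    (forall i1 j1, (i1 < nr)%N -> (j1 < nc)%N -> rm i1 -> cm j1 -> (M s' i1 j1 == 0) = (M s i1 j1 == 0))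
    & (forall i1 j1, (i1 < nr)%N -> (j1 < nc)%N -> rm i1 -> cm j1 -> i1 != i -> j1 != j -> M s' i1 j1 = M s i1 j1)]).

Hypothesis RAP : forall s i i' j, frame s -> Psi (mx s) -> (i < nr)%N -> (i' < nr)%N -> (j < nc)%N ->
  rm i -> rm i' -> cm j -> i != i' -> (rho i <= rho i')%N ->
  neval s PIV = i -> neval s (V 5) = i' -> neval s (V 4) = j -> M s i j = 1 -> M s i' j != 0 ->
  runs RA s B (fun s' => [/\ arr s' = arr s, Psi (mx s')
    & forall i1 j1, (i1 < nr)%N -> (j1 < nc)%N -> rm i1 -> cm j1 ->
      M s' i1 j1 = M s i1 j1 - (i1 == i')%:R * (M s i' j * M s i j1)]).

Hypothesis CAP : forall s i j j', frame s -> Psi (mx s) -> (i < nr)%N -> (j < nc)%N -> (j' < nc)%N ->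
  rm i -> cm j -> cm j' -> j != j' -> (kap j <= kap j')%N ->
  neval s PIV = i -> neval s (V 4) = j -> neval s (V 6) = j' -> M s i j = 1 -> M s i j' != 0 ->
  runs CA s B (fun s' => [/\ arr s' = arr s, Psi (mx s')
    & forall i1 j1, (i1 < nr)%N -> (j1 < nc)%N -> rm i1 -> cm j1 ->
      M s' i1 j1 = M s i1 j1 - (j1 == j')%:R * (M s i j' * M s i1 j)]).

Definition matching (f g : nat -> nat) :=
  (forall i j, f i = j.+1 -> [/\ (i < nr)%N, rm i, (j < nc)%N, cm j & g j = i.+1]) /\
  (forall i j, g j = i.+1 -> f i = j.+1).

Definition isolated (f : nat -> nat) (N : nat -> nat -> K) :=
  forall i j, f i = j.+1 -> [/\ N i j = 1,
    (forall i', (i' < nr)%N -> rm i' -> i' != i -> N i' j = 0)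
    & (forall j', (j' < nc)%N -> cm j' -> j' != j -> N i j' = 0)].

(** [D] is the set of treated columns: those that found no pivot are zero, and only treated columns
    have one. *)
Definition reduced (D : nat -> bool) (g : nat -> nat) (N : nat -> nat -> K) :=
  (forall j, (j < nc)%N -> cm j -> D j -> g j = 0%N -> forall i, (i < nr)%N -> rm i -> N i j = 0) /\
  (forall j, g j != 0%N -> D j).

Lemma keep_frame s s' : keep s s' -> frame s -> frame s'.
Proof. by move=> h1 h2 x k hx n1 n2; rewrite h1 // h2. Qed.

Lemma keep_set s s' x k n : (x <= 9)%N -> keep s s' -> keep s (set_mem s' x k n).
Proof. by move=> hx h y l hy /=; rewrite gtn_eqF ?(leq_ltn_trans hx) // h. Qed.

Lemma keep_arr s s' s'' : arr s'' = arr s' -> keep s s' -> keep s s''.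
Proof. by move=> e h y l hy; rewrite e h. Qed.

Definition cand s j i := [&& rm i, arr s rp i == 0%N & M s i j != 0].

Lemma find_pivot_runs s j : frame s -> neval s (V 4) = j -> (j < nc)%N ->
  runs find_pivot s (max_dim d) (fun s' => [/\ keep s s', mx s' = mx s,
    arr s' 4 = arr s 4, arr s' 3 = arr s 3 &
    if arr s' 1 0 is p.+1 then [/\ (p < nr)%N, cand s j p & forall i, (i < nr)%N -> cand s j i -> (rho p <= rho i)%N]
    else forall i, (i < nr)%N -> ~~ cand s j i]).
Proof.
move=> fs ej hj; apply: (@runs_seq _ _ _ _ _ 0 (max_dim d)) => //; apply: runs_store.
set s1 := set_mem _ _ _ _.
pose I k s' := [/\ keep s s', mx s' = mx s, arr s' 4 = arr s 4, arr s' 3 = arr s 3 &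
    if arr s' 1 0%N is p.+1 then [/\ (p < nr)%N, cand s j p & forall i, (i < k)%N -> cand s j i -> (rho p <= rho i)%N]
    else forall i, (i < k)%N -> ~~ cand s j i].
apply: (@runs_for _ _ _ _ _ _ nr 1 _ I) => //.
- by split=> //; do !apply: keep_set => //.
- move=> k s2 hk [k2 m2 a4 a3 h2] ek.
  have f2 := keep_frame k2 fs.
  have e5 : neval s2 (V 5) = k by [].
  apply: (@runs_ifb _ _ _ _ _ _ _ _ (rm k && (arr s rp k == 0%N))).
  - by rewrite /= !condE /= rmP // e5 ek (k2 rp).
  2: { move=> hn; apply: runs_skip; split=> //; split=> //; first exact: keep_set.
    have nk : ~~ cand s j k by apply: contra hn => /and3P[-> ->].
    rewrite /=; case: (arr s2 1 0) h2 => [|p].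
      by move=> h i; rewrite ltnS leq_eqVlt => /orP[/eqP->|]; last exact: h.
    case=> hp cp' h; split=> // i; rewrite ltnS leq_eqVlt => /orP[/eqP->|]; last exact: h.
    by rewrite (negPf nk). }
  move=> /andP[rk rp0].
  have e4 : arr s2 4 0 = j by rewrite a4.
  apply: (@runs_seq _ _ _ _ _ 1 0) => //; apply: runs_test => //=; rewrite ?ek ?e4 //.
  rewrite m2; set b := (ent _ _ _ == 0).
  set s3 := set_mem _ _ _ _.
  have k3 : keep s s3 by apply: keep_set.
  have f3 := keep_frame k3 fs.
  have v1 : arr s3 1 0 = arr s2 1 0 by [].
  have v5 : arr s3 5 0 = k by [].
  have cE : cand s j k = ~~ b by rewrite /cand rk rp0.
  have rE : forall e, neval s3 (rhoE e) = rho (neval s3 e) by move=> e; apply: rhoP.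
  apply: (@runs_ifb _ _ _ _ _ _ _ _ (~~ b && ((arr s2 1 0 == 0) || (rho k < rho (arr s2 1 0).-1))%N)).
  - by rewrite /= !condE /= !rE /= ek addn1 subn1.
  - move=> /andP[nb hp].
    apply: runs_store; split=> //; split=> //=; rewrite ?ek ?addn1; first by do !apply: keep_set.
    split=> //; first by rewrite cE.
    move=> i; rewrite ltnS leq_eqVlt => /orP[/eqP->|hi ci]; first by rewrite leqnn.
    case e1 : (arr s2 1 0) h2 hp => [|p] /=; first by move/(_ i hi); rewrite ci.
    by case=> _ _ /(_ i hi ci) h4 /ltnW h5; apply: leq_trans h4.
  move=> hn; apply: runs_skip; split=> //; split=> //=; first by do !apply: keep_set.
  case e1 : (arr s2 1 0) h2 hn => [|p] /=.
    move=> h; rewrite andbT negbK => hb i; rewrite ltnS leq_eqVlt => /orP[/eqP->|]; last exact: h.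
    by rewrite cE hb.
  move=> [h4 h5 h6] hn; split=> // i; rewrite ltnS leq_eqVlt => /orP[/eqP->|]; last exact: h6.
  by rewrite cE => nb; move: hn; rewrite nb /= -leqNgt.
- by rewrite muln1; apply: dim_le.
Qed.

(** Matched rows are already zero in column [j] because their pivots are isolated, and the other
    nonzero rows have rank at least that of the pivot row. Both rows of an operation are unmatched,
    hence zero in the matched columns, so earlier pivots stay isolated. *)
Lemma clear_column_runs s i j D : frame s -> Psi (mx s) -> arr s 1 0 = i.+1 -> arr s 4 0 = j ->
  (i < nr)%N -> (j < nc)%N -> rm i -> cm j -> matching (arr s rp) (arr s cp) ->
  isolated (arr s rp) (M s) -> reduced D (arr s cp) (M s) ->
  arr s rp i = 0%N -> arr s cp j = 0%N -> M s i j = 1 ->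
  (forall i', (i' < nr)%N -> rm i' -> arr s rp i' = 0%N -> M s i' j != 0 -> (rho i <= rho i')%N) ->
  runs clear_column s (max_dim d * B.+1) (fun s' => [/\ keep s s',
    [/\ arr s' 1 = arr s 1, arr s' 3 = arr s 3 & arr s' 4 = arr s 4], Psi (mx s'),
    isolated (arr s rp) (M s') /\ reduced D (arr s cp) (M s') &
    M s' i j = 1 /\ forall i', (i' < nr)%N -> rm i' -> i' != i -> M s' i' j = 0]).
Proof.
move=> fs ps e1 e4 hi hj ri cj mfg iso red fi gj mij mono.
set f := arr s rp in mfg iso fi mono *; set g := arr s cp in mfg red gj *.
have iso_unp N : isolated f N -> forall i1 j1 i2, f i1 = j1.+1 -> (i2 < nr)%N -> rm i2 -> f i2 = 0%N -> N i2 j1 = 0.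
  move=> isN i1 j1 i2 fi1 h2 r2 f2; have [_ h _] := isN _ _ fi1.
  by apply: h => //; apply/eqP => e; rewrite e fi1 in f2.
have iso_row N : isolated f N -> forall i1 j1, f i1 = j1.+1 -> N i1 j = 0.
  move=> isN i1 j1 fi1; have [_ _ h] := isN _ _ fi1; apply: h => //.
  by apply/eqP => e; have [_ _ _ _] := mfg.1 _ _ fi1; rewrite -e gj.
pose I k s' := [/\ keep s s',
    [/\ arr s' 1 = arr s 1, arr s' 3 = arr s 3 & arr s' 4 = arr s 4], Psi (mx s'),
    isolated f (M s') /\ reduced D g (M s') &
    [/\ M s' i j = 1,
      (forall i', (i' < k)%N -> (i' < nr)%N -> rm i' -> i' != i -> M s' i' j = 0) &
      (forall i', (k <= i')%N -> (i' < nr)%N -> rm i' -> f i' = 0%N -> i' != i -> M s' i' j = M s i' j)]].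
apply: (@runs_for _ _ _ _ _ _ nr B.+1 _ I) => //.
- by split=> //; apply: keep_set.
- move=> k s2 hk [k2 [a1 a3 a4] p2 [iso2 red2] [m2 c2 o2]] ek.
  have f2 := keep_frame k2 fs.
  have skip s3 : keep s s3 -> mx s3 = mx s2 -> arr s3 1 = arr s2 1 -> arr s3 3 = arr s2 3 -> arr s3 4 = arr s2 4 ->
      (rm k -> k != i -> M s2 k j = 0) -> I k.+1 (set_mem s3 5 0 k.+1).
    move=> h1 h2 h3 h4 h5 h6; split=> //=; rewrite ?h2 ?h3 ?h4 ?h5 //; first exact: keep_set.
    split=> // i'.
      by rewrite ltnS leq_eqVlt => /orP[/eqP->|]; [move=> _; apply: h6 | apply: c2].
    by move=> /ltnW; apply: o2.
  apply: (@runs_ifb _ _ _ _ _ _ _ _ (rm k && (f k == 0%N) && (k != i))).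
  - by rewrite /= !condE /= rmP //= ek (k2 rp) // a1 e1 subn1.
  2: { move=> hn; apply: runs_skip; split=> //; apply: skip => // rk nki.
    move: hn; rewrite rk nki andbT /=; case fk: (f k) => [//|j1] _.
    exact: iso_row fk. }
  move=> /andP[/andP[rk /eqP fk] nki].
  have e4' : arr s2 4 0 = j by rewrite a4.
  have e1' : arr s2 1 0 = i.+1 by rewrite a1.
  apply: (@runs_seq _ _ _ _ _ 1 B) => //; apply: runs_test => //=; rewrite ?ek ?e4' //.
  set b := (ent _ _ _ == 0).
  set s3 := set_mem _ _ _ _.
  have k3 : keep s s3 by apply: keep_set.
  have f3 := keep_frame k3 fs.
  apply: (@runs_ifb _ _ _ _ _ _ _ _ (~~ b)); first by rewrite /= !condE /=.
    move=> nb.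
    have hrho : (rho i <= rho k)%N by apply: mono => //; rewrite -(o2 k).
    have := @RAP s3 i k j f3 p2 hi hk hj ri rk cj _ hrho.
    rewrite /= e1' ek e4' subn1 eq_sym => /(_ nki erefl erefl erefl m2 nb) hRA.
    apply: runs_weak hRA (leqnn _) _ => s4 [e4a p4 m4].
    have k4 : keep s s4 by apply: keep_arr k3.
    split; first by rewrite e4a.
    have cond1 i1 j1 : (i1 < nr)%N -> (j1 < nc)%N -> rm i1 -> cm j1 -> M s2 k j1 = 0 -> M s2 i j1 = 0 -> M s4 i1 j1 = M s2 i1 j1.
      by move=> h1 h2 h3 h4 z1 z2; rewrite m4 //= z2 !mulr0 subr0.
    split=> //=; first exact: keep_set.
    - by rewrite e4a.
    - split.
        move=> i1 j1 fi1; have [h1 h2 h3 h4 h5] := mfg.1 _ _ fi1.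
        have z1 : M s2 k j1 = 0 by apply: iso_unp fi1 _ _ _.
        have z2 : M s2 i j1 = 0 by apply: iso_unp fi1 _ _ _.
        have [x1 x2 x3] := iso2 _ _ fi1.
        split; first by rewrite cond1.
          by move=> i' h6 h7 h8; rewrite cond1 // x2.
        move=> j' h6 h7 h8; rewrite m4 //= (_ : i1 == k = false) ?mul0r ?subr0 ?x3 //.
        by apply/eqP => e; rewrite -e fi1 in fk.
      split; last exact: red2.2.
      move=> j1 h1 h2 h3 h4 i1 h5 h6.
      by rewrite cond1 // (red2.1 j1).
    - split=> //.
      + by rewrite m4 //= eq_sym (negPf nki) mul0r subr0.
      + move=> i'; rewrite ltnS leq_eqVlt => /orP[/eqP->|h1] h2 h3 h4; last first.
          by rewrite m4 //= ltn_eqF // mul0r subr0 c2.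
        by rewrite m4 //= eqxx mul1r m2 mulr1 subrr.
      + move=> i' h1 h2 h3 h5 h6; rewrite m4 //= gtn_eqF // mul0r subr0.
        by apply: o2 => //; apply: ltnW.
  rewrite negbK => /eqP hb; apply: runs_skip; split=> //; exact: skip.
- by rewrite leq_mul2r dim_le orbT.
move=> s1 [h1 h2 h3 h4 [h5 h6 _]]; split=> //; split=> // i' hi'; exact: h6.
Qed.

(** The pivot row vanishes in all treated columns: by [reduced] in those without pivot, by isolation
    of another row in the rest. So only columns of rank at least that of [j] need clearing. Column
    [j] is a unit vector by now, so each operation changes a single entry. *)
Lemma clear_row_runs s i j D : frame s -> Psi (mx s) -> arr s 1 0 = i.+1 -> arr s 4 0 = j ->
  (i < nr)%N -> (j < nc)%N -> rm i -> cm j -> matching (arr s rp) (arr s cp) ->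
  isolated (arr s rp) (M s) -> reduced D (arr s cp) (M s) ->
  (forall j', (j' < nc)%N -> cm j' -> (kap j' < kap j)%N -> D j') ->
  arr s rp i = 0%N -> M s i j = 1 ->
  (forall i', (i' < nr)%N -> rm i' -> i' != i -> M s i' j = 0) ->
  runs clear_row s (max_dim d * B.+1) (fun s' => [/\ keep s s',
    [/\ arr s' 1 = arr s 1, arr s' 3 = arr s 3 & arr s' 4 = arr s 4], Psi (mx s'),
    isolated (arr s rp) (M s') /\ reduced D (arr s cp) (M s') &
    [/\ M s' i j = 1, (forall i', (i' < nr)%N -> rm i' -> i' != i -> M s' i' j = 0)
     & forall j', (j' < nc)%N -> cm j' -> j' != j -> M s' i j' = 0]]).
Proof.
move=> fs ps e1 e4 hi hj ri cj mfg iso red lowD fi mij mcol.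
set f := arr s rp in mfg iso fi *; set g := arr s cp in mfg red *.
pose I k s' := [/\ keep s s',
    [/\ arr s' 1 = arr s 1, arr s' 3 = arr s 3 & arr s' 4 = arr s 4], Psi (mx s'),
    isolated f (M s') /\ reduced D g (M s') &
    [/\ M s' i j = 1, (forall i', (i' < nr)%N -> rm i' -> i' != i -> M s' i' j = 0)
     & forall j', (j' < k)%N -> (j' < nc)%N -> cm j' -> j' != j -> M s' i j' = 0]].
apply: (@runs_for _ _ _ _ _ _ nc B.+1 _ I) => //.
- by split=> //; apply: keep_set.
- move=> k s2 hk [k2 [a1 a3 a4] p2 [iso2 red2] [m2 c2 o2]] ek.
  have f2 := keep_frame k2 fs.
  have skip s3 : keep s s3 -> mx s3 = mx s2 -> arr s3 1 = arr s2 1 -> arr s3 3 = arr s2 3 -> arr s3 4 = arr s2 4 ->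
      (cm k -> k != j -> M s2 i k = 0) -> I k.+1 (set_mem s3 6 0 k.+1).
    move=> h1 h2 h3 h4 h5 h6; split=> //=; rewrite ?h2 ?h3 ?h4 ?h5 //; first exact: keep_set.
    split=> // i'.
    by rewrite ltnS leq_eqVlt => /orP[/eqP->|]; [move=> _; apply: h6 | apply: o2].
  apply: (@runs_ifb _ _ _ _ _ _ _ _ (cm k && (k != j))).
  - by rewrite /= !condE /= cmP //= ek a4 e4.
  2: { move=> hn; apply: runs_skip; split=> //; apply: skip => // rk nki.
    by move: hn; rewrite rk nki. }
  move=> /andP[ck nkj].
  have e4' : arr s2 4 0 = j by rewrite a4.
  have e1' : arr s2 1 0 = i.+1 by rewrite a1.
  apply: (@runs_seq _ _ _ _ _ 1 B) => //; apply: runs_test => //=; rewrite ?ek ?e1' ?subn1 //.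
  set b := (ent _ _ _ == 0).
  set s3 := set_mem _ _ _ _.
  have k3 : keep s s3 by apply: keep_set.
  have f3 := keep_frame k3 fs.
  apply: (@runs_ifb _ _ _ _ _ _ _ _ (~~ b)); first by rewrite /= !condE /=.
    move=> nb.
    have hkap : (kap j <= kap k)%N.
      rewrite leqNgt; apply: contra nb => /(lowD _ hk ck) Dk; rewrite /b.
      case gk: (g k) => [|i1]; first by rewrite (red2.1 k).
      have fi1 := mfg.2 _ _ gk; have [_ h _] := iso2 _ _ fi1; rewrite h //.
      by apply/eqP => e; rewrite -e fi in fi1.
    have := @CAP s3 i j k f3 p2 hi hj hk ri cj ck _ hkap.
    rewrite /= e1' ek e4' subn1 eq_sym => /(_ nkj erefl erefl erefl m2 nb) hCA.
    apply: runs_weak hCA (leqnn _) _ => s4 [e4a p4 m4].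
    have k4 : keep s s4 by apply: keep_arr k3.
    split; first by rewrite e4a.
    have m4' i1 j1 : (i1 < nr)%N -> (j1 < nc)%N -> rm i1 -> cm j1 ->
        M s4 i1 j1 = if (i1 == i) && (j1 == k) then 0 else M s2 i1 j1.
      move=> h1 h2 h3 h4; rewrite m4 //=; case: (eqVneq j1 k) => [->|_]; last by rewrite andbF mul0r subr0.
      case: (eqVneq i1 i) => [->|ni]; first by rewrite m2 mul1r mulr1 subrr.
      by rewrite c2 // !mulr0 subr0.
    have zero i1 j1 : (i1 < nr)%N -> (j1 < nc)%N -> rm i1 -> cm j1 -> M s2 i1 j1 = 0 -> M s4 i1 j1 = 0.
      by move=> h1 h2 h3 h4 h5; rewrite m4' // h5; case: ifP.
    split=> //=; first exact: keep_set.
    - by rewrite e4a.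
    - split.
        move=> i1 j1 fi1; have [h1 h2 h3 h4 h5] := mfg.1 _ _ fi1.
        have [x1 x2 x3] := iso2 _ _ fi1; split.
        + rewrite m4' // (_ : i1 == i = false) //; by apply/eqP => e; rewrite e fi in fi1.
        + by move=> i' h6 h7 h8; apply: zero => //; apply: x2.
        + by move=> j' h6 h7 h8; apply: zero => //; apply: x3.
      split; last exact: red2.2.
      by move=> j1 h1 h2 h3 h4 i1 h5 h6; apply: zero => //; apply: (red2.1 j1).
    - split=> //.
      + by rewrite m4' // [j == k]eq_sym (negPf nkj) andbF.
      + by move=> i' h1 h2 h3; apply: zero => //; apply: c2.
      + move=> j'; rewrite ltnS leq_eqVlt => /orP[/eqP->|h1] h2 h3 h4; first by rewrite m4' // !eqxx.
        by apply: zero => //; apply: o2.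
  rewrite negbK => /eqP hb; apply: runs_skip; split=> //; exact: skip.
- by rewrite leq_mul2r dim_le orbT.
move=> s1 [h1 h2 h3 h4 [h5 h6 h7]]; split=> //; split=> // i' hi'; exact: h7.
Qed.

Definition swept D s := [/\ frame s, Psi (mx s), matching (arr s rp) (arr s cp),
  isolated (arr s rp) (M s) & reduced D (arr s cp) (M s)].

Definition pivot_cost := (max_dim d + (B + (max_dim d * B.+1 + max_dim d * B.+1)))%N.

Lemma pivot_step_runs s j D : swept D s -> arr s 4 0 = j -> (j < nc)%N -> cm j -> ~~ D j ->
  (forall j', (j' < nc)%N -> cm j' -> (kap j' < kap j)%N -> D j') ->
  runs pivot_step s pivot_cost (fun s' => [/\ swept (fun j' => D j' || (j' == j)) s',
     arr s' 3 = arr s 3 & arr s' 4 = arr s 4]).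
Proof.
move=> [fs ps mfg iso red] e4 hj cj nDj lowD.
have gj : arr s cp j = 0%N by apply/eqP; apply: contraNT nDj => /red.2.
apply: (@runs_seq _ _ _ _ _ (max_dim d) (B + (max_dim d * B.+1 + max_dim d * B.+1))%N) => //.
apply: runs_weak (find_pivot_runs fs e4 hj) (leqnn _) _ => s1 [k1 m1 a4 a3 hp].
have f1 := keep_frame k1 fs.
have rp1 k : arr s1 rp k = arr s rp k by apply: k1.
have cp1 k : arr s1 cp k = arr s cp k by apply: k1.
have mfg1 : matching (arr s1 rp) (arr s1 cp).
  by split=> i1 j1; rewrite rp1 cp1; [apply: mfg.1 | apply: mfg.2].
have iso1 : isolated (arr s1 rp) (M s1) by move=> i1 j1; rewrite rp1 m1; apply: iso.
have red1 : reduced D (arr s1 cp) (M s1).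
  by split=> [j1|j1]; rewrite cp1 ?m1; [apply: red.1 | apply: red.2].
have ps1 : Psi (mx s1) by rewrite m1.
have gj1 : arr s1 cp j = 0%N by rewrite cp1.
apply: (@runs_ifb _ _ _ _ _ _ _ _ (arr s1 1 0 != 0%N)) => //; last first.
  rewrite negbK => /eqP e0; apply: runs_skip; split=> //; split=> //; split; last first.
    by move=> j1 /red1.2 ->.
  rewrite e0 in hp.
  move=> j1 h1 h2 /orP[h3|/eqP->] h4 i h5 h6; first exact: (red1.1 j1).
  have := hp i h5; rewrite /cand h6 /= -m1; case ei: (arr s rp i) => [|j2]; first by rewrite negbK => /eqP.
  move=> _; rewrite -rp1 in ei; have [_ _ h] := iso1 _ _ ei; apply: h => //.
  by apply/eqP => e; have [_ _ _ _] := mfg1.1 _ _ ei; rewrite -e gj1.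
case e1: (arr s1 1 0) hp => [//|i] [hi /and3P[ri fi mij] mono] _.
have e4' : arr s1 4 0 = j by rewrite a4.
have fi1 : arr s1 rp i = 0%N by rewrite rp1; apply/eqP.
rewrite -m1 in mij.
apply: (@runs_seq _ _ _ _ _ B (max_dim d * B.+1 + max_dim d * B.+1)) => //.
have hSC := @SCP s1 i j f1 ps1 hi hj ri cj.
rewrite /= e1 subn1 e4' in hSC.
apply: runs_weak (hSC erefl erefl mij) (leqnn _) _ => s2 [e2 ps2 m2 z2 s2e].
have f2 : frame s2 by move=> x k h1 h2 h3; rewrite e2 f1.
have zz i1 j1 : (i1 < nr)%N -> (j1 < nc)%N -> rm i1 -> cm j1 -> M s1 i1 j1 = 0 -> M s2 i1 j1 = 0.
  by move=> h1 h2 h3 h4 h5; apply/eqP; rewrite z2 // h5.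
have iso2 : isolated (arr s2 rp) (M s2).
  rewrite e2 => i1 j1 ei; have [x1 x2 x3] := iso1 _ _ ei; have [h1 h2 h3 h4 h5] := mfg1.1 _ _ ei.
  split; last by move=> j' h6 h7 h8; apply: zz => //; apply: x3.
    rewrite s2e //; first by apply/eqP => e; rewrite e fi1 in ei.
    by apply/eqP => e; rewrite e gj1 in h5.
  by move=> i' h6 h7 h8; apply: zz => //; apply: x2.
have red2 : reduced D (arr s2 cp) (M s2).
  rewrite e2; split; last exact: red1.2.
  by move=> j1 h1 h2 h3 h4 i1 h5 h6; apply: zz => //; apply: (red1.1 j1).
apply: (@runs_seq _ _ _ _ _ (max_dim d * B.+1) (max_dim d * B.+1)) => //.
have e12 : arr s2 1 0 = i.+1 by rewrite e2.
have e42 : arr s2 4 0 = j by rewrite e2.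
have mfg2 : matching (arr s2 rp) (arr s2 cp) by rewrite e2.
have fi2 : arr s2 rp i = 0%N by rewrite e2.
have gj2 : arr s2 cp j = 0%N by rewrite e2.
have hcc := @clear_column_runs s2 i j D f2 ps2 e12 e42 hi hj ri cj mfg2 iso2 red2 fi2 gj2 m2.
apply: runs_weak (hcc _) (leqnn _) _.
  move=> i' h1 h2 h3 h4; apply: mono => //; rewrite /cand h2 -rp1 -e2 h3 /= -m1.
  by rewrite -z2.
move=> s3 [k3 [a31 a33 a34] ps3 [iso3 red3] [m3 c3]].
rewrite e2 in iso3 red3.
have f3 := keep_frame k3 f2.
apply: (@runs_seq _ _ _ _ _ (max_dim d * B.+1) 0); last by rewrite addn0.
have rp3 k : arr s3 rp k = arr s1 rp k by rewrite k3 // e2.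
have cp3 k : arr s3 cp k = arr s1 cp k by rewrite k3 // e2.
have mfg3 : matching (arr s3 rp) (arr s3 cp).
  by split=> i1 j1; rewrite rp3 cp3; [apply: mfg1.1 | apply: mfg1.2].
have iso3' : isolated (arr s3 rp) (M s3) by move=> i1 j1; rewrite rp3; apply: iso3.
have red3' : reduced D (arr s3 cp) (M s3).
  by split=> [j1|j1]; rewrite cp3; [apply: red3.1 | apply: red3.2].
have e13 : arr s3 1 0 = i.+1 by rewrite a31.
have e43 : arr s3 4 0 = j by rewrite a34 e2.
have hcr := @clear_row_runs s3 i j D f3 ps3 e13 e43 hi hj ri cj mfg3 iso3' red3' lowD _ m3 c3.
apply: runs_weak (hcr _) (leqnn _) _; first by rewrite rp3.
move=> s4 [k4 [a41 a43 a44] ps4 [iso4 red4] [m4 c4 r4]].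
have f4 := keep_frame k4 f3.
have e14 : arr s4 1 0 = i.+1 by rewrite a41.
have e44 : arr s4 4 0 = j by rewrite a44.
apply: (@runs_seq _ _ _ _ _ 0 0) => //; apply: runs_store.
rewrite /= e14 e44 addn1 subn1 /=; set s5 := set_mem _ _ _ _.
apply: (@runs_seq _ _ _ _ _ 0 0) => //; apply: runs_store.
have n1 : (1 == rp) = false by apply/negbTE; rewrite neq_ltn (leq_trans _ rp9).
have n4 : (4 == rp) = false by apply/negbTE; rewrite neq_ltn (leq_trans _ rp9).
have n3 : (3 == rp) = false by apply/negbTE; rewrite neq_ltn (leq_trans _ rp9).
have n4' : (4 == cp) = false by apply/negbTE; rewrite neq_ltn (leq_trans _ cp9).
have n3' : (3 == cp) = false by apply/negbTE; rewrite neq_ltn (leq_trans _ cp9).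
rewrite /= n1 n4 /= e14 e44 addn1 subn1 /=.
apply: runs_skip; set s6 := set_mem _ _ _ _.
have rp6 k : arr s6 rp k = if k == i then j.+1 else arr s1 rp k.
  by rewrite /= (negPf rpcp) /= eqxx /= k4 // rp3.
have cp6 k : arr s6 cp k = if k == j then i.+1 else arr s1 cp k.
  by rewrite /= eqxx /=; case: eqP => // _; rewrite [cp == rp]eq_sym (negPf rpcp) /= k4 // cp3.
split; last 2 first.
- by rewrite /= n3 n3' a43 a33 e2.
- by rewrite /= n4 n4' a44 a34 e2.
have M6 : mx s6 = mx s4 by [].
have iso4' i1 j1 : arr s1 rp i1 = j1.+1 -> [/\ M s4 i1 j1 = 1, _ & _] := fun h => iso4 i1 j1 (etrans (rp3 i1) h).
have red4' j1 : (j1 < nc)%N -> cm j1 -> D j1 -> arr s1 cp j1 = 0%N -> forall i1, (i1 < nr)%N -> rm i1 -> M s4 i1 j1 = 0.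
  by move=> h1 h2 h3 h4; apply: red4.1 => //; rewrite cp3.
split=> //.
- move=> x k h1 h2 h3 /=; rewrite (negPf h2) (negPf h3) /=; exact: f4.
- split=> i1 j1; rewrite rp6 cp6.
    case: (eqVneq i1 i) => [-> [<-]|ni]; first by rewrite eqxx.
    move=> h; have [h1 h2 h3 h4 h5] := mfg1.1 _ _ h; split=> //.
    by case: eqP => // e; rewrite e gj1 in h5.
  case: (eqVneq j1 j) => [-> [<-]|nj]; first by rewrite eqxx.
  move=> h; have h1 := mfg1.2 _ _ h; case: eqP => // e.
  by rewrite e fi1 in h1.
- move=> i1 j1; rewrite rp6 M6; case: (eqVneq i1 i) => [-> [<-]|ni]; first by split.
  exact: iso4'.
split=> [j1 h1 h2|j1]; rewrite cp6; last first.
  by case: (j1 =P j) => [_|_ /red1.2 ->]; rewrite ?orbT.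
case: (j1 =P j) => // nj; rewrite orbF; exact: red4'.
Qed.

(** Round [k] of the outer loop treats the columns of rank [k], which orders them without sorting.
    The bound charges every one of the 64 rounds with a full pass. *)
Lemma sweep_runs s : frame s -> Psi (mx s) -> (forall k, arr s rp k = 0%N) -> (forall k, arr s cp k = 0%N) ->
  runs sweep s (64 * (max_dim d * pivot_cost)) (fun s' => [/\ frame s', Psi (mx s'),
    matching (arr s' rp) (arr s' cp) &
    forall i j, (i < nr)%N -> (j < nc)%N -> rm i -> cm j -> M s' i j = (arr s' rp i == j.+1)%:R]).
Proof.
move=> fs ps rp0 cp0.
have frame_set s1 x k n : (x <= 9)%N -> frame s1 -> frame (set_mem s1 x k n).
  by move=> hx h y l hy n1 n2 /=; rewrite gtn_eqF ?(leq_ltn_trans hx) // h.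
have swept_set D s1 x k n : (x <= 9)%N -> swept D s1 -> swept D (set_mem s1 x k n).
  move=> hx [h1 h2 h3 h4 h5].
  have hr : arr (set_mem s1 x k n) rp = arr s1 rp by rewrite /= gtn_eqF ?(leq_ltn_trans hx).
  have hc : arr (set_mem s1 x k n) cp = arr s1 cp by rewrite /= gtn_eqF ?(leq_ltn_trans hx).
  by split; rewrite ?hr ?hc //; apply: frame_set.
have swept_ext D D' s1 : (forall j, (j < nc)%N -> cm j -> D j = D' j) -> swept D s1 -> swept D' s1.
  move=> eD [h1 h2 h3 h4 [h5 h6]]; split=> //; split=> [j x1 x2|j x]; first by rewrite -eD //; apply: h5.
  have [i gj] : exists i, arr s1 cp j = i.+1 by case: (arr s1 cp j) x => // i; exists i.
  have [_ _ x1 x2 _] := h3.1 _ _ (h3.2 _ _ gj); rewrite -eD //; exact: h6.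
apply: (@runs_for _ _ _ _ _ _ 64 (max_dim d * pivot_cost) _
  (fun k => swept (fun j => (kap j < k)%N))) => //.
- apply: swept_set => //; split=> //; first by split=> i j; rewrite ?rp0 ?cp0.
    by move=> i j; rewrite rp0.
  by split=> // j; rewrite cp0.
- move=> k s1 hk sw e3.
  apply: (@runs_for _ _ _ _ _ _ nc pivot_cost _
    (fun j s2 => swept (fun j' => (kap j' < k)%N || ((kap j' == k) && (j' < j)%N)) s2 /\ arr s2 3 0 = k)) => //.
  + split=> //; apply: swept_set => //; apply: swept_ext sw => j _ _; by rewrite ltn0 andbF orbF.
  + move=> j s2 hj [sw2 e32] e4.
    have f2 : frame s2 by case: sw2.
    apply: (@runs_ifb _ _ _ _ _ _ _ _ (cm j && (kap j == k))).
    * by rewrite /= !condE /= cmP // kapP //= e4 e32.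
    * move=> /andP[cj /eqP ek].
      have := @pivot_step_runs s2 j _ sw2 e4 hj cj; rewrite ltnn andbF ek ltnn /= => /(_ isT) h.
      apply: runs_weak (h _) (leqnn _) _; first by move=> j' _ _ ->.
      move=> s3 [sw3 a3 a4]; rewrite a4 e4; split=> //; split; last by rewrite /= a3.
      apply: swept_set => //; apply: swept_ext sw3 => j' _ _.
      rewrite -orbA ltnS [(j' <= j)%N]leq_eqVlt; case: (ltnP (kap j') k) => //= _.
      by case: (eqVneq j' j) => [->|_]; rewrite ?orbT ?orbF /= ?ek ?eqxx.
    move=> hn; apply: runs_skip; split=> //; split=> //.
    apply: swept_set => //; apply: swept_ext sw2 => j' hj' cj'.
    rewrite ltnS [(j' <= j)%N]leq_eqVlt; case: (eqVneq j' j) => [ej|//]; subst j'.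
    by move: hn; rewrite cj' /= => /negPf->.
  + by rewrite leq_mul2r dim_le orbT.
  move=> s2 [sw2 e32]; split=> //; apply: swept_set => //; apply: swept_ext sw2 => j hj _.
  by rewrite hj andbT ltnS [in RHS]leq_eqVlt orbC.
move=> s1 [h1 h2 h3 h4 h5]; split=> // i j hi hj ri cj.
case gj: (arr s1 cp j) => [|i1].
  rewrite (h5.1 j) ?kap64 //; case: eqP => // e.
  by have [_ _ _ _] := h3.1 _ _ e; rewrite gj.
have fi1 := h3.2 _ _ gj; have [x1 x2 _] := h4 _ _ fi1.
case: (eqVneq i i1) => [->|ni]; first by rewrite x1 fi1 eqxx.
rewrite x2 //; case: eqP => // e.
by have [_ _ _ _] := h3.1 _ _ e; rewrite gj => -[e2]; rewrite e2 eqxx in ni.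
Qed.

End Sweep.

(** * Elimination steps realised by operations on labels *)

Definition entry a ei ej := FEntry (Str a) ei ej.
Definition kill_col a ei ej ej' :=
  add_labels a (src a) (IDe (src a) ej) (IDe (src a) ej')
    (FSub FZero (entry a ei ej')) (entry a ei ej').
(** Rows transform contragrediently: subtracting a multiple of row [ei] from row [ei'] means adding
    the vector of [ei'] to that of [ei]. Hence the labels and the signs are exchanged with respect
    to [kill_col]. *)
Definition kill_row a ei ei' ej :=
  add_labels a (tgt a) (IDe (tgt a) ei') (IDe (tgt a) ei)
    (entry a ei' ej) (FSub FZero (entry a ei' ej)).
Definition normalize a ei ej :=
  scale_label a (src a) (IDe (src a) ej) (FDiv FOne (entry a ei ej)) (entry a ei ej).

Definition same_labels (A A' : nat -> nat -> nat) :=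
  forall v k, A' (idA v) k = A (idA v) k /\ A' (ixA v) k = A (ixA v) k.

Section Kill.
Local Open Scope ring_scope.
Variables (K : fieldType) (d : vertex -> nat) (A : nat -> nat -> nat).
Hypothesis ok : labels_ok d A.
Implicit Types (s : state K d).
Notation M a s := (ent (mx s (Str a))).

Lemma same_labels_ok A' : same_labels A A' -> labels_ok d A'.
Proof.
move=> e; split=> [v i hi|v u i]; first by rewrite (e v i).1 (e v _).2 ok.1.
by rewrite (e v u).2 (e v i).1; apply: ok.2.
Qed.

Lemma same_pres A' u v : same_labels A A' -> pres A' u v = pres A u v.
Proof. by move=> e; rewrite /pres (e v u).2. Qed.

Lemma same_pos A' u v : same_labels A A' -> pos A' u v = pos A u v.
Proof. by move=> e; rewrite /pos (e v u).2. Qed.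

Lemma same_added A' x y c (m m' : mxs K d) : same_labels A A' ->
  added A' x y c m m' -> added A x y c m m'.
Proof.
move=> e h r; rewrite h /chg /both /addE; case: r => [b|v]; rewrite !(same_pres _ _ e) //.
  by rewrite !(same_pos _ _ e).
by rewrite !(same_pos _ _ e).
Qed.

Lemma same_scaled A' x c (m m' : mxs K d) : same_labels A A' ->
  scaled A' x c m m' -> scaled A x c m m'.
Proof.
move=> e h r; rewrite h /chg /scaleE; case: r => [b|v]; rewrite !(same_pres _ _ e) //.
  by rewrite !(same_pos _ _ e).
by rewrite !(same_pos _ _ e).
Qed.

Lemma feval_opp s e x : feval s e = Some x -> feval s (FSub FZero e) = Some (- x).
Proof. by move=> /= ->; rewrite sub0r. Qed.

Lemma feval_inv s e x : feval s e = Some x -> x != 0 -> feval s (FDiv FOne e) = Some x^-1.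
Proof. by move=> /= -> /negPf ->; rewrite div1r. Qed.

Lemma feval_entry s a ei ej i j : neval s ei = i -> neval s ej = j ->
  (i < d (tgt a))%N -> (j < d (src a))%N -> feval s (entry a ei ej) = Some (M a s i j).
Proof.
move=> <- <- hi hj; rewrite /= (insubT (fun k => (k < d (tgt a))%N) hi) (insubT (fun k => (k < d (src a))%N) hj) /=.
exact: (congr1 Some (esym (entE (mx s (Str a)) (Ordinal hi) (Ordinal hj)))).
Qed.

Variable a : arrow.
Notation nr := (d (tgt a)).
Notation nc := (d (src a)).

Lemma incident_other v v0 w0 (P : pred vertex) :
  (forall v, incident v (Str a) = (v == v0) || (v == w0)) -> v != v0 -> P v -> ~~ P w0 -> ~~ incident v (Str a).
Proof.
move=> -> nv pv nw; rewrite (negPf nv) /=; apply: contra nw => /eqP <-; exact: pv.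
Qed.

Lemma incidentE v : incident v (Str a) = (v == src a) || (v == tgt a).
Proof. by rewrite /= !veqE ![_ == v]eq_sym. Qed.

Lemma incidentE' v : incident v (Str a) = (v == tgt a) || (v == src a).
Proof. by rewrite incidentE orbC. Qed.

Lemma kill_col_runs s ei ej ej' i j j' : same_labels A (arr s) ->
  neval s ei = i -> neval s ej = j -> neval s ej' = j' ->
  (i < nr)%N -> (j < nc)%N -> (j' < nc)%N -> j != j' ->
  ~~ both A (A (idA (src a)) j) (A (idA (src a)) j') (tgt a) ->
  runs (kill_col a ei ej ej') s (72 * max_dim d) (fun s' => [/\ arr s' = arr s,
    added A (A (idA (src a)) j) (A (idA (src a)) j') (- M a s i j') (mx s) (mx s')
    & forall i1 j1, M a s' i1 j1 = M a s i1 j1 - (j1 == j')%:R * (M a s i j' * M a s i1 j)]).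
Proof.
move=> es ei_ ej_ ej'_ hi hj hj' njj nb.
have ok' := same_labels_ok es.
apply: runs_weak (leqnn _) _.
  apply: (@add_labels_runs K d s a (src a) _ _ _ _ (A (idA (src a)) j) (A (idA (src a)) j') (- M a s i j')) => //.
  - by rewrite /= ej_ (es _ _).1.
  - by rewrite /= ej'_ (es _ _).1.
  - by apply: contra njj => /eqP e; apply/eqP; apply: (id_inj ok hj hj' e).
  - move=> s1 e1 em.
    have h : feval s1 (entry a ei ej') = Some (M a s i j').
      by rewrite -em; apply: feval_entry => //; rewrite (neval_arr _ e1).
    by rewrite (feval_opp h) h opprK.
  - move=> v nv bv; apply: (incident_other (P := both A (A (idA (src a)) j) (A (idA (src a)) j')) incidentE nv _ nb).
    by rewrite /both -!(same_pres _ _ es).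
move=> s' [e1 am]; have {}am := same_added es am.
split=> // i1 j1; rewrite (added_col _ _ ok _ nb am); last first.
  by rewrite /both !(id_pres ok).
by rewrite !(id_pos ok) // mulNr mulrN.
Qed.

Lemma kill_row_runs s ei ei' ej i i' j : same_labels A (arr s) ->
  neval s ei = i -> neval s ei' = i' -> neval s ej = j ->
  (i < nr)%N -> (i' < nr)%N -> (j < nc)%N -> i != i' ->
  ~~ both A (A (idA (tgt a)) i') (A (idA (tgt a)) i) (src a) ->
  runs (kill_row a ei ei' ej) s (72 * max_dim d) (fun s' => [/\ arr s' = arr s,
    added A (A (idA (tgt a)) i') (A (idA (tgt a)) i) (M a s i' j) (mx s) (mx s')
    & forall i1 j1, M a s' i1 j1 = M a s i1 j1 - (i1 == i')%:R * (M a s i' j * M a s i j1)]).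
Proof.
move=> es ei_ ei'_ ej_ hi hi' hj nii nb.
have ok' := same_labels_ok es.
apply: runs_weak (leqnn _) _.
  apply: (@add_labels_runs K d s a (tgt a) _ _ _ _ (A (idA (tgt a)) i') (A (idA (tgt a)) i) (M a s i' j)) => //.
  - by rewrite /= ei'_ (es _ _).1.
  - by rewrite /= ei_ (es _ _).1.
  - by apply: contra nii => /eqP e; apply/eqP/esym; apply: (id_inj ok hi' hi e).
  - move=> s1 e1 em.
    have h : feval s1 (entry a ei' ej) = Some (M a s i' j).
      by rewrite -em; apply: feval_entry => //; rewrite (neval_arr _ e1).
    by rewrite (feval_opp h) h.
  - move=> v nv bv; apply: (incident_other (P := both A (A (idA (tgt a)) i') (A (idA (tgt a)) i)) incidentE' nv _ nb).
    by rewrite /both -!(same_pres _ _ es).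
move=> s' [e1 am]; have {}am := same_added es am.
split=> // i1 j1; rewrite (added_row _ _ ok _ nb am); last first.
  by rewrite /both !(id_pres ok).
by rewrite !(id_pos ok).
Qed.

Lemma normalize_runs s ei ej i j : same_labels A (arr s) ->
  neval s ei = i -> neval s ej = j -> (i < nr)%N -> (j < nc)%N -> M a s i j != 0 ->
  ~~ pres A (A (idA (src a)) j) (tgt a) ->
  runs (normalize a ei ej) s (72 * max_dim d) (fun s' => [/\ arr s' = arr s,
    scaled A (A (idA (src a)) j) (M a s i j)^-1 (mx s) (mx s')
    & forall i1 j1, M a s' i1 j1 = M a s i1 j1 * (if j1 == j then (M a s i j)^-1 else 1)]).
Proof.
move=> es ei_ ej_ hi hj nz nb.
have ok' := same_labels_ok es.
apply: runs_weak (leqnn _) _.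
  apply: (@scale_label_runs K d s a (src a) _ _ _ (A (idA (src a)) j) (M a s i j)^-1) => //.
  - by rewrite /= ej_ (es _ _).1.
  - by rewrite invr_eq0.
  - move=> s1 e1 em.
    have h : feval s1 (entry a ei ej) = Some (M a s i j).
      by rewrite -em; apply: feval_entry => //; rewrite (neval_arr _ e1).
    by rewrite (feval_inv h nz) h invrK.
  - move=> v nv bv; apply: (incident_other (P := pres A (A (idA (src a)) j)) incidentE nv _ nb).
    by rewrite -(same_pres _ _ es).
move=> s' [e1 am]; have {}am := same_scaled es am.
split=> // i1 j1; rewrite am /= (negPf nb) (id_pres ok) // ent_mulD (id_pos ok) //.
Qed.

End Kill.

Section TreeSweep.
Local Open Scope ring_scope.
Variables (K : fieldType) (W : rep K) (Done : seq arrow) (a : arrow) (rp cp : nat).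
Notation d := (rdim W).
Notation nr := (d (tgt a)).
Notation nc := (d (src a)).
Variables (A : nat -> nat -> nat) (kapE rhoE cmE rmE : nexp -> nexp).
Variables (kap rho : nat -> nat) (cm rm : nat -> bool).
Hypothesis ok : labels_ok d A.
Hypotheses (rp9 : (25 < rp)%N) (cp9 : (25 < cp)%N) (rpcp : rp != cp).
Notation frame := (frame rp cp A).
Hypothesis kapP : forall (s : state K d) e, frame s -> neval s (kapE e) = kap (neval s e).
Hypothesis rhoP : forall (s : state K d) e, frame s -> neval s (rhoE e) = rho (neval s e).
Hypothesis cmP : forall (s : state K d) e, frame s -> (neval s (cmE e) != 0%N) = cm (neval s e).
Hypothesis rmP : forall (s : state K d) e, frame s -> (neval s (rmE e) != 0%N) = rm (neval s e).
Hypothesis kap64 : forall j, (j < nc)%N -> cm j -> (kap j < 64)%N.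
(** Selected labels live at one end of [a] only, so a change of labels acts on [Str a] from one
    side. The order of the labels in [rho_adm] is reversed because rows transform
    contragrediently. *)
Hypothesis rm_src : forall i, (i < nr)%N -> rm i -> ~~ pres A (A (idA (tgt a)) i) (src a).
Hypothesis cm_tgt : forall j, (j < nc)%N -> cm j -> ~~ pres A (A (idA (src a)) j) (tgt a).
Hypothesis kap_adm : forall j j', (j < nc)%N -> (j' < nc)%N -> cm j -> cm j' -> (kap j <= kap j')%N ->
  all (adm (pres A (A (idA (src a)) j)) (pres A (A (idA (src a)) j'))) Done.
Hypothesis rho_adm : forall i i', (i < nr)%N -> (i' < nr)%N -> rm i -> rm i' -> (rho i <= rho i')%N ->
  all (adm (pres A (A (idA (tgt a)) i')) (pres A (A (idA (tgt a)) i))) Done.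

(** Rows outside the mask are zero on the selected columns and remain so: row operations alter
    masked rows only, and column operations add zeros to zeros. *)
Definition tree_inv (m : mxs K d) := tree Done A m /\
  forall i j, (i < nr)%N -> (j < nc)%N -> ~~ rm i -> cm j -> ent (m (Str a)) i j = 0.

Definition tree_sweep := sweep a rp cp kapE rhoE cmE rmE
  (kill_row a PIV (V 5) (V 4)) (kill_col a PIV (V 4) (V 6)) (normalize a PIV (V 4)).

Lemma frame_labels (s : state K d) : frame s -> same_labels A (arr s).
Proof.
have h x : (x < 26)%N -> x != rp /\ x != cp.
  by move=> hx; rewrite !neq_ltn !(leq_trans hx).
by move=> fs v k; split; apply: fs; try apply: (h _ _).1; try apply: (h _ _).2; case: v.
Qed.

Lemma tree_sweep_runs (s : state K d) : frame s -> tree_inv (mx s) ->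
  (forall k, arr s rp k = 0%N) -> (forall k, arr s cp k = 0%N) ->
  runs tree_sweep s (64 * (max_dim d * pivot_cost d (72 * max_dim d)))
   (fun s' => [/\ frame s', tree_inv (mx s'), matching a d cm rm (arr s' rp) (arr s' cp) &
    forall i j, (i < nr)%N -> (j < nc)%N -> rm i -> cm j ->
      ent (mx s' (Str a)) i j = (arr s' rp i == j.+1)%:R]).
Proof.
move=> fs ts rp0 cp0.
apply: (@sweep_runs a rp cp kapE rhoE cmE rmE _ _ _ K d A _ _ rpcp kap rho cm rm tree_inv) => //.
- exact: leq_trans rp9.
- exact: leq_trans cp9.
- move=> {fs ts rp0 cp0}s i j fs [ts zs] hi hj ri cj e1 e4 nz.
  apply: runs_weak (normalize_runs ok (frame_labels fs) e1 e4 hi hj nz (cm_tgt hj cj)) (leqnn _) _.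
  move=> s' [ea sc ms].
  have inz : (ent (mx s (Str a)) i j)^-1 != 0 by rewrite invr_eq0.
  split=> //.
  + split; first exact: tree_scale sc ts.
    by move=> i1 j1 h1 h2 h3 h4; rewrite ms zs // mul0r.
  + by rewrite ms eqxx mulfV.
  + move=> i1 j1 _ _ _ _; rewrite ms mulf_eq0; case: (j1 == j); rewrite ?(negPf inz) ?oner_eq0 orbF //.
  + by move=> i1 j1 _ _ _ _ _ nj; rewrite ms (negPf nj) mulr1.
- move=> {fs ts rp0 cp0}s i i' j fs [ts zs] hi hi' hj ri ri' cj nii hrho e1 e5 e4 m1 nz.
  have nb : ~~ both A (A (idA (tgt a)) i') (A (idA (tgt a)) i) (src a).
    by rewrite /both (negPf (rm_src hi' ri')).
  apply: runs_weak (kill_row_runs ok (frame_labels fs) e1 e5 e4 hi hi' hj nii nb) (leqnn _) _.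
  move=> s' [ea am ms]; split=> //; split.
    apply: tree_add am ts => //; last exact: rho_adm.
    by apply: contra nii => /eqP e; apply/eqP/esym; apply: (id_inj ok hi' hi e).
  move=> i1 j1 h1 h2 h3 h4; rewrite ms zs // (_ : i1 == i' = false) ?mul0r ?subr0 //.
  by apply/eqP => e; rewrite e ri' in h3.
- move=> {fs ts rp0 cp0}s i j j' fs [ts zs] hi hj hj' ri cj cj' njj hkap e1 e4 e6 m1 nz.
  have nb : ~~ both A (A (idA (src a)) j) (A (idA (src a)) j') (tgt a).
    by rewrite /both (negPf (cm_tgt hj cj)).
  apply: runs_weak (kill_col_runs ok (frame_labels fs) e1 e4 e6 hi hj hj' njj nb) (leqnn _) _.
  move=> s' [ea am ms]; split=> //; split.
    apply: tree_add am ts => //; last exact: kap_adm.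
    by apply: contra njj => /eqP e; apply/eqP; apply: (id_inj ok hj hj' e).
  by move=> i1 j1 h1 h2 h3 h4; rewrite ms (zs i1 j1) // (zs i1 j) // !mulr0 subr0.
Qed.

End TreeSweep.

(** * The spanning path *)

(** The 64 conceivable supports of a label, over which claims about supports are decided by
    enumeration. *)
Definition allvecs := iter 6 (fun L => map (cons true) L ++ map (cons false) L) [:: [::]].
Definition vat (l : seq bool) v := nth false l (code v).
Definition pvec (px : vertex -> bool) := [:: px v1; px v2; px v3; px v4; px v5; px v6].

Lemma pvecE px v : vat (pvec px) v = px v. Proof. by case: v. Qed.

Lemma pvec_all (P : seq bool -> bool) : all P allvecs -> forall px, P (pvec px).
Proof.
move=> /allP h px; apply: h; rewrite /pvec.
by case: (px v1); case: (px v2); case: (px v3); case: (px v4); case: (px v5); case: (px v6).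
Qed.

Fixpoint triples_from (x : vertex) (p : seq vertex) :=
  if p is y :: q then [seq (x, y, z) | z <- q] ++ triples_from x q else [::].
Fixpoint triples (p : seq vertex) := if p is x :: q then triples_from x q ++ triples q else [::].

(* The zigzag 5 <- 4 <- 1 -> 2 <- 3 -> 6 *)
Definition zigzag := [:: v5; v4; v1; v2; v3; v6].
Definition interval (px : vertex -> bool) :=
  all (fun t => px t.1.1 && px t.2 ==> px t.1.2) (triples zigzag).

Lemma interval_ext px py : px =1 py -> interval px = interval py.
Proof. by move=> h; apply: eq_all => t; rewrite !h. Qed.

(* A path is followed from one of its ends; the boolean tells whether the next
   arrow leaves the current vertex. The basis vectors at the end are ordered in
   such a way that each may be added to the later ones. *)
Fixpoint rank (path : seq (vertex * bool)) (px : vertex -> bool) : nat :=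
  if path is (v, out) :: p then 2 ^ size p * (if out then px v else ~~ px v) + rank p px else 0.
Fixpoint rankE (path : seq (vertex * bool)) u :=
  if path is (v, out) :: p then
    NAdd (NMul (NConst (2 ^ size p))
       (if out then NNot (NNot (NLoad (ixA v) u)) else NNot (NLoad (ixA v) u))) (rankE p u)
  else NConst 0.

Lemma rank_ext path px py : px =1 py -> rank path px = rank path py.
Proof. by move=> h; elim: path => //= -[v o] p ->; rewrite h. Qed.

Lemma rank_lt path px : rank path px < 2 ^ size path.
Proof.
elim: path => //= -[v o] p IH; rewrite expnS.
have : 2 ^ size p * (if o then px v else ~~ px v) <= 2 ^ size p.
  by rewrite -[leqRHS]muln1 leq_mul2l; case: (if o then _ else _); rewrite orbT.
lia.
Qed.

Lemma rankE_eval (K : fieldType) d (s : state K d) A path u : same_labels A (arr s) ->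
  neval s (rankE path u) = rank path (pres A (neval s u)).
Proof.
move=> e; elim: path => //= -[v o] p IH /=; rewrite IH; congr (_ * _ + _).
by case: o => /=; rewrite (e v _).2 /pres; case: (A _ _).
Qed.

(** The rank is lexicographic along the path from [e], the nearest vertex having the largest weight.
    Two intervals through [e] first differ at some vertex, beyond which they share nothing; the
    arrow leading there decides which addition is admissible. *)
Definition total_at Done e path :=
  all (fun l => all (fun l' => [&& interval (vat l), interval (vat l'), vat l e, vat l' e
     & rank path (vat l) <= rank path (vat l')] ==> all (adm (vat l) (vat l')) Done) allvecs) allvecs.

Lemma adm_ext px px' py py' b : px =1 px' -> py =1 py' -> adm px py b = adm px' py' b.
Proof. by move=> h h'; rewrite /adm !h !h'. Qed.

Lemma total_atP Done e path px py : total_at Done e path -> interval px -> interval py ->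
  px e -> py e -> rank path px <= rank path py -> all (adm px py) Done.
Proof.
move=> /pvec_all/(_ px)/pvec_all/(_ py) h i1 i2 e1 e2 r.
rewrite (eq_all (a2 := adm (vat (pvec px)) (vat (pvec py)))) => [|b]; last first.
  by apply: adm_ext => v; rewrite pvecE.
move: h; rewrite !pvecE e1 e2 !(rank_ext _ (pvecE _)) r.
by rewrite !(interval_ext (pvecE _)) i1 i2.
Qed.

Lemma idA_inj v w : (idA v == idA w) = (v == w).
Proof. by rewrite -veqE /veq /idA eqn_add2l. Qed.
Lemma ixA_inj v w : (ixA v == ixA w) = (v == w).
Proof. by rewrite -veqE /veq /ixA eqn_add2l. Qed.
Lemma idA_ixA v w : (idA v == ixA w) = false. Proof. by case: v; case: w. Qed.
Lemma ixA_idA v w : (ixA v == idA w) = false. Proof. by case: v; case: w. Qed.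
Lemma big_idA x w : 29 < x -> (x == idA w) = false.
Proof. by move=> h; apply/eqP => e; move: h; rewrite e; case: w e. Qed.
Lemma big_ixA x w : 29 < x -> (x == ixA w) = false.
Proof. by move=> h; apply/eqP => e; move: h; rewrite e; case: w e. Qed.
(** The first store erases the old label from the inverse array, so that it does not keep pointing
    to a vector that has taken the label of its partner at [e]. *)
Definition link_fresh w e pa := For 4 (NDim w) (If (NLoad pa (V 4))
  (seqs [:: Store (ixA w) (IDe w (V 4)) (NConst 0);
            Store (idA w) (V 4) (IDe e (NSub (NLoad pa (V 4)) (NConst 1)));
            Store (ixA w) (IDe w (V 4)) (NAdd (V 4) (NConst 1))]) Skip).

Definition fresh (d : vertex -> nat) (A : nat -> nat -> nat) w :=
  forall j v, j < d w -> v != w -> ~~ pres A (A (idA w) j) v.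

Section LinkFresh.
Variables (K : fieldType) (d : vertex -> nat).
Implicit Types (s : state K d).

Lemma link_fresh_runs s w e pa : labels_ok d (arr s) -> w != e -> 29 < pa ->
  (forall i k, i < d w -> arr s pa i = k.+1 -> k < d e) ->
  (forall i i' k, i < d w -> i' < d w -> arr s pa i = k.+1 -> arr s pa i' = k.+1 -> i = i') ->
  fresh d (arr s) w ->
  runs (link_fresh w e pa) s 0 (fun s' => [/\ mx s' = mx s,
    (forall x k, x != 4 -> x != idA w -> x != ixA w -> arr s' x k = arr s x k),
    labels_ok d (arr s')
    & forall i, i < d w -> arr s' (idA w) i = if arr s pa i is k.+1 then arr s (idA e) k else arr s (idA w) i]).
Proof.
move=> ok we pa9 pae pinj fr.
pose new i := if arr s pa i is k.+1 then arr s (idA e) k else arr s (idA w) i.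
pose I k s1 := [/\ mx s1 = mx s,
    (forall x l : nat, x != 4 -> x != idA w -> x != ixA w -> arr s1 x l = arr s x l),
    (forall i, i < d w -> arr s1 (ixA w) (arr s1 (idA w) i) = i.+1),
    (forall u i, arr s1 (ixA w) u = i.+1 -> i < d w /\ arr s1 (idA w) i = u)
    & forall i, i < d w -> arr s1 (idA w) i = if i < k then new i else arr s (idA w) i].
have setI k s1 n : I k s1 -> I k (set_mem s1 4 0 n).
  have h4 x : x != 4 -> (x == 4) = false by move/negPf.
  case=> h1 h2 h3 h4' h5; split=> //=.
  by move=> x l n4 n1 n2; rewrite (negPf n4) /= h2.
apply: (@runs_for _ _ _ _ _ _ (d w) 0 _ I) => //.
- by apply: setI; split=> //; [apply: ok.1 | apply: ok.2].
- move=> k s1 hk [h1 h2 h3 h4 h5] e4.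
  have epa l : arr s1 pa l = arr s pa l.
    have n4 : pa != 4 by rewrite neq_ltn (leq_trans _ pa9) // orbT.
    by apply: h2; rewrite ?big_idA ?big_ixA.
  apply: (@runs_ifb _ _ _ _ _ _ _ _ (arr s pa k != 0)); first by rewrite /= e4 epa.
  2: { rewrite negbK => /eqP pk; apply: runs_skip; split=> //; apply: setI; split=> // i hi.
    by rewrite h5 // ltnS [in RHS]leq_eqVlt; case: eqP => [->|//]; rewrite ltnn /new pk. }
  case pk: (arr s pa k) => [//|c] _.
  have hc := pae _ _ hk pk.
  apply: (@runs_seq _ _ _ _ _ 0 0) => //; apply: runs_store.
  rewrite /= e4; set s2 := set_mem _ _ _ _.
  apply: (@runs_seq _ _ _ _ _ 0 0) => //; apply: runs_store.
  rewrite /= idA_ixA big_ixA //= e4 epa pk subn1 /=.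
  have wE : (e == w) = false by rewrite eq_sym (negPf we).
  have eE l : arr s1 (idA e) l = arr s (idA e) l by apply: h2; rewrite ?idA_inj ?wE ?idA_ixA //; case: (e).
  rewrite eE.
  set s3 := set_mem _ _ _ _.
  apply: (@runs_seq _ _ _ _ _ 0 0) => //; apply: runs_store.
  rewrite /= idA_inj !eqxx /= e4 eqxx /=; apply: runs_skip.
  set s4 := set_mem _ _ _ _; split; first exact: e4.
  apply: setI.
  set u0 := arr s1 (idA w) k in s2 s3 s4 *; set u1 := arr s (idA e) c in s3 s4 *.
  have id4 i : arr s4 (idA w) i = if i == k then u1 else arr s1 (idA w) i.
    by rewrite /= idA_ixA /= eqxx.
  have ix4 u : arr s4 (ixA w) u = if u == u1 then k.+1 else if u == u0 then 0 else arr s1 (ixA w) u.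
    by rewrite /= !eqxx ixA_idA /= addn1.
  have nu1 i : i < d w -> i != k -> arr s1 (idA w) i != u1.
    have old l : l < d w -> arr s (idA w) l != u1.
      move=> hl; apply/eqP => el; have := fr l e hl; rewrite eq_sym => /(_ we).
      by rewrite el /u1 (id_pres ok).
    move=> hi nik; rewrite h5 // /new; case: ltnP => hik; last exact: old.
    case pi: (arr s pa i) => [|c']; first exact: old.
    apply/eqP => ec; have ecc := id_inj ok (pae _ _ hi pi) hc ec.
    by rewrite (pinj i k c) ?eqxx // -ecc in nik.
  split=> //.
  - by move=> x l n4 n1 n2; rewrite /= (negPf n1) (negPf n2) /=; apply: h2.
  - move=> i hi; rewrite id4 ix4; case: (eqVneq i k) => [->|nik]; first by rewrite eqxx.
    rewrite (negPf (nu1 i hi nik)); case: eqP => [e1|_]; last exact: h3.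
    by have := h3 i hi; rewrite e1 /u0 h3 // => -[e2]; rewrite e2 eqxx in nik.
  - move=> u i; rewrite ix4 id4; case: eqP => [-> [<-]|nu]; first by rewrite eqxx.
    case: eqP => // nu0 h; have [hi ei] := h4 _ _ h; split=> //.
    by case: eqP => // ek; rewrite -ei ek in nu0.
  - move=> i hi; rewrite id4 ltnS [in RHS]leq_eqVlt; case: eqP => [->|_]; last by rewrite h5.
    by rewrite /= /new pk.
- by rewrite muln0.
- move=> s1 [h1 h2 h3 h4 h5]; split=> //; last by move=> i hi; rewrite h5 // hi.
  have kI v l : v != w -> arr s1 (idA v) l = arr s (idA v) l.
    by move=> nv; apply: h2; rewrite ?idA_inj ?idA_ixA //; case: (v).
  have kX v l : v != w -> arr s1 (ixA v) l = arr s (ixA v) l.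
    by move=> nv; apply: h2; rewrite ?ixA_inj ?ixA_idA //; case: (v).
  split=> [v i hi|v u i]; case: (eqVneq v w) => [ev|nv].
  - by rewrite ev in hi *; apply: h3.
  - by rewrite kX // kI //; apply: ok.1.
  - by rewrite ev; apply: h4.
  - by rewrite kX // kI //; apply: ok.2.
Qed.

End LinkFresh.

Definition adjacent e w :=
  all (fun l => interval (vat l) && vat l e ==> interval (fun v => vat l v || veq v w)) allvecs.

Lemma adjacentP e w px : adjacent e w -> interval px -> px e -> interval (fun v => px v || veq v w).
Proof.
move=> /pvec_all/(_ px); rewrite pvecE (interval_ext (pvecE px)) => h i1 e1.
by move: h; rewrite i1 e1 /= => h; rewrite -(interval_ext (px := fun v => vat (pvec px) v || veq v w)) // => v; rewrite pvecE.
Qed.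

Section Phases.
Variables (K : fieldType) (W : rep K).
Notation d := (rdim W).
Implicit Types (s : state K d).

(** Each phase consumes two arrays of pivots; those from 30 + 2 * m on are still zero, as a sweep
    requires of its arrays at the start. *)
Definition stage (Done : seq arrow) (Fr : seq vertex) m s :=
  [/\ labels_ok d (arr s), forall u, interval (pres (arr s) u), tree Done (arr s) (mx s),
      forall w, w \in Fr -> fresh d (arr s) w & forall x k, 30 + 2 * m <= x -> arr s x k = 0].

Variables (m : nat) (a : arrow) (srcw : bool) (path : seq (vertex * bool)).
Let w := if srcw then src a else tgt a.
Let e := if srcw then tgt a else src a.

(** [w] is the new vertex and [e] the old end. If [w] is the source of [a], the labels at [e] index
    rows and [63 -] reverses their order. The labels at [w] are fresh, may be added freely to each
    other, and have constant rank. *)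
Definition phase :=
  Seq (tree_sweep a (30 + 2 * m) (31 + 2 * m)
        (fun j => if srcw then NConst 0 else rankE path (IDe (src a) j))
        (fun i => if srcw then NSub (NConst 63) (rankE path (IDe (tgt a) i)) else NConst 0)
        (fun=> NConst 1) (fun=> NConst 1))
      (link_fresh w e (if srcw then 31 + 2 * m else 30 + 2 * m)).

Variables (Done : seq arrow) (Fr : seq vertex).
Hypotheses (total : total_at Done e path) (adj : adjacent e w) (path5 : size path <= 5).
Hypothesis (Done_w : all (fun b => ~~ incident w (Str b)) Done).

Lemma we : w != e.
Proof. by rewrite -veqE /w /e; case: (srcw); case: (a). Qed.

Lemma fresh_other A w0 v j : labels_ok d A -> fresh d A w0 -> v != w0 -> j < d v ->
  ~~ pres A (A (idA v) j) w0.
Proof.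
move=> ok fr nv hj; apply/negP => p.
have := fr _ v (pos_lt ok p) nv; rewrite (pos_id ok p).
by rewrite (id_pres ok).
Qed.

Lemma phase_runs s : w \in Fr -> stage Done Fr m s ->
  runs phase s (64 * (max_dim d * pivot_cost d (72 * max_dim d)))
   (stage (a :: Done) [seq v <- Fr | ~~ veq v w && ~~ veq v e] m.+1).
Proof.
move=> wFr [ok ints tr frs zs]; have fw := frs _ wFr.
set A := arr s in ok ints tr frs zs fw.
have r63 px : rank path px <= 63.
  by apply: ltnW; apply: leq_trans (rank_lt _ _) _; apply: (@leq_trans (2 ^ 5)); rewrite ?leq_exp2l.
have inc : forall v, v != w -> v != e -> ~~ incident v (Str a).
  by move=> v; rewrite incidentE /w /e; case: (srcw) => /negPf-> /negPf->.
have other v j : v != w -> j < d v -> ~~ pres A (A (idA v) j) w by apply: fresh_other.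
(* A fresh label lives at neither end of a treated arrow, so both implications of [adm] hold
   vacuously. *)
have fadm j px : j < d w -> all (adm (pres A (A (idA w) j)) px) Done.
  move=> hj; apply/allP => b /(allP Done_w) nb; rewrite /adm.
  have [n1 n2] : ~~ pres A (A (idA w) j) (src b) /\ ~~ pres A (A (idA w) j) (tgt b).
    move: nb; rewrite incidentE negb_or => /andP[n1 n2].
    by split; apply: fw => //; rewrite eq_sym.
  by rewrite (negPf n1) (negPf n2).
have eadm j j' : j < d e -> j' < d e -> rank path (pres A (A (idA e) j)) <= rank path (pres A (A (idA e) j')) ->
    all (adm (pres A (A (idA e) j)) (pres A (A (idA e) j'))) Done.
  by move=> hj hj' hr; apply: (total_atP total) => //; rewrite (id_pres ok).
apply: (@runs_seq _ _ _ _ _ (64 * (max_dim d * pivot_cost d (72 * max_dim d))) 0); last by rewrite addn0.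
have fr0 : frame (30 + 2 * m) (31 + 2 * m) A s by [].
have rp9 : 25 < 30 + 2 * m by lia.
have cp9 : 25 < 31 + 2 * m by lia.
have rpcp : 30 + 2 * m != 31 + 2 * m by lia.
have lab s1 : frame (30 + 2 * m) (31 + 2 * m) A s1 -> same_labels A (arr s1) by apply: frame_labels.
have wsrc : srcw -> w = src a /\ e = tgt a by rewrite /w /e => ->.
have wtgt : ~~ srcw -> w = tgt a /\ e = src a by rewrite /w /e => /negPf ->.
have TS := @tree_sweep_runs K W Done a (30 + 2 * m) (31 + 2 * m) A
        (fun j => if srcw then NConst 0 else rankE path (IDe (src a) j))
        (fun i => if srcw then NSub (NConst 63) (rankE path (IDe (tgt a) i)) else NConst 0)
        (fun=> NConst 1) (fun=> NConst 1)
        (fun j => if srcw then 0 else rank path (pres A (A (idA (src a)) j)))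
        (fun i => if srcw then 63 - rank path (pres A (A (idA (tgt a)) i)) else 0)
        xpredT xpredT ok rp9 cp9 rpcp.
apply: runs_weak (TS _ _ _ _ _ _ _ _ _ s fr0 _ _ _) (leqnn _) _ => {TS} //.
- move=> s1 e1 f1; case: (srcw) => //.
  by rewrite (rankE_eval _ _ (lab _ f1)) /= (lab _ f1 _ _).1.
- move=> s1 e1 f1; case: (srcw) => //=.
  by rewrite (rankE_eval _ _ (lab _ f1)) /= (lab _ f1 _ _).1.
- by move=> j _ _; case: (srcw); rewrite ?ltnS.
- move=> i hi _; case: (boolP srcw) => hs.
    have [ew ee] := wsrc hs; rewrite -ew; apply: other; last exact: hi.
    by rewrite -ee eq_sym we.
  by have [ew ee] := wtgt hs; rewrite -ew -ee; apply: fw; [rewrite ew | rewrite eq_sym we].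
- move=> j hj _; case: (boolP srcw) => hs.
    by have [ew ee] := wsrc hs; rewrite -ew -ee; apply: fw; [rewrite ew | rewrite eq_sym we].
  have [ew ee] := wtgt hs; rewrite -ew; apply: other; last exact: hj.
  by rewrite -ee eq_sym we.
- move=> j j' hj hj' _ _; case: (boolP srcw) => hs.
    by move=> _; have [ew ee] := wsrc hs; rewrite -ew; apply: fadm; rewrite ew.
  by have [ew ee] := wtgt hs; rewrite -ee; apply: eadm; rewrite ee.
- move=> i i' hi hi' _ _; case: (boolP srcw) => hs.
    have [ew ee] := wsrc hs; rewrite -ee => h; apply: eadm; rewrite ?ee //.
    have := r63 (pres A (A (idA e) i)); have := r63 (pres A (A (idA e) i')); rewrite ee in h *; lia.
  by move=> _; have [ew ee] := wtgt hs; rewrite -ew; apply: fadm; rewrite ew.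
- by move=> k; apply: zs; rewrite leqnn.
- by move=> k; apply: zs; lia.
move=> s1 [f1 [ts1 _] [mfg1 mfg2] lk1].
have es1 := lab _ f1.
have ok1 := same_labels_ok ok es1.
set pa := if srcw then 31 + 2 * m else 30 + 2 * m.
have hpa : 29 < pa by rewrite /pa; case: (srcw); lia.
have pae i k : i < d w -> arr s1 pa i = k.+1 -> k < d e.
  move=> _; rewrite /pa; case: (boolP srcw) => hs.
    by have [ew ee] := wsrc hs; move/mfg2/mfg1 => [h _ _ _ _]; rewrite ee.
  by have [ew ee] := wtgt hs; move/mfg1 => [_ _ h _ _]; rewrite ee.
have pinj i i' k : i < d w -> i' < d w -> arr s1 pa i = k.+1 -> arr s1 pa i' = k.+1 -> i = i'.
  move=> _ _; rewrite /pa; case: (srcw).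
    by move=> /mfg2 h1 /mfg2; rewrite h1 => -[].
  by move=> /mfg1 [_ _ _ _ h1] /mfg1 [_ _ _ _]; rewrite h1 => -[].
have fw1 : fresh d (arr s1) w.
  by move=> j v hj nv; rewrite (same_pres _ _ es1) (es1 w j).1; apply: fw.
apply: runs_weak (link_fresh_runs ok1 we hpa pae pinj fw1) (leqnn _) _.
move=> s2 [m2 o2 ok2 id2].
have kI v l : v != w -> arr s2 (idA v) l = A (idA v) l.
  by move=> nv; rewrite o2 ?(es1 v l).1 ?idA_inj ?idA_ixA //; case: (v).
have kX v l : v != w -> arr s2 (ixA v) l = A (ixA v) l.
  by move=> nv; rewrite o2 ?(es1 v l).2 ?ixA_inj ?ixA_idA //; case: (v).
have kP u v : v != w -> pres (arr s2) u v = pres A u v by move=> nv; rewrite /pres kX.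
have ew' : e != w by rewrite eq_sym we.
have {}id2 i : i < d w -> arr s2 (idA w) i = if arr s1 pa i is k.+1 then A (idA e) k else A (idA w) i.
  by move=> hi; rewrite id2 // (es1 w i).1; case: (arr s1 pa i) => // k; rewrite (es1 e k).1.
have new v u i : arr s2 (ixA w) u = i.+1 -> i < d w /\ arr s2 (idA w) i = u by apply: ok2.2.
split=> //.
- move=> u; case: (boolP (pres (arr s2) u w)) => pu.
    have hi := pos_lt ok2 pu; have := pos_id ok2 pu; rewrite id2 //.
    case ep: (arr s1 pa _) => [|k] eu.
      rewrite (@interval_ext _ (fun v => veq v w)); first by case: (w).
      move=> v; rewrite veqE; case: (eqVneq v w) => [->//|nv]; rewrite kP // -eu.
      by apply/negbTE; apply: fw.
    have hk := pae _ _ hi ep.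
    rewrite (@interval_ext _ (fun v => pres A u v || veq v w)).
      by apply: adjacentP adj _ _ => //; rewrite -eu (id_pres ok).
    move=> v; rewrite veqE; case: (eqVneq v w) => [->|nv]; first by rewrite pu orbT.
    by rewrite kP // orbF.
  case: (boolP (pres A u w)) => pu0.
    rewrite (@interval_ext _ (fun v => false)) // => v.
    case: (eqVneq v w) => [->|nv]; first by apply/negbTE.
    rewrite kP // -(pos_id ok pu0); apply/negbTE; apply: fw => //; exact: pos_lt.
  rewrite (@interval_ext _ (pres A u)) // => v.
  case: (eqVneq v w) => [->|nv]; last by rewrite kP.
  by rewrite (negPf pu) (negPf pu0).
- split; first by rewrite m2; case: ts1.
  move=> b; rewrite inE => /orP[/eqP->|hb] i j hi hj; last first.
    have := allP Done_w b hb; rewrite incidentE negb_or ![w == _]eq_sym => /andP[n1 n2].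
    by rewrite m2 !kI //; apply: ts1.2.
  rewrite m2 lk1 //; congr (nat_of_bool _)%:R%R; move: id2 kI; rewrite /pa.
  case: (boolP srcw) => hs id2 kI.
    have [ew ee] := wsrc hs; rewrite -ew -ee in hi hj *.
    rewrite id2 // (kI e i ew').
    case ep: (arr s1 (31 + 2 * m) j) => [|k].
      have -> : (A (idA e) i == A (idA w) j) = false.
        apply/negbTE/eqP => eij; have := fw j e hj; rewrite eq_sym we -eij => /(_ isT).
        by rewrite (id_pres ok).
      by apply/negbTE/eqP => /mfg1 [_ _ _ _]; rewrite ep.
    have fk := mfg2 _ _ ep; have [hk _ _ _ _] := mfg1 _ _ fk; rewrite -ee in hk.
    apply/eqP/eqP => [fi|eij]; first by have [_ _ _ _] := mfg1 _ _ fi; rewrite ep => -[->].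
    by rewrite (id_inj ok hi hk eij).
  have [ew ee] := wtgt hs; rewrite -ew -ee in hi hj *.
  rewrite id2 // (kI e j ew').
  case ep: (arr s1 (30 + 2 * m) i) => [|k].
    apply/esym/negbTE/eqP => eij; have := fw i e hi; rewrite eq_sym we eij => /(_ isT).
    by rewrite (id_pres ok).
  have [_ _ hk _ _] := mfg1 _ _ ep; rewrite -ee in hk.
  by apply/eqP/eqP => [[->]//|eij]; rewrite (id_inj ok hk hj eij).
- move=> w2; rewrite mem_filter !veqE => /andP[/andP[n1 n2] /frs f2] j v hj nv.
  rewrite kI //; case: (eqVneq v w) => [->|nvw]; last by rewrite kP //; apply: f2.
  apply/negP => pu; have hi := pos_lt ok2 pu; have := pos_id ok2 pu; rewrite id2 //.
  case ep: (arr s1 pa _) => [|k] eu.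
    have := f2 j w hj; rewrite eq_sym n1 -eu => /(_ isT).
    by rewrite (id_pres ok).
  have := f2 j e hj; rewrite eq_sym n2 -eu => /(_ isT).
  by rewrite (id_pres ok) // (pae _ _ hi ep).
- move=> x k hx; rewrite o2.
  + by rewrite f1 ?zs //; lia.
  + by lia.
  + by rewrite big_idA //; lia.
  + by rewrite big_ixA //; lia.
Qed.

End Phases.

(** * Initial labels and the treatment of the whole path *)

Definition init_vertex v := For 4 (NDim v)
  (Seq (Store (idA v) (V 4) (NAdd (NMul (NConst 6) (V 4)) (NConst (code v))))
       (Store (ixA v) (IDe v (V 4)) (NAdd (V 4) (NConst 1)))).

Definition stages :=
  seqs [seq init_vertex v | v <- vertices].

Lemma code6 v : code v < 6. Proof. by case: v. Qed.

Section Init.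
Variables (K : fieldType) (d : vertex -> nat).
Implicit Types (s : state K d).

(** Division of an initial label by 6 recovers the position and the vertex, so initial labels are
    pairwise distinct across all vertices. *)
Definition numbered (A : nat -> nat -> nat) v :=
  (forall i, i < d v -> A (idA v) i = 6 * i + code v) /\
  (forall u, A (ixA v) u = if (u %% 6 == code v) && (u %/ 6 < d v) then (u %/ 6).+1 else 0).

Lemma init_vertex_runs s v : (forall u, arr s (ixA v) u = 0) ->
  runs (init_vertex v) s 0 (fun s' => [/\ mx s' = mx s,
    (forall x k, x != 4 -> x != idA v -> x != ixA v -> arr s' x k = arr s x k) & numbered (arr s') v]).
Proof.
move=> z.
pose I k s1 := [/\ mx s1 = mx s,
    (forall x l : nat, x != 4 -> x != idA v -> x != ixA v -> arr s1 x l = arr s x l),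
    (forall i, i < k -> arr s1 (idA v) i = 6 * i + code v) &
    (forall u, arr s1 (ixA v) u = if (u %% 6 == code v) && (u %/ 6 < k) then (u %/ 6).+1 else 0)].
have setI k s1 n : I k s1 -> I k (set_mem s1 4 0 n).
  by case=> h1 h2 h3 h4; split=> //= x l n4 n1 n2; rewrite (negPf n4) /= h2.
apply: (@runs_for _ _ _ _ _ _ (d v) 0 _ I) => //.
- by apply: setI; split=> // u; rewrite z ltn0 andbF.
- move=> k s1 hk [h1 h2 h3 h4] e4.
  apply: (@runs_seq _ _ _ _ _ 0 0) => //; apply: runs_store.
  apply: runs_store; rewrite /= e4 !eqxx /= ?e4 ?eqxx /= addn1.
  split=> //; apply: setI; split=> //=.
  + by move=> x l n4 n1 n2; rewrite (negPf n1) (negPf n2) /= h2.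
  + move=> i; rewrite idA_ixA eqxx /= ltnS leq_eqVlt => /orP[/eqP->|hi]; first by rewrite eqxx.
    by rewrite (ltn_eqF hi) h3.
  + move=> u; rewrite eqxx ixA_idA /= h4 ltnS [in RHS]leq_eqVlt.
    have c6 := code6 v.
    have uE := divn_eq u 6.
    case: (u =P _) => [->|nu].
      by rewrite mulnC modnMDl divnMDl // modn_small // divn_small // addn0 !eqxx.
    case: (u %% 6 =P code v) => //= e6.
    by case: (u %/ 6 =P k) => //= ek; case: nu; lia.
- by rewrite muln0.
by move=> s1 [h1 h2 h3 h4]; split.
Qed.

Lemma init_runs s vs : uniq vs -> (forall v u, v \in vs -> arr s (ixA v) u = 0) ->
  runs (seqs [seq init_vertex v | v <- vs]) s 0 (fun s' => [/\ mx s' = mx s,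
    (forall x k, x != 4 -> (forall v, v \in vs -> x != idA v) -> (forall v, v \in vs -> x != ixA v) -> arr s' x k = arr s x k)
    & forall v, v \in vs -> numbered (arr s') v]).
Proof.
elim: vs s => [|v vs IH] s; first by move=> _ _; apply: runs_skip; split.
move=> /andP[nv uvs] z; apply: (@runs_seq _ _ _ _ _ 0 0) => //.
apply: runs_weak (init_vertex_runs (fun u => z v u (mem_head _ _))) (leqnn _) _ => s1 [m1 o1 n1].
apply: runs_weak (IH s1 uvs _) (leqnn _) _ => [w u hw|s2 [m2 o2 n2]].
  rewrite o1 ?z ?inE ?hw ?orbT ?ixA_idA ?ixA_inj //.
  by apply: contra nv => /eqP <-.
split; first by rewrite m2.
  move=> x k n4 hi hx; rewrite o2 //.
  - by rewrite o1 // ?hi ?hx ?mem_head.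
  - by move=> w hw; rewrite hi // inE hw orbT.
  - by move=> w hw; rewrite hx // inE hw orbT.
move=> w; rewrite inE => /orP[/eqP->|]; last exact: n2.
have kI l : arr s2 (idA v) l = arr s1 (idA v) l.
  rewrite o2 //.
  - by move=> w' hw; rewrite idA_inj; apply: contra nv => /eqP->.
  - by move=> w' hw; rewrite idA_ixA.
have kX l : arr s2 (ixA v) l = arr s1 (ixA v) l.
  rewrite o2 //.
  - by move=> w' hw; rewrite ixA_idA.
  - by move=> w' hw; rewrite ixA_inj; apply: contra nv => /eqP->.
by split=> [i hi|u]; rewrite ?kI ?kX; [apply: n1.1 | apply: n1.2].
Qed.

End Init.

(** The path grows from vertex 2 in both directions. Each list follows the treated part of the path,
    starting at the end that is being extended. *)
Definition zigzag_program :=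
  seqs [:: stages; phase 0 a12 true [::]; phase 1 a32 true [:: (v1, false)];
   phase 2 a14 false [:: (v2, true); (v3, false)];
   phase 3 a36 false [:: (v2, true); (v1, false); (v4, true)];
   phase 4 a45 false [:: (v1, false); (v2, true); (v3, false); (v6, true)]].

Section Zigzag.
Variables (K : fieldType) (W : rep K).
Notation d := (rdim W).

Lemma numbered_stage (s : state K d) : (forall v, numbered d (arr s) v) -> tracks (mx s) ->
  (forall x k, 30 <= x -> arr s x k = 0) -> stage [::] [:: v1; v3; v4; v6; v5] 0 s.
Proof.
move=> num tr z.
have presE u v : pres (arr s) u v = (u %% 6 == code v) && (u %/ 6 < d v).
  by rewrite /pres (num v).2; case: ifP.
have single u : exists px, (pres (arr s) u =1 px) /\ (interval px).
  case: (boolP (has (pres (arr s) u) vertices)) => [/hasP[v _]|/hasPn h]; last first.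
    by exists (fun=> false); split=> // v; apply/negbTE/h/mem_vertices.
  rewrite presE => /andP[/eqP e1 h1]; exists (veq v); split; last by case: (v).
  move=> w; rewrite presE /veq e1; case: eqP => //= e2.
  by have -> : w = v by apply/eqP; rewrite -veqE /veq e2.
split=> //.
- split=> [v i hi|v u i].
    rewrite (num v).1 // (num v).2 mulnC modnMDl divnMDl // modn_small ?code6 // divn_small ?code6 // addn0 eqxx hi //.
  rewrite (num v).2; case: andP => // -[/eqP e1 h1] [<-]; split=> //.
  by rewrite (num v).1 // -e1 mulnC -divn_eq.
- by move=> u; have [px [e1 e2]] := single u; rewrite (interval_ext e1).
- by move=> w _ j v hj nv; rewrite presE (num w).1 // mulnC modnMDl modn_small ?code6 // negb_and -/(veq w v) veqE eq_sym nv.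
Qed.

Definition phase_cost := 64 * (max_dim d * pivot_cost d (72 * max_dim d)).

Lemma zigzag_runs :
  runs zigzag_program (init W) (5 * phase_cost)
    (fun s => exists Fr, stage [:: a45; a36; a14; a32; a12] Fr 5 s).
Proof.
apply: (@runs_seq _ _ _ _ _ 0 (5 * phase_cost)) => //.
apply: runs_weak (@init_runs K d (init W) vertices uniq_vertices _) (leqnn _) _ => // s0 [m0 o0 n0].
have st0 : stage [::] [:: v1; v3; v4; v6; v5] 0 s0.
  apply: numbered_stage.
  - by move=> v; apply: n0; apply: mem_vertices.
  - rewrite m0; split=> [v|b] /=; first exact: unitmx1.
    by rewrite mulmx1 mul1mx.
  - move=> x k hx; rewrite o0 //; first by rewrite neq_ltn (leq_trans _ hx) // orbT.
      by move=> v _; rewrite big_idA.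
    by move=> v _; rewrite big_ixA.
have step m a srcw path Done Fr rest Q (s : state K d) c : stage Done Fr m s ->
    total_at Done (if srcw then tgt a else src a) path ->
    adjacent (if srcw then tgt a else src a) (if srcw then src a else tgt a) ->
    size path <= 5 -> all (fun b => ~~ incident (if srcw then src a else tgt a) (Str b)) Done ->
    has (veq (if srcw then src a else tgt a)) Fr ->
    (forall s', stage (a :: Done) [seq v <- Fr | ~~ veq v (if srcw then src a else tgt a) && ~~ veq v (if srcw then tgt a else src a)] m.+1 s' ->
       runs rest s' (c * phase_cost) Q) ->
    runs (Seq (phase m a srcw path) rest) s (c.+1 * phase_cost) Q.
  move=> st h1 h2 h3 h4 /hasP[w wFr]; rewrite veqE => /eqP ew hr.
  apply: (@runs_seq _ _ _ _ _ phase_cost (c * phase_cost)) => //.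
  by apply: runs_weak (phase_runs h1 h2 h3 h4 _ st) (leqnn _) hr; rewrite ew.
apply: (step _ _ _ _ _ _ _ _ _ _ st0) ; [by vm_compute..|move=> s1 st1].
apply: (step _ _ _ _ _ _ _ _ _ _ st1) ; [by vm_compute..|move=> s2 st2].
apply: (step _ _ _ _ _ _ _ _ _ _ st2) ; [by vm_compute..|move=> s3 st3].
apply: (step _ _ _ _ _ _ _ _ _ _ st3) ; [by vm_compute..|move=> s4 st4].
apply: (step _ _ _ _ _ _ _ _ _ _ st4) ; [by vm_compute..|move=> s5 st5].
by apply: runs_skip; exists [seq v <- [seq v <- [seq v <- [seq v <- [seq v <- [:: v1; v3; v4; v6; v5] | ~~ veq v v1 && ~~ veq v v2] | ~~ veq v v3 && ~~ veq v v2] | ~~ veq v v4 && ~~ veq v v1] | ~~ veq v v6 && ~~ veq v v3] | ~~ veq v v5 && ~~ veq v v4].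
Qed.

End Zigzag.

(** * The arrow from 6 to 5 *)

Definition tree5 := [:: a45; a36; a14; a32; a12].

(** * Clearing selected entries one by one *)

Section Clean.
Local Open Scope ring_scope.
Variables (a : arrow) (G : nexp) (CMD : cmd).

Definition clean := For 5 (NDim (tgt a)) (For 6 (NDim (src a))
  (If G (Seq (TestZero 2 (NConst 0) (Str a) (V 5) (V 6)) (If (NNot (V 2)) CMD Skip)) Skip)).

Variables (K : fieldType) (d : vertex -> nat) (s0 : state K d) (g : nat -> nat -> bool).
Variables (Psi : mxs K d -> Prop) (B : nat).
Implicit Types (s : state K d).
Notation nr := (d (tgt a)).
Notation nc := (d (src a)).
Notation M s := (ent (mx s (Str a))).

Hypothesis GP : forall s i j, keep s0 s -> arr s 5 0 = i -> arr s 6 0 = j ->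
  (i < nr)%N -> (j < nc)%N -> (neval s G != 0%N) = g i j.
Hypothesis CMDP : forall s i j, keep s0 s -> Psi (mx s) -> arr s 5 0 = i -> arr s 6 0 = j ->
  (i < nr)%N -> (j < nc)%N -> g i j -> M s i j != 0 ->
  (forall i1 j1, (i1 < nr)%N -> (j1 < nc)%N -> ~~ g i1 j1 -> M s i1 j1 = M s0 i1 j1) ->
  runs CMD s B (fun s' => [/\ arr s' = arr s, Psi (mx s')
    & forall i1 j1, (i1 < nr)%N -> (j1 < nc)%N ->
       M s' i1 j1 = if (i1 == i) && (j1 == j) then 0 else M s i1 j1]).

(** The command for a selected entry clears it and changes no other entry, so no order among the
    entries is needed. It may rely on the entries outside the selection having their initial values:
    these contain the unit columns and rows used for clearing. *)
Lemma clean_runs : Psi (mx s0) ->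
  runs clean s0 (max_dim d * (max_dim d * B.+1)) (fun s' => [/\ keep s0 s', Psi (mx s')
    & forall i j, (i < nr)%N -> (j < nc)%N -> M s' i j = if g i j then 0 else M s0 i j]).
Proof.
move=> p0.
pose J k l s := [/\ keep s0 s, Psi (mx s) & forall i j, (i < nr)%N -> (j < nc)%N ->
   M s i j = if g i j && ((i < k)%N || (i == k) && (j < l)%N) then 0 else M s0 i j].
have setJ k l s x n : (x <= 9)%N -> J k l s -> J k l (set_mem s x 0 n).
  by move=> hx [h1 h2 h3]; split=> //; apply: keep_set.
apply: (@runs_for _ _ _ _ _ _ nr (max_dim d * B.+1) _ (fun k s => J k 0%N s)) => //.
- by apply: setJ => //; split=> // i j _ _; rewrite !ltn0 andbF orbF andbF.
- move=> k s1 hk J1 e5.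
  apply: (@runs_for _ _ _ _ _ _ nc B.+1 _ (fun l s => J k l s /\ arr s 5 0 = k)) => //.
  + by split=> //; apply: setJ.
  + move=> l s2 hl [J2 e52] e6; have [k2 p2 m2] := J2.
    have next s3 : keep s0 s3 -> Psi (mx s3) -> (forall i j, (i < nr)%N -> (j < nc)%N ->
        M s3 i j = if (i == k) && (j == l) && g k l then 0 else M s2 i j) -> J k l.+1 s3.
      move=> h1 h2 h3; split=> // i j hi hj; rewrite h3 // m2 //.
      rewrite ltnS [(j <= l)%N]leq_eqVlt.
      case: (eqVneq i k) => [->|_] /=; last by [].
      by rewrite ltnn /=; case: (eqVneq j l) => [->|_] /=; case: (g k l) => //=; rewrite ltnn.
    have skip s3 : keep s0 s3 -> mx s3 = mx s2 -> (g k l -> M s2 k l = 0) -> J k l.+1 s3.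
      move=> h1 h2 h3; apply: next => //; rewrite h2 // => i j hi hj.
      by case: (eqVneq i k) => [->|//]; case: (eqVneq j l) => [->|//] /=; case: (boolP (g k l)) => // /h3.
    apply: (@runs_ifb _ _ _ _ _ _ _ _ (g k l)); first by rewrite (GP k2 e52 e6).
    * move=> gkl; apply: (@runs_seq _ _ _ _ _ 1 B) => //; apply: runs_test => //=; rewrite ?e52 ?e6 //.
      set b := (ent _ _ _ == 0); set s3 := set_mem _ _ _ _.
      have k3 : keep s0 s3 by apply: keep_set.
      apply: (@runs_ifb _ _ _ _ _ _ _ _ (~~ b)); first by rewrite /= !condE /=.
        move=> nb; apply: runs_weak (@CMDP s3 k l k3 p2 _ _ hk hl gkl nb _) (leqnn _) _ => //.
          by move=> i1 j1 h1 h2 h3; rewrite m2 // (negPf h3).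
        move=> s4 [e4 p4 m4]; have k4 : keep s0 s4 by apply: keep_arr k3.
        have e64 : arr s4 6 0 = l by rewrite e4.
        have e54 : arr s4 5 0 = k by rewrite e4.
        split=> //; split=> //; apply: setJ => //; apply: next => // i j hi hj.
        by rewrite m4 // gkl andbT.
      rewrite negbK => /eqP hb; apply: runs_skip; split=> //; split=> //.
      by apply: setJ => //; apply: skip.
    move=> ng; apply: runs_skip; split=> //; split=> //; apply: setJ => //; apply: skip => //.
    by rewrite (negPf ng).
  + by rewrite leq_mul2r dim_le orbT.
  move=> s2 [[h1 h2 h3] e52]; split=> //; apply: setJ => //; split=> // i j hi hj.
  by rewrite h3 // hj andbT ltnS [in RHS]leq_eqVlt orbC !andbF !orbF.
- by rewrite leq_mul2r dim_le orbT.
move=> s1 [h1 h2 h3]; split=> // i j hi hj; rewrite h3 // hi andbT //.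
Qed.

End Clean.

(** * What commutativity says about labels and the two remaining matrices *)

Section Commutativity.
Local Open Scope ring_scope.
Variables (K : fieldType) (W : rep K).
Notation d := (rdim W).
Variable (A : nat -> nat -> nat).
Hypotheses (ok : labels_ok d A) (int : forall u, interval (pres A u)).

Lemma mul_linked (m : mxs K d) b (p : nat) (P : 'M[K]_(p, d (tgt b))) u i : linked A b m ->
  pres A u (src b) ->
  ent (P *m m (Str b)) i (pos A u (src b)) = if pres A u (tgt b) then ent P i (pos A u (tgt b)) else 0.
Proof.
move=> lb pu; rewrite ent_mul.
under eq_bigr => l _ do rewrite lb ?(pos_lt ok) // (pos_id ok) // (id_eq ok) //.
case: ifP => pt /=; last by rewrite big1 // => l _; rewrite mulr0.
by rewrite (sum_pick _ (fun l => ent P i l)) (pos_lt ok).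
Qed.

Lemma interval_check (P : seq bool -> bool) u : all P allvecs -> P (pvec (pres A u)).
Proof. by move=> h; apply: pvec_all. Qed.

Variable (m : mxs K d).
Hypothesis (tr : tree tree5 A m).
Notation f b := (ent (m (Str b))).

Let lk b : b \in tree5 -> linked A b m := fun h => tr.2 b h.

Lemma mem_tree5 b : b \in tree5 = has (aeq b) tree5.
Proof. by elim: tree5 => //= c l IH; rewrite inE IH aeqE. Qed.

(** The relation of the left square, evaluated at the basis vector of [u] at 1; three of its four
    arrows are in normal form. *)
Lemma comm1 u i : pres A u v1 -> (i < d v5)%N ->
  (if pres A u v4 then (A (idA v5) i == u)%:R else 0) = (if pres A u v2 then f a25 i (pos A u v2) else 0).
Proof.
move=> p1 hi; have [c1 _] := tracks_comm tr.1.
have h14 : linked A a14 m by apply: lk; rewrite mem_tree5.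
have h12 : linked A a12 m by apply: lk; rewrite mem_tree5.
have h45 : linked A a45 m by apply: lk; rewrite mem_tree5.
have := @mul_linked m a14 _ (m (Str a45)) u i h14 p1; rewrite c1 (@mul_linked m a12 _ (m (Str a25)) u i h12 p1) /= => ->.
by case: ifP => // p4; rewrite h45 ?(pos_lt ok) // (pos_id ok).
Qed.

Lemma comm2 u i : pres A u v3 ->
  (if pres A u v6 then f a65 i (pos A u v6) else 0) = (if pres A u v2 then f a25 i (pos A u v2) else 0).
Proof.
move=> p1; have [_ c1] := tracks_comm tr.1.
have h36 : linked A a36 m by apply: lk; rewrite mem_tree5.
have h32 : linked A a32 m by apply: lk; rewrite mem_tree5.
by have := @mul_linked m a36 _ (m (Str a65)) u i h36 p1; rewrite c1 (@mul_linked m a32 _ (m (Str a25)) u i h32 p1) /= => ->.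
Qed.

Lemma between (x y z : vertex) u :
  all (fun l => interval (vat l) && vat l x && vat l z ==> vat l y) allvecs ->
  pres A u x -> pres A u z -> pres A u y.
Proof.
move=> /(interval_check u); rewrite !pvecE (interval_ext (pvecE _)) int => /implyP h p1 p2.
by apply: h; rewrite p1.
Qed.

(** The path through 4 sends the vector of [u] at 1 to its vector at 5, so the path through 2 cannot
    kill it. *)
Lemma pres51 u : pres A u v5 -> pres A u v1 -> pres A u v2.
Proof.
move=> p5 p1; have p4 : pres A u v4 by apply: between p5 p1; vm_compute.
have := comm1 p1 (pos_lt ok p5); rewrite p4 (pos_id ok) // eqxx.
by case: ifP => // _ /eqP; rewrite oner_eq0.
Qed.

Lemma col1 u i : pres A u v1 -> pres A u v2 -> (i < d v5)%N ->
  f a25 i (pos A u v2) = (A (idA v5) i == u)%:R.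
Proof.
move=> p1 p2 hi; have := comm1 p1 hi; rewrite p2 => <-; case: ifP => // n4.
case: eqP => // eu; have p5 : pres A u v5 by rewrite -eu (id_pres ok).
by have : pres A u v4 by [apply: between p5 p1; vm_compute]; rewrite n4.
Qed.

(** The left square makes the column of [u] in [Str a25] a unit vector; hence the path from 3
    through 2 does not kill [u], and neither does the path through 6. *)
Lemma pres53 u : pres A u v5 -> pres A u v3 -> pres A u v6.
Proof.
move=> p5 p3; have p1 : pres A u v1 by apply: between p5 p3; vm_compute.
have p2 := pres51 p5 p1.
have := comm2 (pos A u v5) p3; rewrite p2 col1 // ?(pos_lt ok) // (pos_id ok) // eqxx.
by case: ifP => // _ /esym/eqP; rewrite oner_eq0.
Qed.

Lemma col6 u i : pres A u v6 -> pres A u v1 -> (i < d v5)%N ->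
  f a65 i (pos A u v6) = (A (idA v5) i == u)%:R.
Proof.
move=> p6 p1 hi.
have p2 : pres A u v2 by apply: between p1 p6; vm_compute.
have p3 : pres A u v3 by apply: between p1 p6; vm_compute.
by have := comm2 i p3; rewrite p6 p2 col1.
Qed.

Lemma col6_t u i : pres A u v6 -> pres A u v5 -> (i < d v5)%N ->
  f a65 i (pos A u v6) = (A (idA v5) i == u)%:R.
Proof. by move=> p6 p5; apply: col6 => //; apply: between p5 p6; vm_compute. Qed.

(** Living at 1 would make the column zero, [u] having no vector at 5; living at 3 but not at 2
    would make it zero by the right square. *)
Lemma col6_nz u i : pres A u v6 -> ~~ pres A u v5 -> (i < d v5)%N -> f a65 i (pos A u v6) != 0 ->
  ~~ pres A u v1 /\ (pres A u v3 -> pres A u v2).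
Proof.
move=> p6 n5 hi nz; split.
  apply: contra nz => p1; rewrite col6 //; case: (A (idA v5) i =P u) => [eu|_]; last exact: eqxx.
  by rewrite -eu (id_pres ok) in n5.
by move=> p3; have := comm2 i p3; rewrite p6; case: ifP => // _ e; rewrite e eqxx in nz.
Qed.

Lemma col3 u i : pres A u v3 -> pres A u v2 ->
  f a25 i (pos A u v2) = if pres A u v6 then f a65 i (pos A u v6) else 0.
Proof. by move=> p3 p2; rewrite comm2 // p2. Qed.

End Commutativity.

Definition path6 := [:: (v3, false); (v2, true); (v1, false); (v4, true); (v5, true)].
Definition path5 := [:: (v4, false); (v1, false); (v2, true); (v3, false); (v6, true)].

(** A label living at 5 and 6 lives on the whole path, and by commutativity its column in [Str a65]
    is the unit vector of its row. This column clears the rest of the row. *)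
Definition clean65 := clean a65
  (NMul (NLoad (ixA v6) (IDe v5 (V 5))) (NNot (NLoad (ixA v5) (IDe v6 (V 6)))))
  (kill_col a65 (V 5) (POSe v6 (IDe v5 (V 5))) (V 6)).

Definition sweep65 := tree_sweep a65 40 41
  (fun j => rankE path6 (IDe v6 j)) (fun i => NSub (NConst 63) (rankE path5 (IDe v5 i)))
  (fun j => NNot (NLoad (ixA v5) (IDe v6 j))) (fun i => NNot (NLoad (ixA v6) (IDe v5 i))).

(** The rows left out of the sweep have a label living at 6 and are linked with this label itself;
    the others take the label of their pivot column. *)
Definition label65 := For 4 (NDim v5) (Store 50 (V 4)
  (NAdd (NMul (NNot (NNot (NLoad (ixA v6) (IDe v5 (V 4))))) (NAdd (IDe v5 (V 4)) (NConst 1)))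
        (NMul (NMul (NNot (NLoad (ixA v6) (IDe v5 (V 4)))) (NNot (NNot (NLoad 40 (V 4)))))
              (NAdd (IDe v6 (NSub (NLoad 40 (V 4)) (NConst 1))) (NConst 1))))).

Lemma sub63_le x y : x <= 63 -> y <= 63 -> 63 - x <= 63 - y -> y <= x.
Proof. lia. Qed.

Section Arrow65.
Local Open Scope ring_scope.
Variables (K : fieldType) (W : rep K).
Notation d := (rdim W).
Variable (A : nat -> nat -> nat).
Hypotheses (ok : labels_ok d A) (int : forall u, interval (pres A u)).
Implicit Types (s : state K d).

Lemma keep_labels s s' : keep s s' -> same_labels A (arr s) -> same_labels A (arr s').
Proof. by move=> h e v k; rewrite !h; [apply: e | case: v | case: v]. Qed.

Lemma clean65_runs s : same_labels A (arr s) -> tree tree5 A (mx s) ->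
  runs clean65 s (max_dim d * (max_dim d * (72 * max_dim d).+1)) (fun s' => [/\ keep s s', tree tree5 A (mx s')
   & forall i j, (i < d v5)%N -> (j < d v6)%N -> pres A (A (idA v5) i) v6 -> ~~ pres A (A (idA v6) j) v5 ->
       ent (mx s' (Str a65)) i j = 0]).
Proof.
move=> es tr.
pose g i j := pres A (A (idA v5) i) v6 && ~~ pres A (A (idA v6) j) v5.
apply: runs_weak (leqnn _) _.
  apply: (@clean_runs a65 _ _ K d s g (tree tree5 A) (72 * max_dim d)) => //.
  - move=> s1 i j k1 e5 e6 hi hj; have e1 := keep_labels k1 es.
    by rewrite /= !condE /= !(e1 _ _).1 !(e1 _ _).2 e5 e6 /g /pres !negbK.
  - move=> s1 i j k1 tr1 e5 e6 hi hj /andP[p6 n5] nz _.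
    have e1 := keep_labels k1 es.
    set t := A (idA v5) i in p6 *; set y := A (idA v6) j in n5 *.
    have p5 : pres A t v5 by rewrite (id_pres ok).
    have hjt := pos_lt ok p6.
    have njt : pos A t v6 != j.
      by apply/eqP => e; move: n5; rewrite /y -e (pos_id ok) // p5.
    have evj : neval s1 (POSe v6 (IDe v5 (V 5))) = pos A t v6.
      by rewrite /= (e1 _ _).1 (e1 _ _).2 e5 subn1.
    have nb : ~~ both A (A (idA (src a65)) (pos A t v6)) (A (idA (src a65)) j) (tgt a65).
      by rewrite /both /= -/y (negPf n5) andbF.
    apply: runs_weak (kill_col_runs ok e1 (e5 : neval s1 (V 5) = i) evj (e6 : neval s1 (V 6) = j) hi hjt hj njt nb) (leqnn _) _.
    (* [t] lives at every vertex, so only the support of [y] matters; the supports left by [col6_nz]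
       are enumerated. *)
    have hadm : all (adm (pres A t) (pres A y)) tree5.
      have py6 : pres A y v6 by rewrite (id_pres ok).
      have nz' : ent (mx s1 (Str a65)) i (pos A y v6) != 0 by rewrite (id_pos ok).
      have [n1 h3] := col6_nz ok int tr1 py6 n5 hi nz'.
      have p1 : pres A t v1 by apply: (between int _ p5 p6); vm_compute.
      have p2 : pres A t v2 by apply: (between int _ p5 p6); vm_compute.
      have p3 : pres A t v3 by apply: (between int _ p5 p6); vm_compute.
      have p4 : pres A t v4 by apply: (between int _ p5 p6); vm_compute.
      have := @interval_check A (fun l => [&& interval (vat l), vat l v6, ~~ vat l v5, ~~ vat l v1 & vat l v3 ==> vat l v2] ==>
        all (adm (fun=> true) (vat l)) tree5) y.
      rewrite !pvecE (interval_ext (pvecE _)) int py6 n5 n1 (introT implyP h3) implyTb => h.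
      rewrite (@eq_all _ _ (adm (fun=> true) (vat (pvec (pres A y))))); first by apply: h; vm_compute.
      by move=> b; apply: adm_ext => v; rewrite ?pvecE //; case: v.
    move=> s2 [e2 am m2]; split=> //.
      rewrite /= (pos_id ok) // in am; apply: (tree_add ok _ hadm am tr1).
      by apply/eqP => e; move: n5; rewrite -e p5.
    move=> i1 j1 hi1 hj1; rewrite m2 col6_t //.
    case: (j1 =P j) => [->|_]; last by rewrite andbF mul0r subr0.
    rewrite andbT mul1r; case: (i1 =P i) => [->|ni]; first by rewrite /t eqxx mulr1 subrr.
    rewrite (_ : _ == t = false) ?mulr0 ?subr0 //; apply/negbTE/eqP => e.
    by apply: ni; apply: (id_inj ok) e.
move=> s1 [k1 tr1 m1]; split=> // i j hi hj p6 n5.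
by rewrite m1 // /g p6 n5.
Qed.

Definition closed65 (Y : nat -> nat) (m : mxs K d) := forall i j, (i < d v5)%N -> (j < d v6)%N ->
  ent (m (Str a65)) i j = (Y i == (A (idA v6) j).+1)%:R.

Lemma arrow65_runs s : same_labels A (arr s) -> tree tree5 A (mx s) ->
  (forall x k, (40 <= x)%N -> arr s x k = 0%N) ->
  runs (seqs [:: clean65; sweep65; label65]) s
   (max_dim d * (max_dim d * (72 * max_dim d).+1) + phase_cost W) (fun s' => [/\ same_labels A (arr s'),
    tree tree5 A (mx s'), closed65 (arr s' 50) (mx s'),
    [/\ (forall i u, (i < d v5)%N -> arr s' 50 i = u.+1 -> pres A u v6),
     (forall i i' u, (i < d v5)%N -> (i' < d v5)%N -> arr s' 50 i = u.+1 -> arr s' 50 i' = u.+1 -> i = i') &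
     (forall i, (i < d v5)%N -> pres A (A (idA v5) i) v6 -> arr s' 50 i = (A (idA v5) i).+1)]
    & forall x k, (51 <= x)%N -> arr s' x k = 0%N]).
Proof.
move=> es tr z.
apply: (runs_seq _ (leqnn _)); apply: runs_weak (clean65_runs es tr) (leqnn _) _ => s1 [k1 tr1 z1].
have es1 := keep_labels k1 es.
apply: (@runs_seq _ _ _ _ _ (phase_cost W) 0); last by rewrite addn0.
have fr0 : frame 40 41 (arr s1) s1 by [].
have ok1 := same_labels_ok ok es1.
have lab s2 : frame 40 41 (arr s1) s2 -> same_labels A (arr s2).
  move=> f2 v k; have := @frame_labels K W 40 41 (arr s1) isT isT s2 f2 v k => -[-> ->]; exact: es1.
have tree1 m : tree tree5 (arr s1) m <-> tree tree5 A m.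
  by split=> -[h1 h2]; split=> // b hb i j hi hj; rewrite h2 // !(es1 _ _).1.
have presE u v : pres (arr s1) u v = pres A u v by apply: same_pres.
have r63 p px : (size p <= 5)%N -> (rank p px <= 63)%N.
  move=> h; apply: ltnW; apply: leq_trans (rank_lt _ _) _; apply: (@leq_trans (2 ^ 5)); rewrite ?leq_exp2l //.
have int1 u : interval (pres (arr s1) u) by rewrite (interval_ext (presE u)).
have TS := @tree_sweep_runs K W tree5 a65 40 41 (arr s1)
  (fun j => rankE path6 (IDe v6 j)) (fun i => NSub (NConst 63) (rankE path5 (IDe v5 i)))
  (fun j => NNot (NLoad (ixA v5) (IDe v6 j))) (fun i => NNot (NLoad (ixA v6) (IDe v5 i)))
  (fun j => rank path6 (pres (arr s1) (arr s1 (idA v6) j)))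
  (fun i => 63 - rank path5 (pres (arr s1) (arr s1 (idA v5) i)))%N
  (fun j => ~~ pres (arr s1) (arr s1 (idA v6) j) v5)
  (fun i => ~~ pres (arr s1) (arr s1 (idA v5) i) v6) ok1 isT isT isT.
have fl s2 : frame 40 41 (arr s1) s2 -> same_labels (arr s1) (arr s2) by apply: frame_labels.
apply: runs_weak (TS _ _ _ _ _ _ _ _ _ s1 fr0 _ _ _) (leqnn _) _ => {TS} //.
- by move=> s2 e1 f2; rewrite (rankE_eval _ _ (fl _ f2)) /= (fl _ f2 _ _).1.
- move=> s2 e1 f2; rewrite -(fl _ f2 _ _).1.
  exact: (congr1 (fun x => 63 - x)%N (rankE_eval path5 (IDe v5 e1) (fl _ f2))).
- by move=> s2 e1 f2; rewrite /= !condE /= (fl _ f2 _ _).1 (fl _ f2 _ _).2 /pres.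
- by move=> s2 e1 f2; rewrite /= !condE /= (fl _ f2 _ _).1 (fl _ f2 _ _).2 /pres.
- by move=> j _ _; apply: r63.
- move=> j j' hj hj' _ _ hr.
  have t6 : total_at tree5 v6 path6 by vm_compute.
  exact: (total_atP t6 (int1 _) (int1 _) (id_pres ok1 hj) (id_pres ok1 hj') hr).
- move=> i i' hi hi' _ _ hr.
  have t5 : total_at tree5 v5 path5 by vm_compute.
  have h5 : (size path5 <= 5)%N by [].
  have hr' := sub63_le (r63 _ _ h5) (r63 _ _ h5) hr.
  exact: (total_atP t5 (int1 _) (int1 _) (id_pres ok1 hi') (id_pres ok1 hi) hr').
- split; first exact/tree1.
  move=> i j hi hj; rewrite negbK !presE !(es1 _ _).1 => p6 n5; exact: z1.
- by move=> k; rewrite k1 // z.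
- by move=> k; rewrite k1 // z.
move=> s2 [f2 [/tree1 tr2 z2] [mf mg] m2].
have es2 := lab _ f2.
have z2' x k : (50 <= x)%N -> arr s2 x k = 0%N.
  by move=> hx; rewrite f2 ?k1 ?z //; lia.
have z3 i j : (i < d v5)%N -> (j < d v6)%N -> pres A (A (idA v5) i) v6 -> ~~ pres A (A (idA v6) j) v5 ->
    ent (mx s2 (Str a65)) i j = 0.
  move=> hi hj p6 n5; have h := z2 i j hi hj.
  by rewrite !presE !(es1 _ _).1 negbK in h; apply: h.
have m3' i j : (i < d v5)%N -> (j < d v6)%N -> ~~ pres A (A (idA v5) i) v6 -> ~~ pres A (A (idA v6) j) v5 ->
    ent (mx s2 (Str a65)) i j = (arr s2 40 i == j.+1)%:R.
  move=> hi hj p6 n5; have h := m2 i j hi hj.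
  by rewrite !presE !(es1 _ _).1 in h; apply: h.
pose Y i := (if pres A (A (idA v5) i) v6 then (A (idA v5) i).+1 else
  if arr s2 40 i is j.+1 then (A (idA v6) j).+1 else 0)%N.
apply: (@runs_seq _ _ _ _ _ 0 0) => //.
pose I k s3 := [/\ mx s3 = mx s2, (forall x l, (9 < x)%N -> x != 50 -> arr s3 x l = arr s2 x l)
  & forall i, (i < k)%N -> arr s3 50 i = Y i].
have setI k s3 n : I k s3 -> I k (set_mem s3 4 0 n).
  by case=> h1 h2 h3; split=> //= x l h4 h5; rewrite gtn_eqF /= ?h2 // (leq_trans _ h4).
apply: (@runs_for _ _ _ _ _ _ (d v5) 0 _ I) => //; last first.
  move=> s3 [m3 o3 y3]; apply: runs_skip.
  have es3 : same_labels A (arr s3).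
    by move=> v k; rewrite !o3; [apply: es2 | case: v ..].
  split=> //; rewrite ?m3 //.
  - move=> i j hi hj; rewrite y3 // /Y.
    have pj : pres A (A (idA v6) j) v6 by rewrite (id_pres ok).
    have ni : ~~ pres A (A (idA v5) i) v6 -> (A (idA v5) i == A (idA v6) j) = false.
      by move=> n6; apply/negbTE; apply: contra n6 => /eqP->.
    have colt : pres A (A (idA v6) j) v5 -> ent (mx s2 (Str a65)) i j = (A (idA v5) i == A (idA v6) j)%:R.
      by move=> p5; rewrite -(col6_t ok int tr2 pj p5) // (id_pos ok).
    case: (boolP (pres A (A (idA v5) i) v6)) => p6.
      rewrite eqSS; case: (boolP (pres A (A (idA v6) j) v5)) => p5; first exact: colt.
      rewrite z3 //; case: eqP => // e.
      by move: p5; rewrite -e (id_pres ok).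
    case: (boolP (pres A (A (idA v6) j) v5)) => p5.
      rewrite colt // ni //; case e40: (arr s2 40 i) => [//|k].
      rewrite eqSS; case: eqP => // e; have [_ _ _ + _] := mf _ _ e40.
      by rewrite presE (es1 _ _).1 e p5.
    rewrite m3' //; case e40: (arr s2 40 i) => [//|k].
    have [_ _ hk _ _] := mf _ _ e40; rewrite !eqSS; congr (nat_of_bool _)%:R.
    by apply/eqP/eqP => [->//|e]; apply: (id_inj ok hk hj e).
  - split.
    + move=> i u hi; rewrite y3 // /Y; case: ifP => [p6 [<-] //|n6].
      case e40: (arr s2 40 i) => [//|k] [<-]; have [_ _ hk _ _] := mf _ _ e40.
      by rewrite (id_pres ok).
    + move=> i i' u hi hi'; rewrite !y3 // /Y.
      case: (boolP (pres A _ v6)) => p6; case: (boolP (pres A _ v6)) => p6'.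
      * by move=> [e1] [e2]; apply: (id_inj ok hi hi'); rewrite e1 e2.
      * move=> [e1]; case e40: (arr s2 40 i') => [//|k] [e2]; have [_ _ hk + _] := mf _ _ e40.
        by rewrite presE (es1 _ _).1 e2 -e1 (id_pres ok).
      * case e40: (arr s2 40 i) => [//|k] [e2] [e1]; have [_ _ hk + _] := mf _ _ e40.
        by rewrite presE (es1 _ _).1 e2 -e1 (id_pres ok).
      case e40: (arr s2 40 i) => [//|k] [e1]; case e40': (arr s2 40 i') => [//|k'] [e2].
      have [_ _ hk _ g1] := mf _ _ e40; have [_ _ hk' _ g2] := mf _ _ e40'.
      have ek : k = k' by apply: (id_inj ok hk hk'); rewrite e1 e2.
      by move: g1; rewrite ek g2 => -[].
    + by move=> i hi p6; rewrite y3 // /Y p6.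
  - by move=> x k hx; rewrite o3 ?z2' //; lia.
- by rewrite muln0.
- move=> k s3 hk [m3 o3 y3] e4.
  apply: runs_store => /=; rewrite e4; split=> //; apply: setI; split=> //=.
    by move=> x l h1 h2; rewrite (negPf h2) /= o3.
  have es3 : same_labels A (arr s3).
    by move=> v l; rewrite !o3; [apply: es2 | case: v ..].
  move=> i; rewrite ltnS leq_eqVlt => /orP[/eqP->|hi].
    rewrite eqxx !(es3 _ _).1 !(es3 _ _).2 !o3 // /Y /pres subn1 !addn1.
    case: (A (ixA v6) _) => [|p] /=; last by rewrite mul1n mul0n addn0.
    by case: (arr s2 40 k) => [|j] /=; rewrite ?mul0n ?muln0 ?mul1n.
  by rewrite (ltn_eqF hi) y3.
- by apply: setI; split.
Qed.

End Arrow65.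

(** * The arrow from 2 to 5 *)

Definition YE i := NLoad 50 i.
Definition pureE j := NMul (NNot (NLoad (ixA v1) (IDe v2 j))) (NNot (NLoad (ixA v3) (IDe v2 j))).
(** A row is bad if its label lives at 2, or if it is linked through [a65] with a label that does.
    Then commutativity makes the column of that label at 2 the unit vector of this row, which clears
    it. For good rows [alE] and [beE] are the two coordinates of the type. *)
Definition bad1E i := NLoad (ixA v2) (IDe v5 i).
Definition bad2E i := NMul (YE i) (NLoad (ixA v2) (NSub (YE i) (NConst 1))).
Definition goodE i := NMul (NNot (bad1E i)) (NNot (bad2E i)).
Definition alE i := NNot (NNot (NLoad (ixA v4) (IDe v5 i))).
Definition beE i := NNot (NNot (YE i)).

(* Adding row [ei] to row [ei'] of [Str a25], with the induced changes at the
   vertices 6 (through [Str a65]) and 4. *)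
Definition row_op25 ei ei' ej :=
  Seq (If (YE ei) (add_labels a25 v6 (NSub (YE ei') (NConst 1)) (NSub (YE ei) (NConst 1))
         (entry a25 ei' ej) (FSub FZero (entry a25 ei' ej))) Skip)
      (kill_row a25 ei ei' ej).

(** In the last sweep every column already has an entry 1 in a row of the first block, so the pivot
    is made 1 by scaling its row. The partner at 6 is scaled along to keep [Str a65] in normal
    form. *)
Definition row_normalize25 ei ej :=
  Seq (scale_label a25 v6 (NSub (YE ei) (NConst 1)) (entry a25 ei ej) (FDiv FOne (entry a25 ei ej)))
      (scale_label a25 v5 (IDe v5 ei) (entry a25 ei ej) (FDiv FOne (entry a25 ei ej))).

Section Arrow25.
Local Open Scope ring_scope.
Variables (K : fieldType) (W : rep K).
Notation d := (rdim W).
Variables (A : nat -> nat -> nat) (Y : nat -> nat).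
Hypotheses (ok : labels_ok d A) (int : forall u, interval (pres A u)).
Hypothesis (Y6 : forall i u, (i < d v5)%N -> Y i = u.+1 -> pres A u v6).
Hypothesis (Yinj : forall i i' u, (i < d v5)%N -> (i' < d v5)%N -> Y i = u.+1 -> Y i' = u.+1 -> i = i').
Hypothesis (Yt : forall i, (i < d v5)%N -> pres A (A (idA v5) i) v6 -> Y i = (A (idA v5) i).+1).
Implicit Types (s : state K d) (m : mxs K d).
Notation f25 m := (ent (m (Str a25))).
Notation id5 i := (A (idA v5) i).
Notation id2 j := (A (idA v2) j).

Definition closed_inv m := tree tree5 A m /\ closed65 A Y m.

Definition pure u := ~~ pres A u v1 && ~~ pres A u v3.
Definition good i := ~~ pres A (id5 i) v2 && ~~ ((Y i != 0%N) && pres A (Y i).-1 v2).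
Definition al i := pres A (id5 i) v4.
Definition be i := Y i != 0%N.

Lemma Y_pred i : be i -> Y i = (Y i).-1.+1. Proof. by rewrite /be; case: (Y i). Qed.

Lemma only_at (v : vertex) (P : seq bool -> bool) u :
  all (fun l => interval (vat l) && P l ==> all (fun w => vat l w == veq w v) vertices) allvecs ->
  P (pvec (pres A u)) -> forall w, pres A u w = veq w v.
Proof.
move=> h pu w; have /implyP h2 := pvec_all h (pres A u).
have h3 : interval (vat (pvec (pres A u))) && P (pvec (pres A u)).
  by rewrite (interval_ext (pvecE _)) int.
by have /allP/(_ w (mem_vertices w)) := h2 h3; rewrite pvecE => /eqP.
Qed.

Lemma pure2 u : pure u -> pres A u v2 -> forall w, pres A u w = veq w v2.
Proof.
move=> /andP[n1 n3] p2; apply: (@only_at v2 (fun l => [&& ~~ vat l v1, ~~ vat l v3 & vat l v2])).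
  by vm_compute.
by rewrite !pvecE n1 n3 p2.
Qed.

(** A label living at 5 and 1 lives at 2 by commutativity; so the interval of a good label stops
    before 1. *)
Lemma good_row m i : closed_inv m -> (i < d v5)%N -> good i ->
  forall w, pres A (id5 i) w = veq w v5 || veq w v4 && al i.
Proof.
move=> [tr _] hi /andP[n2 _] w; have p5 : pres A (id5 i) v5 by rewrite (id_pres ok).
have n1 : ~~ pres A (id5 i) v1 by apply: contra n2; exact: (pres51 ok int tr p5).
have := @interval_check A (fun l => [&& interval (vat l), vat l v5, ~~ vat l v1 & ~~ vat l v2] ==>
  all (fun w => vat l w == veq w v5 || veq w v4 && vat l v4) vertices) (id5 i).
rewrite !pvecE (interval_ext (pvecE _)) int p5 n1 n2 implyTb => h.
have {}h := h (ltac:(vm_compute; reflexivity)).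
by have /allP/(_ w (mem_vertices w)) := h; rewrite !pvecE => /eqP.
Qed.

(** If the partner lived at 5, its column would be the unit vector of its own row, so it would be
    the label of row [i], which does not live at 6. Not living at 2, it cannot live at 3 either, by
    [col6_nz]. *)
Lemma good_Y m i : closed_inv m -> (i < d v5)%N -> good i -> be i ->
  forall w, pres A (Y i).-1 w = veq w v6.
Proof.
move=> inv hi gi bi; have [tr cl] := inv.
have p6 : pres A (Y i).-1 v6 by apply: Y6 hi _; apply: Y_pred.
have n5 : ~~ pres A (Y i).-1 v5.
  apply/negP => p5; have := col6_t ok int tr p6 p5 hi.
  rewrite cl ?(pos_lt ok) // (pos_id ok) // -Y_pred // eqxx.
  case: eqP => [e _|_ /eqP]; last by rewrite oner_eq0.
  by move: p6; rewrite -e (good_row inv) // -!veqE.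
have nz : ent (m (Str a65)) i (pos A (Y i).-1 v6) != 0.
  by rewrite cl ?(pos_lt ok) // (pos_id ok) // -Y_pred // eqxx oner_eq0.
have [n1 h3] := col6_nz ok int tr p6 n5 hi nz.
have n2 : ~~ pres A (Y i).-1 v2 by move: gi => /andP[_]; rewrite -/(be i) bi.
apply: (@only_at v6 (fun l => [&& vat l v6, ~~ vat l v2, ~~ vat l v3 & ~~ vat l v5])); first by vm_compute.
by rewrite !pvecE p6 n2 n5 /= andbT; apply: contra n2.
Qed.

(** By commutativity a column that is not pure is zero or the unit vector of a bad row. *)
Lemma good_nonpure m i j : closed_inv m -> (i < d v5)%N -> (j < d v2)%N -> good i -> ~~ pure (id2 j) ->
  f25 m i j = 0.
Proof.
move=> [tr cl] hi hj /andP[n2 nY] np.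
have p2 : pres A (id2 j) v2 by rewrite (id_pres ok).
rewrite -(id_pos ok hj); case: (boolP (pres A (id2 j) v1)) => p1.
  rewrite (col1 ok int tr) //; case: eqP => // e.
  by move: n2; rewrite e p2.
have p3 : pres A (id2 j) v3 by move: np; rewrite /pure p1 negbK.
rewrite (col3 ok tr) //; case: ifP => // p6.
rewrite cl ?(pos_lt ok) // (pos_id ok) //; case: eqP => // e.
by move: nY; rewrite e p2.
Qed.

(** A label living only at a vertex from which no treated arrow starts may receive any other label:
    nothing has to be carried further. *)
Lemma adm_single px (py : vertex -> bool) v0 : all (fun b => ~~ veq (src b) v0) tree5 ->
  (forall w, py w = veq w v0) -> all (adm px py) tree5.
Proof.
move=> hv h; apply/allP => b /(allP hv) /negPf nb.
by rewrite /adm !h nb !andbF.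
Qed.

Lemma closed65_same m m' : m' (Str a65) = m (Str a65) -> closed65 A Y m -> closed65 A Y m'.
Proof. by move=> e h i j hi hj; rewrite e h. Qed.

Lemma kill_col25_runs s ei ej ej' i j j' : same_labels A (arr s) -> closed_inv (mx s) ->
  neval s ei = i -> neval s ej = j -> neval s ej' = j' -> (i < d v5)%N -> (j < d v2)%N -> (j' < d v2)%N ->
  j != j' -> pure (id2 j') ->
  runs (kill_col a25 ei ej ej') s (72 * max_dim d) (fun s' => [/\ arr s' = arr s, closed_inv (mx s')
    & forall i1 j1, f25 (mx s') i1 j1 = f25 (mx s) i1 j1 - (j1 == j')%:R * (f25 (mx s) i j' * f25 (mx s) i1 j)]).
Proof.
move=> es [tr cl] e1 e2 e3 hi hj hj' nj pj.
have py := pure2 pj (id_pres ok hj').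
have nb v : ~~ veq v v2 -> ~~ both A (id2 j) (id2 j') v by rewrite /both py => /negPf ->; rewrite andbF.
apply: runs_weak (@kill_col_runs K d A ok a25 s ei ej ej' i j j' es e1 e2 e3 hi hj hj' nj (nb v5 isT)) (leqnn _) _.
move=> s' [ea am m2]; split=> //; split.
  apply: (tree_add ok _ _ am tr); last exact: (@adm_single _ _ v2 isT py).
  by apply: contra nj => /eqP e; apply/eqP; apply: (id_inj ok hj hj' e).
apply: closed65_same cl; apply: added_same am _ => v /=.
by case: v => // _; apply: nb.
Qed.

Lemma normalize25_runs s ei ej i j : same_labels A (arr s) -> closed_inv (mx s) ->
  neval s ei = i -> neval s ej = j -> (i < d v5)%N -> (j < d v2)%N -> pure (id2 j) -> f25 (mx s) i j != 0 ->
  runs (normalize a25 ei ej) s (72 * max_dim d) (fun s' => [/\ arr s' = arr s, closed_inv (mx s')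
    & forall i1 j1, f25 (mx s') i1 j1 = f25 (mx s) i1 j1 * (if j1 == j then (f25 (mx s) i j)^-1 else 1)]).
Proof.
move=> es [tr cl] e1 e2 hi hj pj nz.
have py := pure2 pj (id_pres ok hj).
have nb : ~~ pres A (A (idA (src a25)) j) (tgt a25) by rewrite /= py.
apply: runs_weak (@normalize_runs K d A ok a25 s ei ej i j es e1 e2 hi hj nz nb) (leqnn _) _.
move=> s' [ea sm m2]; split=> //; split.
  by apply: (tree_scale ok _ sm tr); rewrite invr_eq0.
by apply: closed65_same cl; rewrite sm /= !py.
Qed.

(** Row [i] is added to row [i'] by adding the vector of [i'] to that of [i]. Wherever [i] has a
    partner, at 4 or at 6, the addition must be made there too, so [i'] needs a partner there: the
    type of [i] has to lie below that of [i']. *)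
Lemma row_op25_runs s ei ei' ej i i' j : same_labels A (arr s) -> (forall k, arr s 50 k = Y k) ->
  closed_inv (mx s) ->
  neval s ei = i -> neval s ei' = i' -> neval s ej = j -> (i < d v5)%N -> (i' < d v5)%N -> (j < d v2)%N ->
  i != i' -> good i -> good i' -> (al i ==> al i') -> (be i ==> be i') ->
  runs (row_op25 ei ei' ej) s (144 * max_dim d) (fun s' => [/\ arr s' = arr s, closed_inv (mx s')
    & forall i1 j1, f25 (mx s') i1 j1 = f25 (mx s) i1 j1 - (i1 == i')%:R * (f25 (mx s) i' j * f25 (mx s) i j1)]).
Proof.
move=> es eY inv e1 e2 e3 hi hi' hj ni gi gi' lal lbe; have [tr cl] := inv.
set g := f25 (mx s) i' j.
have px := good_row inv hi gi; have px' := good_row inv hi' gi'.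
(* Between the two commands [Str a65] carries only the change at 6 and may be out of normal form;
   the change at 5 restores it by [add_fixes]. *)
pose Q s1 := [/\ arr s1 = arr s, tree tree5 A (mx s1), mx s1 (Str a25) = mx s (Str a25) &
  mx s1 (Str a65) = if be i then mx s (Str a65) *m Emx (pos A (Y i').-1 v6) (pos A (Y i).-1 v6) g _ else mx s (Str a65)].
apply: (@runs_seq _ _ _ _ _ (72 * max_dim d) (72 * max_dim d)); last by lia.
have first : runs (If (YE ei) (add_labels a25 v6 (NSub (YE ei') (NConst 1)) (NSub (YE ei) (NConst 1))
         (entry a25 ei' ej) (FSub FZero (entry a25 ei' ej))) Skip) s (72 * max_dim d) Q.
  apply: (@runs_ifb _ _ _ _ _ _ _ _ (be i)); first by rewrite /= e1 eY.
    move=> bi; have bi' := implyP lbe bi.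
    have py := good_Y inv hi gi bi; have py' := good_Y inv hi' gi' bi'.
    have ny : (Y i').-1 != (Y i).-1.
      apply: contra ni => /eqP e; apply/eqP; apply: (Yinj hi hi' (Y_pred bi)).
      by rewrite -e -Y_pred.
    have ok' := same_labels_ok ok es.
    apply: runs_weak (leqnn _) _.
      apply: (@add_labels_runs K d s a25 v6 _ _ _ _ (Y i').-1 (Y i).-1 g) => //.
      - by rewrite /= e2 eY subn1.
      - by rewrite /= e1 eY subn1.
      - move=> s1 h1 h2.
        have h : feval s1 (entry a25 ei' ej) = Some g.
          rewrite /g -h2; apply: feval_entry => //; by rewrite (neval_arr _ h1).
        by rewrite (feval_opp h) h.
      - by move=> v nv; rewrite /both !(same_pres _ _ es) py' py veqE (negPf nv).
    move=> s1 [h1 am]; have {}am := same_added es am; split=> //.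
    + exact: (tree_add ok ny (@adm_single _ _ v6 isT py) am tr).
    + by apply: added_same am _ => v; case: v => // _; rewrite /both py' py.
    by rewrite bi am /= /both !py' !py.
  by move=> nb; apply: runs_skip; split=> //; rewrite (negPf nb).
apply: runs_weak first (leqnn _) _ => s1 [h1 tr1 m25 m65].
have nb : ~~ both A (A (idA (tgt a25)) i') (A (idA (tgt a25)) i) (src a25) by rewrite /both /= px px'.
have es1 : same_labels A (arr s1) by rewrite h1.
have e1' : neval s1 ei = i by rewrite (neval_arr _ h1).
have e2' : neval s1 ei' = i' by rewrite (neval_arr _ h1).
have e3' : neval s1 ej = j by rewrite (neval_arr _ h1).
apply: runs_weak (@kill_row_runs K d A ok a25 s1 ei ei' ej i i' j es1 e1' e2' e3' hi hi' hj ni nb) (leqnn _) _.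
move=> s2 [h2 am m2]; rewrite m25 -/g in am m2; split; rewrite ?h2 //; split.
  apply: (tree_add ok _ _ am tr1).
    by apply: contra ni => /eqP e; apply/eqP; rewrite (id_inj ok hi' hi e).
  by rewrite /= /adm !px !px' /=; case: (al i) lal; case: (al i').
apply: (closed65_same _ cl); rewrite am /= {1}/both !px !px' /= /both px px' /= m65 /addE !(id_pos ok) //.
apply: (@add_fixes K _ _ (mx s (Str a65)) i' i (pos A (Y i').-1 v6) (pos A (Y i).-1 v6) true (be i) g).
- by move=> bi; rewrite (pos_lt ok) // (good_Y inv hi gi bi).
- by [].
- by rewrite eq_sym.
- move=> bi i1 hi1; have bi' := implyP lbe bi.
  have p6 : pres A (Y i').-1 v6 by rewrite (good_Y inv hi' gi' bi').
  rewrite cl ?(pos_lt ok) // (pos_id ok) // -Y_pred //=; congr (nat_of_bool _)%:R.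
  by apply/eqP/eqP => [e|->//]; apply: (Yinj hi1 hi' _ (Y_pred bi')); rewrite e -Y_pred.
- move=> _ j1 hj1; rewrite cl //; congr (nat_of_bool _)%:R; case: (boolP (be i)) => bi /=; last first.
    by move: bi; rewrite /be negbK => /eqP ->.
  have p6 : pres A (Y i).-1 v6 by rewrite (good_Y inv hi gi bi).
  by rewrite (Y_pred bi) eqSS eq_sym (id_eq ok) // p6.
Qed.

(** The label does not live at 4, so it lives at 5 only and its partner at 6 only. The two scalings
    meet nowhere but in [Str a65], where they cancel on the linked entry. *)
Lemma row_normalize25_runs s ei ej i j : same_labels A (arr s) -> (forall k, arr s 50 k = Y k) ->
  closed_inv (mx s) ->
  neval s ei = i -> neval s ej = j -> (i < d v5)%N -> (j < d v2)%N ->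
  good i -> be i -> ~~ al i -> f25 (mx s) i j != 0 ->
  runs (row_normalize25 ei ej) s (144 * max_dim d) (fun s' => [/\ arr s' = arr s, closed_inv (mx s')
    & forall i1 j1, f25 (mx s') i1 j1 = f25 (mx s) i1 j1 * (if i1 == i then (f25 (mx s) i j)^-1 else 1)]).
Proof.
move=> es eY inv e1 e2 hi hj gi bi nal nz; have [tr cl] := inv.
set g := f25 (mx s) i j in nz *.
have px := good_row inv hi gi; have py := good_Y inv hi gi bi.
have px5 w : pres A (id5 i) w = veq w v5 by rewrite px (negPf nal) andbF orbF.
have gi0 : g^-1 != 0 by rewrite invr_eq0.
have ok' := same_labels_ok ok es.
have ev s1 : arr s1 = arr s -> mx s1 (Str a25) = mx s (Str a25) ->
    feval s1 (entry a25 ei ej) = Some g /\ feval s1 (FDiv FOne (entry a25 ei ej)) = Some g^-1.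
  move=> h1 h2.
  have h : feval s1 (entry a25 ei ej) = Some g.
    by rewrite /g -h2; apply: feval_entry => //; rewrite (neval_arr _ h1).
  by rewrite (feval_inv h nz) h.
apply: (@runs_seq _ _ _ _ _ (72 * max_dim d) (72 * max_dim d)); last by lia.
apply: runs_weak (leqnn _) _.
  apply: (@scale_label_runs K d s a25 v6 _ _ _ (Y i).-1 g) => //.
  - by rewrite /= e1 eY subn1.
  - by move=> v nv; rewrite (same_pres _ _ es) py veqE (negPf nv).
move=> s1 [h1 am]; have {}am := same_scaled es am.
have m25 : mx s1 (Str a25) = mx s (Str a25) by rewrite am /= !py.
have es1 : same_labels A (arr s1) by rewrite h1.
have tr1 := tree_scale ok nz am tr.
apply: runs_weak (leqnn _) _.
  apply: (@scale_label_runs K d s1 a25 v5 _ _ _ (id5 i) g) => //.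
  - by rewrite h1.
  - by rewrite /= (neval_arr _ h1) e1 (es1 _ _).1.
  - by move=> s2 h2 h3; apply: ev; rewrite ?h2 ?h3.
  - by move=> v nv; rewrite (same_pres _ _ es1) px5 veqE (negPf nv).
move=> s2 [h2 am2]; have {}am2 := same_scaled es1 am2.
have m65 : mx s2 (Str a65) = Dmx i g^-1 _ *m (mx s (Str a65) *m Dmx (pos A (Y i).-1 v6) g _).
  by rewrite am2 /= !px5 /= am /= !py /= /scaleE (id_pos ok).
split; rewrite ?h2 //.
  split; first exact: tree_scale ok nz am2 tr1.
  have p6 : pres A (Y i).-1 v6 by rewrite py.
  move=> i1 j1 hi1 hj1; rewrite m65 ent_Dmul ent_mulD cl //.
  case: eqP => [e|_]; last by rewrite !mul0r.
  case: (eqVneq i1 i) => [ei1|ni].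
    have ej1 : A (idA v6) j1 = (Y i).-1 by rewrite -ei1 e.
    by rewrite -ej1 (id_pos ok) // eqxx mul1r mulfV.
  rewrite mulr1; case: eqP => [ej1|]; last by rewrite mulr1.
  have e2' : Y i1 = (Y i).-1.+1 by rewrite e ej1 (pos_id ok).
  by case/eqP: ni; apply: Yinj hi1 hi e2' (Y_pred bi).
by move=> i1 j1; rewrite am2 /= !px5 /= m25 ent_Dmul (id_pos ok).
Qed.

End Arrow25.

Definition clean25a := clean a25 (NMul (bad1E (V 5)) (pureE (V 6)))
  (kill_col a25 (V 5) (POSe v2 (IDe v5 (V 5))) (V 6)).
Definition clean25b := clean a25 (NMul (bad2E (V 5)) (pureE (V 6)))
  (kill_col a25 (V 5) (POSe v2 (NSub (YE (V 5)) (NConst 1))) (V 6)).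
Definition sweep25 rp cp cmE rmE := sweep a25 rp cp (fun=> NConst 0) alE cmE rmE
  (row_op25 PIV (V 5) (V 4)) (kill_col a25 PIV (V 4) (V 6)) (normalize a25 PIV (V 4)).
Definition c1E j := NSub (NLoad 62 j) (NConst 1).
Definition r2E i := NSub (NLoad 63 i) (NConst 1).
(** Rows not linked through [a65] are reduced before linked ones, as they may be added to linked
    rows but not conversely. Linked rows then use the columns left over. A linked row with a pivot
    is cleared by its pivot column ([clean25c]), any other by a comparable unlinked row
    ([clean25d]). This leaves linked rows not living at 4 against columns whose unlinked row lives
    at 4: the incomparable pair of types. *)
Definition sweep25_1 := sweep25 61 62 pureE (fun i => NMul (goodE i) (NNot (beE i))).
Definition sweep25_2 := sweep25 63 64 (fun j => NMul (pureE j) (NNot (NLoad 62 j)))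
  (fun i => NMul (goodE i) (beE i)).
Definition clean25c := clean a25
  (NMul (NMul (goodE (V 5)) (NMul (beE (V 5)) (NLoad 63 (V 5)))) (NMul (pureE (V 6)) (NLoad 62 (V 6))))
  (kill_col a25 (V 5) (r2E (V 5)) (V 6)).
Definition clean25d := clean a25
  (NMul (NMul (goodE (V 5)) (beE (V 5))) (NMul (pureE (V 6))
     (NMul (NLoad 62 (V 6)) (NLe (alE (c1E (V 6))) (alE (V 5))))))
  (row_op25 (c1E (V 6)) (V 5) (V 6)).
(* The column operation spoils the row of [Str a25] already linked to the
   column [V 4], which is repaired by a row operation. *)
Definition sweep25_3 := sweep a25 65 66 (fun=> NConst 0) (fun=> NConst 0)
  (fun j => NMul (pureE j) (NMul (NLoad 62 j) (alE (c1E j))))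
  (fun i => NMul (NMul (goodE i) (beE i)) (NMul (NNot (alE i)) (NNot (NLoad 63 i))))
  (row_op25 PIV (V 5) (V 4))
  (Seq (kill_col a25 PIV (V 4) (V 6)) (row_op25 (c1E (V 6)) (c1E (V 4)) (V 6)))
  (row_normalize25 PIV (V 4)).

Definition program25 := seqs [:: clean25a; clean25b; sweep25_1; sweep25_2; clean25c; clean25d; sweep25_3].

(** * Correctness of the eliminations for the arrow from 2 to 5 *)

Section Sweeps25.
Local Open Scope ring_scope.
Variables (K : fieldType) (W : rep K).
Notation d := (rdim W).
Variables (A : nat -> nat -> nat) (Y : nat -> nat).
Hypotheses (ok : labels_ok d A) (int : forall u, interval (pres A u)).
Hypothesis (Y6 : forall i u, (i < d v5)%N -> Y i = u.+1 -> pres A u v6).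
Hypothesis (Yinj : forall i i' u, (i < d v5)%N -> (i' < d v5)%N -> Y i = u.+1 -> Y i' = u.+1 -> i = i').
Implicit Types (s : state K d) (m : mxs K d).
Notation f25 m := (ent (m (Str a25))).
Notation id5 i := (A (idA v5) i).
Notation id2 j := (A (idA v2) j).
Notation good' := (good A Y).
Notation al' := (al A).
Notation be' := (be Y).
Notation pure' := (pure A).
Notation closed_inv' := (closed_inv A Y).
Notation N := (max_dim d).

Definition ctx s := same_labels A (arr s) /\ forall k, arr s 50 k = Y k.

Lemma keep_ctx s s' : keep s s' -> ctx s -> ctx s'.
Proof. by move=> k1 [h1 h2]; split=> [|k]; [apply: keep_labels k1 h1 | rewrite k1]. Qed.

Lemma frame_ctx s s' rp cp : (59 < rp)%N -> (59 < cp)%N -> ctx s -> frame rp cp (arr s) s' -> ctx s'.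
Proof.
move=> h1 h2 [e1 e2] f.
have h x k : (9 < x)%N -> (x < 59)%N -> arr s' x k = arr s x k.
  by move=> h3 h4; apply: f => //; rewrite neq_ltn (ltn_trans h4).
split=> [v k|k]; last by rewrite h.
by rewrite !h; try exact: e1; case: v.
Qed.

Lemma pureP s e : ctx s -> (neval s (pureE e) != 0%N) = pure' (id2 (neval s e)).
Proof. by move=> [e1 e2]; rewrite /= !condE /= !(e1 _ _).1 !(e1 _ _).2 /pure /pres !negbK. Qed.

Lemma bad2P s e : ctx s -> (neval s (bad2E e) != 0%N) = be' (neval s e) && pres A (Y (neval s e)).-1 v2.
Proof. by move=> [e1 e2]; rewrite /= !condE /= !(e1 _ _).2 !e2 subn1. Qed.

Lemma goodP s e : ctx s -> (neval s (goodE e) != 0%N) = good' (neval s e).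
Proof.
by move=> [e1 e2]; rewrite /= !condE /= !(e1 _ _).1 !(e1 _ _).2 !e2 subn1 /good /pres !negb_and !negbK.
Qed.

Lemma alP s e : ctx s -> neval s (alE e) = al' (neval s e).
Proof. by move=> [e1 e2]; rewrite /= !(e1 _ _).1 !(e1 _ _).2 /al /pres; case: (A _ _). Qed.

Lemma beP s e : ctx s -> neval s (beE e) = be' (neval s e).
Proof. by move=> [e1 e2]; rewrite /= e2 /be; case: (Y _). Qed.

Definition clean_cost := (N * (N * (144 * N).+1))%N.

Lemma clean25ab_runs s : ctx s -> closed_inv' (mx s) ->
  runs (seqs [:: clean25a; clean25b]) s (2 * clean_cost) (fun s' => [/\ keep s s', closed_inv' (mx s')
   & forall i j, (i < d v5)%N -> (j < d v2)%N -> ~~ good' i -> pure' (id2 j) -> f25 (mx s') i j = 0]).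
Proof.
move=> cs inv.
(* Both kinds of bad rows follow one pattern: [t i] is a label at 2 that is not pure and whose
   column is the unit vector of row [i]. *)
have unit_clean s0 G (g : nat -> bool) (t : nat -> nat) te : ctx s0 -> closed_inv' (mx s0) ->
    (forall s1, ctx s1 -> (neval s1 G != 0%N) = g (arr s1 5 0%N) && pure' (id2 (arr s1 6 0%N))) ->
    (forall s1, ctx s1 -> (arr s1 5 0 < d v5)%N -> g (arr s1 5 0%N) -> neval s1 (POSe v2 te) = pos A (t (arr s1 5 0%N)) v2) ->
    (forall i, (i < d v5)%N -> g i -> pres A (t i) v2 /\ ~~ pure' (t i)) ->
    (forall m i i1, closed_inv' m -> (i < d v5)%N -> (i1 < d v5)%N -> g i -> f25 m i1 (pos A (t i) v2) = (i1 == i)%:R) ->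
    runs (clean a25 G (kill_col a25 (V 5) (POSe v2 te) (V 6))) s0 clean_cost (fun s' => [/\ keep s0 s', closed_inv' (mx s')
   & forall i j, (i < d v5)%N -> (j < d v2)%N -> f25 (mx s') i j = if g i && pure' (id2 j) then 0 else f25 (mx s0) i j]).
  move=> c0 i0 HG Ht Hp Hu.
  apply: (@clean_runs a25 _ _ K d s0 (fun i j => g i && pure' (id2 j)) closed_inv' (144 * N)) => //.
    by move=> s1 i j k1 e5 e6 _ _; rewrite HG ?e5 ?e6 //; apply: keep_ctx k1 c0.
  move=> s1 i j k1 inv1 e5 e6 hi hj /andP[gi pj] nz _.
  have c1 := keep_ctx k1 c0.
  have [p2 np] := Hp i hi gi.
  have hjt := pos_lt ok p2.
  have nj : pos A (t i) v2 != j by apply: contra np => /eqP e; rewrite -(pos_id ok p2) e.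
  have evj : neval s1 (POSe v2 te) = pos A (t i) v2 by rewrite Ht ?e5.
  have := kill_col25_runs ok int c1.1 inv1 (e5 : neval s1 (V 5) = i) evj (e6 : neval s1 (V 6) = j) hi hjt hj nj pj.
  move=> h; apply: (runs_weak h); first by rewrite leq_mul2r orbT.
  move=> s2 [e2 inv2 m2]; split=> // i1 j1 hi1 hj1; rewrite m2 Hu //.
  case: (j1 =P j) => [->|_]; last by rewrite andbF mul0r subr0.
  by rewrite andbT mul1r; case: (i1 =P i) => [->|_]; rewrite ?mulr1 ?subrr // mulr0 subr0.
apply: (@runs_seq _ _ _ _ _ clean_cost clean_cost); last by lia.
have h1 := @unit_clean s (NMul (bad1E (V 5)) (pureE (V 6))) (fun i => pres A (id5 i) v2) (fun i => id5 i) (IDe v5 (V 5)) cs inv.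
apply: runs_weak (h1 _ _ _ _) (leqnn _) _.
- by move=> s1 c1; rewrite /= muln_eq0 negb_or [X in _ && X](@pureP s1 (V 6) c1) /= !(c1.1 _ _).1 !(c1.1 _ _).2.
- by move=> s1 c1 _ _; rewrite /= (c1.1 _ _).1 (c1.1 _ _).2 subn1.
- move=> i hi p2; split=> //; rewrite /pure negb_and !negbK.
  have p5 : pres A (id5 i) v5 by rewrite (id_pres ok).
  by rewrite (between (y := v1) int _ p5 p2) //; vm_compute.
- move=> m i i1 [tr cl] hi hi1 p2.
  have p5 : pres A (id5 i) v5 by rewrite (id_pres ok).
  have p1 : pres A (id5 i) v1 by apply: (between int _ p5 p2); vm_compute.
  rewrite (col1 ok int tr) //; congr (nat_of_bool _)%:R; apply/eqP/eqP => [e|->//].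
  exact: (id_inj ok hi1 hi e).
move=> s1 [k1 inv1 m1]; have cs1 := keep_ctx k1 cs.
apply: (@runs_seq _ _ _ _ _ clean_cost 0); last by lia.
have h2 := @unit_clean s1 (NMul (bad2E (V 5)) (pureE (V 6))) (fun i => be' i && pres A (Y i).-1 v2) (fun i => (Y i).-1)
  (NSub (YE (V 5)) (NConst 1)) cs1 inv1.
apply: runs_weak (h2 _ _ _ _) (leqnn _) _.
- move=> s2 c2; have e1 := @pureP s2 (V 6) c2; have e2 := @bad2P s2 (V 5) c2.
  by rewrite [neval _ _]/(neval s2 (bad2E (V 5)) * neval s2 (pureE (V 6)))%N muln_eq0 negb_or e1 e2.
- by move=> s2 [c2 c2'] _ _; rewrite /= (c2 _ _).2 c2' !subn1.
- move=> i hi /andP[bi p2]; split=> //.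
  have p6 := Y6 hi (Y_pred bi).
  by rewrite /pure (between (y := v3) int _ p2 p6) ?andbF //; vm_compute.
- move=> m i i1 [tr cl] hi hi1 /andP[bi p2].
  have p6 := Y6 hi (Y_pred bi).
  have p3 : pres A (Y i).-1 v3 by apply: (between int _ p2 p6); vm_compute.
  rewrite (col3 ok tr) // p6 cl ?(pos_lt ok) // (pos_id ok) //; congr (nat_of_bool _)%:R.
  rewrite -Y_pred //; apply/eqP/eqP => [e|->//].
  by apply: (Yinj hi1 hi _ (Y_pred bi)); rewrite e -Y_pred.
move=> s2 [k2 inv2 m2]; apply: runs_skip; split=> //; first by move=> x k hx; rewrite k2 // k1.
move=> i j hi hj ng pj; rewrite m2 // m1 // pj !andbT.
case: ifP => // nb; case: ifP => // np.
by move: ng; rewrite /good np -/(be' i) nb.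
Qed.

Definition sweep_cost := (64 * (N * pivot_cost d (216 * N)))%N.

(** [Dr] selects the rows finished earlier and [F] gives their entries. These are zero in the swept
    columns, so column operations do not disturb them, and row operations do not reach them. *)
Lemma sweep25_runs s rp cp cmE rmE (cm rm Dr : nat -> bool) (F : nat -> nat -> K) :
  (59 < rp)%N -> (59 < cp)%N -> rp != cp ->
  (forall s1 e, frame rp cp (arr s) s1 -> (neval s1 (cmE e) != 0%N) = cm (neval s1 e)) ->
  (forall s1 e, frame rp cp (arr s) s1 -> (neval s1 (rmE e) != 0%N) = rm (neval s1 e)) ->
  (forall j, cm j -> pure' (id2 j)) -> (forall i, rm i -> good' i) ->
  (forall i i', rm i -> rm i' -> be' i = be' i') ->
  (forall i, Dr i -> ~~ rm i) ->
  (forall i j, Dr i -> cm j -> F i j = 0) ->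
  ctx s -> closed_inv' (mx s) ->
  (forall i j, (i < d v5)%N -> (j < d v2)%N -> Dr i -> pure' (id2 j) -> f25 (mx s) i j = F i j) ->
  (forall k, arr s rp k = 0%N) -> (forall k, arr s cp k = 0%N) ->
  runs (sweep25 rp cp cmE rmE) s sweep_cost (fun s' => [/\ frame rp cp (arr s) s', closed_inv' (mx s'),
    (forall i j, (i < d v5)%N -> (j < d v2)%N -> Dr i -> pure' (id2 j) -> f25 (mx s') i j = F i j),
    matching a25 d cm rm (arr s' rp) (arr s' cp)
    & forall i j, (i < d v5)%N -> (j < d v2)%N -> rm i -> cm j -> f25 (mx s') i j = (arr s' rp i == j.+1)%:R]).
Proof.
move=> hrp hcp nrc cmP rmP cmp rmg rmb Drm F0 cs inv hF rp0 cp0.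
pose Psi m := closed_inv' m /\ forall i j, (i < d v5)%N -> (j < d v2)%N -> Dr i -> pure' (id2 j) -> f25 m i j = F i j.
have fc s1 : frame rp cp (arr s) s1 -> ctx s1 by apply: frame_ctx.
have le1 : (72 * N <= 216 * N)%N by rewrite leq_mul2r orbT.
have le2 : (144 * N <= 216 * N)%N by rewrite leq_mul2r orbT.
have h9 x : (59 < x)%N -> (9 < x)%N by apply: leq_trans.
have SW := @sweep_runs a25 rp cp (fun=> NConst 0) alE cmE rmE
  (row_op25 PIV (V 5) (V 4)) (kill_col a25 PIV (V 4) (V 6)) (normalize a25 PIV (V 4)) K d (arr s)
  (h9 _ hrp) (h9 _ hcp) nrc (fun=> 0%N) (fun i => nat_of_bool (al' i)) cm rm Psi (216 * N).
have fr0 : frame rp cp (arr s) s by [].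
apply: runs_weak (SW _ _ _ _ _ _ _ _ s fr0 _ rp0 cp0) (leqnn _) _ => {SW} //.
- by move=> s1 e /fc c1; rewrite alP.
- move=> s1 i j f1 [inv1 hF1] hi hj ri cj e1 e4 nz.
  have pj := cmp _ cj.
  apply: runs_weak (normalize25_runs ok int (fc _ f1).1 inv1 e1 e4 hi hj pj nz) le1 _.
  move=> s2 [ea inv2 m2]; have gi0 : (f25 (mx s1) i j)^-1 != 0 by rewrite invr_eq0.
  split=> //.
  + split=> // i1 j1 hi1 hj1 Di pj1; rewrite m2 hF1 //; case: eqP => [->|_]; last by rewrite mulr1.
    by rewrite F0 // mul0r.
  + by rewrite m2 eqxx mulfV.
  + by move=> i1 j1 _ _ _ _; rewrite m2 mulf_eq0; case: (j1 == j); rewrite ?(negPf gi0) ?oner_eq0 orbF.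
  + by move=> i1 j1 _ _ _ _ _ nj; rewrite m2 (negPf nj) mulr1.
- move=> s1 i i' j f1 [inv1 hF1] hi hi' hj ri ri' cj ni lal e1 e5 e4 m1 nz.
  have [c1 c2] := fc _ f1.
  have la : al' i ==> al' i' by move: lal; case: (al' i); case: (al' i').
  have lb : be' i ==> be' i' by rewrite (rmb i i') // implybb.
  apply: runs_weak (row_op25_runs ok int Y6 Yinj c1 c2 inv1 e1 e5 e4 hi hi' hj ni (rmg _ ri) (rmg _ ri') la lb) le2 _.
  move=> s2 [ea inv2 m2]; split=> //; split=> // i1 j1 hi1 hj1 Di pj1; rewrite m2 hF1 //.
  case: eqP => [e|_]; last by rewrite mul0r subr0.
  by have := Drm _ Di; rewrite e ri'.
- move=> s1 i j j' f1 [inv1 hF1] hi hj hj' ri cj cj' nj _ e1 e4 e6 m1 nz.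
  have [c1 c2] := fc _ f1.
  apply: runs_weak (kill_col25_runs ok int c1 inv1 e1 e4 e6 hi hj hj' nj (cmp _ cj')) le1 _.
  move=> s2 [ea inv2 m2]; split=> //; split=> // i1 j1 hi1 hj1 Di pj1; rewrite m2 hF1 //.
  by rewrite (hF1 i1 j) ?(F0 i1 j) ?cmp // !mulr0 subr0.
by move=> s1 [f1 [inv1 hF1] mf m1]; split.
Qed.

Definition block1 i := good' i && ~~ be' i.
Definition block2 i := good' i && be' i.
(* Entries outside the last block to be reduced. *)
Definition target (r1 r2 : nat -> nat) i j : K :=
  if ~~ good' i then 0 else if ~~ be' i then (r1 i == j.+1)%:R else (r2 i == j.+1)%:R.

Lemma clean25cd_runs s r1 c1 r2 c2 : ctx s -> closed_inv' (mx s) ->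
  (forall k, arr s 62 k = c1 k) -> (forall k, arr s 63 k = r2 k) ->
  matching a25 d (fun j => pure' (id2 j)) block1 r1 c1 ->
  matching a25 d (fun j => pure' (id2 j) && (c1 j == 0%N)) block2 r2 c2 ->
  (forall i j, (i < d v5)%N -> (j < d v2)%N -> ~~ block2 i -> pure' (id2 j) ->
     f25 (mx s) i j = target r1 r2 i j) ->
  (forall i j, (i < d v5)%N -> (j < d v2)%N -> block2 i -> pure' (id2 j) -> c1 j = 0%N ->
     f25 (mx s) i j = (r2 i == j.+1)%:R) ->
  runs (seqs [:: clean25c; clean25d]) s (2 * clean_cost) (fun s' => [/\ keep s s', closed_inv' (mx s')
   & forall i j, (i < d v5)%N -> (j < d v2)%N -> pure' (id2 j) ->
      ~~ [&& block2 i, ~~ al' i, r2 i == 0%N, c1 j != 0%N & al' (c1 j).-1] -> f25 (mx s') i j = target r1 r2 i j]).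
Proof.
move=> cs inv e62 e63 mt1 mt2 h1 h2.
pose g i j := block2 i && (r2 i != 0%N) && (pure' (id2 j) && (c1 j != 0%N)).
apply: (@runs_seq _ _ _ _ _ clean_cost clean_cost); last by lia.
have step1 : runs clean25c s clean_cost (fun s' => [/\ keep s s', closed_inv' (mx s')
    & forall i j, (i < d v5)%N -> (j < d v2)%N -> f25 (mx s') i j = if g i j then 0 else f25 (mx s) i j]).
  apply: (@clean_runs a25 _ _ K d s g closed_inv' (144 * N)) => //.
    move=> s1 i j k1 e5 e6 _ _; have cs1 := keep_ctx k1 cs.
    have E1 := @goodP s1 (V 5) cs1; have E2 := @beP s1 (V 5) cs1; have E3 := @pureP s1 (V 6) cs1.
    rewrite [neval _ _]/((neval s1 (goodE (V 5)) * (neval s1 (beE (V 5)) * arr s1 63 (arr s1 5 0%N))) *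
       (neval s1 (pureE (V 6)) * arr s1 62 (arr s1 6 0%N)))%N.
    move: (neval s1 (goodE (V 5))) (neval s1 (beE (V 5))) (neval s1 (pureE (V 6))) E1 E2 E3 => x1 x2 x3 E1 E2 E3.
    rewrite !muln_eq0 !negb_or E1 E2 E3 (k1 62) // (k1 63) // e62 e63 /= e5 e6 /g /block2 eqb0 negbK.
    by rewrite !andbA.
  move=> s1 i j k1 inv1 e5 e6 hi hj /andP[/andP[bi ri] /andP[pj cj]] nz agree.
  have cs1 := keep_ctx k1 cs.
  case er: (r2 i) ri => [//|k] _; have [_ _ hk /andP[pk /eqP ck] _] := mt2.1 _ _ er.
  have nj : k != j by apply: contra cj => /eqP <-; rewrite ck.
  have evk : neval s1 (r2E (V 5)) = k by rewrite /= (k1 63) // e5 e63 er subn1.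
  have h := kill_col25_runs ok int cs1.1 inv1 (e5 : neval s1 (V 5) = i) evk (e6 : neval s1 (V 6) = j) hi hk hj nj pj.
  apply: (runs_weak h); first by rewrite leq_mul2r orbT.
  move=> s2 [e2 inv2 m2]; split=> // i1 j1 hi1 hj1; rewrite m2.
  (* Column [k] is the unit vector of row [i]: it is not selected for clearing, and no row of the
     first block has its pivot there. *)
  have -> : f25 (mx s1) i1 k = (i1 == i)%:R.
    rewrite agree //; last by rewrite /g ck eqxx !andbF.
    case: (boolP (block2 i1)) => b1.
      rewrite h2 //; congr (nat_of_bool _)%:R; apply/eqP/eqP => [e|->//].
      have [_ _ _ _ x1] := mt2.1 _ _ er; have [_ _ _ _ x2] := mt2.1 _ _ e.
      by move: x1; rewrite x2 => -[].
    rewrite h1 // /target; have -> : (i1 == i) = false by apply/negbTE; apply: contra b1 => /eqP->.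
    case: ifP => // /negbFE gi1; rewrite ifT; last by move: b1; rewrite /block2 gi1.
    case: eqP => // e; have [_ _ _ _] := mt1.1 _ _ e; by rewrite ck.
  case: (j1 =P j) => [->|_]; last by rewrite andbF mul0r subr0.
  by rewrite andbT mul1r; case: (i1 =P i) => [->|_]; rewrite ?mulr1 ?subrr // mulr0 subr0.
apply: runs_weak step1 (leqnn _) _ => s1 [k1 inv1 m1]; have cs1 := keep_ctx k1 cs.
apply: (@runs_seq _ _ _ _ _ clean_cost 0); last by rewrite addn0.
pose g' i j := block2 i && (pure' (id2 j) && ((c1 j != 0%N) && (al' (c1 j).-1 <= al' i)%N)).
have step2 : runs clean25d s1 clean_cost (fun s' => [/\ keep s1 s', closed_inv' (mx s')
    & forall i j, (i < d v5)%N -> (j < d v2)%N -> f25 (mx s') i j = if g' i j then 0 else f25 (mx s1) i j]).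
  apply: (@clean_runs a25 _ _ K d s1 g' closed_inv' (144 * N)) => //.
    move=> s2 i j k2 e5 e6 _ _; have cs2 := keep_ctx k2 cs1.
    have E1 := @goodP s2 (V 5) cs2; have E2 := @beP s2 (V 5) cs2; have E3 := @pureP s2 (V 6) cs2.
    have E4 := @alP s2 (V 5) cs2; have E5 := @alP s2 (c1E (V 6)) cs2.
    rewrite [neval _ _]/((neval s2 (goodE (V 5)) * neval s2 (beE (V 5))) *
       (neval s2 (pureE (V 6)) * (arr s2 62 (arr s2 6 0%N) * (neval s2 (alE (c1E (V 6))) <= neval s2 (alE (V 5))))))%N.
    move: (neval s2 (goodE (V 5))) (neval s2 (beE (V 5))) (neval s2 (pureE (V 6))) (neval s2 (alE (V 5)))
      (neval s2 (alE (c1E (V 6)))) E1 E2 E3 E4 E5 => x1 x2 x3 x4 x5 E1 E2 E3 E4 E5.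
    rewrite !muln_eq0 !negb_or E1 E2 E3 E4 E5 /= (k2 62) // (k1 62) // !e62 e5 e6 subn1 /g' /block2 !eqb0 !negbK.
    by [].
  move=> s2 i j k2 inv2 e5 e6 hi hj /andP[bi /andP[pj /andP[cj lal]]] nz agree.
  have cs2 := keep_ctx k2 cs1; have [gi be_i] := andP bi.
  case ec: (c1 j) cj lal => [//|p] _ /= lal.
  have rp := mt1.2 _ _ ec; have [hp /andP[gp nbp] _ _ _] := mt1.1 _ _ rp.
  have np : p != i by apply: contra nbp => /eqP->.
  have evp : neval s2 (c1E (V 6)) = p by rewrite /= (k2 62) // (k1 62) // e6 e62 ec subn1.
  have la : al' p ==> al' i by move: lal; case: (al' p); case: (al' i).
  have lb : be' p ==> be' i by rewrite (negPf nbp).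
  have h := row_op25_runs ok int Y6 Yinj cs2.1 cs2.2 inv2 evp (e5 : neval s2 (V 5) = i) (e6 : neval s2 (V 6) = j)
    hp hi hj np gp gi la lb.
  apply: (runs_weak h) => // s3 [e3 inv3 m3]; split=> // i1 j1 hi1 hj1; rewrite m3.
  (* Row [p] is the unit vector of column [j]: on pure columns by the first sweep, on the others
     because the row is good. *)
  have -> : f25 (mx s2) p j1 = (j1 == j)%:R.
    rewrite agree //; last by rewrite /g' /block2 (negPf nbp) andbF.
    rewrite m1 // /g /block2 (negPf nbp) andbF /=.
    case: (boolP (pure' (id2 j1))) => pj1.
      rewrite h1 // /target; last by rewrite /block2 (negPf nbp) andbF.
      by rewrite gp nbp rp eqSS eq_sym.
    rewrite (good_nonpure ok int inv) //; case: (j1 =P j) => // e; by move: pj; rewrite -e (negPf pj1).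
  case: (i1 =P i) => [->|_]; last by rewrite mul0r subr0.
  by rewrite /= mul1r; case: (j1 =P j) => [->|_]; rewrite ?mulr1 ?subrr // mulr0 subr0.
apply: runs_weak step2 (leqnn _) _ => s2 [k2 inv2 m2]; apply: runs_skip.
split=> //; first by move=> x k hx; rewrite k2 // k1.
move=> i j hi hj pj nb3; rewrite m2 // m1 // /g' /g pj /=.
case: (boolP (block2 i)) => b2 /=; last by rewrite h1.
have [gi bi] := andP b2.
have T : target r1 r2 i j = (r2 i == j.+1)%:R by rewrite /target gi bi.
rewrite T; case: (eqVneq (c1 j) 0%N) => cj /=.
  by rewrite andbF h2.
have r2j : (r2 i == j.+1) = false.
  by apply/negbTE/eqP => /mt2.1 [_ _ _ /andP[_]]; rewrite (negPf cj).
rewrite r2j andbT; case: (eqVneq (r2 i) 0%N) => ri /=; last by rewrite if_same.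
rewrite ifT //; move: nb3; rewrite b2 ri eqxx cj /=.
by case: (al' i); case: (al' (c1 j).-1).
Qed.

End Sweeps25.

Section Final25.
Local Open Scope ring_scope.
Variables (K : fieldType) (W : rep K).
Notation d := (rdim W).
Variables (A : nat -> nat -> nat) (Y : nat -> nat).
Hypotheses (ok : labels_ok d A) (int : forall u, interval (pres A u)).
Hypothesis (Y6 : forall i u, (i < d v5)%N -> Y i = u.+1 -> pres A u v6).
Hypothesis (Yinj : forall i i' u, (i < d v5)%N -> (i' < d v5)%N -> Y i = u.+1 -> Y i' = u.+1 -> i = i').
Implicit Types (s : state K d) (m : mxs K d).
Notation f25 m := (ent (m (Str a25))).
Notation id5 i := (A (idA v5) i).
Notation id2 j := (A (idA v2) j).
Notation good' := (good A Y).
Notation al' := (al A).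
Notation be' := (be Y).
Notation pure' := (pure A).
Notation closed_inv' := (closed_inv A Y).
Notation N := (max_dim d).
Notation ctx' := (ctx A Y).
Notation block1' := (block1 A Y).
Notation block2' := (block2 A Y).
Notation target' := (target K A Y).

Definition block3 r2 i := [&& block2' i, ~~ al' i & r2 i == 0%N].
Definition cols3 c1 j := [&& pure' (id2 j), c1 j != 0%N & al' (c1 j).-1].

Lemma sweep25_3_runs s r1 c1 r2 c2 : ctx' s -> closed_inv' (mx s) ->
  (forall k, arr s 62 k = c1 k) -> (forall k, arr s 63 k = r2 k) ->
  matching a25 d (fun j => pure' (id2 j)) block1' r1 c1 ->
  matching a25 d (fun j => pure' (id2 j) && (c1 j == 0%N)) block2' r2 c2 ->
  (forall i j, (i < d v5)%N -> (j < d v2)%N -> pure' (id2 j) ->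
      ~~ (block3 r2 i && cols3 c1 j) -> f25 (mx s) i j = target' r1 r2 i j) ->
  (forall k, arr s 65 k = 0%N) -> (forall k, arr s 66 k = 0%N) ->
  runs sweep25_3 s (sweep_cost W) (fun s' => [/\ frame 65 66 (arr s) s', closed_inv' (mx s'),
    (forall i j, (i < d v5)%N -> (j < d v2)%N -> pure' (id2 j) ->
      ~~ (block3 r2 i && cols3 c1 j) -> f25 (mx s') i j = target' r1 r2 i j),
    matching a25 d (cols3 c1) (block3 r2) (arr s' 65) (arr s' 66)
    & forall i j, (i < d v5)%N -> (j < d v2)%N -> block3 r2 i -> cols3 c1 j -> f25 (mx s') i j = (arr s' 65 i == j.+1)%:R]).
Proof.
move=> cs inv e62 e63 mt1 mt2 hT rp0 cp0.
pose Psi m := closed_inv' m /\ forall i j, (i < d v5)%N -> (j < d v2)%N -> pure' (id2 j) ->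
      ~~ (block3 r2 i && cols3 c1 j) -> f25 m i j = target' r1 r2 i j.
have fc s1 : frame 65 66 (arr s) s1 -> ctx' s1 by apply: frame_ctx.
have f62 s1 k : frame 65 66 (arr s) s1 -> arr s1 62 k = c1 k by move=> f; rewrite f.
have f63 s1 k : frame 65 66 (arr s) s1 -> arr s1 63 k = r2 k by move=> f; rewrite f.
have le2 : (144 * N <= 216 * N)%N by rewrite leq_mul2r orbT.
have T3 i j : block3 r2 i -> target' r1 r2 i j = 0.
  by case/and3P=> /andP[gi bi] _ /eqP r0; rewrite /target gi bi r0.
have colsP j : cols3 c1 j -> exists p, [/\ c1 j = p.+1, r1 p = j.+1, (p < d v5)%N, block1' p & al' p].
  case/and3P=> _; case e: (c1 j) => [//|p] _ ap; exists p.
  by have e' := mt1.2 _ _ e; have [h1 h2 _ _ _] := mt1.1 _ _ e'.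
have n13 p : block1' p -> block3 r2 p = false.
  by case/andP=> _ nb; rewrite /block3 /block2 (negPf nb) andbF.
have T1 p j : block1' p -> target' r1 r2 p j = (r1 p == j.+1)%:R.
  by case/andP=> gp nb; rewrite /target gp nb.
have SW := @sweep_runs a25 65 66 (fun=> NConst 0) (fun=> NConst 0)
  (fun j => NMul (pureE j) (NMul (NLoad 62 j) (alE (c1E j))))
  (fun i => NMul (NMul (goodE i) (beE i)) (NMul (NNot (alE i)) (NNot (NLoad 63 i))))
  (row_op25 PIV (V 5) (V 4))
  (Seq (kill_col a25 PIV (V 4) (V 6)) (row_op25 (c1E (V 6)) (c1E (V 4)) (V 6)))
  (row_normalize25 PIV (V 4)) K d (arr s)
  isT isT isT (fun=> 0%N) (fun=> 0%N) (cols3 c1) (block3 r2) Psi (216 * N).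
have fr0 : frame 65 66 (arr s) s by [].
apply: runs_weak (SW _ _ _ _ _ _ _ _ s fr0 _ rp0 cp0) (leqnn _) _ => {SW} //.
- move=> s1 e f1; have cs1 := fc _ f1.
  have E1 := @pureP _ _ A Y s1 e cs1; have E2 := @alP _ _ A Y s1 (c1E e) cs1.
  rewrite [neval _ _]/(neval s1 (pureE e) * (arr s1 62 (neval s1 e) * neval s1 (alE (c1E e))))%N.
  move: (neval s1 (pureE e)) (neval s1 (alE (c1E e))) E1 E2 => x1 x2 E1 ->.
  by rewrite !muln_eq0 !negb_or E1 /= f62 // subn1 eqb0 negbK.
- move=> s1 e f1; have cs1 := fc _ f1.
  have E1 := @goodP _ _ A Y s1 e cs1; have E2 := @beP _ _ A Y s1 e cs1; have E3 := @alP _ _ A Y s1 e cs1.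
  rewrite [neval _ _]/((neval s1 (goodE e) * neval s1 (beE e)) * ((neval s1 (alE e) == 0) * (arr s1 63 (neval s1 e) == 0)))%N.
  move: (neval s1 (goodE e)) (neval s1 (beE e)) (neval s1 (alE e)) E1 E2 E3 => x1 x2 x3 E1 -> ->.
  rewrite !muln_eq0 !negb_or E1 f63 // !eqb0 /block3 /block2 -!andbA.
  by case: (good _ _ _); case: (be _ _); case: (al _ _); case: (r2 _).
- move=> s1 i j f1 [inv1 hT1] hi hj ri cj e1 e4 nz.
  have [pj _ _] := and3P cj; have [/andP[gi bi] nal /eqP r0] := and3P ri.
  have [cs1 cs1'] := fc _ f1.
  apply: runs_weak (row_normalize25_runs ok int Y6 Yinj cs1 cs1' inv1 e1 e4 hi hj gi bi nal nz) le2 _.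
  move=> s2 [ea inv2 m2]; have gi0 : (f25 (mx s1) i j)^-1 != 0 by rewrite invr_eq0.
  split=> //.
  + split=> // i1 j1 hi1 hj1 pj1 nb; rewrite m2 hT1 //; case: eqP => [e|_]; last by rewrite mulr1.
    by rewrite e T3 // mul0r.
  + by rewrite m2 eqxx mulfV.
  + by move=> i1 j1 _ _ _ _; rewrite m2 mulf_eq0; case: (i1 == i); rewrite ?(negPf gi0) ?oner_eq0 orbF.
  + by move=> i1 j1 _ _ _ _ ni _; rewrite m2 (negPf ni) mulr1.
- move=> s1 i i' j f1 [inv1 hT1] hi hi' hj ri ri' cj ni _ e1 e5 e4 m1 nz.
  have [cs1 cs1'] := fc _ f1.
  have [/andP[gi bi] nal /eqP r0] := and3P ri; have [/andP[gi' bi'] nal' /eqP r0'] := and3P ri'.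
  have la : al' i ==> al' i' by rewrite (negPf nal).
  have lb : be' i ==> be' i' by rewrite bi'  implybT.
  apply: runs_weak (row_op25_runs ok int Y6 Yinj cs1 cs1' inv1 e1 e5 e4 hi hi' hj ni gi gi' la lb) le2 _.
  move=> s2 [ea inv2 m2]; split=> //; split=> // i1 j1 hi1 hj1 pj1 nb; rewrite m2 hT1 //.
  case: eqP => [e|_]; last by rewrite mul0r subr0.
  rewrite (hT1 i j1) //; last by move: nb; rewrite e ri ri'.
  by rewrite (T3 i) // !mulr0 subr0.
- move=> s1 i j j' f1 [inv1 hT1] hi hj hj' ri cj cj' nj _ e1 e4 e6 m1 nz.
  have cs1 := fc _ f1.
  have [pj _ _] := and3P cj; have [pj' _ _] := and3P cj'.
  have [p [cp rp hp bp ap]] := colsP _ cj; have [p' [cp' rp' hp' bp' ap']] := colsP _ cj'.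
  apply: (@runs_seq _ _ _ _ _ (72 * N) (144 * N)); last by lia.
  apply: runs_weak (kill_col25_runs ok int cs1.1 inv1 e1 e4 e6 hi hj hj' nj pj') (leqnn _) _.
  move=> s2 [ea inv2 m2].
  have cs2 : ctx' s2 by rewrite /ctx ea; exact: cs1.
  have np : p' != p by apply: contra nj => /eqP e; move: rp'; rewrite e rp => -[->].
  have e6' : arr s1 6 0%N = j' := e6; have e4' : arr s1 4 0%N = j := e4.
  have ev1 : neval s2 (c1E (V 6)) = p' by rewrite /= ea e6' f62 // cp' subn1.
  have ev2 : neval s2 (c1E (V 4)) = p by rewrite /= ea e4' f62 // cp subn1.
  have ev3 : neval s2 (V 6) = j' by rewrite /= ea.
  have [gp nbp] := andP bp; have [gp' nbp'] := andP bp'.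
  have la : al' p' ==> al' p by rewrite ap implybT.
  have lb : be' p' ==> be' p by rewrite (negPf nbp').
  apply: runs_weak (row_op25_runs ok int Y6 Yinj cs2.1 cs2.2 inv2 ev1 ev2 ev3 hp' hp hj' np gp' gp la lb) (leqnn _) _.
  move=> s3 [eb inv3 m3].
  have M1 i1 j1 : block1' i1 -> (i1 < d v5)%N -> (j1 < d v2)%N -> pure' (id2 j1) -> f25 (mx s1) i1 j1 = (r1 i1 == j1.+1)%:R.
    by move=> b1 hi1 hj1 pj1; rewrite hT1 // ?T1 // n13.
  (* On pure columns row [p'] is the unit vector of column [j'], so the row operation cancels
     exactly the entry that the column operation created in row [p]. *)
  have Mfinal i1 j1 : (i1 < d v5)%N -> (j1 < d v2)%N -> pure' (id2 j1) ->
      f25 (mx s3) i1 j1 = if i1 == p then f25 (mx s1) i1 j1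
        else f25 (mx s1) i1 j1 - (j1 == j')%:R * (f25 (mx s1) i j' * f25 (mx s1) i1 j).
    move=> hi1 hj1 pj1; rewrite m3 !m2; case: (eqVneq i1 p) => [->|_]; last by rewrite mul0r subr0.
    have z1 : (j.+1 == j'.+1) = false by rewrite eqSS (negPf nj).
    have z2 : (j'.+1 == j.+1) = false by rewrite eqSS eq_sym (negPf nj).
    rewrite (M1 p j) // (M1 p j') // (M1 p' j1) // (M1 p' j) // rp rp' z1 z2 !eqxx eqSS [j' == j1]eq_sym.
    by case: (j1 == j') => /=; ring.
  split=> //; first by rewrite eb ea.
    split=> // i1 j1 hi1 hj1 pj1 nb; rewrite Mfinal // hT1 //; case: eqP => // /eqP nip.
    case: (j1 =P j') => [ej|_]; last by rewrite mul0r subr0.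
    have nr3 : ~~ block3 r2 i1 by move: nb; rewrite ej cj' andbT.
    rewrite (hT1 i1 j) //; last by rewrite (negPf nr3).
    suff -> : target' r1 r2 i1 j = 0 by rewrite !mulr0 subr0.
    rewrite /target; case: ifP => // /negbFE gi1; case: ifP => nb1.
      case: eqP => // e; have [_ _ _ _] := mt1.1 _ _ e; rewrite cp => -[e'].
      by rewrite e' eqxx in nip.
    by case: eqP => // /mt2.1 [_ _ _ /andP[_ /eqP]]; rewrite cp.
  move=> i1 j1 hi1 hj1 ri1 cj1; have [pj1 _ _] := and3P cj1; rewrite Mfinal // ifF //.
  by apply/negbTE/eqP => e; move: ri1; rewrite e n13.
by move=> s1 [f1 [inv1 hT1] mf m1]; split.
Qed.

Definition cost25 := (4 * clean_cost W + 3 * sweep_cost W)%N.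

(** The blocks of the three sweeps exclude each other or require the earlier pivot to be missing, so
    at most one summand is nonzero. *)
Definition Zrow (B : nat -> nat -> nat) i := (B 61 i + B 63 i + B 65 i)%N.

Lemma program25_runs s : ctx' s -> closed_inv' (mx s) -> (forall x k, (51 <= x)%N -> arr s x k = 0%N) ->
  runs program25 s cost25 (fun s' => [/\ ctx' s', closed_inv' (mx s'),
    [/\ matching a25 d (fun j => pure' (id2 j)) block1' (arr s' 61) (arr s' 62),
        matching a25 d (fun j => pure' (id2 j) && (arr s' 62 j == 0%N)) block2' (arr s' 63) (arr s' 64)
      & matching a25 d (cols3 (arr s' 62)) (block3 (arr s' 63)) (arr s' 65) (arr s' 66)],
    (forall i j, (i < d v5)%N -> (j < d v2)%N -> pure' (id2 j) -> f25 (mx s') i j = (Zrow (arr s') i == j.+1)%:R)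
    & forall x k, (67 <= x)%N -> arr s' x k = 0%N]).
Proof.
move=> cs inv z; rewrite /program25 -[X in seqs X]/([:: clean25a; clean25b] ++ [:: sweep25_1; sweep25_2; clean25c; clean25d; sweep25_3]).
have h1 := clean25ab_runs ok int Y6 Yinj cs inv.
apply: (@runs_cat _ _ _ _ _ (2 * clean_cost W) (2 * clean_cost W + 3 * sweep_cost W)); last by rewrite /cost25; lia.
apply: runs_weak h1 (leqnn _) _ => s1 [k1 inv1 bad1].
have cs1 := keep_ctx k1 cs.
have z1 x k : (51 <= x)%N -> arr s1 x k = 0%N by move=> hx; rewrite k1 ?z // (leq_trans _ hx).
apply: (@runs_seq _ _ _ _ _ (sweep_cost W) (2 * clean_cost W + 2 * sweep_cost W)); last by lia.
have S1 := @sweep25_runs K W A Y ok int Y6 Yinj s1 61 62 pureE (fun i => NMul (goodE i) (NNot (beE i)))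
  (fun j => pure' (id2 j)) block1' (fun i => ~~ good' i) (fun _ _ => 0) isT isT isT.
apply: runs_weak (S1 _ _ _ _ _ _ _ cs1 inv1 _ _ _) (leqnn _) _ => {S1} //.
- by move=> s2 e f2; rewrite (@pureP _ _ A Y) //; apply: frame_ctx f2.
- move=> s2 e f2; have cs2 : ctx' s2 by apply: frame_ctx f2.
  have E1 := @goodP _ _ A Y s2 e cs2; have E2 := @beP _ _ A Y s2 e cs2.
  rewrite [neval _ _]/(neval s2 (goodE e) * (neval s2 (beE e) == 0))%N.
  move: (neval s2 (goodE e)) (neval s2 (beE e)) E1 E2 => x1 x2 E1 ->.
  by rewrite !muln_eq0 !negb_or E1 /block1 /block2; case: (good _ _ _); case: (be _ _).
- by move=> i /andP[].
- by move=> i i' /andP[_ /negPf->] /andP[_ /negPf->].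
- by move=> i ng; rewrite /block1 (negPf ng).
- by move=> k; apply: z1.
- by move=> k; apply: z1.
move=> s2 [f2 inv2 bad2 mt1 m2].
have cs2 : ctx' s2 by apply: frame_ctx f2.
have z2 x k : (63 <= x)%N -> arr s2 x k = 0%N by move=> hx; rewrite f2 ?z1 //; lia.
set r1 := arr s2 61 in mt1 m2; set c1 := arr s2 62 in mt1.
apply: (@runs_seq _ _ _ _ _ (sweep_cost W) (2 * clean_cost W + sweep_cost W)); last by lia.
have S2 := @sweep25_runs K W A Y ok int Y6 Yinj s2 63 64 (fun j => NMul (pureE j) (NNot (NLoad 62 j)))
  (fun i => NMul (goodE i) (beE i))
  (fun j => pure' (id2 j) && (c1 j == 0%N)) block2' (fun i => ~~ block2' i) (target' r1 (fun=> 0%N)) isT isT isT.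
have T1 i j : ~~ block2' i -> target' r1 (fun=> 0%N) i j = if block1' i then (r1 i == j.+1)%:R else 0.
  by rewrite /block2 /block1 /target; case: (good' i); case: (be' i).
apply: runs_weak (S2 _ _ _ _ _ _ _ cs2 inv2 _ _ _) (leqnn _) _ => {S2} //.
- move=> s3 e f3; have cs3 : ctx' s3 by apply: frame_ctx f3.
  have E1 := @pureP _ _ A Y s3 e cs3.
  rewrite [neval _ _]/(neval s3 (pureE e) * (arr s3 62 (neval s3 e) == 0))%N.
  move: (neval s3 (pureE e)) E1 => x1 E1.
  by rewrite !muln_eq0 !negb_or E1 f3 // eqb0 negbK.
- move=> s3 e f3; have cs3 : ctx' s3 by apply: frame_ctx f3.
  have E1 := @goodP _ _ A Y s3 e cs3; have E2 := @beP _ _ A Y s3 e cs3.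
  rewrite [neval _ _]/(neval s3 (goodE e) * neval s3 (beE e))%N.
  move: (neval s3 (goodE e)) (neval s3 (beE e)) E1 E2 => x1 x2 E1 ->.
  by rewrite !muln_eq0 !negb_or E1 /block1 /block2; case: (good _ _ _); case: (be _ _).
- by move=> j /andP[].
- by move=> i /andP[].
- by move=> i i' /andP[_ ->] /andP[_ ->].
- move=> i j nb /andP[pj /eqP cj]; rewrite T1 //; case: ifP => // b1; case: eqP => // e.
  by have [_ _ _ _] := mt1.1 _ _ e; rewrite cj.
- move=> i j hi hj nb pj; rewrite T1 //; case: ifP => b1; first exact: m2.
  apply: bad2 => //; move: nb b1; rewrite /block1 /block2; by case: (good' i); case: (be' i).
- by move=> k; apply: z2.
- by move=> k; apply: z2.
move=> s3 [f3 inv3 t3 mt2 m3].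
have cs3 : ctx' s3 by apply: frame_ctx f3.
set r2 := arr s3 63 in mt2 m3; set c2 := arr s3 64 in mt2.
have e62 k : arr s3 62 k = c1 k by rewrite f3.
have T12 i j : ~~ block2' i -> target' r1 (fun=> 0%N) i j = target' r1 r2 i j.
  by rewrite /block2 /target; case: (good' i); case: (be' i).
have h3 : runs (seqs [:: clean25c; clean25d]) s3 (2 * clean_cost W) (fun s' => [/\ keep s3 s', closed_inv' (mx s')
   & forall i j, (i < d v5)%N -> (j < d v2)%N -> pure' (id2 j) ->
      ~~ [&& block2' i, ~~ al' i, r2 i == 0%N, c1 j != 0%N & al' (c1 j).-1] -> f25 (mx s') i j = target' r1 r2 i j]).
  apply: (clean25cd_runs ok int Y6 Yinj (c2 := c2)) => //.
    by move=> i j hi hj nb pj; rewrite -T12 //; apply: t3.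
  by move=> i j hi hj b2 pj cj; apply: m3; rewrite ?pj ?cj.
apply: (@runs_cat _ _ [:: clean25c; clean25d] [:: sweep25_3] _ (2 * clean_cost W) (sweep_cost W)); last by [].
apply: runs_weak h3 (leqnn _) _ => s4 [k4 inv4 t4]; have cs4 := keep_ctx k4 cs3.
apply: (@runs_seq _ _ _ _ _ (sweep_cost W) 0); last by lia.
have z4 x k : (65 <= x)%N -> arr s4 x k = 0%N.
  by move=> hx; rewrite k4 ?f3 ?z2 //; lia.
have e462 k : arr s4 62 k = c1 k by rewrite k4.
have e463 k : arr s4 63 k = r2 k by rewrite k4.
apply: runs_weak (sweep25_3_runs (r1 := r1) cs4 inv4 e462 e463 mt1 mt2 _ _ _) (leqnn _) _.
- move=> i j hi hj pj nb; apply: t4 => //; apply: contra nb => /and5P[b1 b2 b3 b4 b5].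
  by rewrite /block3 /cols3 b1 b2 b3 b4 b5 pj.
- by move=> k; apply: z4.
- by move=> k; apply: z4.
move=> s5 [f5 inv5 t5 mt3 m5]; apply: runs_skip.
have E61 k : arr s5 61 k = r1 k by rewrite f5 // k4 // f3.
have E62 k : arr s5 62 k = c1 k by rewrite f5 // k4.
have E63 k : arr s5 63 k = r2 k by rewrite f5 // k4.
have E64 k : arr s5 64 k = c2 k by rewrite f5 // k4.
have b3E i : block3 (arr s5 63) i = block3 r2 i by rewrite /block3 E63.
have c3E j : cols3 (arr s5 62) j = cols3 c1 j by rewrite /cols3 E62.
split=> //.
- exact: frame_ctx f5.
- split.
  + by split=> i j; rewrite E61 E62; [apply: mt1.1 | apply: mt1.2].
  + by split=> i j; rewrite E63 E64; [move/mt2.1; rewrite E62 | apply: mt2.2].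
  + by split=> i j; [move/mt3.1; rewrite b3E c3E | apply: mt3.2].
- move=> i j hi hj pj; rewrite /Zrow E61 E63.
  have r1P : r1 i != 0%N -> block1' i by case e: (r1 i) => [//|k] _; have [] := mt1.1 _ _ e.
  have r2P : r2 i != 0%N -> block2' i by case e: (r2 i) => [//|k] _; have [] := mt2.1 _ _ e.
  have r3P : arr s5 65 i != 0%N -> block3 r2 i by case e: (arr s5 65 i) => [//|k] _; have [] := mt3.1 _ _ e.
  case: (boolP (block3 r2 i && cols3 c1 j)) => [/andP[b3 c3]|nb].
    rewrite m5 //; have [/andP[_ bi] _ /eqP ->] := and3P b3.
    suff -> : r1 i = 0%N by rewrite !add0n.
    by apply/eqP; apply: contraT => /r1P /andP[_]; rewrite bi.
  rewrite t5 // /target.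
  have z3 : block3 r2 i -> (arr s5 65 i == j.+1) = false.
    move=> b3; apply/negbTE/eqP => /mt3.1 [_ _ _ c3 _].
    by rewrite b3 c3 in nb.
  case: (boolP (good' i)) => gi /=; last first.
    have -> : r1 i = 0%N by apply/eqP; apply: contraT => /r1P /andP[h]; rewrite h in gi.
    have -> : r2 i = 0%N by apply/eqP; apply: contraT => /r2P /andP[h]; rewrite h in gi.
    have -> : arr s5 65 i = 0%N by apply/eqP; apply: contraT => /r3P /and3P[/andP[h]]; rewrite h in gi.
    by [].
  case: (boolP (be' i)) => bi /=; last first.
    have -> : r2 i = 0%N by apply/eqP; apply: contraT => /r2P /andP[_ h]; rewrite h in bi.
    have -> : arr s5 65 i = 0%N by apply/eqP; apply: contraT => /r3P /and3P[/andP[_ h]]; rewrite h in bi.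
    by rewrite !addn0.
  have -> : r1 i = 0%N by apply/eqP; apply: contraT => /r1P /andP[_]; rewrite bi.
  rewrite add0n; case: (eqVneq (arr s5 65 i) 0%N) => [->|n3]; first by rewrite addn0.
  have b3 := r3P n3; have [_ _ /eqP r0] := and3P b3; rewrite r0 add0n z3 //.
- by move=> x k hx; rewrite f5 ?z4 //; lia.
Qed.

End Final25.

(** * The indecomposable representations *)

Section Isomorphisms.
Local Open Scope ring_scope.
Variable K : fieldType.
Implicit Types (U X Y : rep K).

Lemma iso_dim U X v : isomorphic U X -> rdim U v = rdim X v.
Proof.
case=> phi [_ /(_ v)[psi [h1 h2]]]; apply/eqP; rewrite eqn_leq.
by rewrite (mulmx1_min h1) (mulmx1_min h2).
Qed.

Lemma iso_trans U X Y : isomorphic U X -> isomorphic X Y -> isomorphic U Y.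
Proof.
move=> [f [fh fi]] [g [gh gi]]; exists (fun v => g v *m f v); split.
  by move=> a; rewrite -mulmxA fh !mulmxA gh.
move=> v; have [f' [f1 f2]] := fi v; have [g' [g1 g2]] := gi v.
by exists (f' *m g'); rewrite !mulmxA -[f' *m g' *m _]mulmxA g1 mulmx1 f1 -[_ *m f v *m f']mulmxA f2 mulmx1 g2.
Qed.

(** The definition only asserts an inverse at each vertex separately; [pinvmx] turns these into a
    family of matrices, which is then shown to commute with the arrows. *)
Lemma iso_inverse U X (f : forall v, 'M[K]_(rdim X v, rdim U v)) : is_iso f ->
  exists g : forall v, 'M[K]_(rdim U v, rdim X v),
    is_hom g /\ forall v, g v *m f v = 1%:M /\ f v *m g v = 1%:M.
Proof.
move=> [fh fi].
pose g v := pinvmx (f v).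
have gP v : g v *m f v = 1%:M /\ f v *m g v = 1%:M.
  have [f' [h1 h2]] := fi v.
  have ff : row_free (f v) by apply/row_freeP; exists f'.
  have h : f v *m g v = 1%:M by apply: mulmxVp.
  split=> //.
  by rewrite -[g v]mul1mx -h1 -[f' *m f v *m g v]mulmxA h mulmx1.
exists g; split=> // a; have [h1 h2] := gP (src a); have [h3 h4] := gP (tgt a).
move: (g (src a)) (g (tgt a)) h1 h2 h3 h4 => g1 g2 h1 h2 h3 h4.
by rewrite -[g2 *m _]mulmx1 -h2 !mulmxA -[g2 *m rmap X a *m _]mulmxA -fh mulmxA h3 mul1mx.
Qed.

Lemma iso_sym U X : isomorphic U X -> isomorphic X U.
Proof.
move=> [f /iso_inverse[g [gh gP]]]; exists g; split=> // v.
by exists (f v); have [] := gP v.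
Qed.

Lemma dsum_zero_r U X : is_zero X -> isomorphic (dsum U X) U.
Proof.
move=> zX; exists (fun v => row_mx 1%:M 0 : 'M_(rdim U v, rdim U v + rdim X v)); split.
  move=> a; rewrite /= /dsum_f mul_row_block mul_mx_row !mul1mx !mulmx1 !mulmx0 !mul0mx !addr0 //.
move=> v; exists (col_mx 1%:M 0); split; last by rewrite mul_row_col mulmx1 mulmx0 addr0.
rewrite mul_col_row mulmx1 mul1mx mul0mx mul0mx.
have e (M : 'M[K]_(rdim X v)) : M = 1%:M.
  by apply/matrixP => i; have := ltn_ord i; rewrite [X in (_ < X)%N]zX.
by rewrite (_ : (0 : 'M_(rdim X v)) = 1%:M) ?(e 0) // -scalar_mx_block.
Qed.

(* The idempotent of a decomposition is scalar, hence 0 or 1. *)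
Lemma scalar_end_indecomposable U : ~ is_zero U ->
  (forall phi : forall v, 'M[K]_(rdim U v), is_hom phi -> exists c, forall v, phi v = c%:M) ->
  indecomposable U.
Proof.
move=> nz h; split=> // X Y [f fiso]; have [fh _] := fiso.
have [g [gh gP]] := iso_inverse fiso.
pose e v : 'M[K]_(rdim X v + rdim Y v) := block_mx 1%:M 0 0 0.
have [|c hc] := h (fun v => g v *m e v *m f v).
  move=> a; rewrite -mulmxA fh -[g _ *m e _ *m (_ *m _)]mulmxA [e _ *m _]mulmxA.
  have -> : e (tgt a) *m rmap (dsum X Y) a = rmap (dsum X Y) a *m e (src a).
    by rewrite /e /= /dsum_f !mulmx_block !mul1mx !mulmx1 !mul0mx !mulmx0 !addr0.
  by rewrite !mulmxA gh.
have he v : e v = c%:M.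
  have [h1 h2] := gP v; have := congr1 (fun M => f v *m M *m g v) (hc v).
  rewrite mul_mx_scalar -scalemxAl h2 scalemx1 => <-.
  by rewrite !mulmxA h2 mul1mx -mulmxA h2 mulmx1.
have hX v : (0 < rdim X v)%N -> c = 1.
  move=> p; have := congr1 (fun M : 'M_(_ + _) => ulsubmx M) (he v); rewrite /e block_mxKul.
  rewrite scalar_mx_block block_mxKul => /matrixP/(_ (Ordinal p) (Ordinal p)).
  by rewrite !mxE eqxx.
have hY v : (0 < rdim Y v)%N -> c = 0.
  move=> p; have := congr1 (fun M : 'M_(_ + _) => drsubmx M) (he v); rewrite /e block_mxKdr.
  rewrite scalar_mx_block block_mxKdr => /matrixP/(_ (Ordinal p) (Ordinal p)).
  by rewrite !mxE eqxx.
case: (boolP (has (fun v => 0 < rdim X v)%N vertices)) => [/hasP[v0 _ /hX c1]|/hasPn zX].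
  right=> v; case: (posnP (rdim Y v)) => // /hY; rewrite c1 => /eqP.
  by rewrite oner_eq0.
by left=> v; have := zX v (mem_vertices v); rewrite -eqn0Ngt => /eqP.
Qed.

End Isomorphisms.

(** * Shapes of the components *)

Record shape := Shape { sx : seq bool; sy : seq bool; sz : bool; sw : bool }.
Lemma shape_tupleK : cancel (fun sh => (sx sh, sy sh, sz sh, sw sh)) (fun t => Shape t.1.1.1 t.1.1.2 t.1.2 t.2).
Proof. by case. Qed.
HB.instance Definition _ := Equality.copy shape (can_type shape_tupleK).

(* A summand is built from up to four labels, called its slots: 0 is a label
   without restriction, 1 a label linked through [a65], 2 a label living at 2
   only and 3 a label living at 5 only. [sx] and [sy] list the vertices at which
   the slots 0 and 1 are present. *)
Definition spres sh t v :=
  match t with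
  | 0 => vat (sx sh) v
  | 1 => vat (sy sh) v
  | 2 => sz sh && veq v v2
  | _ => sw sh && veq v v5
  end.
Definition slots_at sh v := [seq t <- [:: 0; 1; 2; 3] | spres sh t v].
(** Slot 3 occurs only beside a slot 0 that is not linked through [a65]; slot 1 is then the partner
    of slot 3. Otherwise slot 0 is linked with itself or with slot 1. *)
Definition slink65 sh t s :=
  if sw sh then (t == 3) && (s == 1)
  else (t == 0) && (if vat (sx sh) v5 && vat (sx sh) v6 then s == 0 else s == 1).
(** [slink65] enters the case of [a25] because a label living at 6 and 2 also lives at 3, and the
    right square then equates its columns in [a25] and [a65]. *)
Definition slink b sh t s :=
  match b with
  | a65 => slink65 sh t s
  | a25 => (t == s) || slink65 sh t s || [&& sz sh, (t == 0) || (t == 3) & s == 2]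
  | _ => t == s
  end.
Definition sdim sh v := size (slots_at sh v).
Definition smat b sh i j : nat := slink b sh (nth 0 (slots_at sh (tgt b)) i) (nth 0 (slots_at sh (src b)) j).

Definition sprod b c sh i j := sumn [seq smat b sh i l * smat c sh l j | l <- iota 0 (sdim sh (tgt c))].
Definition scomm sh :=
  all (fun i => all (fun j => sprod a45 a14 sh i j == sprod a25 a12 sh i j) (iota 0 (sdim sh v1)) &&
    all (fun j => sprod a65 a36 sh i j == sprod a25 a32 sh i j) (iota 0 (sdim sh v3)))
    (iota 0 (sdim sh v5)).

(** The constraints that [relations] puts on the supports within one component, in decidable
    form. *)
Definition valid sh :=
  let px := vat (sx sh) in let py := vat (sy sh) in let hy := has id (sy sh) in
  [&& interval px, has id (sx sh), px v5 ==> (px v1 ==> px v2) && (px v3 ==> px v6),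
      hy ==> [&& interval py, py v6, ~~ py v5, ~~ py v1, py v3 ==> py v2, px v5 & ~~ px v6],
      sz sh ==> [&& px v5, ~~ px v2 & ~~ py v2] & sw sh ==> [&& sz sh, px v4 & hy]].

Definition shapes0 :=
  [seq sh <- flatten [seq flatten [seq [:: Shape x y false false; Shape x y true false; Shape x y false true; Shape x y true true]
     | y <- allvecs] | x <- allvecs] | valid sh].
Definition shapes := Eval vm_compute in shapes0.
(** It depends on the dimension vector alone, so shapes with distinct codes give representations
    that are not isomorphic. *)
Definition scode sh := sumn [seq 3 ^ code v * sdim sh v | v <- vertices].

(** * Endomorphisms of a shape, computed by propagation *)

Definition kvar := (vertex * nat * nat)%type.
Definition kvar_eq (x y : kvar) := [&& veq x.1.1 y.1.1, x.1.2 == y.1.2 & x.2 == y.2].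
Definition known (st : seq (kvar * bool)) x :=
  ohead [seq p.2 | p <- st & kvar_eq p.1 x].

(** An entry marked [true] equals an unknown scalar [c], one marked [false] is 0. The equation
    [m c + x = n c] is solved when [n - m] is 0 or 1, which is valid over any field. *)
Definition deduce st (x : kvar) m n : seq (kvar * bool) :=
  if m == n then (x, false) :: st else if n == m.+1 then (x, true) :: st else st.

Definition propagate st (e : seq kvar * seq kvar) : seq (kvar * bool) :=
  let unknown L := [seq x <- L | known st x == None] in
  let ones L := count (fun x => known st x == Some true) L in
  match unknown e.1, unknown e.2 with
  | [:: x], [::] => deduce st x (ones e.1) (ones e.2)
  | [::], [:: x] => deduce st x (ones e.2) (ones e.1)
  | _, _ => st
  end.

Definition hom_equation sh b i j : seq kvar * seq kvar :=
  ([seq (tgt b, i, l) | l <- iota 0 (sdim sh (tgt b)) & smat b sh l j == 1],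
   [seq (src b, l, j) | l <- iota 0 (sdim sh (src b)) & smat b sh i l == 1]).
Definition hom_equations sh :=
  flatten [seq flatten [seq [seq hom_equation sh b i j | j <- iota 0 (sdim sh (src b))]
    | i <- iota 0 (sdim sh (tgt b))] | b <- arrows].

(** A brick has only scalar endomorphisms. The first diagonal entry at some vertex is called [c],
    and the linear equations of an endomorphism, each used once it has a single unknown, must force
    every other entry. Six rounds suffice for all the shapes in the list. *)
Definition brick sh :=
  has (fun v =>
    let st := foldl propagate [:: ((v, 0, 0), true)] (flatten (nseq 6 (hom_equations sh))) in
    (0 < sdim sh v) &&
    all (fun u => all (fun i => all (fun j => known st (u, i, j) == Some (i == j))
      (iota 0 (sdim sh u))) (iota 0 (sdim sh u))) vertices) vertices.

Section Bricks.
Local Open Scope ring_scope.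
Variable K : fieldType.

Definition shape_mx sh b : 'M[K]_(sdim sh (tgt b), sdim sh (src b)) :=
  \matrix_(i, j) (smat b sh i j)%:R.

Lemma shape_mxE sh b i j : shape_mx sh b i j = (smat b sh i j)%:R.
Proof. exact: mxE. Qed.

Lemma ent_shape_mx sh b i j : (i < sdim sh (tgt b))%N -> (j < sdim sh (src b))%N ->
  ent (shape_mx sh b) i j = (smat b sh i j)%:R.
Proof. exact: (@ent_mx K _ _ (fun i j => (smat b sh i j)%:R)). Qed.

Lemma sum_smat sh b c i j :
  \sum_(l < sdim sh (tgt c)) (smat b sh i l)%:R * (smat c sh l j)%:R = (sprod b c sh i j)%:R :> K.
Proof.
rewrite /sprod sumnE big_map natr_sum -val_enum_ord big_map big_enum /=.
by apply: eq_bigr => l _; rewrite natrM.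
Qed.

(** The inner dimension is a variable [n] because [src b] and [tgt c] coincide only for concrete
    pairs of arrows. *)
Lemma shape_mx_mul sh b c i j :
  forall (n : nat) (e : sdim sh (tgt c) = n) (B : 'M[K]_(sdim sh (tgt b), n)) (C : 'M[K]_(n, sdim sh (src c))),
  (forall i j, B i j = (smat b sh i j)%:R) -> (forall i j, C i j = (smat c sh i j)%:R) ->
  (B *m C) i j = (sprod b c sh i j)%:R.
Proof.
move=> n e; case: _ / e => B C hB hC; rewrite mxE -sum_smat.
by apply: eq_bigr => l _; rewrite hB hC.
Qed.

Lemma scomm_l sh : scomm sh -> shape_mx sh a45 *m shape_mx sh a14 = shape_mx sh a25 *m shape_mx sh a12.
Proof.
move=> /allP h; apply/matrixP => i j.
rewrite (@shape_mx_mul sh a45 a14 i j _ erefl _ _ (@shape_mxE sh a45) (@shape_mxE sh a14)).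
rewrite (@shape_mx_mul sh a25 a12 i j _ erefl _ _ (@shape_mxE sh a25) (@shape_mxE sh a12)).
have /h/andP[/allP h1 _] : val i \in iota 0 (sdim sh v5) by rewrite mem_iota /=.
by have /h1/eqP-> : val j \in iota 0 (sdim sh v1) by rewrite mem_iota /=.
Qed.

Lemma scomm_r sh : scomm sh -> shape_mx sh a65 *m shape_mx sh a36 = shape_mx sh a25 *m shape_mx sh a32.
Proof.
move=> /allP h; apply/matrixP => i j.
rewrite (@shape_mx_mul sh a65 a36 i j _ erefl _ _ (@shape_mxE sh a65) (@shape_mxE sh a36)).
rewrite (@shape_mx_mul sh a25 a32 i j _ erefl _ _ (@shape_mxE sh a25) (@shape_mxE sh a32)).
have /h/andP[_ /allP h1] : val i \in iota 0 (sdim sh v5) by rewrite mem_iota /=.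
by have /h1/eqP-> : val j \in iota 0 (sdim sh v3) by rewrite mem_iota /=.
Qed.

Definition rep_of_shape sh (h : scomm sh) : rep K :=
  Rep (scomm_l h) (scomm_r h).

Variables (sh : shape) (comm : scomm sh).
Variable phi : forall v, 'M[K]_(rdim (rep_of_shape comm) v).
Hypothesis hom : is_hom (V := rep_of_shape comm) (W := rep_of_shape comm) phi.

Let value (x : kvar) : K := ent (phi x.1.1) x.1.2 x.2.
Let sound c (st : seq (kvar * bool)) := forall x b, known st x = Some b -> value x = c *+ b.

Lemma kvar_eqP x y : reflect (x = y) (kvar_eq x y).
Proof.
case: x y => [[v i] j] [[v' i'] j']; rewrite /kvar_eq /= veqE.
apply: (iffP and3P) => [[/eqP-> /eqP-> /eqP->] //|[-> -> ->]].
by rewrite !eqxx.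
Qed.

Lemma sound_cons c st x (b : bool) : sound c st -> value x = c *+ b -> sound c ((x, b) :: st).
Proof.
move=> h e y b'; rewrite /known /=; case: kvar_eqP => [<-|_] /=; first by case=> <-.
by apply: h.
Qed.

Lemma sum_known c st (L : seq kvar) : sound c st ->
  \sum_(x <- L) value x = c *+ count (fun x => known st x == Some true) L +
    \sum_(x <- [seq x <- L | known st x == None]) value x.
Proof.
move=> h; elim: L => [|x L IH]; first by rewrite !big_nil addr0.
rewrite big_cons IH /=; case e : (known st x) => [[]|] /=; rewrite ?(h _ _ e) ?mulr1n ?mulr0n.
- by rewrite add1n mulrS addrA.
- by rewrite add0n add0r.
by rewrite big_cons add0n addrCA.
Qed.

Lemma sound_deduce c st x m n : sound c st -> c *+ m + value x = c *+ n -> sound c (deduce st x m n).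
Proof.
move=> h e; rewrite /deduce; case: eqP => [mn|_].
  apply: sound_cons => //; rewrite mulr0n; apply: (@addrI _ (c *+ m)).
  by rewrite e addr0 mn.
case: (n =P m.+1) => [nm|//]; apply: sound_cons => //.
by apply: (@addrI _ (c *+ m)); rewrite e nm mulrSr.
Qed.

Lemma sound_propagate c st e : sound c st ->
  \sum_(x <- e.1) value x = \sum_(x <- e.2) value x -> sound c (propagate st e).
Proof.
move=> h; rewrite (sum_known e.1 h) (sum_known e.2 h) /propagate.
case: [seq x <- e.1 | _] => [|x [|x' L]]; case: [seq x <- e.2 | _] => [|y [|y' L']] //.
- by rewrite big_nil big_seq1 addr0 => E; apply: sound_deduce.
- by rewrite big_nil big_seq1 addr0 => E; apply: sound_deduce.
Qed.

Lemma hom_equation_sound b i j : (i < sdim sh (tgt b))%N -> (j < sdim sh (src b))%N ->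
  \sum_(x <- (hom_equation sh b i j).1) value x = \sum_(x <- (hom_equation sh b i j).2) value x.
Proof.
move=> hi hj; have := hom b => /(congr1 (fun M => ent M i j)); rewrite !ent_mul /=.
rewrite !big_map !big_filter => E.
have pick n (F G : nat -> K) (p : pred nat) : (forall l : 'I_n, F l = G l *+ p l) ->
    \sum_(l <- iota 0 n | p l) G l = \sum_(l < n) F l.
  move=> h; rewrite -val_enum_ord big_map big_enum_cond /= big_mkcond /=.
  by apply: eq_bigr => l _; rewrite h; case: (p l).
have b01 (x : bool) : ((x : nat) == 1%N) = x by case: x.
rewrite (pick _ (fun l => ent (phi (tgt b)) i l * ent (shape_mx sh b) l j)); last first.
  by move=> l; rewrite ent_shape_mx // b01 mulr_natr.
rewrite E (pick _ (fun l => ent (shape_mx sh b) i l * ent (phi (src b)) l j)) //.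
by move=> l; rewrite ent_shape_mx // b01 mulr_natl.
Qed.

Lemma brick_scalar : brick sh -> exists c, forall v, phi v = c%:M.
Proof.
case/hasP=> v0 _ /andP[h0 /allP]; set st := foldl _ _ _ => h; pose c := value (v0, 0%N, 0%N).
have S : sound c st.
  rewrite /st; have : sound c [:: ((v0, 0%N, 0%N), true)].
    by apply: sound_cons.
  have : forall e, e \in flatten (nseq 6 (hom_equations sh)) ->
      \sum_(x <- e.1) value x = \sum_(x <- e.2) value x.
    move=> e /flattenP[es /nseqP[-> _]] /flatten_mapP[b _] /flatten_mapP[i hi] /mapP[j hj ->].
    by apply: hom_equation_sound; [move: hi|move: hj]; rewrite mem_iota.
  elim: (flatten _) [:: _] => //= e es IH st0 he h1; apply: IH => [e' h'|].
    by apply: he; rewrite inE h' orbT.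
  by apply: sound_propagate => //; apply: he; rewrite mem_head.
exists c => v; apply: ent_eq => i j hi hj.
have /allP/(_ i) := h v (mem_vertices v); rewrite mem_iota => /(_ hi)/allP/(_ j).
rewrite mem_iota => /(_ hj)/eqP/S; rewrite /value /= => ->.
by rewrite -[i]/(nat_of_ord (Ordinal hi)) -[j]/(nat_of_ord (Ordinal hj)) entE mxE.
Qed.

End Bricks.

Lemma brick_indecomposable (K : fieldType) sh (comm : scomm sh) :
  brick sh -> indecomposable (rep_of_shape K comm).
Proof.
move=> h; apply: scalar_end_indecomposable => [z|phi hphi]; last exact: (brick_scalar hphi h).
by case/hasP: h => v _ /andP[]; have := z v => /= ->.
Qed.

Definition shape_of (k : 'I_30) := nth (Shape [::] [::] false false) shapes k.

Lemma mem_shape_of k : shape_of k \in shapes.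
Proof. exact: mem_nth. Qed.

Lemma scomm_shape k : scomm (shape_of k).
Proof.
have /allP h : all scomm shapes by vm_compute.
exact: h (mem_shape_of k).
Qed.

Definition Gamma K k : rep K := rep_of_shape K (scomm_shape k).

Lemma Gamma_indecomposable K k : indecomposable (Gamma K k).
Proof.
apply: brick_indecomposable.
have /allP h : all brick shapes by vm_compute.
exact: h (mem_shape_of k).
Qed.

Lemma Gamma_inj K k l : isomorphic (Gamma K k) (Gamma K l) -> k = l.
Proof.
move=> h; have U : uniq (map scode shapes) by vm_compute.
have sz : size (map scode shapes) = 30 by vm_compute.
have lt (i : 'I_30) : val i < size (map scode shapes) by rewrite sz; apply: ltn_ord.
have hk i : nth 0 (map scode shapes) (val i) = scode (shape_of i).
  by apply: nth_map; rewrite -(size_map scode).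
apply/val_inj/eqP; rewrite -(nth_uniq 0 (lt k) (lt l) U) !hk /scode; apply/eqP.
by congr sumn; apply: eq_map => v; have /= -> := iso_dim v h.
Qed.

(** Take the decomposition of an indecomposable and split off its first summand. That summand is not
    zero, so the remaining sum is, and the summand is isomorphic to the whole. *)
Lemma Gamma_complete K : (forall V : rep K, exists D, isomorphic (dsum_of (Gamma K) D) V) ->
  forall I : rep K, indecomposable I -> exists k, isomorphic I (Gamma K k).
Proof.
move=> h I [nz ind]; have [D] := h I; rewrite /dsum_of.
(* [List.In] is used since representations have no decidable equality. *)
have : forall X, List.In X (flatten [seq nseq (D k) (Gamma K k) | k <- enum 'I_30]) ->
    exists k, X = Gamma K k.
  move=> X; elim: (enum _) => //= k ks IH hX.
  have [hk|/IH//] := List.in_app_or _ _ _ hX; exists k.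
  by elim: (D k) hk => //= m IHm [->|/IHm].
case: (flatten _) => [_ e|X L /(_ X (or_introl erefl))[k ->] /iso_sym e].
  by case: nz => v; rewrite -(iso_dim v e).
exists k; have [z|z] := ind _ _ e.
  by have [[]] := Gamma_indecomposable K k.
exact: iso_trans e (dsum_zero_r _ z).
Qed.

(* [P u v] says that the label [u] lives at the vertex [v]; [Yid] links a label at 5
   with one at 6 through [a65], [Zid] with one at 2 through [a25]; [YR], [ZR] and [ZS]
   are their inverses, [ZS] giving the second of two labels linked with one at 2. *)
Record relations (P : nat -> vertex -> bool) (Yid Zid YR ZR ZS : nat -> nat) : Prop := Relations {
  r_int : forall u, interval (P u);
  r_P51 : forall u, P u v5 -> P u v1 -> P u v2;
  r_P53 : forall u, P u v5 -> P u v3 -> P u v6;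
  r_YRP : forall x y, Yid x = y.+1 <-> YR y = x.+1;
  r_Y5 : forall x y, Yid x = y.+1 -> P x v5;
  r_Y6 : forall x y, Yid x = y.+1 -> P y v6;
  r_Ynt : forall x y, Yid x = y.+1 -> x <> y -> [/\ ~~ P y v5, ~~ P y v1, P y v3 -> P y v2 & ~~ P x v6];
  r_Yt : forall u, P u v5 -> P u v6 -> Yid u = u.+1;
  r_Z5 : forall x z, Zid x = z.+1 -> P x v5;
  r_Znot2 : forall x z, Zid x = z.+1 -> ~~ P x v2;
  r_ZY : forall x z y, Zid x = z.+1 -> Yid x = y.+1 -> ~~ P y v2;
  r_Z2 : forall x z, Zid x = z.+1 -> forall v, P z v = veq v v2;
  r_ZRS : forall x z, Zid x = z.+1 -> ZR z = x.+1 \/ ZS z = x.+1;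
  r_ZRP : forall x z, ZR z = x.+1 -> Zid x = z.+1;
  r_ZSP : forall w z, ZS z = w.+1 -> [/\ Zid w = z.+1, Yid w != 0, forall v, P w v = veq v v5 & exists x, [/\ ZR z = x.+1, Yid x = 0 & P x v4]] }.

(** * Connected components of the links *)

Section Components.
Variable P : nat -> vertex -> bool.
Variables Yid Zid YR ZR ZS : nat -> nat.

Hypothesis rel : relations P Yid Zid YR ZR ZS.
Let int := r_int rel.
Let P51 := r_P51 rel.
Let P53 := r_P53 rel.
Let YRP := r_YRP rel.
Let Y5 := r_Y5 rel.
Let Y6 := r_Y6 rel.
Let Ynt := r_Ynt rel.
Let Yt := r_Yt rel.
Let Z5 := r_Z5 rel.
Let Znot2 := r_Znot2 rel.
Let ZY := r_ZY rel.
Let Z2 := r_Z2 rel.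
Let ZRS := r_ZRS rel.
Let ZRP := r_ZRP rel.
Let ZSP := r_ZSP rel.

Definition second u := (Zid u != 0) && (ZS (Zid u).-1 == u.+1).

(** Values are labels plus one, with 0 for an empty slot. If there is a second row, the head is not
    linked through [a65] and slot 1 is the partner of the second row. A head linked with itself
    leaves slot 1 empty. *)
Definition slot g t :=
  let w := if Zid g == 0 then 0 else ZS (Zid g).-1 in
  match t with
  | 0 => g.+1
  | 1 => let y := if w == 0 then Yid g else Yid w.-1 in if y == g.+1 then 0 else y
  | 2 => Zid g
  | _ => w
  end.

(** The representative of a component: it is no second row, no partner at 6 of a different label,
    and no label at 2 linked with a row. *)
Definition head g := [&& ~~ second g, (YR g == 0) || (YR g == g.+1) & ZR g == 0].

Definition own u : nat * nat :=
  if second u then ((ZR (Zid u).-1).-1, 3)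
  else if ZR u != 0 then ((ZR u).-1, 2)
  else if (YR u == 0) || (YR u == u.+1) then (u, 0)
  else let x := (YR u).-1 in
    (if second x then (ZR (Zid x).-1).-1 else x, 1).

Definition present g t v := (slot g t != 0) && P (slot g t).-1 v.
Definition head_shape g :=
  Shape (pvec (present g 0)) (pvec (present g 1)) (slot g 2 != 0) (slot g 3 != 0).

Lemma ZR_inj x x' z : ZR z = x.+1 -> ZR z = x'.+1 -> x = x'.
Proof. by move=> ->; case. Qed.

Variant second_spec u : bool -> Prop :=
| Second z x of Zid u = z.+1 & ZS z = u.+1 & ZR z = x.+1 & Yid x = 0 & P x v4 & x <> u : second_spec u true
| NotSecond of (forall z, Zid u = z.+1 -> ZR z = u.+1 /\ ZS z <> u.+1) : second_spec u false.

Lemma secondP u : second_spec u (second u).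
Proof.
rewrite /second; case ez: (Zid u) => [|z] /=; first by constructor => z; rewrite ez.
case: eqP => [es|ns].
  have [_ nY _ [x [h1 h2 h3]]] := ZSP es.
  apply: (@Second u z x) => // e; by rewrite -e h2 in nY.
by constructor => z'; rewrite ez => -[<-]; have [] := ZRS ez.
Qed.

(* A first row is never second, as the two kinds differ in [Yid]. *)
Lemma first_not_second x z : ZR z = x.+1 -> second x = false.
Proof.
move=> e; case: secondP => // z' x' e1 e2 e3 e4 e5 ne.
by have := ZRP e; rewrite e1 => -[e6]; move: e3; rewrite e6 e => -[e7]; case: ne.
Qed.

Lemma P5_ZR u : P u v5 -> ZR u = 0.
Proof. by move=> p; case e: (ZR u) => [//|x]; have := Z2 (ZRP e) v5; rewrite p. Qed.

Lemma P5_YR u : P u v5 -> (YR u == 0) || (YR u == u.+1).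
Proof.
move=> p; case e: (YR u) => [//|x] /=; rewrite eqSS; apply/eqP => //.
have /YRP e' := e; case: (x =P u) => // /(Ynt e')[]; by rewrite p.
Qed.

(** With [slot_own] this makes [own] and [slot] inverse to each other, so every label lies in
    exactly one slot of one component. *)
Lemma own_slot g t u : head g -> t < 4 -> slot g t = u.+1 -> own u = (g, t).
Proof.
case/and3P=> ns yg /eqP zg; rewrite /own; case: t => [|[|[|[|//]]]] _ /=.
- by move=> [<-]; rewrite (negPf ns) zg /= yg.
- case ez: (Zid g) => [|z] /=.
    case: eqP => // ny ey; have ngu : g <> u by move=> e; apply: ny; rewrite ey e.
    have [n5 n1 _ n6] := Ynt ey ngu.
    have -> : second u = false by case: secondP => // z x /Z5; rewrite (negPf n5).
    have -> : ZR u = 0 by case e: (ZR u) => [//|x]; have := Z2 (ZRP e) v6; rewrite (Y6 ey).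
    have /YRP -> := ey; rewrite /= eqSS (introF eqP ngu).
    by have -> : second g = false by apply/negbTE.
  case es: (ZS z) => [|w] /=.
    case: eqP => // ny ey; have ngu : g <> u by move=> e; apply: ny; rewrite ey e.
    have [n5 n1 _ n6] := Ynt ey ngu.
    have -> : second u = false by case: secondP => // z' x /Z5; rewrite (negPf n5).
    have -> : ZR u = 0 by case e: (ZR u) => [//|x]; have := Z2 (ZRP e) v6; rewrite (Y6 ey).
    have /YRP -> := ey; rewrite /= eqSS (introF eqP ngu).
    by have -> : second g = false by apply/negbTE.
  have [ew nw pw [x [h1 h2 h3]]] := ZSP es.
  case: eqP => // ny ey.
  (* The second row [w] lives at 5 only, whereas the partner [u] lives at 6. *)
  have ngu : w <> u.
    by move=> e; have := Y6 ey; rewrite -e pw.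
  have [n5 n1 _ n6] := Ynt ey ngu.
  have -> : second u = false by case: secondP => // z' x' /Z5; rewrite (negPf n5).
  have -> : ZR u = 0 by case e: (ZR u) => [//|x']; have := Z2 (ZRP e) v6; rewrite (Y6 ey).
  have /YRP -> := ey; rewrite /= eqSS (introF eqP ngu).
  have -> : second w by rewrite /second ew /= es.
  have -> : ZR (Zid w).-1 = g.+1; last by [].
  rewrite ew /=; have [//|e] := ZRS ez.
  by move: ns; rewrite /second ez e /= eqxx.
- move=> ez; have -> : second u = false.
    by case: secondP => // z x /Z5; rewrite (Z2 ez).
  have [->//|e] := ZRS ez.
  by move: ns; rewrite /second ez e /= eqxx.
case ez: (Zid g) => [//|z] /= es.
have [ew nw pw [x [h1 h2 h3]]] := ZSP es.
have -> : second u by rewrite /second ew /= es.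
rewrite ew /=; have [->//|e] := ZRS ez.
by move: ns; rewrite /second ez e /= eqxx.
Qed.

Lemma slot_own u : [/\ head (own u).1, (own u).2 < 4 & slot (own u).1 (own u).2 = u.+1].
Proof.
rewrite /own; case: secondP => [z x ez es er eY p4 nx|h1].
  rewrite ez er /= (ZRP er) /= es; split=> //.
  by rewrite /head (first_not_second er) P5_ZR ?P5_YR // (Z5 (ZRP er)).
case e: (ZR u) => [|x] /=; last first.
  split; rewrite ?(ZRP e) //.
  by rewrite /head (first_not_second e) P5_ZR ?P5_YR // (Z5 (ZRP e)).
case: ifP => /= [yu|nyu].
  rewrite /head yu e eqxx !andbT; split=> //.
  by case: secondP => // z x ez es; have [] := h1 z ez.
case ey: (YR u) nyu => [//|x] /=; rewrite eqSS => /eqP nx.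
have /YRP ex := ey.
case: secondP => [z x' ez es er eY p4 nx'|hx].
  rewrite ez er /= (ZRP er) /= es /= ex; split=> //.
    by rewrite /head (first_not_second er) P5_ZR ?P5_YR // (Z5 (ZRP er)).
  case: eqP => // -[e']; have := Z5 (ZRP er); rewrite -e'.
  by have [/negPf->] := Ynt ex nx.
split=> //.
  rewrite /head P5_ZR ?P5_YR ?(Y5 ex) // !andbT.
  by case: secondP => // z x' ez es; have [] := hx z ez.
case ez: (Zid x) => [|z] /=; first by rewrite ex eqSS; case: eqP => // e'; case: nx.
have [er ns] := hx z ez.
case es: (ZS z) => [|w] /=; first by rewrite ex eqSS; case: eqP => // e'; case: nx.
have [ew nw pw [x' [h2 h3 h4]]] := ZSP es.
by move: h3; rewrite (ZR_inj h2 er) ex.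
Qed.

Lemma own_inj u u' : own u = own u' -> u = u'.
Proof. by move=> e; have [_ _] := slot_own u; rewrite e; have [_ _ ->] := slot_own u'; case. Qed.

Lemma own5 u : P u v5 -> own u = if second u then ((ZR (Zid u).-1).-1, 3) else (u, 0).
Proof. by move=> p; rewrite /own (P5_ZR p) (P5_YR p). Qed.

Lemma head_shape5 g t s : slink65 (head_shape g) t s =
  if slot g 3 != 0 then (t == 3) && (s == 1)
  else (t == 0) && (if P g v5 && P g v6 then s == 0 else s == 1).
Proof. by rewrite /slink65 /= /present /= . Qed.

Definition link b u' u :=
  match b with
  | a65 => Yid u' == u.+1
  | a25 => [|| u' == u, Yid u' == u.+1 | Zid u' == u.+1]
  | _ => u' == u
  end.

Definition same_head u' u := (own u').1 == (own u).1.

Lemma link_eq u' u : (u' == u) = same_head u' u && ((own u').2 == (own u).2).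
Proof.
apply/eqP/andP => [->|[/eqP h1 /eqP h2]]; first by rewrite /same_head !eqxx.
by apply: own_inj; apply: injective_projections.
Qed.

Lemma link65 u' u : P u' v5 ->
  (Yid u' == u.+1) = same_head u' u && slink65 (head_shape (own u).1) (own u').2 (own u).2.
Proof.
move=> p; apply/eqP/andP => [ey|[/eqP e1]].
  case: (u' =P u) => [e|ne].
    have p6 := Y6 ey; subst u'; rewrite /same_head eqxx head_shape5; split=> //.
    have ns : second u = false.
      case: secondP => // z x ez es er eY p4 nx; have [_ _ pw _] := ZSP es.
      by move: p6; rewrite pw.
    rewrite own5 // ns /= p p6 /=; case ez: (Zid u) => [|z] //=.
    case es: (ZS z) => [|w] //=.
    have [_ _ pw [x [h1 h2 h3]]] := ZSP es.
    move: ns; case: secondP => // h; have [er _] := h z ez.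
    by move: h2; rewrite (ZR_inj h1 er) ey.
  have [n5 n1 _ n6] := Ynt ey ne.
  have nsu : second u = false by case: secondP => // z x /Z5; rewrite (negPf n5).
  have zu : ZR u = 0 by case e: (ZR u) => [//|x]; have := Z2 (ZRP e) v6; rewrite (Y6 ey).
  have /YRP yu := ey.
  rewrite /same_head; have -> : own u = (if second u' then (ZR (Zid u').-1).-1 else u', 1).
    by rewrite /own nsu zu yu /= eqSS (introF eqP ne).
  rewrite own5 // head_shape5; case: secondP => [z x ez es er eY p4 nx|h] /=.
    by rewrite eqxx ez /= er /= (ZRP er) /= es /=.
  rewrite eqxx p (negPf n6) /=; split=> //.
  case ez: (Zid u') => [|z] //=; case es: (ZS z) => [|w] //=.
  have [_ _ pw [x [h1 h2 h3]]] := ZSP es; have [er _] := h z ez.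
  by move: h2; rewrite (ZR_inj h1 er) ey.
have [h1 _ s1] := slot_own u'; have [_ _ s2] := slot_own u; move: s1; rewrite e1.
rewrite head_shape5; move: s2; case: (own u) => g s /=.
set w := if Zid g == 0 then _ else _; case: (own u').2 => [|[|[|t]]] /= s2.
- move=> [eg]; subst g; case: eqP => //= w0; rewrite p /=; case: ifP => [p6|_] /eqP es; rewrite es /= in s2.
    by case: s2 => <-; rewrite Yt.
  by move: s2; rewrite -/w w0 /=; case: ifP.
- by move=> _; case: ifP.
- by move=> _; case: ifP.
rewrite -/w => ew; rewrite ew /= => /andP[_ /eqP es]; move: s2; rewrite es /= -/w ew /=.
by case: ifP.
Qed.

Lemma link25 u' u : P u' v5 ->
  (Zid u' == u.+1) = [&& same_head u' u, slot (own u).1 2 != 0, ((own u').2 == 0) || ((own u').2 == 3) & (own u).2 == 2].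
Proof.
move=> p; apply/eqP/and4P => [ez|[/eqP e1 _ t03 /eqP es]].
  have nsu : second u = false by case: secondP => // z x /Z5; rewrite (Z2 ez).
  rewrite /same_head own5 //; case: secondP => [z x ez' es er eY p4 nx|h].
    have ezu : z = u by move: ez'; rewrite ez => -[].
    subst z; have eo : own u = (x, 2) by rewrite /own nsu er.
    by rewrite eo ez /= er /= (ZRP er) !eqxx.
  have [er _] := h u ez; have eo : own u = (u', 2) by rewrite /own nsu er.
  by rewrite eo /= ez !eqxx.
have [_ _ s1] := slot_own u'; have [_ _ s2] := slot_own u; move: s1 s2; rewrite e1 es /=.
case: (own u').2 t03 => [_ [<-] //|[//|[//|[_|//]]]] /=.
by move=> ew ez; move: ew; rewrite ez /= => /ZSP[].
Qed.

(** Links never leave a component, and inside it they depend only on the slots and the shape. This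
    is what makes the final matrices block diagonal with blocks from the list. *)
Lemma link_slink b u' u : P u' (tgt b) -> P u (src b) ->
  link b u' u = same_head u' u && slink b (head_shape (own u).1) (own u').2 (own u).2.
Proof.
case: b => p' p; try exact: link_eq u' u; first exact: link65 p'.
rewrite [LHS]/link (link_eq u' u) (link65 u p') (link25 u p') [slink _ _ _ _]/slink.
by case: (same_head u' u) => //=; rewrite orbA.
Qed.

Lemma head_shape_spres g t v : spres (head_shape g) t v = if t < 4 then present g t v else present g 3 v.
Proof.
have z2 : (slot g 2 != 0) && veq v v2 = present g 2 v.
  by rewrite /present /=; case ez: (Zid g) => [//|z] /=; rewrite (Z2 ez).
have w5 : (slot g 3 != 0) && veq v v5 = present g 3 v.
  rewrite /present /=; case ez: (Zid g) => [//|z] /=; case es: (ZS z) => [//|w] /=.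
  by have [_ _ -> _] := ZSP es.
by case: t => [|[|[|[|t]]]] /=; rewrite ?pvecE.
Qed.

Lemma pvec_mem px : pvec px \in allvecs.
Proof. by apply: (@pvec_all (fun l => l \in allvecs)); apply/allP. Qed.

Lemma has_pvec (px : vertex -> bool) : reflect (exists v, px v) (has id (pvec px)).
Proof.
apply: (iffP hasP) => [[b hb pb]|[v pv]].
  move: hb; rewrite !inE => /or4P[|||/or3P[]] /eqP e; rewrite e in pb; eexists; exact: pb.
by exists (px v) => //; rewrite !inE; case: v {pv}; rewrite eqxx ?orbT.
Qed.

Lemma slot1_spec g y : head g -> slot g 1 = y.+1 ->
  exists2 x, Yid x = y.+1 /\ x <> y & x = g \/ slot g 3 = x.+1.
Proof.
rewrite /=; set w := if Zid g == 0 then _ else _ => hg; case: eqP => // ne.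
have hx x : Yid x = y.+1 -> x = y -> g <> y -> slot g 3 = x.+1 -> False.
  rewrite /= -/w /w; case ez: (Zid g) => [//|z] /= ex exy ng /ZSP[_ _ pw _].
  by have := Y6 ex; rewrite -exy pw.
case ew: w ne hx => [|x] /= ne hx e; first by exists g; [split=> // eg; apply: ne; rewrite e eg|left].
exists x; [split=> // ex|by right; rewrite -/w].
by apply: (hx x e ex); rewrite -/w // => eg; apply: ne; rewrite e eg.
Qed.

Lemma head_shape_valid g v : head g -> P g v -> valid (head_shape g).
Proof.
move=> hg pv; rewrite /valid -[sx _]/(pvec (P g)) -[sy _]/(pvec (present g 1)) -[sz _]/(slot g 2 != 0) -[sw _]/(slot g 3 != 0).
rewrite (interval_ext (pvecE _)) int !pvecE andTb.
have -> : has id (pvec (P g)) by apply/has_pvec; exists v.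
rewrite andTb; apply/and4P; split.
- by apply/implyP => p5; apply/andP; split; apply/implyP; [apply: P51|apply: P53].
- apply/implyP => /has_pvec[u]; rewrite /present; case e: (slot g 1) => [//|y] _ /=.
  have [x [ex ne] hx] := slot1_spec hg e.
  have [n5 n1 p32 n6] := Ynt ex ne.
  rewrite (interval_ext (pvecE _)) int (Y6 ex) n5 n1 /=.
  have -> : P y v3 ==> P y v2 by apply/implyP.
  case: hx => [eg|es] /=; first by rewrite -eg n6 (Y5 ex).
  move: es => /=; case ez: (Zid g) => [//|z] /= es; rewrite (Z5 ez) /=.
  have [ew _ _ [x' [h1 h2 h3]]] := ZSP es.
  have [er|er] := ZRS ez; last first.
    by case/and3P: hg; rewrite /second ez /= er eqxx.
  have eg := ZR_inj er h1; subst x'.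
  (* The head is the first row of its column, hence not linked through [a65]; living at 6 it would
     be linked with itself. *)
  by apply/negP => p6; move: (Yt (Z5 ez) p6); rewrite h2.
- rewrite [slot g 2]/=; case ez: (Zid g) => [//|z]; rewrite (Z5 ez) (negPf (Znot2 ez)) /present.
  case e: (slot g 1) => [//|y] /=.
  have [x [ex ne] [eg|es]] := slot1_spec hg e; first by apply: (ZY ez); rewrite -eg.
  by move: es; rewrite /= ez => /ZSP[ew _ _ _]; apply: (ZY ew ex).
case es: (slot g 3) => [//|w].
have := es; rewrite /=; case ez: (Zid g) => [//|z] /= es'.
have [ew nw pw [x [h1 h2 h3]]] := ZSP es'.
have eg : g = x.
  have [er|er] := ZRS ez; first exact: ZR_inj er h1.
  by case/and3P: hg; rewrite /second ez /= er eqxx.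
rewrite eg h3 /=; apply/has_pvec; case ey: (Yid w) nw => [//|y] _; exists v6.
rewrite /present -eg /= ez /= es' /= ey eqSS.
case: (y =P g) => [e|_] /=; last by apply: (Y6 ey).
have ng : w <> y.
  by move=> e'; have := Y6 ey; rewrite -e' pw.
by have [] := Ynt ey ng; rewrite e (Z5 ez).
Qed.

Lemma head_shape_mem g v : head g -> P g v -> head_shape g \in shapes.
Proof.
move=> hg pv; have -> : shapes = shapes0 by vm_compute.
rewrite /shapes0 mem_filter (head_shape_valid hg pv) andTb.
apply/flatten_mapP; exists (pvec (present g 0)); first exact: pvec_mem.
apply/flatten_mapP; exists (pvec (present g 1)); first exact: pvec_mem.
by rewrite /head_shape; case: (slot g 2 != 0); case: (slot g 3 != 0); rewrite !inE eqxx ?orbT.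
Qed.

End Components.

(** * Links between labels *)

Definition record x cE kE vE :=
  For 4 (NDim v5) (If (cE (V 4)) (Store x (kE (V 4)) (NAdd (vE (V 4)) (NConst 1))) Skip).
Definition first_rowE i := NAdd (NLoad 61 i) (NLoad 63 i).
Definition any_rowE i := NAdd (first_rowE i) (NLoad 65 i).
(** The sum of all labels, each plus one, exceeds every label, and natural numbers are free of
    charge. *)
Definition bound_ids v :=
  For 4 (NDim v) (Store 75 (NConst 0) (NAdd (NLoad 75 (NConst 0)) (NAdd (IDe v (V 4)) (NConst 1)))).

Definition predE e := NSub e (NConst 1).
(** The output permutes the basis vectors, so the links are rewritten from positions to labels,
    which stay attached to their vectors. *)
Definition freeze := seqs ([::
  record 70 YE (IDe v5) (fun i => predE (YE i));
  record 71 any_rowE (IDe v5) (fun i => IDe v2 (predE (any_rowE i)));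
  record 72 YE (fun i => predE (YE i)) (IDe v5);
  record 73 first_rowE (fun i => IDe v2 (predE (first_rowE i))) (IDe v5);
  record 74 (NLoad 65) (fun i => IDe v2 (predE (NLoad 65 i))) (IDe v5)] ++
  [seq bound_ids v | v <- vertices]).

Section Freeze.
Variables (K : fieldType) (d : vertex -> nat).
Implicit Types (s : state K d).

Definition records n (c : nat -> bool) (key val : nat -> nat) (f : nat -> nat) :=
  forall u w, f u = w.+1 <-> exists i, [/\ i < n, c i, key i = u & val i = w].

Definition keep_but x s s' := mx s' = mx s /\ forall y k, 9 < y -> y != x -> arr s' y k = arr s y k.

Lemma record_runs s x cE kE vE c key val : 9 < x ->
  (forall s1 e, keep_but x s s1 -> [/\ (neval s1 (cE e) != 0) = c (neval s1 e),
     neval s1 (kE e) = key (neval s1 e) & neval s1 (vE e) = val (neval s1 e)]) ->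
  (forall i i', i < d v5 -> i' < d v5 -> c i -> c i' -> key i = key i' -> i = i') ->
  (forall k, arr s x k = 0) ->
  runs (record x cE kE vE) s 0 (fun s' => keep_but x s s' /\ records (d v5) c key val (arr s' x)).
Proof.
move=> hx ev inj z.
pose I n s1 := keep_but x s s1 /\ records n c key val (arr s1 x).
have setI n s1 k : I n s1 -> I n (set_mem s1 4 0 k).
  move=> [[h1 h2] h3]; split; [split=> // y l hy ny /=|move=> u w /=].
    by rewrite gtn_eqF ?h2 // (leq_trans _ hy).
  by rewrite gtn_eqF ?(leq_trans _ hx) //; apply: h3.
apply: (@runs_for _ _ _ _ _ _ (d v5) 0 _ I) => //; last by rewrite muln0.
  by apply: setI; split=> // u w; rewrite z; split=> // -[i []].
move=> n s1 hn I1 e4.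
have e4' : neval s1 (V 4) = n by rewrite /= e4.
have [E1 E2 E3] := ev s1 (V 4) I1.1; rewrite e4' in E1 E2 E3.
apply: (runs_ifb E1) => cn.
  apply: runs_store; rewrite [neval _ (NAdd _ _)]/= E2 E3 addn1; split.
    by rewrite /= ltn_eqF ?e4 // (leq_trans _ hx).
  apply: setI; split.
    case: I1 => -[h1 h2] _; split=> // y k hy ny /=; rewrite (negPf ny) h2 //.
  move=> u w /=; rewrite eqxx /=; case: (u =P key n) => [->|nu].
    split=> [[<-]|[i [hi ci ki <-]]]; first by exists n.
    move: hi; rewrite ltnS leq_eqVlt => /orP[/eqP->//|hi].
    by have := inj i n (ltn_trans hi hn) hn ci cn ki => e; rewrite e ltnn in hi.
  rewrite I1.2; split=> -[i [hi ci ki vi]]; exists i; split=> //; first exact: ltnW.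
  by move: hi; rewrite ltnS leq_eqVlt => /orP[/eqP e|//]; case: nu; rewrite -ki e.
apply: runs_skip; split=> //; apply: setI; split; first exact: I1.1.
move=> u w; rewrite I1.2; split=> -[i [hi ci ki vi]]; exists i; split=> //; first exact: ltnW.
by move: hi; rewrite ltnS leq_eqVlt => /orP[/eqP e|//]; rewrite e (negPf cn) in ci.
Qed.

Lemma bound_ids_runs s v :
  runs (bound_ids v) s 0 (fun s' => [/\ keep_but 75 s s', arr s 75 0 <= arr s' 75 0
    & forall i, i < d v -> arr s (idA v) i < arr s' 75 0]).
Proof.
pose I n s1 := [/\ keep_but 75 s s1, arr s 75 0 <= arr s1 75 0
    & forall i, i < n -> arr s (idA v) i < arr s1 75 0].
have setI n s1 k : I n s1 -> I n (set_mem s1 4 0 k).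
  move=> [[h1 h2] h3 h4]; split=> //; split=> // y l hy ny /=.
  by rewrite gtn_eqF ?h2 // (leq_trans _ hy).
apply: (@runs_for _ _ _ _ _ _ (d v) 0 _ I) => //; last by rewrite muln0.
  exact: setI.
move=> n s1 hn [[h1 h2] h3 h4] e4; apply: runs_store; split; first by rewrite /= e4.
have h9 : 9 < idA v by case: (v).
have n75 : idA v != 75 by case: (v).
rewrite /= e4 (h2 _ _ h9 n75); apply: setI; split=> [|/=|i].
- by split=> // y l hy ny /=; rewrite (negPf ny) /= h2.
- by apply: leq_trans h3 _; rewrite leq_addr.
rewrite ltnS leq_eqVlt /= => /orP[/eqP->|hi]; first by rewrite addn1 addnS ltnS leq_addl.
by apply: leq_trans (h4 i hi) _; rewrite leq_addr.
Qed.

Lemma keep_but_trans x s s1 s2 : keep_but x s s1 -> keep_but x s1 s2 -> keep_but x s s2.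
Proof. by move=> [h1 h2] [h3 h4]; split=> [|y k hy ny]; rewrite ?h3 // h4 ?h2. Qed.

Lemma bounds_runs vs s :
  runs (seqs [seq bound_ids v | v <- vs]) s 0 (fun s' => [/\ keep_but 75 s s', arr s 75 0 <= arr s' 75 0
    & forall v, v \in vs -> forall i, i < d v -> arr s (idA v) i < arr s' 75 0]).
Proof.
elim: vs s => [|v vs IH] s; first by apply: runs_skip.
apply: (@runs_seq _ _ _ _ _ 0 0) => //.
apply: runs_weak (bound_ids_runs s v) (leqnn _) _ => s1 [k1 l1 b1].
apply: runs_weak (IH s1) (leqnn _) _ => s2 [k2 l2 b2]; split.
- exact: keep_but_trans k1 k2.
- exact: leq_trans l1 l2.
move=> w; rewrite inE => /orP[/eqP->|hw] i hi; first exact: leq_trans (b1 i hi) l2.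
by rewrite -k1.2 ?b2 //; case: (w).
Qed.

End Freeze.

Section FreezeRows.
Local Open Scope ring_scope.
Variables (K : fieldType) (W : rep K).
Notation d := (rdim W).
Variables (A : nat -> nat -> nat) (Y : nat -> nat).
Hypotheses (ok : labels_ok d A).
Hypothesis (Yinj : forall i i' u, (i < d v5)%N -> (i' < d v5)%N -> Y i = u.+1 -> Y i' = u.+1 -> i = i').
Notation id5 i := (A (idA v5) i).
Notation id2 j := (A (idA v2) j).
Variables r1 c1 r2 c2 r3 c3 : nat -> nat.
Hypothesis mt1 : matching a25 d (fun j => pure A (id2 j)) (block1 A Y) r1 c1.
Hypothesis mt2 : matching a25 d (fun j => pure A (id2 j) && (c1 j == 0%N)) (block2 A Y) r2 c2.
Hypothesis mt3 : matching a25 d (cols3 A c1) (block3 A Y r2) r3 c3.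

(** The second sweep uses only columns without a pivot in the first, so a column has at most one
    first row. *)
Lemma first_row_inj i i' j : (r1 i + r2 i = j.+1)%N -> (r1 i' + r2 i' = j.+1)%N -> i = i'.
Proof.
have h k : (r1 k + r2 k = j.+1)%N -> r1 k = j.+1 \/ r2 k = j.+1.
  case e: (r1 k) => [|l] e2; first by right.
  have [_ b1 _ _ _] := mt1.1 _ _ e; left; case e': (r2 k) e2 => [|l']; rewrite ?addn0 //.
  by have [_ /andP[_ b2] _ _ _] := mt2.1 _ _ e'; move: b1; rewrite /block1 b2 andbF.
case/h=> e; case/h=> e'.
- have [_ _ _ _ g] := mt1.1 _ _ e; have [_ _ _ _ g'] := mt1.1 _ _ e'.
  by move: g'; rewrite g => -[].
- have [_ _ _ _ g] := mt1.1 _ _ e; have [_ _ _ /andP[_ /eqP g'] _] := mt2.1 _ _ e'.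
  by move: g'; rewrite g.
- have [_ _ _ _ g] := mt1.1 _ _ e'; have [_ _ _ /andP[_ /eqP g'] _] := mt2.1 _ _ e.
  by move: g'; rewrite g.
have [_ _ _ _ g] := mt2.1 _ _ e; have [_ _ _ _ g'] := mt2.1 _ _ e'.
by move: g'; rewrite g => -[].
Qed.

Definition frozen (B : nat -> nat -> nat) :=
  [/\ records (d v5) (fun i => Y i != 0%N) (fun i => id5 i) (fun i => (Y i).-1) (B 70),
      records (d v5) (fun i => (r1 i + r2 i + r3 i != 0)%N) (fun i => id5 i) (fun i => id2 (r1 i + r2 i + r3 i).-1) (B 71),
      records (d v5) (fun i => Y i != 0%N) (fun i => (Y i).-1) (fun i => id5 i) (B 72),
      records (d v5) (fun i => (r1 i + r2 i != 0)%N) (fun i => id2 (r1 i + r2 i).-1) (fun i => id5 i) (B 73)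
    & records (d v5) (fun i => (r3 i != 0)%N) (fun i => id2 (r3 i).-1) (fun i => id5 i) (B 74)].

Lemma first_row_lt i : (r1 i + r2 i != 0)%N -> ((r1 i + r2 i).-1 < d v2)%N.
Proof.
case e: (r1 i) => [|j]; last first.
  have [_ b1 h _ _] := mt1.1 _ _ e; case e': (r2 i) => [|l']; rewrite ?addn0 //.
  by have [_ /andP[_ b2] _ _ _] := mt2.1 _ _ e'; move: b1; rewrite /block1 b2 andbF.
by case e': (r2 i) => [//|l']; have [_ _ h _ _] := mt2.1 _ _ e'.
Qed.

Lemma freeze_runs (s : state K d) : ctx A Y s ->
  (forall k, arr s 61 k = r1 k) -> (forall k, arr s 63 k = r2 k) -> (forall k, arr s 65 k = r3 k) ->
  (forall x k, (67 <= x)%N -> arr s x k = 0%N) ->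
  runs freeze s 0 (fun s' => [/\ mx s' = mx s, same_labels A (arr s'), frozen (arr s'),
     forall v i, (i < d v)%N -> (A (idA v) i < arr s' 75 0)%N & forall x k, (75 < x)%N -> arr s' x k = 0%N]).
Proof.
move=> [es eY] e61 e63 e65 z.
pose same (s1 : state K d) := [/\ mx s1 = mx s, same_labels A (arr s1) &
  [/\ forall k, arr s1 50 k = Y k, forall k, arr s1 61 k = r1 k, forall k, arr s1 63 k = r2 k & forall k, arr s1 65 k = r3 k]].
have same_but x s1 s2 : (67 <= x)%N -> same s1 -> keep_but x s1 s2 -> same s2.
  move=> hx [m1 h1 [h2 h3 h4 h5]] [m2 k2]; split; first by rewrite m2.
    by move=> v k; rewrite !k2; try exact: h1; case: v => //; apply/negP => /eqP ex; rewrite -ex in hx.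
  by split=> k; rewrite k2 // ltn_eqF // (leq_trans _ hx).
have same0 : same s by [].
have id_lab s1 e v : same s1 -> neval s1 (IDe v e) = A (idA v) (neval s1 e).
  by case=> _ h _ /=; rewrite (h v _).1.
rewrite /freeze.
apply: (@runs_cat _ _ _ _ _ 0 0) => //.
apply: (@runs_seq _ _ _ _ _ 0 0) => //.
apply: runs_weak (@record_runs K d s 70 _ _ _ (fun i => Y i != 0%N) (fun i => id5 i) (fun i => (Y i).-1) isT _ _ _) (leqnn _) _.
- move=> s1 e /(same_but 70 _ _ isT same0) h; have [_ _ [h1 _ _ _]] := h.
  by split; rewrite ?id_lab //= h1 // subn1.
- by move=> i i' hi hi' _ _; apply: (id_inj ok hi hi').
- by move=> k; apply: z.
move=> s1 [k1 R1]; have same1 := same_but 70 _ _ isT same0 k1.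
have z1 x k : (70 < x)%N -> arr s1 x k = 0%N.
  by move=> hx; rewrite k1.2 ?z ?gtn_eqF // (leq_trans _ hx).
apply: (@runs_seq _ _ _ _ _ 0 0) => //.
apply: runs_weak (@record_runs K d s1 71 _ _ _ (fun i => r1 i + r2 i + r3 i != 0)%N (fun i => id5 i)
  (fun i => id2 (r1 i + r2 i + r3 i).-1) isT _ _ _) (leqnn _) _.
- move=> s2 e /(same_but 71 _ _ isT same1) h; have [_ _ [_ h1 h2 h3]] := h.
  by split; rewrite ?id_lab //= !(h1, h2, h3) // subn1.
- by move=> i i' hi hi' _ _; apply: (id_inj ok hi hi').
- by move=> k; apply: z1.
move=> s2 [k2 R2]; have same2 := same_but 71 _ _ isT same1 k2.
have z2 x k : (71 < x)%N -> arr s2 x k = 0%N.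
  by move=> hx; rewrite k2.2 ?z1 ?gtn_eqF // (leq_trans _ hx).
apply: (@runs_seq _ _ _ _ _ 0 0) => //.
apply: runs_weak (@record_runs K d s2 72 _ _ _ (fun i => Y i != 0%N) (fun i => (Y i).-1) (fun i => id5 i) isT _ _ _) (leqnn _) _.
- move=> s3 e /(same_but 72 _ _ isT same2) h; have [_ _ [h1 _ _ _]] := h.
  by split; rewrite ?id_lab //= h1 // subn1.
- move=> i i' hi hi' bi bi' e; apply: (Yinj hi hi' (Y_pred bi)).
  by rewrite e; apply: Y_pred.
- by move=> k; apply: z2.
move=> s3 [k3 R3]; have same3 := same_but 72 _ _ isT same2 k3.
have z3 x k : (72 < x)%N -> arr s3 x k = 0%N.
  by move=> hx; rewrite k3.2 ?z2 ?gtn_eqF // (leq_trans _ hx).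
apply: (@runs_seq _ _ _ _ _ 0 0) => //.
apply: runs_weak (@record_runs K d s3 73 _ _ _ (fun i => r1 i + r2 i != 0)%N (fun i => id2 (r1 i + r2 i).-1)
  (fun i => id5 i) isT _ _ _) (leqnn _) _.
- move=> s4 e /(same_but 73 _ _ isT same3) h; have [_ _ [_ h1 h2 h3]] := h.
  by split; rewrite ?id_lab //= !(h1, h2) // subn1.
- move=> i i' hi hi' bi bi' /(id_inj ok (first_row_lt bi) (first_row_lt bi')).
  case e: (r1 i + r2 i)%N bi => [//|j] _; case e': (r1 i' + r2 i')%N bi' => [//|j'] _ /= jj.
  by apply: (first_row_inj e); rewrite e' jj.
- by move=> k; apply: z3.
move=> s4 [k4 R4]; have same4 := same_but 73 _ _ isT same3 k4.
have z4 x k : (73 < x)%N -> arr s4 x k = 0%N.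
  by move=> hx; rewrite k4.2 ?z3 ?gtn_eqF // (leq_trans _ hx).
apply: (@runs_seq _ _ _ _ _ 0 0) => //.
apply: runs_weak (@record_runs K d s4 74 _ _ _ (fun i => r3 i != 0)%N (fun i => id2 (r3 i).-1)
  (fun i => id5 i) isT _ _ _) (leqnn _) _.
- move=> s5 e /(same_but 74 _ _ isT same4) h; have [_ _ [_ h1 h2 h3]] := h.
  by split; rewrite ?id_lab //= !h3 // subn1.
- move=> i i' hi hi'; case e: (r3 i) => [//|j] _; case e': (r3 i') => [//|j'] _ /= ee.
  have [_ _ h1 _ g] := mt3.1 _ _ e; have [_ _ h2 _ g'] := mt3.1 _ _ e'.
  by move: g'; rewrite -(id_inj ok h1 h2 ee) g => -[].
- by move=> k; apply: z4.
move=> s5 [k5 R5]; have same5 := same_but 74 _ _ isT same4 k5.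
have z5 x k : (74 < x)%N -> arr s5 x k = 0%N.
  by move=> hx; rewrite k5.2 ?z4 ?gtn_eqF // (leq_trans _ hx).
apply: runs_skip.
apply: runs_weak (bounds_runs vertices s5) (leqnn _) _ => s6 [k6 _ b6].
have [m6 l6 _] := same_but 75 _ _ isT same5 k6; have [_ l5 _] := same5.
split=> //.
- rewrite /frozen; split.
  + by move=> u w; rewrite k6.2 // k5.2 // k4.2 // k3.2 // k2.2.
  + by move=> u w; rewrite k6.2 // k5.2 // k4.2 // k3.2.
  + by move=> u w; rewrite k6.2 // k5.2 // k4.2.
  + by move=> u w; rewrite k6.2 // k5.2.
  by move=> u w; rewrite k6.2.
- by move=> v i hi; rewrite -(l5 v i).1; apply: b6 => //; apply: mem_vertices.
by move=> x k hx; rewrite k6.2 ?z5 ?gtn_eqF // ?(ltnW hx) // (leq_trans _ hx).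
Qed.

End FreezeRows.

Section FrozenRelations.
Local Open Scope ring_scope.
Variables (K : fieldType) (W : rep K).
Notation d := (rdim W).
Variables (A : nat -> nat -> nat) (Y : nat -> nat).
Hypotheses (ok : labels_ok d A) (int : forall u, interval (pres A u)).
Hypothesis (Y6 : forall i u, (i < d v5)%N -> Y i = u.+1 -> pres A u v6).
Hypothesis (Yinj : forall i i' u, (i < d v5)%N -> (i' < d v5)%N -> Y i = u.+1 -> Y i' = u.+1 -> i = i').
Hypothesis (Yt : forall i, (i < d v5)%N -> pres A (A (idA v5) i) v6 -> Y i = (A (idA v5) i).+1).
Notation id5 i := (A (idA v5) i).
Notation id2 j := (A (idA v2) j).
Variables (m : mxs K d) (B : nat -> nat -> nat) (r1 c1 r2 c2 r3 c3 : nat -> nat).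
Hypothesis inv : closed_inv A Y m.
Hypothesis mt1 : matching a25 d (fun j => pure A (id2 j)) (block1 A Y) r1 c1.
Hypothesis mt2 : matching a25 d (fun j => pure A (id2 j) && (c1 j == 0%N)) (block2 A Y) r2 c2.
Hypothesis mt3 : matching a25 d (cols3 A c1) (block3 A Y r2) r3 c3.
Hypothesis fr : frozen W A Y r1 r2 r3 B.
Hypothesis f25 : forall i j, (i < d v5)%N -> (j < d v2)%N -> pure A (id2 j) ->
  ent (m (Str a25)) i j = ((r1 i + r2 i + r3 i)%N == j.+1)%:R.

Definition row_at i j := [/\ (i < d v5)%N, (j < d v2)%N, good A Y i & pure A (id2 j)].

Lemma any_rowP i j : (r1 i + r2 i + r3 i = j.+1)%N -> row_at i j /\
  ((r1 i + r2 i = j.+1)%N /\ r3 i = 0%N \/ r3 i = j.+1 /\ (r1 i + r2 i = 0)%N).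
Proof.
case e3: (r3 i) => [|k].
  rewrite addn0; case e1: (r1 i) => [|k]; last first.
    have [h1 b1 h2 h3 _] := mt1.1 _ _ e1; case e2: (r2 i) => [|l].
      by rewrite addn0 => -[<-]; split; [split=> //; case/andP: b1|left].
    by have [_ /andP[_ b2] _ _ _] := mt2.1 _ _ e2; move: b1; rewrite /block1 b2 andbF.
  rewrite add0n => e2; have [h1 /andP[h4 _] h2 /andP[h3 _] _] := mt2.1 _ _ e2.
  by split; [split|left].
have [h1 /and3P[/andP[h4 h5] _ /eqP r20] h2 /andP[h3 _] _] := mt3.1 _ _ e3.
case e1: (r1 i) => [|l]; last first.
  by have [_ /andP[_] ] := mt1.1 _ _ e1; rewrite h5.
by rewrite r20 !add0n => -[<-]; split; [split|right].
Qed.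

Lemma first_rowP i j : (r1 i + r2 i = j.+1)%N -> row_at i j /\ (r1 i + r2 i + r3 i = j.+1)%N.
Proof.
move=> e; have : (r1 i + r2 i + r3 i = (j + r3 i).+1)%N by rewrite e.
move=> e'; have [ra [[e2 e3]|[e2 e3]]] := any_rowP e'; last by rewrite e in e3.
by move: ra; rewrite e3 !addn0.
Qed.

Lemma Yid_id i : (i < d v5)%N -> B 70 (id5 i) = Y i.
Proof.
move=> hi; have [h _ _ _ _] := fr; case e: (B 70 (id5 i)) => [|y].
  case eY: (Y i) => [//|y]; have /h : exists i', [/\ (i' < d v5)%N, Y i' != 0%N, id5 i' = id5 i & (Y i').-1 = y].
    by exists i; rewrite eY.
  by rewrite e.
have /h[i' [hi' n0 /(id_inj ok hi' hi) <- <-]] := e.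
by case: (Y i') n0.
Qed.

Lemma Zid_id i z : (i < d v5)%N -> B 71 (id5 i) = z.+1 <->
  exists j, (r1 i + r2 i + r3 i = j.+1)%N /\ id2 j = z.
Proof.
move=> hi; have [_ h _ _ _] := fr; rewrite h; split.
  case=> i' [hi' + /(id_inj ok hi' hi) e1]; rewrite e1; case: (r1 i + _ + _)%N => [//|j] _ /= e.
  by exists j.
by case=> j [e e']; exists i; rewrite e.
Qed.

Local Notation Yid := (B 70).
Local Notation Zid := (B 71).
Local Notation YR := (B 72).
Local Notation ZR := (B 73).
Local Notation ZS := (B 74).

Let tr : tree tree5 A m. Proof. by case: inv. Qed.

Lemma rel_YRP x y : Yid x = y.+1 <-> YR y = x.+1.
Proof. by have [h _ h' _ _] := fr; rewrite h h'; split=> -[i [? ? ? ?]]; exists i. Qed.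

Lemma rel_row x y : Yid x = y.+1 -> exists i, [/\ (i < d v5)%N, id5 i = x & Y i = y.+1].
Proof.
by have [h _ _ _ _] := fr => /h[i [hi n0 ei <-]]; exists i; split=> //; case: (Y i) n0.
Qed.

Lemma rel_Y5 x y : Yid x = y.+1 -> pres A x v5.
Proof. by case/rel_row => i [hi <- _]; rewrite (id_pres ok). Qed.

Lemma rel_Y6 x y : Yid x = y.+1 -> pres A y v6.
Proof. by case/rel_row => i [hi _]; apply: Y6. Qed.

Lemma rel_Yt u : pres A u v5 -> pres A u v6 -> Yid u = u.+1.
Proof.
by move=> p5 p6; rewrite -{1}(pos_id ok p5) Yid_id ?(pos_lt ok) // Yt ?(pos_id ok) ?(pos_lt ok).
Qed.

Lemma rel_Ynt x y : Yid x = y.+1 -> x <> y ->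
  [/\ ~~ pres A y v5, ~~ pres A y v1, pres A y v3 -> pres A y v2 & ~~ pres A x v6].
Proof.
move=> e ne; have p6 := rel_Y6 e.
have [i [hi ei eY]] := rel_row e.
have n5 : ~~ pres A y v5.
  apply/negP => p5; apply: ne; rewrite -ei -(pos_id ok p5).
  congr (A _ _); apply: (Yinj hi (pos_lt ok p5) eY).
  by rewrite Yt ?(pos_id ok) ?(pos_lt ok).
have nz : ent (m (Str a65)) i (pos A y v6) != 0.
  by rewrite inv.2 ?(pos_lt ok) // (pos_id ok) // eY eqxx oner_eq0.
have [n1 h3] := col6_nz ok int tr p6 n5 hi nz; split=> //.
apply/negP => x6; apply: ne; have := Yt hi; rewrite ei => /(_ x6).
by rewrite eY => -[].
Qed.

Lemma rel_Z x z : Zid x = z.+1 -> exists i j, [/\ row_at i j, id5 i = x, id2 j = z & (r1 i + r2 i + r3 i = j.+1)%N].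
Proof.
have [_ h _ _ _] := fr; case/h=> i [hi /= + ei]; case e: (r1 i + _ + _)%N => [//|j] _ ej.
by exists i, j; have [ra _] := any_rowP e.
Qed.

Lemma rel_Z5 x z : Zid x = z.+1 -> pres A x v5.
Proof. by case/rel_Z=> i [j [[hi _ _ _] <- _ _]]; rewrite (id_pres ok). Qed.

Lemma rel_Znot2 x z : Zid x = z.+1 -> ~~ pres A x v2.
Proof. by case/rel_Z=> i [j [[hi _ /andP[h _] _] <- _ _]]. Qed.

Lemma rel_ZY x z y : Zid x = z.+1 -> Yid x = y.+1 -> ~~ pres A y v2.
Proof.
case/rel_Z=> i [j [[hi _ /andP[_ h] _] <- _ _]]; rewrite Yid_id // => eY.
by move: h; rewrite eY.
Qed.

Lemma rel_Z2 x z : Zid x = z.+1 -> forall v, pres A z v = veq v v2.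
Proof. by case/rel_Z=> i [j [[hi hj _ pj] _ <- _]]; apply: (pure2 int) => //; rewrite (id_pres ok). Qed.

Lemma rel_ZRS x z : Zid x = z.+1 -> ZR z = x.+1 \/ ZS z = x.+1.
Proof.
case/rel_Z=> i [j [[hi hj _ pj] <- <- e]]; have [_ _ _ h h'] := fr.
have [_ [[e1 e2]|[e1 e2]]] := any_rowP e; [left; apply/h|right; apply/h']; exists i.
  by rewrite e1.
by rewrite e1.
Qed.

Lemma rel_ZRP x z : ZR z = x.+1 -> Zid x = z.+1.
Proof.
have [_ _ _ h _] := fr; case/h=> i [hi /= + ez <-]; case e: (r1 i + r2 i)%N ez => [//|j] /= ez _.
by apply/Zid_id => //; exists j; have [_ ->] := first_rowP e.
Qed.

(** A row of the third sweep is linked through [a65] and does not live at 4; its column already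
    belongs to an unlinked row living at 4. So two rows share a column only when their types are
    incomparable. *)
Lemma rel_ZSP w z : ZS z = w.+1 -> [/\ Zid w = z.+1, Yid w != 0%N, forall v, pres A w v = veq v v5
  & exists x, [/\ ZR z = x.+1, Yid x = 0%N & pres A x v4]].
Proof.
have [_ _ _ h h'] := fr; case/h'=> i [hi /= + ez <-]; case e: (r3 i) ez => [//|j] /= ez _.
have [_ /and3P[/andP[gi bi] nal /eqP r20] hj /and3P[pj c10 al1] _] := mt3.1 _ _ e.
have r10 : r1 i = 0%N by case e1: (r1 i) => [//|l]; have [_ /andP[_]] := mt1.1 _ _ e1; rewrite bi.
split.
- by apply/Zid_id => //; exists j; rewrite r10 r20 e.
- by rewrite Yid_id.
- by move=> v; rewrite (good_row ok int inv hi gi) (negPf nal) andbF orbF.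
case ec: (c1 j) c10 al1 => [//|i1] _ /= al1.
have er := mt1.2 _ _ ec; have [hi1 /andP[_ nb] _ _ _] := mt1.1 _ _ er.
have r21 : r2 i1 = 0%N by case e2: (r2 i1) => [//|l]; have [_ /andP[_ b2]] := mt2.1 _ _ e2; rewrite b2 in nb.
exists (id5 i1); split=> //.
  by apply/h; exists i1; rewrite er r21 addn0.
by rewrite Yid_id //; move: nb; rewrite /be negbK => /eqP.
Qed.

Lemma frozen_relations : relations (pres A) Yid Zid YR ZR ZS.
Proof.
split; first exact: int.
- by move=> u; apply: (pres51 ok int tr).
- by move=> u; apply: (pres53 ok int tr).
- exact: rel_YRP.
- exact: rel_Y5.
- exact: rel_Y6.
- exact: rel_Ynt.
- exact: rel_Yt.
- exact: rel_Z5.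
- exact: rel_Znot2.
- exact: rel_ZY.
- exact: rel_Z2.
- exact: rel_ZRS.
- exact: rel_ZRP.
exact: rel_ZSP.
Qed.

Lemma tree_arrow b : b != a65 -> b != a25 -> b \in tree5.
Proof. by rewrite mem_tree5 -!aeqE; case: b. Qed.

(** The path and [a65] are in normal form by the invariant. In [a25] the pure columns are given by
    the three sweeps and the others by commutativity. *)
Lemma links b i j : (i < d (tgt b))%N -> (j < d (src b))%N ->
  ent (m (Str b)) i j = (link Yid Zid b (A (idA (tgt b)) i) (A (idA (src b)) j))%:R.
Proof.
move=> hi hj.
case: (b =P a65) => [e|/eqP n65]; first by subst b; rewrite inv.2 //= Yid_id.
case: (b =P a25) => [e|/eqP n25]; last first.
  have lk : linked A b m by have [_ h] := tr; apply: h; apply: tree_arrow.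
  by rewrite lk //; case: b n65 n25 {lk hi hj}; rewrite -!aeqE.
subst b; rewrite /= in hi hj *; set u := id2 j; have pu : pres A u v2 by rewrite (id_pres ok).
have ej : j = pos A u v2 by rewrite (id_pos ok).
have p5 : pres A (id5 i) v5 by rewrite (id_pres ok).
case: (boolP (pure A u)) => [pp|].
  rewrite f25 //; have only := pure2 int pp pu.
  case: (id5 i =P u) => [e5|_]; first by move: p5; rewrite e5 only.
  case: (Yid (id5 i) =P u.+1) => [/rel_Y6|_]; first by rewrite only.
  congr (nat_of_bool _)%:R; apply/eqP/eqP => [e|/(Zid_id _ hi)[j' [e ej']]].
    by apply/(Zid_id _ hi); exists j.
  by have [[_ hj' _ _] _] := any_rowP e; rewrite e (id_inj ok hj' hj ej').
rewrite /pure negb_and !negbK.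
have noZ w : ~~ pure A w -> pres A w v2 -> Zid (id5 i) == w.+1 = false.
  move=> np p2; apply/negbTE/negP => /eqP/(Zid_id _ hi)[j' [e ej']].
  by have [[_ _ _ pj] _] := any_rowP e; move: np; rewrite -ej' pj.
case: (boolP (pres A u v1)) => [p1 _|n1 /= p3].
  rewrite {1}ej (col1 ok int tr p1 pu hi) noZ ?orbF //; last by rewrite /pure p1.
  case: (id5 i =P u) => //= ne; case: (Yid (id5 i) =P u.+1) => // ey.
  have p6 := rel_Y6 ey; have := col6 ok int tr p6 p1 hi.
  rewrite inv.2 ?(pos_lt ok) // (pos_id ok) // -Yid_id // ey eqxx.
  by case: eqP => // _ /eqP; rewrite oner_eq0.
rewrite {1}ej (col3 ok tr i p3 pu) noZ ?orbF //; last by rewrite /pure p3 andbF.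
case: (id5 i =P u) => [e5|_] /=.
  by have := between int (x := v5) (y := v1) (z := v3) _ p5; rewrite e5 => /(_ isT p3); rewrite (negPf n1).
case: ifP => p6; first by rewrite inv.2 ?(pos_lt ok) // (pos_id ok) // Yid_id.
by case: (Yid (id5 i) =P u.+1) => // /rel_Y6; rewrite p6.
Qed.

End FrozenRelations.

(** * Output of the summands *)

Definition countE v := NLoad 80 (NConst (code v)).
Definition occursE e v := NMul e (NLoad (ixA v) (predE e)).

(** A swap brings the vector to the first position not yet final, and the label arrays are updated
    accordingly. Swaps read no coefficient, so the arrow passed to [change_basis] is arbitrary. *)
Definition emit_slot v e :=
  If (occursE e v) (seqs [::
    Store 7 (NConst 0) (POSe v (predE e));
    change_basis (fun w => NConst (veq w v)) (fun w r => ColSwap r (V 7) (countE v))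
      (fun w r => RowSwap r (V 7) (countE v)) a12 v;
    Store 8 (NConst 0) (IDe v (countE v));
    Store (idA v) (V 7) (V 8);
    Store (ixA v) (V 8) (NAdd (V 7) (NConst 1));
    Store (idA v) (countE v) (predE e);
    Store (ixA v) (predE e) (NAdd (countE v) (NConst 1));
    Store 80 (NConst (code v)) (NAdd (countE v) (NConst 1))]) Skip.

Definition swap_labels v p q (A : nat -> nat -> nat) x k :=
  if x == idA v then A x (swp p q k)
  else if x == ixA v then (if A x k == 0 then 0 else (swp p q (A x k).-1).+1)
  else A x k.

Lemma swap_id v p q A w k :
  swap_labels v p q A (idA w) k = A (idA w) (if veq w v then swp p q k else k).
Proof. by rewrite /swap_labels idA_inj idA_ixA veqE; case: eqP. Qed.

Lemma swap_pres v p q A u w : pres (swap_labels v p q A) u w = pres A u w.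
Proof.
rewrite /pres /swap_labels ixA_idA ixA_inj; case: (w =P v) => // _.
by case: (A _ _).
Qed.

Lemma swap_labels_ok d v p q A : p < d v -> q < d v -> labels_ok d A -> labels_ok d (swap_labels v p q A).
Proof.
move=> hp hq [h1 h2]; split=> [w i hi|w u i].
  rewrite swap_id veqE /swap_labels ixA_idA ixA_inj; case: (w =P v) => [e|_]; last exact: h1.
  by subst w; rewrite h1 ?swp_lt //= swpK.
rewrite swap_id veqE {1}/swap_labels ixA_idA ixA_inj; case: (w =P v) => [e|_]; last exact: h2.
subst w; case e: (A _ u) => [//|j] /= [<-]; have [hj <-] := h2 _ _ _ e.
by split; rewrite ?swpK ?swp_lt.
Qed.

Section EmitSlot.
Variables (K : fieldType) (W : rep K).
Notation d := (rdim W).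
Variables (P : nat -> vertex -> bool) (B : nat -> nat -> nat).
Implicit Types (s : state K d) (L : vertex -> seq nat).

Definition linked_by A (m : mxs K d) := forall b i j, (i < d (tgt b)) -> (j < d (src b)) ->
  ent (m (Str b)) i j = (link (B 70) (B 71) b (A (idA (tgt b)) i) (A (idA (src b)) j))%:R%R.

(** [L v] lists the labels already in final position at [v], in order. Positions move during the
    output, but where labels live and how they are linked does not. *)
Definition emitted s L :=
  [/\ labels_ok d (arr s), tracks (mx s), linked_by (arr s) (mx s), forall u v, pres (arr s) u v = P u v
   & [/\ forall v i, (i < size (L v)) -> (i < d v) /\ arr s (idA v) i = nth 0 (L v) i,
         forall v, arr s 80 (code v) = size (L v)
       & forall x k, (70 <= x <= 75) -> arr s x k = B x k]].

(** The arrays on which the enclosing loops rely: the multiplicities, the loop counter and the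
    recorded links. *)
Definition stable s s' := forall x k, [|| x == 0, x == 4 | 70 <= x <= 75] -> arr s' x k = arr s x k.

Lemma emitted_ext s L L' : L =1 L' -> emitted s L -> emitted s L'.
Proof.
move=> e [h1 h2 h3 h4 [h5 h6 h7]]; split=> //; split=> // v; first by rewrite -e; apply: h5.
by rewrite -e; apply: h6.
Qed.

Lemma emit_slot_runs s L v e n : emitted s L -> (forall s', stable s s' -> neval s' e = n) ->
  (n != 0 -> P n.-1 v -> n.-1 \notin L v) ->
  runs (emit_slot v e) s 0 (fun s' => stable s s' /\
    emitted s' (fun w => if [&& veq w v, n != 0 & P n.-1 v] then rcons (L w) n.-1 else L w)).
Proof.
move=> em he nin; have [ok tr lk pP [pre cnt fr]] := em; have en : neval s e = n by apply: he.
have eo : (neval s (occursE e v) != 0) = (n != 0) && P n.-1 v.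
  by rewrite /= en subn1 muln_eq0 negb_or -pP.
apply: (runs_ifb eo) => [/andP[n0 pn]|nn]; last first.
  apply: runs_skip; split=> //; apply: emitted_ext em => w.
  by rewrite (negPf nn) andbF.
have {}nin := nin n0 pn; set u := n.-1 in nin pn *; set A := arr s; set p := pos A u v; set q := size (L v).
have cntA : A 80 (code v) = q by apply: cnt.
have okA : labels_ok d A := ok.
have pu : pres A u v by rewrite pP.
have idp : A (idA v) p = u := pos_id ok pu.
have hp : (p < d v) by apply: pos_lt.
(* The positions below [q] hold emitted labels, and [u] is not one of them; so the swap moves no
   vector that is already final. *)
have hpq : (q <= p).
  rewrite leqNgt; apply/negP => h; have [_ e1] := pre _ _ h.
  by move: nin; rewrite -(pos_id ok pu) e1 mem_nth.
have hq : (q < d v) by apply: leq_ltn_trans hp.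
apply: (@runs_seq _ _ _ _ _ 0 0) => //; apply: runs_store.
set s1 := set_mem _ _ _ _.
have e1 : arr s1 7 0 = p by rewrite /= en !subn1.
have a1 x k : x != 7 -> arr s1 x k = A x k by move=> hx; rewrite /= (negPf hx).
apply: (@runs_seq _ _ _ _ _ 0 0) => //.
have CB := @change_basis_runs K d a12 s1 (veq^~ v) (fun _ => Smx K p q) (fun _ => Smx K p q)
  (fun w => NConst (veq w v)) (fun w r => ColSwap r (V 7) (countE v))
      (fun w r => RowSwap r (V 7) (countE v)) 0 _ _ _ v _.
have ev7 s2 : arr s2 = arr s1 -> neval s2 (V 7) = p by move=> h; rewrite /= h e1.
have evc s2 : arr s2 = arr s1 -> neval s2 (countE v) = q by move=> h; rewrite /= h a1 // cnt.
rewrite muln0 in CB; apply: runs_weak (CB _ _ _ _) (leqnn _) _ => {CB}.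
- by move=> s2 w _; rewrite /=; case: (veq w v).
- move=> s2 w r; rewrite veqE => /eqP-> h _ er.
  by apply: runs_colswap; rewrite ?ev7 ?evc ?er.
- move=> s2 w r; rewrite veqE => /eqP-> h _ er.
  by apply: runs_rowswap; rewrite ?ev7 ?evc ?er.
- by move=> w nw; rewrite veqE (negPf nw).
move=> s2 [as2 ms2].
set w0 := A (idA v) q.
have idv : [/\ idA v != 7, idA v != 8 & idA v != 80] by case: (v).
have ixv : [/\ ixA v != 7, ixA v != 8 & ixA v != 80] by case: (v).
have [i7 i8 i80] := idv; have [x7 x8 x80] := ixv.
apply: (@runs_seq _ _ _ _ _ 0 0) => //; apply: runs_store.
have -> : neval s2 (IDe v (countE v)) = w0 by rewrite [LHS]/= as2 !a1 // cntA.
set s3 := set_mem s2 8 _ w0.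
have a3 x k : x != 7 -> x != 8 -> arr s3 x k = A x k.
  by move=> h7 h8; rewrite /= (negPf h8) /= as2 a1.
have e37 : neval s3 (V 7) = p by rewrite /= as2 e1.
have e38 : neval s3 (V 8) = w0 by [].
apply: (@runs_seq _ _ _ _ _ 0 0) => //; apply: runs_store; rewrite e37 e38.
set s4 := set_mem s3 _ _ _.
have e47 : neval s4 (V 7) = p by rewrite [LHS]/= ?(eq_sym 7) ?(negPf i7) /= as2 e1.
have e48 : neval s4 (V 8) = w0 by rewrite [LHS]/= ?(eq_sym 8) ?(negPf i8).
apply: (@runs_seq _ _ _ _ _ 0 0) => //; apply: runs_store; rewrite [neval s4 (NAdd _ _)]/= e48.
rewrite as2 e1 addn1; set s5 := set_mem s4 _ _ _.
have a5 x k : x != 7 -> x != 8 -> arr s5 x k =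
    if (x == ixA v) && (k == w0) then p.+1 else if (x == idA v) && (k == p) then w0 else A x k.
  by move=> h7 h8; rewrite -(a3 x k h7 h8).
have sep x : [|| x == 0, x == 4 | 70 <= x <= 75] ->
    [/\ x != 7, x != 8, x == ixA v = false & (x == idA v = false) * (x == 80 = false)].
  have hv := code6 v.
  case/or3P=> [/eqP->|/eqP->|/andP[l1 l2]]; [by case: (v)|by case: (v)|].
  by rewrite /ixA /idA; split; try split; apply/eqP; lia.
have st5 : stable s s5.
  by move=> x k /sep[h7 h8 h1 [h2 _]]; rewrite a5 // h1 h2.
have en5 : neval s5 (predE e) = u by rewrite /= he // subn1.
have ec5 : neval s5 (countE v) = q.
  by rewrite -[LHS]/(arr s5 80 (code v)) a5 // !(eq_sym 80) (negPf i80) (negPf x80).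
apply: (@runs_seq _ _ _ _ _ 0 0) => //; apply: runs_store; rewrite en5 ec5.
set s6 := set_mem s5 _ _ _.
have a6 x k : arr s6 x k = if (x == idA v) && (k == q) then u else arr s5 x k by [].
have st6 : stable s s6.
  by move=> x k hx; have [_ _ _ [h2 _]] := sep _ hx; rewrite a6 h2 st5.
have en6 : neval s6 (predE e) = u by rewrite /= he // subn1.
have ec6 : neval s6 (countE v) = q.
  by rewrite -[LHS]/(arr s6 80 (code v)) a6 (eq_sym 80) (negPf i80).
apply: (@runs_seq _ _ _ _ _ 0 0) => //; apply: runs_store; rewrite en6.
have -> : neval s6 (NAdd (countE v) (NConst 1)) = q.+1.
  by rewrite -[LHS]/(neval s6 (countE v) + 1) ec6 addn1.
set s7 := set_mem s6 _ _ _.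
have a7 x k : arr s7 x k = if (x == ixA v) && (k == u) then q.+1 else arr s6 x k by [].
have ec7 : neval s7 (countE v) = q.
  by rewrite -[LHS]/(arr s7 80 (code v)) a7 (eq_sym 80) (negPf x80).
apply: (@runs_seq _ _ _ _ _ 0 0) => //; apply: runs_store.
have -> : neval s7 (NAdd (countE v) (NConst 1)) = q.+1.
  by rewrite -[LHS]/(neval s7 (countE v) + 1) ec7 addn1.
apply: runs_skip.
set s8 := set_mem s7 _ _ _.
have a8 x k : x != 7 -> x != 8 ->
    arr s8 x k = if (x == 80) && (k == code v) then q.+1 else swap_labels v p q A x k.
  move=> h7 h8; rewrite -[LHS]/(if (x == 80) && (k == code v) then q.+1 else arr s7 x k).
  case: ifP => // _; rewrite a7 a6 a5 // /swap_labels.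
  case: (x =P idA v) => [->|nx]; rewrite ?idA_ixA ?eqxx /=.
    rewrite /swp; case: (k =P p) => [->|_]; first by case: (p =P q) => // <-; rewrite idp.
    by case: (k =P q) => // _; rewrite idp.
  case: (x =P ixA v) => [->|//] /=.
  case: (k =P u) => [->|nu].
    have : A (ixA v) u != 0 by [].
    by rewrite /p /pos; case: (A (ixA v) u) => //= j _; rewrite /swp eqxx.
  case: (k =P w0) => [->|nw].
    by rewrite /w0 okA.1 //= /swp eqxx; case: eqP => // ->.
  case ek: (A (ixA v) k) => [//|j] /=; have [hj ej] := okA.2 _ _ _ ek.
  rewrite /swp; case: (j =P p) => [ejp|_]; first by case: nu; rewrite -ej ejp idp.
  by case: (j =P q) => // ejq; case: nw; rewrite -ej ejq.
have lab : same_labels (swap_labels v p q A) (arr s8) by move=> w k; rewrite !a8; case: (w).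
have st8 : stable s s8.
  move=> x k hx; have [h7 h8 h1 [h2 h3]] := sep _ hx.
  by rewrite a8 // h3 /swap_labels h1 h2.
split=> //.
have ent8 b i j : ent (mx s8 (Str b)) i j =
    ent (mx s (Str b)) (if veq (tgt b) v then swp p q i else i) (if veq (src b) v then swp p q j else j).
  have hpw w : w = v -> p < d w by move=> ->.
  have hqw w : w = v -> q < d w by move=> ->.
  rewrite ms2 /= !veqE; case: (tgt b =P v) => [et|_]; case: (src b =P v) => [es|_] //.
  - by rewrite (ent_Smul _ _ _ (hpw _ et) (hqw _ et)) (ent_mulS _ _ _ (hpw _ es) (hqw _ es)).
  - by rewrite (ent_Smul _ _ _ (hpw _ et) (hqw _ et)).
  by rewrite (ent_mulS _ _ _ (hpw _ es) (hqw _ es)).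
have lt8 w i : i < d w -> (if veq w v then swp p q i else i) < d w.
  by rewrite veqE; case: (w =P v) => // ->; rewrite swp_lt.
have id8 w i : arr s8 (idA w) i = A (idA w) (if veq w v then swp p q i else i).
  by rewrite (lab w i).1 swap_id.
split.
- by have := same_labels_ok (swap_labels_ok hp hq okA) lab.
- apply: (chg_tracks (T := veq^~ v) (E := fun _ => Smx K p q) (E' := fun _ => Smx K p q) (m := mx s)) => //.
  by move=> w; rewrite veqE => /eqP->; apply: SmxK.
- by move=> b i j hi hj; rewrite ent8 lk ?lt8 // !id8.
- by move=> x w; rewrite (same_pres x w lab) swap_pres; apply: pP.
split=> [w i|w|x k hx].
- rewrite id8 veqE n0 pn !andbT; case: (w =P v) => [->|_]; last exact: pre.
  rewrite size_rcons ltnS leq_eqVlt nth_rcons => /orP[/eqP->|hi].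
    have -> : swp p q (size (L v)) = p by rewrite /swp -/q eqxx; case: (q =P p).
    by rewrite ltnn eqxx hq idp.
  have [h1 h2] := pre _ _ hi; rewrite hi h1 -h2 /swp.
  by rewrite (ltn_eqF hi) (ltn_eqF (leq_trans hi hpq)).
- rewrite n0 pn !andbT veqE.
  rewrite a8 //= -veqE /veq eq_sym; case: eqP => [e1'|_]; last first.
    by rewrite /swap_labels; case: (v) => /=; apply: cnt.
  by rewrite size_rcons -/q; congr (size _).+1; apply: congr1; apply/eqP; rewrite -veqE /veq e1'.
by rewrite st8 ?fr // hx !orbT.
Qed.

End EmitSlot.

Definition secondE g := NMul (NLoad 71 g) (NEq (NLoad 74 (predE (NLoad 71 g))) (NAdd g (NConst 1))).
Definition slot3E g := NMul (NNot (NNot (NLoad 71 g))) (NLoad 74 (predE (NLoad 71 g))).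
Definition slot1yE g := NAdd (NMul (NNot (slot3E g)) (NLoad 70 g))
  (NMul (NNot (NNot (slot3E g))) (NLoad 70 (predE (slot3E g)))).
Definition slotE t g :=
  match t with
  | 0 => NAdd g (NConst 1)
  | 1 => NMul (NNot (NEq (slot1yE g) (NAdd g (NConst 1)))) (slot1yE g)
  | 2 => NLoad 71 g
  | _ => slot3E g
  end.
Definition headE g := NMul (NNot (secondE g))
  (NMul (NAdd (NNot (NLoad 72 g)) (NEq (NLoad 72 g) (NAdd g (NConst 1)))) (NNot (NLoad 73 g))).
Definition slots_of_vertices := [seq (v, t) | v <- vertices, t <- [:: 0; 1; 2; 3]].
Definition shapeE sh g := foldr (fun p e => NMul (NEq (NNot (NNot (occursE (slotE p.2 g) p.1)))
  (NConst (spres sh p.2 p.1))) e) (NConst 1) slots_of_vertices.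
Definition emit_head := seqs [seq emit_slot p.1 (slotE p.2 (V 4)) | p <- slots_of_vertices].
(** The loop tries every number below the bound as a head. It performs only swaps and computations
    with natural numbers, so its length adds no arithmetic operation in the field. *)
Definition emit_shape k sh := Seq (Store 0 (NConst k) (NConst 0))
  (For 4 (NLoad 75 (NConst 0)) (If (NMul (headE (V 4)) (shapeE sh (V 4)))
     (Seq emit_head (Store 0 (NConst k) (NAdd (NLoad 0 (NConst k)) (NConst 1)))) Skip)).

Section Evaluation.
Variables (K : fieldType) (d : vertex -> nat) (B : nat -> nat -> nat) (s : state K d).
Hypothesis fr : forall x k, 70 <= x <= 75 -> arr s x k = B x k.

Lemma secondE_eval e : (neval s (secondE e) != 0) = second (B 71) (B 74) (neval s e).
Proof.
by rewrite /secondE /predE /= !fr // subn1 addn1 muln_eq0 negb_or /second; case: (_ == _.+1).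
Qed.

Lemma slot3E_eval e : neval s (slot3E e) = slot (B 70) (B 71) (B 74) (neval s e) 3.
Proof. by rewrite /= !fr // subn1; case: (B 71 _) => [|z] //=; rewrite mul1n. Qed.

Lemma slotE_eval t e : neval s (slotE t e) = slot (B 70) (B 71) (B 74) (neval s e) t.
Proof.
case: t => [|[|[|t]]].
- by rewrite /= addn1.
- have ey : neval s (slot1yE e) = if slot (B 70) (B 71) (B 74) (neval s e) 3 == 0 then B 70 (neval s e)
      else B 70 (slot (B 70) (B 71) (B 74) (neval s e) 3).-1.
    rewrite -slot3E_eval; move E : (slot3E e) => e3; rewrite /slot1yE E /= !fr // subn1.
    by case: eqP => _ /=; rewrite ?mul1n ?mul0n ?addn0 ?add0n.
  have -> : neval s (slotE 1 e) = (((neval s (slot1yE e) == neval s e + 1) : nat) == 0) * neval s (slot1yE e) by [].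
  rewrite ey addn1 /=; by case: (_ == _.+1); rewrite ?mul1n ?mul0n.
- by rewrite /= fr.
exact: slot3E_eval.
Qed.

Lemma headE_eval e : (neval s (headE e) != 0) = head (B 71) (B 72) (B 73) (B 74) (neval s e).
Proof.
rewrite /head -secondE_eval; move E : (secondE e) => e2; rewrite /headE E /= !fr // addn1.
by case: (neval s e2 == 0); case: (B 72 _ == 0); case: (B 72 _ == _); case: (B 73 _ == 0).
Qed.

Variable P : nat -> vertex -> bool.
Hypothesis pP : forall u v, pres (arr s) u v = P u v.

Lemma occursE_eval t e v : (neval s (occursE (slotE t e) v) != 0) = present P (B 70) (B 71) (B 74) (neval s e) t v.
Proof.
rewrite /occursE /predE [neval _ _]/= slotE_eval subn1 muln_eq0 negb_or /present.
by congr (_ && _); rewrite -pP.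
Qed.

Lemma shapeE_eval sh e : (neval s (shapeE sh e) != 0) =
  all (fun p => present P (B 70) (B 71) (B 74) (neval s e) p.2 p.1 == spres sh p.2 p.1) slots_of_vertices.
Proof.
rewrite /shapeE; elim: slots_of_vertices => [//|[v t] ps IH].
rewrite [foldr _ _ _]/= [all _ _]/= -occursE_eval -IH.
move: (occursE _ _) (foldr _ _ _) => e1 e2 /=; rewrite muln_eq0 negb_or; congr (_ && _).
by case: (neval s e1 == 0); case: (spres _ _ _).
Qed.

End Evaluation.

(** * The order in which the components are output *)

Section Emission.
Variables (K : fieldType) (W : rep K).
Notation d := (rdim W).
Variables (P : nat -> vertex -> bool) (B : nat -> nat -> nat).
Hypothesis rel : relations P (B 70) (B 71) (B 72) (B 73) (B 74).
Hypothesis bound : forall u v, P u v -> u < B 75 0.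
Notation hd := (head (B 71) (B 72) (B 73) (B 74)).
Notation sl := (slot (B 70) (B 71) (B 74)).
Notation ow := (own (B 71) (B 72) (B 73) (B 74)).
Notation prs := (present P (B 70) (B 71) (B 74)).
Implicit Types (s : state K d) (L : vertex -> seq nat) (E : seq nat).

Definition labels_at g v := [seq (sl g t).-1 | t <- [:: 0; 1; 2; 3] & prs g t v].
Definition labels_of E v := flatten [seq labels_at g v | g <- E].

Lemma mem_labels_at g v u : hd g -> (u \in labels_at g v) = ((ow u).1 == g) && P u v.
Proof.
move=> hg; apply/mapP/andP => [[t]|[/eqP e pu]].
  rewrite mem_filter => /andP[/andP[n0 pt] ht] ->; split=> //.
  have t4 : t < 4 by move: ht; rewrite !inE => /or4P[] /eqP->.
  have es : sl g t = (sl g t).-1.+1 by case: (sl g t) n0.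
  by rewrite (own_slot rel hg t4 es).
have [_ t4 es] := slot_own rel u; rewrite e in es.
exists (ow u).2; rewrite ?es // mem_filter /present es pu /=.
by move: t4; case: (ow u).2 => [|[|[|[|t]]]].
Qed.

Lemma uniq_labels_at g v : hd g -> uniq (labels_at g v).
Proof.
move=> hg; rewrite map_inj_in_uniq ?filter_uniq // => t t'.
rewrite !mem_filter => /andP[/andP[n0 _] ht] /andP[/andP[n0' _] ht'] e.
have [t4 t4'] : t < 4 /\ t' < 4.
  by split; [move: ht|move: ht']; rewrite !inE => /or4P[] /eqP->.
have es : sl g t = (sl g t).-1.+1 by case: (sl g t) n0.
have es' : sl g t' = (sl g t).-1.+1 by rewrite e; case: (sl g t') n0'.
by have := own_slot rel hg t4 es; rewrite (own_slot rel hg t4' es') => -[].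
Qed.

Lemma mem_labels_of E v u : all hd E -> (u \in labels_of E v) = ((ow u).1 \in E) && P u v.
Proof.
elim: E => [|g E IH] //= /andP[hg hE]; rewrite /labels_of /= mem_cat mem_labels_at // -/(labels_of E v) IH //.
by rewrite inE -andb_orl.
Qed.

Lemma uniq_labels_of E v : all hd E -> uniq E -> uniq (labels_of E v).
Proof.
elim: E => [//|g E IH] /= /andP[hg hE] /andP[ng uE].
rewrite /labels_of /= cat_uniq uniq_labels_at // -/(labels_of E v) IH // andbT.
apply/hasPn => u; rewrite mem_labels_of // => /andP[h _]; rewrite mem_labels_at //.
by apply: contra ng => /andP[/eqP<-].
Qed.

Lemma emit_pairs_runs ps s L g : emitted P B s L -> arr s 4 0 = g ->
  (forall v, uniq (L v ++ [seq (sl g p.2).-1 | p <- ps & veq p.1 v && prs g p.2 v])) ->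
  runs (seqs [seq emit_slot p.1 (slotE p.2 (V 4)) | p <- ps]) s 0 (fun s' => stable s s' /\
    emitted P B s' (fun v => L v ++ [seq (sl g p.2).-1 | p <- ps & veq p.1 v && prs g p.2 v])).
Proof.
elim: ps s L => [|[v t] ps IH] s L em e4 un.
  by apply: runs_skip; split=> //; apply: emitted_ext em => w; rewrite cats0.
apply: (@runs_seq _ _ _ _ _ 0 0) => //.
have ev s' : stable s s' -> neval s' (slotE t (V 4)) = sl g t.
  move=> st; have [_ _ _ _ [_ _ fr]] := em.
  rewrite (@slotE_eval _ _ B) => [|x k hx]; last by rewrite st ?fr // hx !orbT.
  by rewrite /= st ?e4.
set L1 := fun w => if [&& veq w v, sl g t != 0 & P (sl g t).-1 v] then rcons (L w) (sl g t).-1 else L w.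
have eL w : L1 w ++ [seq (sl g p.2).-1 | p <- ps & veq p.1 w && prs g p.2 w] =
    L w ++ [seq (sl g p.2).-1 | p <- (v, t) :: ps & veq p.1 w && prs g p.2 w].
  rewrite /L1 /= /veq eq_sym -/(veq v w); case: (boolP (veq v w)) => [|_] //.
  by rewrite veqE => /eqP e; subst w; rewrite -/(prs g t v); case: (prs g t v); rewrite ?cat_rcons.
apply: runs_weak (emit_slot_runs em ev _) (leqnn _) _ => [n0 pn|s1 [st1 em1]].
  have := un v; rewrite /= /veq eqxx /present n0 pn /= cat_uniq => /and3P[_ /hasPn h _].
  by apply: h; rewrite mem_head.
apply: runs_weak (IH s1 L1 em1 _ _) (leqnn _) _ => [|w|s2 [st2 em2]].
- by rewrite st1.
- by rewrite eL.
split; last by apply: emitted_ext em2.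
by move=> x k hx; rewrite st2 // st1.
Qed.

Lemma labels_at_pairs g v :
  [seq (sl g p.2).-1 | p <- slots_of_vertices & veq p.1 v && prs g p.2 v] = labels_at g v.
Proof.
rewrite /labels_at; move: (present P _ _ _ g) (slot _ _ _ g) => q f.
by case: v => /=; case: (q 0 _); case: (q 1 _); case: (q 2 _); case: (q 3 _).
Qed.

Lemma emit_head_runs s E g : emitted P B s (labels_of E) -> arr s 4 0 = g ->
  hd g -> all hd E -> uniq (rcons E g) ->
  runs emit_head s 0 (fun s' => stable s s' /\ emitted P B s' (labels_of (rcons E g))).
Proof.
move=> em e4 hg hE un.
have eL v : labels_of E v ++ [seq (sl g p.2).-1 | p <- slots_of_vertices & veq p.1 v && prs g p.2 v] =
    labels_of (rcons E g) v.
  by rewrite labels_at_pairs /labels_of map_rcons flatten_rcons.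
apply: runs_weak (emit_pairs_runs em e4 _) (leqnn _) _ => [v|s1 [st1 em1]].
  by rewrite eL uniq_labels_of // all_rcons hg.
by split=> //; apply: emitted_ext em1.
Qed.

Definition matches sh g :=
  all (fun p => prs g p.2 p.1 == spres sh p.2 p.1) slots_of_vertices.
Definition selected sh := [seq g <- iota 0 (B 75 0) | hd g && matches sh g].

Lemma emit_shape_runs s E k sh : emitted P B s (labels_of E) -> uniq (E ++ selected sh) -> all hd E ->
  runs (emit_shape k sh) s 0 (fun s' => [/\ emitted P B s' (labels_of (E ++ selected sh)),
    arr s' 0 k = size (selected sh) & forall k', k' != k -> arr s' 0 k' = arr s 0 k']).
Proof.
move=> em un hE.
pose sel n := [seq g <- iota 0 n | hd g && matches sh g].
pose I n s1 := [/\ emitted P B s1 (labels_of (E ++ sel n)), arr s1 0 k = size (sel n)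
  & forall k', k' != k -> arr s1 0 k' = arr s 0 k'].
have em0 L s1 s2 : mx s2 = mx s1 -> (forall x l, x != 0 -> x != 4 -> arr s2 x l = arr s1 x l) ->
    emitted P B s1 L -> emitted P B s2 L.
  move=> em1 ea [h1 h2 h3 h4 [h5 h6 h7]].
  have eid v l : arr s2 (idA v) l = arr s1 (idA v) l by apply: ea; case: (v).
  have eix v l : arr s2 (ixA v) l = arr s1 (ixA v) l by apply: ea; case: (v).
  split; rewrite ?em1 //.
  - by split=> [v i hi|v u i]; rewrite eix !eid; [apply: h1.1|apply: h1.2].
  - by move=> b i j hi hj; rewrite h3 // !eid.
  - by move=> u v; rewrite /pres eix; apply: h4.
  split=> [v i hi|v|x l hx]; first by rewrite eid; apply: h5.
    by rewrite ea.
  by rewrite ea ?h7 //; apply/eqP => ex; rewrite ex in hx.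
have selS n : sel n.+1 = if hd n && matches sh n then rcons (sel n) n else sel n.
  by rewrite /sel -(addn1 n) iotaD filter_cat /= add0n; case: ifP; rewrite ?cats0 ?cats1.
have hsel n : all hd (sel n) by apply/allP => g; rewrite mem_filter => /andP[/andP[]].
have unS n : n <= B 75 0 -> uniq (E ++ sel n).
  move=> hn; move: un; rewrite /selected -(subnKC hn) iotaD filter_cat catA cat_uniq -/(sel n).
  by case/and3P.
apply: (@runs_seq _ _ _ _ _ 0 0) => //; apply: runs_store.
apply: (@runs_for _ _ _ _ _ _ (B 75 0) 0 _ I) => //; last by rewrite muln0.
- rewrite /I /sel /= cats0; split.
  + by apply: em0 em => // x l h0 h4 /=; rewrite (negPf h0) (negPf h4).
  + by rewrite eqxx.
  by move=> k' nk; rewrite (negPf nk).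
- by move=> n s1 hn [[_ _ _ _ [_ _ fr]] _ _]; rewrite /= fr.
- move=> n s1 hn [em1 c1 o1] e4; have [_ _ _ pP [_ _ fr]] := em1.
  have cond : (neval s1 (NMul (headE (V 4)) (shapeE sh (V 4))) != 0) = hd n && matches sh n.
    have := headE_eval fr (V 4); have := shapeE_eval fr pP sh (V 4).
    rewrite (_ : neval s1 (V 4) = n) // -[neval s1 (NMul _ _)]/(neval s1 (headE (V 4)) * neval s1 (shapeE sh (V 4))).
    by rewrite muln_eq0 negb_or => -> ->.
  apply: (runs_ifb cond) => [hm|nm].
    have [hn1 _] := andP hm.
    apply: (@runs_seq _ _ _ _ _ 0 0) => //.
    apply: runs_weak (@emit_head_runs s1 (E ++ sel n) n em1 e4 hn1 _ _) (leqnn _) _.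
    + by rewrite all_cat hE hsel.
    + by have := unS _ hn; rewrite selS hm rcons_cat.
    move=> s2 [st2 em2]; apply: runs_store.
    have e42 : arr s2 4 0 = n by rewrite st2.
    split; first by rewrite /=.
    rewrite /I selS hm -rcons_cat; split.
    + by apply: em0 em2 => // x l h0 h4; rewrite /= (negPf h0) (negPf h4).
    + by rewrite /= eqxx /= st2 // c1 size_rcons addn1.
    by move=> k' nk; rewrite /= (negPf nk) st2 // o1.
  apply: runs_skip; split=> //; rewrite /I selS (negPf nm); split=> //.
  by apply: em0 em1 => // x l h0 h4; rewrite /= (negPf h4).
Qed.

Notation shp k := (nth (Shape [::] [::] false false) shapes k).

(** Two shapes matching one component have the same slots at each vertex, hence the same code; so no
    component is output twice. *)
Lemma matches_inj g k k' : k < 30 -> k' < 30 -> matches (shp k) g -> matches (shp k') g -> k = k'.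
Proof.
move=> hk hk' /allP m /allP m'.
have U : uniq (map scode shapes) by vm_compute.
have sz : size shapes = 30 by vm_compute.
have hkz : k < size (map scode shapes) by rewrite size_map sz.
have hkz' : k' < size (map scode shapes) by rewrite size_map sz.
apply/eqP; rewrite -(nth_uniq 0 hkz hkz' U) !(nth_map (Shape [::] [::] false false)) ?sz //.
apply/eqP; rewrite /scode; congr sumn; apply: eq_map => v; congr (_ * size _).
apply: eq_in_filter => t ht; have h : (v, t) \in slots_of_vertices.
  by apply/allpairsP; exists (v, t); rewrite mem_vertices.
by have /eqP <- := m _ h; have /eqP <- := m' _ h.
Qed.

Definition all_selected ks := flatten [seq selected (shp k) | k <- ks].

Lemma uniq_all_selected ks : uniq ks -> all (fun k => k < 30) ks -> uniq (all_selected ks).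
Proof.
elim: ks => [//|k ks IH] /= /andP[nk uk] /andP[hk hks].
rewrite /all_selected /= cat_uniq filter_uniq ?iota_uniq // -/(all_selected ks) IH // andbT.
apply/hasPn => g /flatten_mapP[k' hk']; rewrite !mem_filter => /andP[/andP[_ m'] _].
apply: contra nk => /andP[/andP[_ m] _].
by rewrite (matches_inj hk _ m m') // (allP hks).
Qed.

Lemma all_selected_heads ks : all hd (all_selected ks).
Proof. by apply/allP => g /flatten_mapP[k _]; rewrite mem_filter => /andP[/andP[]]. Qed.

Lemma emit_shapes_runs ks s E : emitted P B s (labels_of E) -> uniq (E ++ all_selected ks) -> all hd E ->
  uniq ks ->
  runs (seqs [seq emit_shape k (shp k) | k <- ks]) s 0 (fun s' =>
    [/\ emitted P B s' (labels_of (E ++ all_selected ks)),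
     forall k, k \in ks -> arr s' 0 k = size (selected (shp k)) & forall k, k \notin ks -> arr s' 0 k = arr s 0 k]).
Proof.
elim: ks s E => [|k ks IH] s E em un hE.
  by move=> _; apply: runs_skip; rewrite cats0.
move=> /= /andP[nk uk].
have eE : E ++ all_selected (k :: ks) = (E ++ selected (shp k)) ++ all_selected ks by rewrite -catA.
rewrite eE in un *; apply: (@runs_seq _ _ _ _ _ 0 0) => //.
apply: runs_weak (@emit_shape_runs s E k (shp k) em _ hE) (leqnn _) _ => [|s1 [em1 c1 o1]].
  by move: un; rewrite cat_uniq => /and3P[].
have hE1 : all hd (E ++ selected (shp k)).
  by rewrite all_cat hE; apply/allP => g; rewrite mem_filter => /andP[/andP[]].
apply: runs_weak (IH s1 _ em1 un hE1 uk) (leqnn _) _ => s2 [em2 c2 o2]; split=> // k'.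
  rewrite inE; case: (k' =P k) => [->|_] /=; first by rewrite o2.
  exact: c2.
by rewrite inE negb_or => /andP[n1 n2]; rewrite o2 // o1.
Qed.

Definition emission := seqs [seq emit_shape k (shp k) | k <- iota 0 30].
Definition heads := all_selected (iota 0 30).

(** The head of the component of [u] lives somewhere. Hence it is below the bound and its shape is
    in the list, so one of the loops selects it. *)
Lemma mem_heads u v : P u v -> (ow u).1 \in heads.
Proof.
move=> pu; have [hg t4 es] := slot_own rel u; set g := (ow u).1 in hg es *.
(* If [u] is not the head itself, then the head is an end of a link and lives at 5. *)
have [w pw] : exists w, P g w.
  case: (ow u).2 es => [[->]|[|[|t]]]; [by exists v| | |]; move=> /= e; exists v5.
  - case ez: (B 71 g) e => [|z] /=; last by rewrite (r_Z5 rel ez).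
    by case: ifP => // _; apply: (r_Y5 rel).
  - exact: (r_Z5 rel e).
  by case ez: (B 71 g) e => [//|z] _; apply: (r_Z5 rel ez).
have hm := head_shape_mem rel hg pw.
set k := index (head_shape P (B 70) (B 71) (B 74) g) shapes.
have hk : k < 30 by have : k < size shapes by rewrite index_mem.
apply/flatten_mapP; exists k; first by rewrite mem_iota.
rewrite mem_filter hg mem_iota /= (bound pw) andbT /matches nth_index //.
apply/allP => -[w' t] /allpairsP[[w1 t1] [_ /= ht [-> ->]]].
rewrite (head_shape_spres rel).
by move: ht; rewrite !inE => /or4P[] /eqP->.
Qed.

(** The emitted labels occupy an initial segment of the positions, and each label present at [v] is
    among them; counting gives equality. *)
Lemma full_labels s : emitted P B s (labels_of heads) -> forall v, size (labels_of heads v) = d v.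
Proof.
move=> [ok _ _ pP [pre _ _]] v; apply/eqP; rewrite eqn_leq; apply/andP; split.
  by rewrite leqNgt; apply/negP => /pre[]; rewrite ltnn.
rewrite -[X in X <= _](size_iota 0) -(size_map (fun i => arr s (idA v) i)).
apply: uniq_leq_size.
  rewrite map_inj_in_uniq ?iota_uniq // => i j; rewrite !mem_iota !add0n /= => hi hj.
  exact: (id_inj ok hi hj).
move=> u /mapP[i]; rewrite mem_iota add0n /= => hi ->.
have pu : P (arr s (idA v) i) v by rewrite -pP (id_pres ok).
by rewrite mem_labels_of ?all_selected_heads // pu (mem_heads pu).
Qed.

End Emission.

Lemma slink_ext b sh sh' : (forall t v, t < 4 -> spres sh t v = spres sh' t v) -> slink b sh =2 slink b sh'.
Proof.
move=> h t s; have hx v : vat (sx sh) v = vat (sx sh') v := h 0 v isT.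
have hz : sz sh = sz sh' by have := h 2 v2 isT; rewrite /= !andbT.
have hw : sw sh = sw sh' by have := h 3 v5 isT; rewrite /= !andbT.
by rewrite /slink /slink65 !hx hz hw.
Qed.

(** * The isomorphism from the direct sum *)

Section Assembly.
Local Open Scope ring_scope.
Variables (K : fieldType).

Lemma ent_diag_block m1 m2 n1 n2 (X : 'M[K]_(m1, n1)) (Y : 'M[K]_(m2, n2)) i j :
  ent (block_mx X 0 0 Y) i j = if (i < m1)%N then if (j < n1)%N then ent X i j else 0
    else if (j < n1)%N then 0 else ent Y (i - m1) (j - n1).
Proof.
case: (ltnP i m1) => hi; case: (ltnP j n1) => hj.
- have -> : ent (block_mx X 0 0 Y) i j = block_mx X 0 0 Y (lshift m2 (Ordinal hi)) (lshift n2 (Ordinal hj)) by rewrite -entE.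
  by rewrite block_mxEul -entE.
- case: (ltnP (j - n1) n2) => hj'; last by rewrite ent_out_col // -leq_subRL.
  have -> : ent (block_mx X 0 0 Y) i j = block_mx X 0 0 Y (lshift m2 (Ordinal hi)) (rshift n1 (Ordinal hj')).
    by rewrite -entE /= subnKC.
  by rewrite block_mxEur mxE.
- case: (ltnP (i - m1) m2) => hi'; last by rewrite ent_out_row // -leq_subRL.
  have -> : ent (block_mx X 0 0 Y) i j = block_mx X 0 0 Y (rshift m1 (Ordinal hi')) (lshift n2 (Ordinal hj)).
    by rewrite -entE /= subnKC.
  by rewrite block_mxEdl mxE.
case: (ltnP (i - m1) m2) => hi'; last by rewrite ent_out_row ?(ent_out_row _ _ hi') // -leq_subRL.
case: (ltnP (j - n1) n2) => hj'; last by rewrite ent_out_col ?(ent_out_col _ _ hj') // -leq_subRL.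
have -> : ent (block_mx X 0 0 Y) i j = block_mx X 0 0 Y (rshift m1 (Ordinal hi')) (rshift n1 (Ordinal hj')).
  by rewrite -entE /= !subnKC.
by rewrite block_mxEdr -entE.
Qed.

Variables (W : rep K).
Notation d := (rdim W).
Variables (P : nat -> vertex -> bool) (B : nat -> nat -> nat).
Hypothesis rel : relations P (B 70) (B 71) (B 72) (B 73) (B 74).
Hypothesis bound : forall u v, P u v -> (u < B 75 0)%N.
Notation hd := (head (B 71) (B 72) (B 73) (B 74)).
Notation sl := (slot (B 70) (B 71) (B 74)).
Notation prs := (present P (B 70) (B 71) (B 74)).
Notation labels_at := (labels_at P B).
Notation labels_of := (labels_of P B).
Notation lnk := (link (B 70) (B 71)).
Notation matches := (matches P B).
Notation selected := (selected P B).

Definition kind g : 'I_30 := odflt ord0 [pick k | matches (shape_of k) g].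

Lemma kindE g (k : 'I_30) : matches (shape_of k) g -> kind g = k.
Proof.
rewrite /kind => m; case: pickP => [k' m'|/(_ k)]; last by rewrite m.
by apply/val_inj/(matches_inj _ _ m' m); apply: ltn_ord.
Qed.

Lemma matched_slots g k v : matches (shape_of k) g ->
  slots_at (shape_of k) v = [seq t <- [:: 0; 1; 2; 3]%N | prs g t v].
Proof.
move=> /allP m; apply: eq_in_filter => t ht; have h : (v, t) \in slots_of_vertices.
  by apply/allpairsP; exists (v, t); rewrite mem_vertices.
by have /eqP <- := m _ h.
Qed.

Lemma piece_dim g k v : matches (shape_of k) g -> rdim (Gamma K k) v = size (labels_at g v).
Proof. by move=> m; rewrite /= /sdim (matched_slots v m) size_map. Qed.

Lemma piece_ent g k b i j : hd g -> matches (shape_of k) g ->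
  (i < size (labels_at g (tgt b)))%N -> (j < size (labels_at g (src b)))%N ->
  ent (rmap (Gamma K k) b) i j = (lnk b (nth 0%N (labels_at g (tgt b)) i) (nth 0%N (labels_at g (src b)) j))%:R.
Proof.
move=> hg m hi hj.
have hi' : (i < sdim (shape_of k) (tgt b))%N by have /= -> := piece_dim (tgt b) m.
have hj' : (j < sdim (shape_of k) (src b))%N by have /= -> := piece_dim (src b) m.
have slot_prs v l : (l < size (labels_at g v))%N ->
    let t := nth 0%N (slots_at (shape_of k) v) l in
    [/\ (t < 4)%N, nth 0%N (labels_at g v) l = (sl g t).-1 & prs g t v].
  rewrite size_map => hl; rewrite /= (matched_slots v m) (nth_map 0%N) //.
  have := mem_nth 0%N hl; rewrite mem_filter => /andP[pt ht]; split=> //.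
  by move: ht; rewrite !inE => /or4P[] /eqP->.
have own_nth v l : (l < size (labels_at g v))%N ->
    own (B 71) (B 72) (B 73) (B 74) (nth 0%N (labels_at g v) l) = (g, nth 0%N (slots_at (shape_of k) v) l)
    /\ P (nth 0%N (labels_at g v) l) v.
  move=> /slot_prs[t4 -> /andP[n0 p]]; split=> //.
  by apply: (own_slot rel hg t4); case: (sl g _) n0.
have [o1 p1] := own_nth _ _ hi; have [o2 p2] := own_nth _ _ hj.
rewrite (link_slink rel p1 p2) /same_head o1 o2 eqxx andTb.
rewrite -[rmap _ _]/(shape_mx K (shape_of k) b) ent_shape_mx //.
congr (nat_of_bool _)%:R; apply: slink_ext => t v t4.
rewrite (head_shape_spres rel) t4.
have h : (v, t) \in slots_of_vertices.
  apply/allpairsP; exists (v, t); rewrite mem_vertices; split=> //=.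
  by move: t4; case: t => [|[|[|[|t]]]].
by have /allP/(_ _ h)/eqP-> := m.
Qed.

Definition pieces E := foldr (@dsum K) (rep0 K) [seq Gamma K (kind g) | g <- E].
Definition matched g := matches (shape_of (kind g)) g.

Lemma pieces_dim E v : all matched E -> rdim (pieces E) v = size (labels_of E v).
Proof.
elim: E => [//|g E IH] /= /andP[m mE]; rewrite size_cat -(piece_dim v m); congr (_ + _)%N.
exact: IH.
Qed.

(** The off-diagonal blocks vanish because labels of different components are not linked. *)
Lemma pieces_ent E b i j : all hd E -> uniq E -> all matched E ->
  (i < size (labels_of E (tgt b)))%N -> (j < size (labels_of E (src b)))%N ->
  ent (rmap (pieces E) b) i j = (lnk b (nth 0%N (labels_of E (tgt b)) i) (nth 0%N (labels_of E (src b)) j))%:R.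
Proof.
elim: E i j => [//|g E IH] i j /= /andP[hg hE] /andP[ng uE] /andP[m mE].
have cross v v' u u' : u \in labels_at g v -> u' \in labels_of E v' ->
    [/\ P u v, P u' v', same_head (B 71) (B 72) (B 73) (B 74) u u' = false
      & same_head (B 71) (B 72) (B 73) (B 74) u' u = false].
  rewrite (mem_labels_at rel _ _ hg) (mem_labels_of rel _ _ hE) => /andP[/eqP e pu] /andP[hu' pu'].
  have ne : (own (B 71) (B 72) (B 73) (B 74) u').1 != g by apply: contra ng => /eqP <-.
  by split=> //; rewrite /same_head e; [apply/negbTE; rewrite eq_sym|apply/negbTE].
rewrite /labels_of /= !size_cat -!/(labels_of E _) => hi hj.
rewrite ent_diag_block !nth_cat.
rewrite -[sdim _ (tgt b)]/(rdim (Gamma K (kind g)) (tgt b)) -[sdim _ (src b)]/(rdim (Gamma K (kind g)) (src b)).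
have et := piece_dim (tgt b) m; have es := piece_dim (src b) m.
rewrite -et -es; case: (ltnP i (rdim (Gamma K (kind g)) (tgt b))) => hi'; case: (ltnP j (rdim (Gamma K (kind g)) (src b))) => hj'.
- by apply: piece_ent; rewrite // -?et -?es.
- have [||p1 p2 n1 n2] := cross (tgt b) (src b) (nth 0%N (labels_at g (tgt b)) i) (nth 0%N (labels_of E (src b)) (j - rdim (Gamma K (kind g)) (src b))).
  + by rewrite mem_nth // -et.
  + by rewrite mem_nth // ltn_subLR // es.
  by rewrite (link_slink rel p1 p2) n1.
- have [||p1 p2 n1 n2] := cross (src b) (tgt b) (nth 0%N (labels_at g (src b)) j) (nth 0%N (labels_of E (tgt b)) (i - rdim (Gamma K (kind g)) (tgt b))).
  + by rewrite mem_nth // -es.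
  + by rewrite mem_nth // ltn_subLR // et.
  by rewrite (link_slink rel p2 p1) n2.
apply: IH => //.
- by rewrite ltn_subLR // et.
by rewrite ltn_subLR // es.
Qed.

Lemma pieces_heads (D : 'I_30 -> nat) : (forall k : 'I_30, D k = size (selected (shape_of k))) ->
  dsum_of (Gamma K) D = pieces (heads P B) /\ all matched (heads P B).
Proof.
move=> hD.
have kE (k : 'I_30) g : g \in selected (shape_of k) -> matches (shape_of k) g.
  by rewrite mem_filter => /andP[/andP[]].
have eh : heads P B = flatten [seq selected (shape_of k) | k <- enum 'I_30].
  by rewrite /heads /all_selected -val_enum_ord -map_comp.
split.
  rewrite /dsum_of /pieces eh map_flatten -map_comp; congr (foldr _ _ (flatten _)).
  apply: eq_map => k /=; rewrite hD; have := kE k.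
  by elim: (selected _) => [//|g s IH] /= h; rewrite IH ?(kindE (h g _)) ?mem_head // => g' hg'; apply: h; rewrite inE hg' orbT.
by rewrite eh; apply/allP => g /flatten_mapP[k _ /kE m]; rewrite /matched (kindE m).
Qed.

Lemma sum_ord_cast m n (F : nat -> K) : m = n -> \sum_(l < m) F l = \sum_(l < n) F l.
Proof. by move->. Qed.

Lemma decomposition (s : state K d) : emitted P B s (labels_of (heads P B)) ->
  (forall k : 'I_30, arr s 0 k = size (selected (shape_of k))) ->
  outputs_decomposition (Gamma K) s.
Proof.
move=> em hD; rewrite /outputs_decomposition; set D := output_diagram s (N := 30).
have [-> mh] := pieces_heads (D := D) hD.
have hh := @all_selected_heads P B (iota 0 30) : all hd (heads P B).
have uh : uniq (heads P B) by apply: uniq_all_selected; rewrite ?iota_uniq //; apply/allP => k; rewrite mem_iota.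
have full := full_labels rel bound em.
set U := pieces (heads P B).
have dU v : rdim U v = d v by rewrite /U pieces_dim // full.
have [ok tr lk pP [pre _ _]] := em.
have eU b i j : ent (rmap U b) i j = ent (mx s (Str b)) i j.
  case: (ltnP i (d (tgt b))) => hi; last by rewrite !ent_out_row // dU.
  case: (ltnP j (d (src b))) => hj; last by rewrite !ent_out_col // dU.
  rewrite lk // pieces_ent ?full //.
  by have [|_ ->] := pre (tgt b) i; rewrite ?full //; have [|_ ->] := pre (src b) j; rewrite ?full.
have [hu hc] := tr.
(* [rdim U v] and [d v] are only provably equal, so the basis matrix and its inverse are transported
   entry by entry. *)
pose phi v : 'M[K]_(d v, rdim U v) := \matrix_(i, j) ent (mx s (Bas v)) i j.
pose psi v : 'M[K]_(rdim U v, d v) := \matrix_(i, j) ent (invmx (mx s (Bas v))) i j.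
have ephi v i j : ent (phi v) i j = ent (mx s (Bas v)) i j.
  case: (ltnP i (d v)) => hi; last by rewrite !ent_out_row.
  case: (ltnP j (d v)) => hj; last by rewrite !ent_out_col // dU.
  by rewrite (@ent_mx K _ _ (fun i j => ent (mx s (Bas v)) i j)) // dU.
have epsi v i j : ent (psi v) i j = ent (invmx (mx s (Bas v))) i j.
  case: (ltnP i (d v)) => hi; last by rewrite !ent_out_row // dU.
  case: (ltnP j (d v)) => hj; last by rewrite !ent_out_col.
  by rewrite (@ent_mx K _ _ (fun i j => ent (invmx (mx s (Bas v))) i j)) // dU.
exists phi; last by move=> v i j j' ejj'; rewrite mxE ejj' entE.
split=> [b|v].
  apply: ent_eq => i j hi hj; rewrite !ent_mul.
  have := congr1 (fun M => ent M i j) (hc b); rewrite !ent_mul /= => e.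
  under eq_bigr => l _ do rewrite ephi eU.
  rewrite (sum_ord_cast (fun l => ent (mx s (Bas (tgt b))) i l * ent (mx s (Str b)) l j) (dU _)) -e.
  by apply: eq_bigr => l _; rewrite ephi.
exists (psi v); split; apply: ent_eq => i j hi hj; rewrite ent_mul.
  under eq_bigr => l _ do rewrite ephi epsi.
  rewrite -ent_mul mulVmx // !ent1 //; rewrite dU in hi *; exact: hi.
under eq_bigr => l _ do rewrite ephi epsi.
rewrite (sum_ord_cast (fun l => ent (mx s (Bas v)) i l * ent (invmx (mx s (Bas v))) l j) (dU _)).
by rewrite -ent_mul mulmxV.
Qed.

End Assembly.

(** * The complete program and its cost *)

Definition decompose := seqs [:: zigzag_program; seqs [:: clean65; sweep65; label65]; program25; freeze; emission].

Section Correctness.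
Variables (K : fieldType) (W : rep K).
Notation d := (rdim W).
Notation N := (max_dim d).

Definition cost := 5 * phase_cost W + (N * (N * (72 * N).+1) + phase_cost W) + cost25 W.

Lemma decompose_runs : runs decompose (init W) cost (fun s => outputs_decomposition (Gamma K) s).
Proof.
apply: (@runs_seq _ _ _ _ _ (5 * phase_cost W) ((N * (N * (72 * N).+1) + phase_cost W) + cost25 W)); last by rewrite /cost addnA.
apply: runs_weak (zigzag_runs W) (leqnn _) _ => s1 [Fr [ok int tr _ z1]].
apply: (@runs_seq _ _ _ _ _ (N * (N * (72 * N).+1) + phase_cost W) (cost25 W)) => //.
have refl1 : same_labels (arr s1) (arr s1) by [].
apply: runs_weak (@arrow65_runs K W (arr s1) ok int s1 refl1 tr z1) (leqnn _) _ => s2 [l2 tr2 cl2 [Y6 Yinj Yt] z2].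
apply: (@runs_seq _ _ _ _ _ (cost25 W) 0); last by rewrite addn0.
have ctx2 : ctx (arr s1) (arr s2 50) s2 by split.
have inv2 : closed_inv (arr s1) (arr s2 50) (mx s2) by split.
apply: runs_weak (program25_runs ok int Y6 Yinj ctx2 inv2 z2) (leqnn _) _ => s3 [ctx3 inv3 [mt1 mt2 mt3] f25 z3].
apply: (@runs_seq _ _ _ _ _ 0 0) => //.
apply: runs_weak (@freeze_runs K W (arr s1) (arr s2 50) ok Yinj _ _ _ _ _ _ mt1 mt2 mt3 s3 ctx3 _ _ _ z3) (leqnn _) _ => // s4 [m4 l4 fr4 b4 z4].
have rel := frozen_relations ok int Y6 Yinj Yt inv3 mt1 mt2 mt3 fr4.
have lks := links ok int Y6 inv3 mt1 mt2 mt3 fr4 f25.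
set P := pres (arr s1) in rel; set B := arr s4 in rel.
have bnd u v : P u v -> u < B 75 0.
  by move=> p; rewrite -(pos_id ok p); apply: b4; apply: pos_lt.
have em : emitted P B s4 (labels_of P B [::]).
  split.
  - by have := same_labels_ok ok l4.
  - by rewrite m4; case: inv3 => -[].
  - by move=> b i j hi hj; rewrite m4 lks // !(l4 _ _).1.
  - by move=> u v; apply: same_pres.
  by split=> // v; rewrite z4.
apply: (@runs_seq _ _ _ _ _ 0 0) => //.
apply: runs_weak (@emit_shapes_runs K W P B rel (iota 0 30) s4 [::] em _ isT (iota_uniq _ _)) (leqnn _) _.
  by apply: uniq_all_selected; rewrite ?iota_uniq //; apply/allP => k; rewrite mem_iota.
move=> s5 [em5 c5 _]; apply: runs_skip.
apply: (decomposition rel bnd em5) => k.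
by apply: c5; rewrite mem_iota ltn_ord.
Qed.

(** The cost has only quadratic and cubic terms in [N], and the square is at most the cube. The
    coefficients add up to 209741, below 262144 = 64 ^ 3. *)
Lemma cost_bound : cost <= 64 ^ 3 * N ^ 3.
Proof.
rewrite /cost /cost25 /clean_cost /sweep_cost /phase_cost /pivot_cost; set n := N.
have h : n * n <= n * n * n by case: n => // n'; apply: leq_pmulr.
have -> : n ^ 3 = n * n * n by rewrite !expnS expn0 muln1 mulnA.
move: h; clear; lia.
Qed.

End Correctness.

Theorem mainTheorem4 (K : fieldType) :
  exists (N : nat) (Gamma : 'I_N -> rep K),
    is_Gamma0 Gamma /\
    exists (p : cmd) (C : nat), forall V : rep K,
      exists (s : state K (rdim V)) (t : nat),
        [/\ exec p (init V) s t,
            outputs_decomposition Gamma s,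
            is_persistence_diagram Gamma V (output_diagram s (N := N))
          & t <= C * max_dim (rdim V) ^ 3].
Proof.
have persistent (V : rep K) (s : state K (rdim V)) :
    outputs_decomposition (Gamma K) s -> is_persistence_diagram (Gamma K) V (output_diagram s (N := 30)).
  by case=> phi iso _; exists phi.
exists 30, (Gamma K); split.
  split; [exact: Gamma_indecomposable | apply: Gamma_complete => V | exact: Gamma_inj].
  (* The output of the algorithm supplies the decompositions from which the completeness of the list
     follows. *)
  by have [s [t [_ _ /persistent h]]] := decompose_runs V; exists (output_diagram s (N := 30)).
exists decompose, (64 ^ 3) => V; have [s [t [e l o]]] := decompose_runs V; exists s, t; split=> //.
  exact: persistent.
exact: leq_trans l (cost_bound V).
Qed.
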